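(* Let $F$ be a non-archimedean local field of nonzero characteristic, $D_F$ a central division algebra of dimension $d^2$ over $F$, $r\ge1$, $G'_F=GL_r(D_F)$, and $l\ge1$ an integer. Let $m\ge l$ be an integer such that for every local field of characteristic zero $m$-close to $F$ the linear isomorphism $\bar\zeta^{\,l}_{D_FD_L}:H(G'_F;K_F^l)\simeq H(G'_L;K_L^l)$ is an isomorphism of algebras, and let $L$ be a local field of characteristic zero $m$-close to $F$. Then: a) The map $\bar\zeta^{\,l}_{D_FD_L}$ induces a bijection from the set of equivalence classes of irreducible smooth representations of $G'_F$ of level less than or equal to $l$ (resp. equal to $l$) onto the set of equivalence classes of irreducible smooth representations of $G'_L$ of level less than or equal to $l$ (resp. equal to $l$). b) Let $\pi$ be an irreducible smooth representation of $G'_F$ of level $\le l$. Then $\pi$ is square integrable if and only if $\bar\zeta^{\,l}_{D_FD_L}(\pi)$ is a square integrable representation of $G'_L$. c) Let $\pi$ be an irreducible smooth representation of $G'_F$ of level $\le l$. Then $\pi$ is cuspidal if and only if $\bar\zeta^{\,l}_{D_FD_L}(\pi)$ is a cuspidal representation of $G'_L$.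
   Context: Notation. $O_F,P_F$: ring of integers and maximal ideal of $F$; similarly $O_{D_F}$, $P_{D_F}$ for $D_F$. $K_F=GL_r(O_{D_F})$, and for $l\ge1$, $K_F^l=Id+M_r(P_{D_F}^{ld})$. $H(G'_F;K)$ is the convolution algebra of complex locally constant compactly supported functions on $G'_F$ bi-invariant under $K$ (Haar measure with $vol(K_F)=1$). Fix a uniformizer $\pi_F$ of $F$, a maximal subfield $E\subset D_F$ unramified of degree $d$ over $F$, an element $\pi_{D_F}\in D_F$ and a generator $\sigma_E$ of $Gal(E/F)$ with $\pi_{D_F}^d=\pi_F$, $D_F=\bigoplus_{i=0}^{d-1}\pi_{D_F}^iE$, $\pi_{D_F}^{-1}e\pi_{D_F}=\sigma_E(e)$ for $e\in E$. Close fields. A local field $L$ of characteristic $0$ is $m$-close to $F$ if $O_F/P_F^m$ and $O_L/P_L^m$ are isomorphic rings; one then fixes a triple $(\pi_F;\pi_L;\bar\lambda^m_{FL})$, $\pi_L$ a uniformizer of $L$ and $\bar\lambda^m_{FL}:O_F/P_F^m\simeq O_L/P_L^m$ a ring isomorphism sending the class of $\pi_F$ to that of $\pi_L$. Let $K/L$ be the unramified extension of degree $d$; one fixes a ring isomorphism $\bar\lambda^m_{EK}:O_E/P_E^m\simeq O_K/P_K^m$ extending $\bar\lambda^m_{FL}$. Let $\sigma_K\in Gal(K/L)$ be the image of $\sigma_E$ under the isomorphism $Gal(E/F)\simeq Gal(K/L)$ matching the Frobenius elements, let $D_L=\bigoplus_{i=0}^{d-1}\pi_{D_L}^iK$ be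 the division algebra with $\pi_{D_L}^d=\pi_L$, $\pi_{D_L}^{-1}e\pi_{D_L}=\sigma_K(e)$ ($e\in K$), and put $G'_L=GL_r(D_L)$, with $K_L$, $K_L^l$ defined as over $F$. The map $\sum_i\pi_{D_F}^i\hat e_i\mapsto\sum_i\pi_{D_L}^i\bar\lambda^m_{EK}(\hat e_i)$ is a ring isomorphism $O_{D_F}/P_{D_F}^{md}\simeq O_{D_L}/P_{D_L}^{md}$; for $l\le m$ its reduction induces $GL_r(O_{D_F}/P_{D_F}^{ld})\simeq GL_r(O_{D_L}/P_{D_L}^{ld})$. The map $\bar\zeta^{\,l}_{D_FD_L}$ on Hecke algebras ($l\le m$). Let $\mathcal{A}_F$ be the set of matrices $A=diag(\pi_{D_F}^{a_1},\dots,\pi_{D_F}^{a_r})$ with integers $a_1\le\dots\le a_r$, and let $A_L=diag(\pi_{D_L}^{a_1},\dots,\pi_{D_L}^{a_r})$. The distinct characteristic functions $\mathbf{1}_{K_F^lBAC^{-1}K_F^l}$ ($A\in\mathcal{A}_F$, $B,C\in K_F$) form a basis of $H(G'_F;K_F^l)$. $\bar\zeta^{\,l}_{D_FD_L}$ is the (well defined) linear isomorphism sending $\mathbf{1}_{K_F^lBAC^{-1}K_F^l}$ to $\mathbf{1}_{K_L^lB_LA_LC_L^{-1}K_L^l}$, where $B_L,C_L\in K_L$ are any lifts of the images of $B,C$ in $GL_r(O_{D_L}/P_{D_L}^{ld})$. Level and transfer of representations. The level of an irreducible smooth representation $\pi$ of $G'_F$ is $0$ if $\pi$ has a nonzero vector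 fixed by $K_F$, and otherwise the least $l\geq 1$ such that $\pi$ has a nonzero $K_F^l$-fixed vector; same for $G'_L$. The map $\pi\mapsto\pi^{K_F^l}$ is a bijection from classes of irreducible smooth representations of level $\le l$ to isomorphism classes of irreducible $H(G'_F;K_F^l)$-modules. When $\bar\zeta^{\,l}_{D_FD_L}$ is an algebra isomorphism, $\bar\zeta^{\,l}_{D_FD_L}(\pi)$ denotes the class of irreducible smooth representations of $G'_L$ of level $\le l$ whose $H(G'_L;K_L^l)$-module of $K_L^l$-fixed vectors corresponds to $\pi^{K_F^l}$ through this isomorphism. ''Square integrable'' means unitary central character and matrix coefficients square integrable modulo the center; ''cuspidal'' means matrix coefficients compactly supported modulo the center. *)

(* Defs.v *)
From HB Require Import structures.
From mathcomp Require Import all_boot all_order all_algebra all_fingroup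
  all_solvable all_field.
From mathcomp Require Import complex.
From mathcomp Require Import all_classical all_reals all_analysis.

Set Implicit Arguments.
Unset Strict Implicit.
Unset Printing Implicit Defensive.

Import Order.TTheory GRing.Theory Num.Theory.

Local Open Scope classical_set_scope.
Local Open Scope ring_scope.

(** * Local fields and division algebras *)

(* A normalized discrete valuation. The value [v 0] is irrelevant: every use
   goes through [pw], which puts [0] in all the ideals. *)
Record is_valuation (A : nzRingType) (v : A -> int) : Prop := IsValuation {
  valuationM : forall x y : A, x != 0 -> y != 0 -> x * y != 0 /\ v (x * y) = v x + v y;
  valuationD : forall x y : A, x != 0 -> y != 0 -> x + y != 0 ->
    Num.min (v x) (v y) <= v (x + y);
  val_onto : exists2 x : A, x != 0 & v x = 1 }.

(* [pw v n] is P^n; in particular [pw v 0] is the ring of integers. *)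
Definition pw (A : nzRingType) (v : A -> int) (n : int) : set A :=
  [set x | x = 0 \/ n <= v x].

Definition residue_card (A : nzRingType) (v : A -> int) (q : nat) : Prop :=
  exists s : seq A, [/\ uniq s, size s = q,
    {in s, forall y, pw v 0 y} &
    forall x, pw v 0 x -> exists! y, y \in s /\ pw v 1 (x - y)].

Record localField := LocalField {
  lf_field :> fieldType;
  lf_val : lf_field -> int;
  lf_valP : is_valuation lf_val;
  lf_complete : forall u : nat -> lf_field,
    (forall n : int, exists N : nat, forall i j : nat,
       (N <= i)%N -> (N <= j)%N -> pw lf_val n (u i - u j)) ->
    exists x, forall n : int, exists N : nat, forall i : nat,
       (N <= i)%N -> pw lf_val n (u i - x);
  lf_residue : exists q, residue_card lf_val q }.

(* Since the valuation of [F] extends uniquely to [D], [da_val] is the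
   normalized valuation of [D]. *)
Record divAlg (F : localField) (d : nat) := DivAlg {
  da_alg :> falgType F;
  da_div : forall x : da_alg, x != 0 -> x \is a GRing.unit;
  da_central : 'Z({:da_alg})%VS = 1%VS;
  da_dim : \dim {: da_alg} = (d ^ 2)%N;
  da_val : da_alg -> int;
  da_valP : is_valuation da_val;
  da_val_ext : exists2 e : int, 0 < e &
    forall a : F, a != 0 -> da_val a%:A = e * lf_val a }.

(* The normalized valuation of the extension restricts to the normalized
   valuation of [F]: the ramification index is 1. *)
Record unramExt (F : localField) (d : nat) := UnramExt {
  ue_field :> splittingFieldType F;
  ue_dim : \dim {: ue_field} = d;
  ue_val : ue_field -> int;
  ue_valP : is_valuation ue_val;
  ue_val_ext : forall a : F, a != 0 -> ue_val a%:A = lf_val a }.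

Definition is_frobenius (F : localField) (d : nat) (E : unramExt F d)
    (phi : gal_of {: E}) : Prop :=
  exists2 q, residue_card (@lf_val F) q &
    forall x : E, pw (@ue_val F d E) 0 x -> pw (@ue_val F d E) 1 (phi x - x ^+ q).

(* The choices pi_F, E, pi_D, sigma_E presenting [D] as a cyclic algebra. As
   [D] has dimension [d ^ 2], the subfield [E] of degree [d] is maximal. *)
Record cyclicPres (F : localField) (d : nat) (D : divAlg F d) := CyclicPres {
  cp_unif : F;
  cp_unifP : cp_unif != 0 /\ lf_val cp_unif = 1;
  cp_E : unramExt F d;
  cp_emb : {lrmorphism cp_E -> D};
  cp_val : exists2 e : int, 0 < e &
    forall x : cp_E, x != 0 -> da_val (cp_emb x) = e * ue_val x;
  cp_pi : D;
  cp_sigma : gal_of {: cp_E};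
  cp_gen : generator 'Gal({: cp_E} / 1)%g cp_sigma;
  cp_pi_pow : cp_pi ^+ d = cp_unif%:A;
  cp_conj : forall e : cp_E,
    cp_pi^-1 * cp_emb e * cp_pi = cp_emb (cp_sigma e);
  cp_sum : forall x : D, exists! c : {ffun 'I_d -> cp_E},
    x = \sum_(i < d) cp_pi ^+ i * cp_emb (c i) }.

(** * The group GL_r(D) *)

(* An invertible matrix is stored together with its inverse. *)
Definition GL (F : localField) (d : nat) (D : divAlg F d) (r : nat) : Type :=
  {p : 'M[D]_r * 'M[D]_r | (p.1 *m p.2 == 1%:M) && (p.2 *m p.1 == 1%:M)}.

Section GLStructure.
Variables (F : localField) (d : nat) (D : divAlg F d) (r : nat).
Local Notation G := (GL D r).
Implicit Types g h : G.

Definition glm g : 'M[D]_r := (val g).1.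
Definition glmV g : 'M[D]_r := (val g).2.

Lemma glmK g : glm g *m glmV g = 1%:M.
Proof. by have /andP[/eqP] := valP g. Qed.
Lemma glmVK g : glmV g *m glm g = 1%:M.
Proof. by have /andP[_ /eqP] := valP g. Qed.

Lemma glm_inj : injective glm.
Proof.
move=> g h eq_gh; apply: val_inj.
have eqV : glmV g = glmV h.
  by rewrite -[LHS]mulmx1 -(glmK h) mulmxA -eq_gh glmVK mul1mx.
move: eq_gh eqV; rewrite /glm /glmV.
by case: (val g) => ? ?; case: (val h) => ? ? /= -> ->.
Qed.

Definition mkGL (A B : 'M[D]_r) (AB : A *m B = 1%:M) (BA : B *m A = 1%:M) : G.
Proof. by exists (A, B); apply/andP; split; apply/eqP. Defined.

Definition gl_one : G := mkGL (mulmx1 1%:M) (mulmx1 1%:M).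
Definition gl_inv g : G := mkGL (glmVK g) (glmK g).
Fact gl_mul_subproof g h :
  (glm g *m glm h) *m (glmV h *m glmV g) = 1%:M /\
  (glmV h *m glmV g) *m (glm g *m glm h) = 1%:M.
Proof.
split; first by rewrite mulmxA -(mulmxA (glm g)) glmK mulmx1 glmK.
by rewrite mulmxA -(mulmxA (glmV h)) glmVK mulmx1 glmVK.
Qed.
Definition gl_mul g h : G :=
  mkGL (proj1 (gl_mul_subproof g h)) (proj2 (gl_mul_subproof g h)).

HB.instance Definition _ := Choice.on G.

Fact gl_mulA : associative gl_mul.
Proof. by move=> a b c; apply: glm_inj; rewrite /glm /= mulmxA. Qed.
Fact gl_mul1 : left_id gl_one gl_mul.
Proof. by move=> a; apply: glm_inj; rewrite /glm /= mul1mx. Qed.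
Fact gl_1mul : right_id gl_one gl_mul.
Proof. by move=> a; apply: glm_inj; rewrite /glm /= mulmx1. Qed.
Fact gl_mulV : left_inverse gl_one gl_inv gl_mul.
Proof. by move=> a; apply: glm_inj; exact: glmVK. Qed.
Fact gl_Vmul : right_inverse gl_one gl_inv gl_mul.
Proof. by move=> a; apply: glm_inj; exact: glmK. Qed.

HB.instance Definition _ :=
  isGroup.Build G gl_mulA gl_mul1 gl_1mul gl_mulV gl_Vmul.
HB.instance Definition _ := isPointed.Build G gl_one.

(* The subspace topology of M_r(D), for the valuation topology of [D]. *)
Definition gl_open : set_system G := [set U | forall g, U g ->
  exists n : nat, forall h,
    (forall i j, pw (@da_val F d D) n%:Z (glm h i j - glm g i j)) -> U h].

Fact gl_openT : gl_open setT. Proof. by move=> g _; exists 0%N. Qed.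
Fact gl_openI : setI_closed gl_open.
Proof.
move=> U V oU oV g [/oU[n nU] /oV[k kV]]; exists (maxn n k) => h hg.
split; [apply: nU|apply: kV] => i j; case: (hg i j) => [->|le_v];
  by [left | right; apply: le_trans le_v; rewrite lez_nat leq_max leqnn ?orbT].
Qed.
Fact gl_open_bigU (I : Type) (f : I -> set G) :
  (forall i, gl_open (f i)) -> gl_open (\bigcup_i f i).
Proof.
move=> fo g [i _ /fo[n fin]]; exists n => h hg; exists i => //; exact: fin.
Qed.

HB.instance Definition _ :=
  isOpenTopological.Build G gl_openT gl_openI gl_open_bigU.

(* [congK 0] is GL_r(O_D) and, for [l > 0], [congK l] is 1 + M_r(P_D^(ld)). *)
Definition congK (l : nat) : set G :=
  if l is 0%N then
    [set g | forall i j, pw (@da_val F d D) 0 (glm g i j) /\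
                         pw (@da_val F d D) 0 (glmV g i j)]
  else [set g | forall i j,
    pw (@da_val F d D) (l * d)%:Z (glm g i j - (1%:M : 'M[D]_r) i j)].

Definition glcenter : set G := [set z | forall g, (z * g = g * z)%g].

Definition dcoset (K : set G) g : set G :=
  [set (k.1 * g * k.2)%g | k in K `*` K].

End GLStructure.

Arguments congK {F d} D r l _ : rename.
Arguments glcenter {F d} D r _ : rename.

(** * Haar measures *)

(* The Borel sets of [G] *)
Definition borelGL (F : localField) (d : nat) (D : divAlg F d) (r : nat) :=
  g_sigma_algebraType (@open (GL D r)).

(* The Borel sets of [G/Z], where [Z] is the center, seen as [Z]-invariant
   subsets of [G]. A measure on [G/Z] is thus a measure on this sigma-algebra,
   and a function on [G/Z] a [Z]-invariant function on [G]. *)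
Definition borelPGL (F : localField) (d : nat) (D : divAlg F d) (r : nat) :=
  g_sigma_algebraType [set U : set (GL D r) | open U /\
    forall z g, glcenter D r z -> U g -> U (z * g)%g].

Record haarMeasures (R : realType) (F : localField) (d : nat)
    (D : divAlg F d) (r : nat) := HaarMeasures {
  hm_G : {measure set (borelGL D r) -> \bar R};
  hm_G_inv : forall (g : GL D r) (A : set (borelGL D r)), measurable A ->
    hm_G ((fun x : GL D r => (g * x)%g) @` A) = hm_G A;
  hm_G_norm : hm_G (congK D r 0) = 1%E;
  hm_Z : {measure set (borelPGL D r) -> \bar R};
  hm_Z_inv : forall (g : GL D r) (A : set (borelPGL D r)), measurable A ->
    hm_Z ((fun x : GL D r => (g * x)%g) @` A) = hm_Z A;
  hm_Z_neq0 : hm_Z setT <> 0%E;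
  hm_Z_compact : forall C : set (GL D r), compact C ->
    (hm_Z [set (z * x)%g | z in glcenter D r & x in C] < +oo)%E }.

(* The integral of a locally constant compactly supported function with values
   in a complex vector space: such a function takes finitely many values, and
   its integral is the sum of [mu (f^-1 w) w] over its nonzero values [w]. *)
Definition lc_integral (R : realType) (T : Type) (mu : set T -> \bar R)
    (V : lmodType R[i]) (f : T -> V) : V :=
  \sum_(w \in [set: V]) (fine (mu (f @^-1` [set w])))%:C%C *: w.

(** * Hecke algebras *)

Section Hecke.
Variables (R : realType) (F : localField) (d : nat) (D : divAlg F d) (r : nat).
Local Notation G := (GL D r).
Implicit Types (f g : G -> R[i]) (K : set G).

Definition hecke K : set (G -> R[i]) := [set f |
  [/\ forall c, open (f @^-1` [set c]),
      exists2 C : set G, compact C & forall x, f x != 0 -> C x &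
      forall k k' x, K k -> K k' -> f (k * x * k')%g = f x]].

Definition hecke_conv (mu : haarMeasures R D r) f g : G -> R[i] := fun x =>
  lc_integral (hm_G mu) (fun y => f y * g (y^-1 * x)%g : R[i]^o).

End Hecke.

Arguments hecke R {F d D r} K _.

(** * Smooth representations *)

Record smoothRep (R : realType) (F : localField) (d : nat) (D : divAlg F d)
    (r : nat) := SmoothRep {
  rep_space :> lmodType R[i];
  rep_act : GL D r -> {linear rep_space -> rep_space};
  rep_act1 : forall v, rep_act 1%g v = v;
  rep_actM : forall g h v, rep_act (g * h)%g v = rep_act g (rep_act h v);
  rep_smooth : forall v, open [set g | rep_act g v = v] }.

Section Rep.
Variables (R : realType) (F : localField) (d : nat) (D : divAlg F d) (r : nat).
Local Notation G := (GL D r).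
Implicit Types (pi : smoothRep R D r) (K : set G) (mu : haarMeasures R D r).

Definition irreducible pi : Prop :=
  (exists v : pi, v != 0) /\
  forall W : set pi,
    W 0 -> (forall (a : R[i]) u v, W u -> W v -> W (a *: u + v)) ->
    (forall g v, W v -> W (rep_act pi g v)) ->
    W = [set 0] \/ W = setT.

Definition equivalent pi pi' : Prop :=
  exists2 phi : {linear pi -> pi'}, bijective phi &
    forall g v, phi (rep_act pi g v) = rep_act pi' g (phi v).

Definition fixed pi K : set pi := [set v | forall k, K k -> rep_act pi k v = v].
Arguments fixed : clear implicits.

Definition has_level pi (n : nat) : Prop :=
  (exists2 v, fixed pi (congK D r n) v & v != 0) /\
  forall k, (k < n)%N -> fixed pi (congK D r k) `<=` [set 0].

Definition level_le (l : nat) pi : Prop :=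
  exists2 n, (n <= l)%N & has_level pi n.

Definition hecke_act mu pi (f : G -> R[i]) (v : pi) : pi :=
  lc_integral (hm_G mu) (fun g => f g *: rep_act pi g v).

(* A linear form in the smooth dual *)
Definition smooth_form pi (xi : {linear pi -> R[i]^o}) : Prop :=
  open [set g | forall v, xi (rep_act pi g v) = xi v].

Definition coefficient pi (v : pi) (xi : {linear pi -> R[i]^o}) : G -> R[i] :=
  fun g => xi (rep_act pi g v).

Definition unitary_central_char pi : Prop :=
  forall z, glcenter D r z ->
    exists2 c : R[i], `|c| = 1 & forall v, rep_act pi z v = c *: v.

Definition square_integrable mu pi : Prop :=
  unitary_central_char pi /\
  forall v xi, smooth_form xi ->
    (\int[hm_Z mu]_g ((ComplexField.Normc.normc (@coefficient pi v xi g)) ^+ 2)%:E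
      < +oo)%E.

Definition cuspidal pi : Prop :=
  forall v xi, smooth_form xi -> exists2 C : set G, compact C &
    forall g, @coefficient pi v xi g != 0 ->
      exists z h, [/\ glcenter D r z, C h & g = (z * h)%g].

(* [c] is the equivalence class of an irreducible representation satisfying
   [Q]. Classes are plain predicates, since the universe of [set] is too small
   for representations. *)
Definition irr_class (Q : smoothRep R D r -> Prop) (c : smoothRep R D r -> Prop)
    : Prop :=
  exists pi, [/\ irreducible pi, Q pi & c = equivalent pi].

End Rep.

Arguments fixed {R F d D r} pi K _.

(* [set_bij], again without the universe constraint of [set] *)
Definition bij_between (X Y : Type) (A : X -> Prop) (B : Y -> Prop)
    (f : X -> Y) : Prop :=
  [/\ forall x, A x -> B (f x),
      forall x y, A x -> A y -> f x = f y -> x = y &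
      forall y, B y -> exists2 x, A x & f x = y].

(** * Close fields *)

(* [f] induces a ring isomorphism [O / I -> O' / I']. *)
Record quot_iso (A B : nzRingType) (O I : set A) (O' I' : set B) (f : A -> B) :
    Prop := QuotIso {
  qi_int : forall a, O a -> O' (f a);
  qi_1 : I' (f 1 - 1);
  qi_D : forall a b, O a -> O b -> I' (f (a + b) - (f a + f b));
  qi_M : forall a b, O a -> O b -> I' (f (a * b) - f a * f b);
  qi_inj : forall a b, O a -> O b -> I (a - b) <-> I' (f a - f b);
  qi_surj : forall b, O' b -> exists2 a, O a & I' (f a - b) }.

Definition level_iso (A B : nzRingType) (v : A -> int) (w : B -> int) (m : nat) :=
  quot_iso (pw v 0) (pw v m%:Z) (pw w 0) (pw w m%:Z).

Definition m_close (m : nat) (F L : localField) : Prop :=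
  exists f : F -> L, level_iso (@lf_val F) (@lf_val L) m f.

(* Everything that is fixed over a field [L] which is [m]-close to [F]. The maps
   [cd_lam] and [cd_lamE] lift isomorphisms of residue rings, which are all that
   matters below. *)
Record closeData (R : realType) (F : localField) (d : nat) (D : divAlg F d)
    (P : cyclicPres D) (r m : nat) (L : localField) := CloseData {
  cd_D : divAlg L d;
  cd_P : cyclicPres cd_D;
  cd_lam : F -> L;
  cd_lamP : level_iso (@lf_val F) (@lf_val L) m cd_lam;
  cd_lam_unif : pw (@lf_val L) m%:Z (cd_lam (cp_unif P) - cp_unif cd_P);
  cd_lamE : cp_E P -> cp_E cd_P;
  cd_lamEP : level_iso (@ue_val F d (cp_E P)) (@ue_val L d (cp_E cd_P)) m cd_lamE;
  cd_lamE_ext : forall a : F, pw (@lf_val F) 0 a ->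
    pw (@ue_val L d (cp_E cd_P)) m%:Z (cd_lamE a%:A - (cd_lam a)%:A);
  cd_sigma : exists (phi : gal_of {: cp_E P}) (psi : gal_of {: cp_E cd_P}) k,
    [/\ is_frobenius phi, is_frobenius psi,
        cp_sigma P = (phi ^+ k)%g & cp_sigma cd_P = (psi ^+ k)%g];
  cd_haar : haarMeasures R cd_D r }.

(** * The map zeta *)

Section Zeta.
Variables (R : realType) (F : localField) (d : nat) (D : divAlg F d)
  (P : cyclicPres D) (r m : nat) (L : localField) (T : closeData R P r m L).
Local Notation GF := (GL D r).
Local Notation GL' := (GL (cd_D T) r).

(* [B' : GL_r(O_{D_L})] lifts the image of [B : GL_r(O_{D_F})] in
   GL_r(O_{D_L} / P_{D_L}^(ld)); recall that O_D is the sum of the pi_D^i O_E. *)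
Definition lifts (l : nat) (B : GF) (B' : GL') : Prop :=
  [/\ congK D r 0 B, congK (cd_D T) r 0 B' &
  forall i j, exists e : 'I_d -> cp_E P,
    [/\ forall k, pw (@ue_val F d (cp_E P)) 0 (e k),
        glm B i j = \sum_(k < d) cp_pi P ^+ k * cp_emb P (e k) &
        pw (@da_val L d (cd_D T)) (l * d)%:Z
          (glm B' i j - \sum_(k < d) cp_pi (cd_P T) ^+ k
                          * cp_emb (cd_P T) (cd_lamE T (e k)))]].

(* The matrix [A] is diag(pi_D^(a_1), ..., pi_D^(a_r)). *)
Definition is_diag_pi (F0 : localField) (D0 : divAlg F0 d) (P0 : cyclicPres D0)
    (a : 'I_r -> int) (A : GL D0 r) : Prop :=
  glm A = diag_mx (\row_i (cp_pi P0 ^ a i)).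

(* This determines [z] on the Hecke algebra, which the indicator functions of
   double cosets span; the values of [z] elsewhere are irrelevant. *)
Definition is_zeta (l : nat) (z : (GF -> R[i]) -> (GL' -> R[i])) : Prop :=
  (forall (c : R[i]) f g, hecke R (congK D r l) f -> hecke R (congK D r l) g ->
     z (fun x => c * f x + g x) = (fun y => c * z f y + z g y)) /\
  (forall (a : 'I_r -> int) (A B C : GF) (A' B' C' : GL'),
     (forall i j : 'I_r, (i <= j)%N -> a i <= a j) ->
     is_diag_pi P a A -> is_diag_pi (cd_P T) a A' ->
     lifts l B B' -> lifts l C C' ->
     z (\1_(dcoset (congK D r l) (B * A * C^-1)%g)) =
     \1_(dcoset (congK (cd_D T) r l) (B' * A' * C'^-1)%g)).

Definition is_hecke_iso (l : nat) (mu : haarMeasures R D r)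
    (z : (GF -> R[i]) -> (GL' -> R[i])) : Prop :=
  [/\ set_bij (hecke R (congK D r l)) (hecke R (congK (cd_D T) r l)) z,
      forall (c : R[i]) f g, hecke R (congK D r l) f -> hecke R (congK D r l) g ->
        z (fun x => c * f x + g x) = (fun y => c * z f y + z g y) &
      forall f g, hecke R (congK D r l) f -> hecke R (congK D r l) g ->
        z (hecke_conv mu f g) = hecke_conv (cd_haar T) (z f) (z g)].

(* [pi'] belongs to the class zeta(pi). *)
Definition transfer (l : nat) (mu : haarMeasures R D r)
    (z : (GF -> R[i]) -> (GL' -> R[i]))
    (pi : smoothRep R D r) (pi' : smoothRep R (cd_D T) r) : Prop :=
  [/\ irreducible pi', level_le l pi' &
  exists phi : pi -> pi',
    [/\ set_bij (fixed pi (congK D r l)) (fixed pi' (congK (cd_D T) r l)) phi,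
        forall (c : R[i]) u v, fixed pi (congK D r l) u ->
          fixed pi (congK D r l) v -> phi (c *: u + v) = c *: phi u + phi v &
        forall f v, hecke R (congK D r l) f -> fixed pi (congK D r l) v ->
          phi (hecke_act mu f v) = hecke_act (cd_haar T) (z f) (phi v)]].

(* The map induced by zeta on equivalence classes *)
Definition transfer_class (l : nat) (mu : haarMeasures R D r)
    (z : (GF -> R[i]) -> (GL' -> R[i]))
    (c : smoothRep R D r -> Prop) : smoothRep R (cd_D T) r -> Prop :=
  fun pi' => exists2 pi, c pi & transfer l mu z pi pi'.

End Zeta.

(* Main.v *)
(** Lifting modulo P^{ld} is a correspondence between the elements of the two
    groups; it matches the double cosets of K^l and their volumes, so zeta is a
    rescaled isomorphism of Hecke algebras with matching modules. An irreducible
    representation with nonzero K^l-fixed vectors is recovered from that module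
    inside the functions on the group with values in it, and levels n <= l are
    read off the averages over K^n, which the Hecke algebra of K^l contains.

    For b) and c), an irreducible V is admissible: one shows that V/W has
    finite-dimensional spaces of fixed vectors for W maximal among the proper
    subspaces stable under a parabolic subgroup, shrinking the parabolic until
    no further coinvariants survive. Then antidominant elements kill any given
    fixed vector once they are deep enough, and the Cartan decomposition
    together with Schur's lemma in countable dimension leaves finitely many
    vectors. Hence the smooth dual is spanned by translates of K^l-fixed
    forms, and both properties need only be tested on coefficients c between
    K^l-fixed vectors and forms. These are functions of the double coset K^l g
    K^l. Modulo the powers of pi_F, cuspidality says that such a c has
    finitely many double cosets in its support, and square integrability that
    the sums of vol(K^l g K^l) |c(g)|^2 over inequivalent g are bounded
    (together with a central character of absolute value 1). The
    correspondence preserves both conditions. *)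

Require Import Defs.
From HB Require Import structures.
From mathcomp Require Import all_boot all_order all_algebra all_fingroup
  all_field.
From mathcomp Require Import complex.
From mathcomp Require Import all_classical all_reals all_analysis measurable_realfun.
From mathcomp Require Import zify ring lra.

Set Implicit Arguments.
Unset Strict Implicit.
Unset Printing Implicit Defensive.

Import Order.TTheory GRing.Theory Num.Theory.

Local Open Scope classical_set_scope.
Local Open Scope ring_scope.

Local Arguments congK : simpl never.
(** * Valuations and completeness *)

(** The matching of group elements is read off [zeta] itself: [g] and [g'] correspond when [zeta]
    sends the indicator of one double coset to that of the other. Uniqueness over L is then the fact
    that [zeta] is a function, and uniqueness over F its injectivity; lifting only has to supply
    invertible lifts that respect the subgroups K^k. Equality of volumes comes from convolutions
    evaluated at 1. Quotients are never formed. Cosets are handled by finite lists of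
    representatives, so that integrals become finite sums or suprema of finite sums, and finite
    dimension is a statement about spans modulo a subspace W. In the proof of admissibility,
    maximality of W keeps Schur's lemma available on V/W: the centre of the Levi factor acts by
    scalars there, so the exponents of a diagonal matrix may be shifted by constants on blocks at
    the cost of a scalar. The data linking the two groups are symmetric, so each implication of b)
    and c) is proved in one direction and then applied to the inverse correspondence. *)

Section Valuation.
Variables (A : unitRingType) (v : A -> int).
Hypothesis vP : is_valuation v.
Implicit Types (x y : A) (n m : int).

Lemma valM x y : x != 0 -> y != 0 -> v (x * y) = v x + v y.
Proof. by move=> x0 y0; have [] := valuationM vP x0 y0. Qed.

Lemma val_mul_neq0 x y : x != 0 -> y != 0 -> x * y != 0.
Proof. by move=> x0 y0; have [] := valuationM vP x0 y0. Qed.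

Lemma val1 : v 1 = 0.
Proof.
have := valM (oner_neq0 A) (oner_neq0 A); rewrite mulr1 => /eqP.
by rewrite -subr_eq0 opprD addrA subrr add0r oppr_eq0 => /eqP.
Qed.

Lemma valN x : v (- x) = v x.
Proof.
have [->|x0] := eqVneq x 0; first by rewrite oppr0.
have N0 : (-1 : A) != 0 by rewrite oppr_eq0 oner_neq0.
have : v (-1) = 0.
  by have := valM N0 N0; rewrite mulrNN mulr1 val1; lia.
by move=> vN1; rewrite -mulN1r (valM N0 x0) vN1 add0r.
Qed.

Lemma pwP x n : x != 0 -> pw v n x <-> n <= v x.
Proof. by move=> /eqP x0; split=> [[]//|]; right. Qed.

Lemma pw1 : pw v 0 1. Proof. by right; rewrite val1. Qed.

Lemma pwD n x y : pw v n x -> pw v n y -> pw v n (x + y).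
Proof.
case=> [->|nx]; first by rewrite add0r.
case=> [->|ny]; first by rewrite addr0; right.
have [->|x0] := eqVneq x 0; first by rewrite add0r; right.
have [->|y0] := eqVneq y 0; first by rewrite addr0; right.
have [|xy0] := eqVneq (x + y) 0; first by left.
right; apply: le_trans (valuationD vP x0 y0 xy0).
by rewrite le_min nx ny.
Qed.

Lemma pwN n x : pw v n x -> pw v n (- x).
Proof. by case=> [->|nx]; [left; rewrite oppr0|right; rewrite valN]. Qed.

Lemma pwB n x y : pw v n x -> pw v n y -> pw v n (x - y).
Proof. by move=> nx /pwN; exact: pwD. Qed.

Lemma pwBC n x y : pw v n (x - y) -> pw v n (y - x).
Proof. by move=> /pwN; rewrite opprB. Qed.

Lemma pwM n m x y : pw v n x -> pw v m y -> pw v (n + m) (x * y).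
Proof.
case=> [->|nx]; first by rewrite mul0r; left.
case=> [->|my]; first by rewrite mulr0; left.
have [->|x0] := eqVneq x 0; first by rewrite mul0r; left.
have [->|y0] := eqVneq y 0; first by rewrite mulr0; left.
by right; rewrite valM // lerD.
Qed.

Lemma pwMl n x y : pw v 0 x -> pw v n y -> pw v n (x * y).
Proof. by move=> ox ny; rewrite -(add0r n); exact: pwM. Qed.

Lemma pwMr n x y : pw v n x -> pw v 0 y -> pw v n (x * y).
Proof. by move=> ox ny; rewrite -(addr0 n); exact: pwM. Qed.

Lemma pw_le n m x : m <= n -> pw v n x -> pw v m x.
Proof. by move=> mn [->|nx]; [left|right; exact: le_trans mn nx]. Qed.

Lemma pw_sum (I : Type) (s : seq I) (P : pred I) n (f : I -> A) :
  (forall i, P i -> pw v n (f i)) -> pw v n (\sum_(i <- s | P i) f i).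
Proof.
by move=> fn; elim/big_ind : _ => [|x y|i Pi]; [left|exact: pwD|exact: fn].
Qed.

Lemma pw_prop0 x : (forall n : nat, pw v n%:Z x) -> x = 0.
Proof.
move=> nx; apply/eqP; apply: contrapT => /negP x0.
have := nx `|v x|.+1; rewrite pwP //; lia.
Qed.

Lemma pw_exists x : exists n : nat, pw v (- n%:Z) x.
Proof. by exists `|v x|%N; right; lia. Qed.

Lemma valX x (n : nat) : x != 0 -> x ^+ n != 0 /\ v (x ^+ n) = n%:Z * v x.
Proof.
move=> x0; elim: n => [|n [IH1 IH2]]; first by rewrite expr0 oner_neq0 val1 mul0r.
by rewrite exprS val_mul_neq0 // valM // IH2; split => //; lia.
Qed.

Lemma valV x : x \is a GRing.unit -> v x^-1 = - v x.
Proof.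
move=> xu; have x0 : x != 0 by apply: contraTneq xu => ->; rewrite unitr0.
have y0 : x^-1 != 0 by rewrite invr_eq0.
by have := valM x0 y0; rewrite divrr // val1; lia.
Qed.

Lemma valXz x (z : int) : x \is a GRing.unit -> v (x ^ z) = z * v x.
Proof.
move=> xu; have x0 : x != 0 by apply: contraTneq xu => ->; rewrite unitr0.
case: z => n; first by rewrite -exprnP; have [] := valX n x0.
rewrite NegzE -exprnN valV ?unitrX //.
by have [_ ->] := valX n.+1 x0; rewrite mulNr.
Qed.

Lemma pw_unitV x : x \is a GRing.unit -> v x = 0 -> pw v 0 x^-1.
Proof. by move=> xu x0; right; rewrite valV // x0. Qed.

Lemma val_dominant n x y : x != 0 -> v x = n -> pw v (n + 1) y ->
  x + y != 0 /\ v (x + y) = n.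
Proof.
move=> x0 vx ny.
have xy0 : x + y != 0.
  apply/eqP => /eqP; rewrite addr_eq0 => /eqP xE.
  have : pw v (n + 1) x by rewrite xE; exact: pwN.
  by rewrite pwP // vx; lia.
split=> //; apply/eqP; rewrite eq_le; apply/andP; split.
  rewrite leNgt; apply/negP => lt_n.
  have : pw v (n + 1) x.
    have -> : x = (x + y) - y by rewrite addrK.
    by apply: pwB => //; right; lia.
  by rewrite pwP // vx; lia.
rewrite -pwP //; apply: pwD; first by right; rewrite vx.
by apply: pw_le ny; lia.
Qed.

End Valuation.

(** * The valuation of D in cyclic coordinates *)

Section CyclicPresentation.
Variables (F : localField) (d : nat) (D : divAlg F d) (P : cyclicPres D).
Local Notation vF := (@lf_val F).
Local Notation vD := (@da_val F d D).
Local Notation vE := (@ue_val F d (cp_E P)).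
Local Notation ppi := (cp_pi P).
Local Notation emb := (cp_emb P).

Lemma da_degree_gt0 : (0 < d)%N.
Proof.
have := da_dim D; case: d D => // D0; rewrite exp0n // => /eqP.
by rewrite dimv_eq0 => /eqP full0; have := memvf (1 : D0);
  rewrite full0 memv0 oner_eq0.
Qed.

Lemma cp_pi_neq0 : ppi != 0.
Proof.
apply/eqP => pi0; have := cp_pi_pow P.
rewrite pi0 expr0n eqn0Ngt da_degree_gt0 => /esym/eqP.
by rewrite scaler_eq0 oner_eq0 orbF; have [/negPf->] := cp_unifP P.
Qed.

Lemma cp_pi_unit : ppi \is a GRing.unit.
Proof. exact: da_div cp_pi_neq0. Qed.

(** The constant e of [cp_val] is evaluated at the uniformizer of F, which has [ue_val] 1 in E and
    is the d-th power of [ppi] in D. *)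
Lemma da_val_pi_gt0 : 0 < vD ppi /\
  forall x : cp_E P, x != 0 -> vD (emb x) = (d%:Z * vD ppi) * vE x.
Proof.
have [e e0 eE] := cp_val P; have [unif0 vunif] := cp_unifP P.
have uA0 : (cp_unif P)%:A != 0 :> cp_E P by rewrite scaler_eq0 oner_eq0 orbF.
have := eE _ uA0; rewrite ue_val_ext // vunif mulr1 rmorph_alg.
rewrite -cp_pi_pow; have [_ ->] := valX (@da_valP F d D) d cp_pi_neq0 => vpi.
by split; [have := da_degree_gt0; nia|move=> x x0; rewrite eE // vpi].
Qed.

Lemma cp_emb_neq0 (x : cp_E P) : x != 0 -> emb x != 0.
Proof. by rewrite fmorph_eq0. Qed.

(** The nonzero summand of index i has valuation [vD ppi] times i + d vE(c i). These integers are
    distinct modulo d, so the summand of least valuation is unique and dominates the sum. *)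
Lemma cp_sum_val (c : 'I_d -> cp_E P) (i1 : 'I_d) : c i1 != 0 ->
  exists i0 : 'I_d, [/\ c i0 != 0,
    \sum_(i < d) ppi ^+ i * emb (c i) != 0,
    vD (\sum_(i < d) ppi ^+ i * emb (c i)) = vD ppi * (i0%:Z + d%:Z * vE (c i0)) &
    forall i, c i != 0 -> i0%:Z + d%:Z * vE (c i0) <= i%:Z + d%:Z * vE (c i)].
Proof.
move=> ci1; have [w0 wE] := da_val_pi_gt0.
pose f (i : 'I_d) := i%:Z + d%:Z * vE (c i).
have [i0 ci0 i0_min] := @arg_minP _ _ _ i1 (fun i => c i != 0) f ci1.
exists i0.
have term i : c i != 0 -> ppi ^+ i * emb (c i) != 0 /\
    vD (ppi ^+ i * emb (c i)) = vD ppi * f i.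
  move=> ci; have [pin0 pinv] := valX (@da_valP F d D) i cp_pi_neq0.
  have e0 := cp_emb_neq0 ci.
  rewrite (val_mul_neq0 (@da_valP F d D)) // (valM (@da_valP F d D)) //.
  by rewrite pinv wE // /f; split => //; ring.
have [t0 tv] := term _ ci0.
rewrite (bigD1 i0) //=.
suff rest : pw vD (vD ppi * f i0 + 1) (\sum_(i < d | i != i0) ppi ^+ i * emb (c i)).
  by have [] := val_dominant (@da_valP F d D) t0 tv rest; split.
apply: (pw_sum (@da_valP F d D)) => i i_neq.
have [->|ci] := eqVneq (c i) 0; first by left; rewrite rmorph0 mulr0.
right; have [_ ->] := term _ ci.
have lt_f : f i0 < f i.
  rewrite lt_neqAle i0_min // andbT; apply: contraNneq i_neq; rewrite /f => fE.
  apply/eqP/val_inj => /=.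
  have := ltn_ord i; have := ltn_ord i0.
  move: (nat_of_ord i) (nat_of_ord i0) (vE (c i)) (vE (c i0)) fE; clear.
  move=> a b u v fE bd ad.
  have : u = v.
    apply/eqP; rewrite eq_le !leNgt; apply/andP; split; apply/negP => h; nia.
  by move=> uv; rewrite uv in fE; lia.
nia.
Qed.

(** By [cp_sum_val] every value of [vD] is a multiple of [vD ppi], and normalization makes 1 a
    value. *)
Lemma da_val_pi : vD ppi = 1.
Proof.
have [x x0 vx] := val_onto (@da_valP F d D).
have [c [xE _]] := cp_sum P x.
have [[i ci]|c0] := pselect (exists i, c i != 0).
  have [i0 [_ _]] := cp_sum_val ci; rewrite -xE vx => h _.
  have [+ _] := da_val_pi_gt0; move: h.
  move: (vD ppi) (i0%:Z + _) => w m h w0.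
  by have m0 : 0 < m by [nia]; nia.
case/eqP: x0; rewrite xE big1 // => i _.
have [->|ci] := eqVneq (c i) 0; first by rewrite rmorph0 mulr0.
by case: c0; exists i.
Qed.

Lemma da_val_emb (x : cp_E P) : x != 0 -> vD (emb x) = d%:Z * vE x.
Proof. by move=> x0; have [_ ->//] := da_val_pi_gt0; rewrite da_val_pi mulr1. Qed.

(** A leading exponent i0 + d v with i0 < d is at least kd exactly when v is at least k. This is why
    only ideals with exponent divisible by d are described by coordinates. *)
Lemma pw_cp_sum (c : 'I_d -> cp_E P) (k : int) :
  pw vD (k * d%:Z) (\sum_(i < d) ppi ^+ i * emb (c i)) <-> forall i, pw vE k (c i).
Proof.
split=> [kx i|kc].
  have [->|ci] := eqVneq (c i) 0; first by left.
  have [i0 [ci0 x0 vx minx]] := cp_sum_val ci.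
  rewrite da_val_pi mul1r in vx.
  have vE0 : k <= vE (c i0).
    by have := ltn_ord i0; move: kx; rewrite pwP // vx; nia.
  by right; have := ltn_ord i; have := ltn_ord i0; have := minx _ ci; nia.
apply: (pw_sum (@da_valP F d D)) => i _; case: (kc i) => [->|ki].
  by left; rewrite rmorph0 mulr0.
have [->|ci] := eqVneq (c i) 0; first by left; rewrite rmorph0 mulr0.
have [pi0 piv] := valX (@da_valP F d D) i cp_pi_neq0.
right; rewrite (valM (@da_valP F d D)) ?cp_emb_neq0 // piv da_val_emb // da_val_pi.
nia.
Qed.

Lemma pw_emb (x : cp_E P) (k : int) : pw vE k x <-> pw vD (k * d%:Z) (emb x).
Proof.
have [->|x0] := eqVneq x 0; first by rewrite rmorph0; split; left.
rewrite !pwP ?cp_emb_neq0 // da_val_emb //; have := da_degree_gt0; nia.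
Qed.

Lemma da_val_alg (a : F) : a != 0 -> vD a%:A = d%:Z * vF a.
Proof.
move=> a0; have -> : a%:A = emb a%:A by rewrite rmorph_alg.
by rewrite da_val_emb ?ue_val_ext // scaler_eq0 oner_eq0 orbF.
Qed.

Lemma pw_alg (a : F) (k : int) : pw vF k a <-> pw vD (k * d%:Z) a%:A.
Proof.
have [->|x0] := eqVneq a 0; first by rewrite scale0r; split; left.
have a0 : a%:A != 0 :> D by rewrite scaler_eq0 oner_eq0 orbF.
by rewrite !pwP // da_val_alg //; have := da_degree_gt0; nia.
Qed.

Lemma pw_scale (a : F) (x : D) (k n : int) :
  pw vF k a -> pw vD n x -> pw vD (k * d%:Z + n) (a *: x).
Proof.
by move=> /pw_alg ka nx; rewrite -mulr_algl; exact: (pwM (@da_valP F d D)).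
Qed.

End CyclicPresentation.

(** * Completeness of D and finiteness of its residue rings *)

Section Completeness.
Variables (F : localField) (d : nat) (D : divAlg F d) (P : cyclicPres D).
Local Notation vF := (@lf_val F).
Local Notation vD := (@da_val F d D).
Local Notation unif := (cp_unif P).
Local Notation vFP := (@lf_valP F).
Local Notation vDP := (@da_valP F d D).

Let d_gt0 : (0 < d)%N := da_degree_gt0 D.

Lemma lf_series (b : nat -> F) : (forall n : nat, pw vF n%:Z (b n)) ->
  exists c, forall n : nat, pw vF n%:Z (c - \sum_(m < n) b m).
Proof.
move=> bn; pose u n := \sum_(m < n) b m.
have ule n i : (n <= i)%N -> pw vF n%:Z (u i - u n).
  elim: i => [|i IH]; first by rewrite leqn0 => /eqP ->; rewrite subrr; left.
  rewrite leq_eqVlt => /orP[/eqP->|ni]; first by rewrite subrr; left.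
  rewrite /u big_ord_recr /= -/(u i) addrAC.
  by apply: (pwD vFP) (IH ni) _; apply: pw_le (bn i); rewrite lez_nat -ltnS.
have [n|c cP] := @lf_complete F u.
  exists `|n|%N => i j ni nj.
  have -> : u i - u j = (u i - u `|n|%N) - (u j - u `|n|%N) by ring.
  by apply: pw_le (pwB vFP (ule _ _ ni) (ule _ _ nj)); lia.
exists c => n; have [N NP] := cP n%:Z.
have -> : c - \sum_(m < n) b m =
   (u (maxn N n) - u n) - (u (maxn N n) - c) by rewrite /u; ring.
by apply: (pwB vFP); [apply: ule; rewrite leq_maxr|apply: NP; rewrite leq_maxl].
Qed.

Let unif0 : unif != 0. Proof. by have [] := cp_unifP P. Qed.
Let vunif : vF unif = 1. Proof. by have [] := cp_unifP P. Qed.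

Lemma pw_unifX n : pw vF n%:Z (unif ^+ n).
Proof. by right; have [_ ->] := valX vFP n unif0; rewrite vunif mulr1. Qed.

(** Independence over the residue field of F modulo P_D^d, the ideal generated by the uniformizer of
    F. *)
Definition residue_free k (x : 'I_k -> D) := (forall i, pw vD 0 (x i)) /\
  forall a : 'I_k -> F, (forall i, pw vF 0 (a i)) ->
    pw vD d%:Z (\sum_i a i *: x i) -> forall i, pw vF 1 (a i).

(** Dividing an F-linear relation by a coefficient of least valuation gives integral coefficients,
    one of them equal to 1, against residual independence. So the family is free over F. *)
Lemma residue_free_bound k (x : 'I_k -> D) : residue_free x -> (k <= d ^ 2)%N.
Proof.
case=> Ox xfree; rewrite -(da_dim D).
have /eqP : free [tuple x i | i < k].
  apply/freeP => a a0 i; apply/eqP; apply: contrapT => /negP ai.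
  have [i0 ai0 i0_min] := @arg_minP _ _ _ i (fun i => a i != 0) (vF \o a) ai.
  have /(_ (fun j => a j / a i0)) := xfree => /(_ _ _ i0).
  have ui0 : a i0 \is a GRing.unit by rewrite unitfE.
  rewrite divff //; case.
  - move=> j; have [->|aj] := eqVneq (a j) 0; first by rewrite mul0r; left.
    right; rewrite (valM vFP) ?invr_eq0 // (valV vFP) //.
    by have := i0_min _ aj; rewrite /= subr_ge0.
  - left; transitivity ((a i0)^-1 *: \sum_(j < k) a j *: x j).
      by rewrite scaler_sumr; apply: eq_bigr => j _; rewrite scalerA mulrC.
    rewrite -[RHS](scaler0 _ (a i0)^-1) -[in RHS]a0; congr (_ *: _).
    by apply: eq_bigr => j _; rewrite -tnth_nth tnth_mktuple.
  - by move/eqP; rewrite oner_eq0.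
  - by rewrite (val1 vFP).
by rewrite size_tuple => <-; exact/dimvS/subvf.
Qed.

Lemma residue_span : exists k (x : 'I_k -> D), (forall i, pw vD 0 (x i)) /\
  forall y, pw vD 0 y -> exists (a : 'I_k -> F) z,
    [/\ forall i, pw vF 0 (a i), pw vD 0 z & y = \sum_i a i *: x i + unif *: z].
Proof.
pose Q := [pred k | `[< exists x : 'I_k -> D, residue_free x >]].
have Q0 : exists k, Q k.
  by exists 0%N; apply/asboolP; exists (fun=> 0); split=> [[]|a _ _ []].
have Qb k : Q k -> (k <= d ^ 2)%N by move=> /asboolP[x /residue_free_bound].
case: (ex_maxnP Q0 Qb) => k /asboolP[x [Ox xfree]] kmax.
exists k, x; split=> // y Oy.
pose x' (i : 'I_k.+1) := if unlift ord_max i is Some j then x j else y.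
have x'E (a : 'I_k.+1 -> F) : \sum_i a i *: x' i =
    \sum_(i < k) a (lift ord_max i) *: x i + a ord_max *: y.
  rewrite big_ord_recr /= /x' unlift_none; congr (_ + _).
  apply: eq_bigr => i _.
  have -> : widen_ord (leqnSn k) i = lift ord_max i.
    by apply/val_inj; rewrite /= /bump leqNgt ltn_ord.
  by rewrite liftK.
have : ~ residue_free x'.
  by move=> x'f; have := kmax k.+1; rewrite ltnn => /(_ _)/negP; apply=> //;
    apply/asboolP; exists x'.
move=> nfree.
have [a [aO [apw [i0 ai0]]]] : exists a : 'I_k.+1 -> F,
    (forall i, pw vF 0 (a i)) /\ pw vD d%:Z (\sum_i a i *: x' i) /\
    exists i, ~ pw vF 1 (a i).
  apply: contrapT => h; apply: nfree; split.
    by move=> i; rewrite /x'; case: unliftP => [j _|_].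
  move=> a aO ax i; apply: contrapT => nai; apply: h.
  by exists a; split=> //; split=> //; exists i.
rewrite x'E in apw.
(* With the coefficient of y in P_F, the relation would already hold among the [x i]. *)
have [a1|na1] := pselect (pw vF 1 (a ord_max)).
  exfalso; have ay : pw vD d%:Z (a ord_max *: y).
    by have := pw_scale P a1 Oy; rewrite mul1r addr0.
  have ax := pwB vDP apw ay; rewrite addrK in ax.
  have /= h := xfree _ (fun i => aO (lift ord_max i)) ax.
  apply: ai0; case: (unliftP ord_max i0) => [j ->|->] //; exact: h.
have aN0 : a ord_max != 0 by apply: contra_notN na1 => /eqP->; left.
have va : vF (a ord_max) = 0.
  have := aO ord_max; rewrite pwP // => h; move: na1; rewrite pwP //; lia.
set c := (a ord_max)^-1.
have Oc : pw vF 0 c by apply: (pw_unitV vFP); rewrite ?unitfE.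
pose w := \sum_(i < k) a (lift ord_max i) *: x i + a ord_max *: y.
exists (fun i => - (c * a (lift ord_max i))), (unif^-1 *: (c *: w)).
split.
- by move=> i; apply: (pwN vFP); apply: (pwMl vFP).
- have h1 : pw vF (-1) unif^-1.
    by right; rewrite (valV vFP) ?unitfE // vunif.
  have h2 : pw vD d%:Z (c *: w) by have := pw_scale P Oc apw; rewrite mul0r add0r.
  by have := pw_scale P h1 h2; rewrite mulN1r addNr.
rewrite (scalerA unif) divff // scale1r /w scalerDr scalerA mulVf // scale1r addrA.
rewrite scaler_sumr -big_split /= big1 ?add0r // => i _.
by rewrite scaleNr scalerA addNr.
Qed.

(** Successive approximation: each remainder modulo the uniformizer is expanded again, and the
    coefficients are series that converge in F. *)
Lemma da_int_fg : exists k (x : 'I_k -> D), (forall i, pw vD 0 (x i)) /\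
  forall y, pw vD 0 y -> exists a : 'I_k -> F,
    (forall i, pw vF 0 (a i)) /\ y = \sum_i a i *: x i.
Proof.
have [k [x [Ox span]]] := residue_span; exists k, x; split=> // y Oy.
have /choice[step stepP] : forall y, exists az : ('I_k -> F) * D, pw vD 0 y ->
    [/\ forall i, pw vF 0 (az.1 i), pw vD 0 az.2 &
        y = \sum_i az.1 i *: x i + unif *: az.2].
  move=> z; have [/span[a [t ?]]|nO] := pselect (pw vD 0 z); last by exists (fun=> 0, 0).
  by exists (a, t).
(* [Y n] is the n-th remainder, and [b i n] the n-th term of the series for the coefficient of
   [x i]. *)
pose Y n := iter n (fun z => (step z).2) y.
have OY n : pw vD 0 (Y n) by elim: n => //= n /stepP[].
pose b i n := unif ^+ n * (step (Y n)).1 i.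
have bP i n : pw vF n%:Z (b i n).
  by apply: (pwMr vFP) (pw_unifX n) _; have [] := stepP _ (OY n).
have /choice[c cP] i := lf_series (bP i).
have yE n : y = \sum_i (\sum_(m < n) b i m) *: x i + unif ^+ n *: Y n.
  elim: n => [|n IH].
    by rewrite expr0 scale1r big1 ?add0r // => i _; rewrite big_ord0 scale0r.
  rewrite {1}IH; have [_ _ {1}->] := stepP _ (OY n).
  rewrite scalerDr addrA scalerA -exprSr; congr (_ + _).
  rewrite scaler_sumr -big_split /=; apply: eq_bigr => i _.
  by rewrite scalerA -scalerDl big_ord_recr.
exists c; split.
  by move=> i; have := cP i 0%N; rewrite big_ord0 subr0.
apply: subr0_eq; apply: (@pw_prop0 _ vD) => n.
have -> : y - \sum_i c i *: x i =
    unif ^+ n *: Y n - \sum_i (c i - \sum_(m < n) b i m) *: x i.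
  rewrite {1}(yE n); under [in RHS]eq_bigr do rewrite scalerBl.
  by rewrite sumrB opprB addrA (addrC (unif ^+ n *: Y n)).
have nd : n%:Z <= n%:Z * d%:Z by rewrite -PoszM lez_nat leq_pmulr.
apply: (pwB vDP); last apply: (pw_sum vDP) => i _.
  by apply: pw_le nd _; have := pw_scale P (pw_unifX n) (OY n); rewrite addr0.
by apply: pw_le nd _; have := pw_scale P (cP i n) (Ox i); rewrite addr0.
Qed.

(** Expansion to n digits in powers of the uniformizer of F; a digit is a combination of the
    generators of O_D with coefficients among representatives of the residue field. *)
Lemma da_int_finite (n : nat) : exists s : seq D, forall y, pw vD 0 y ->
  exists2 x, x \in s & pw vD 0 x /\ pw vD n%:Z (y - x).
Proof.
suff [s sP] : exists s : seq D, forall y, pw vD 0 y ->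
    exists2 x, x \in s & pw vD 0 x /\ exists2 z, pw vD 0 z & y = x + unif ^+ n *: z.
  exists s => y /sP[x xs [Ox [z Oz ->]]]; exists x => //; split=> //.
  rewrite addrC addKr; have := pw_scale P (pw_unifX n) Oz; rewrite addr0.
  by apply: pw_le; rewrite -PoszM lez_nat leq_pmulr.
have [k [x [Ox xP]]] := da_int_fg.
have [q [sF [_ _ sF0 sFP]]] := lf_residue F.
pose s0 := [seq \sum_i nth 0 sF (nat_of_ord (h i)) *: x i |
             h : {ffun 'I_k -> 'I_(size sF)}].
have s0P y : pw vD 0 y -> exists2 t, t \in s0 &
     pw vD 0 t /\ exists2 z, pw vD 0 z & y = t + unif *: z.
  move=> /xP[a [aO ->]].
  have /choice[h hP] : forall i, exists h : 'I_(size sF), pw vF 1 (a i - nth 0 sF h).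
    move=> i; have [t [[ts tP] _]] := sFP _ (aO i).
    by have tsz : (index t sF < size sF)%N by [rewrite index_mem];
      exists (Ordinal tsz); rewrite /= nth_index.
  exists (\sum_i nth 0 sF (nat_of_ord (h i)) *: x i).
    by apply/fintype.imageP; exists (finfun h) => //; apply: eq_bigr => i _; rewrite ffunE.
  split.
    apply: (pw_sum vDP) => i _; have -> : 0 = 0%Z * d%:Z + 0 by rewrite mul0r.
    by apply: (pw_scale P) => //; apply: sF0; rewrite mem_nth.
  exists (\sum_i (unif^-1 * (a i - nth 0 sF (h i))) *: x i).
    apply: (pw_sum vDP) => i _; have -> : 0 = 0%Z * d%:Z + 0 by rewrite mul0r.
    apply: (pw_scale P) => //; have -> : 0 = (-1) + 1%Z :> int by [].
    by apply: (pwM vFP) => //; right; rewrite (valV vFP) ?unitfE // vunif.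
  rewrite scaler_sumr -big_split /=; apply: eq_bigr => i _.
  by rewrite scalerA mulrA divff // mul1r -scalerDl addrC subrK.
elim: n => [|n [s sP]].
  exists [:: 0] => y Oy; exists 0; rewrite ?inE //; split; first by left.
  by exists y => //; rewrite add0r expr0 scale1r.
exists [seq u + unif ^+ n *: t | u <- s, t <- s0] => y /sP[u us [Ou [z /s0P[t ts [Ot [z' Oz' zE]]] yE]]].
exists (u + unif ^+ n *: t).
  by apply/allpairsP; exists (u, t).
split.
  apply: (pwD vDP) => //; have := pw_scale P (pw_unifX n) Ot; rewrite addr0.
  exact: pw_le.
by exists z' => //; rewrite yE zE scalerDr addrA scalerA exprSr.
Qed.

(** Along the indices nd the differences are divisible by the n-th power of the uniformizer, so
    their coordinates on a finite family of generators of O_D sum to convergent series in F. *)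
Lemma da_complete (u : nat -> D) : (forall n : nat, pw vD n%:Z (u n.+1 - u n)) ->
  exists x, forall n : nat, pw vD n%:Z (x - u n).
Proof.
move=> uP.
have ule n i : (n <= i)%N -> pw vD n%:Z (u i - u n).
  elim: i => [|i IH]; first by rewrite leqn0 => /eqP ->; rewrite subrr; left.
  rewrite leq_eqVlt => /orP[/eqP->|ni]; first by rewrite subrr; left.
  have -> : u i.+1 - u n = (u i.+1 - u i) + (u i - u n) by rewrite addrA subrK.
  by apply: (pwD vDP) (IH ni); apply: pw_le (uP i); rewrite lez_nat -ltnS.
suff [x xP] : exists x, forall n, pw vD (n * d)%N%:Z (x - u (n * d)%N).
  exists x => n; have nd : (n <= n * d)%N by rewrite leq_pmulr.
  have -> : x - u n = (x - u (n * d)%N) + (u (n * d)%N - u n) by rewrite addrA subrK.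
  by apply: (pwD vDP) (ule _ _ nd); apply: pw_le (xP n); rewrite lez_nat.
have [k [x [Ox xP]]] := da_int_fg.
pose w n := u (n.+1 * d)%N - u (n * d)%N.
have wP n : exists b : 'I_k -> F, (forall i, pw vF n%:Z (b i)) /\
    w n = \sum_i b i *: x i.
  have Ow : pw vD 0 (unif ^- n *: w n).
    have h1 : pw vF (- n%:Z) (unif ^- n).
      right; rewrite (valV vFP) ?unitfE ?expf_eq0 ?(negPf unif0) ?andbF //.
      by have [_ ->] := valX vFP n unif0; rewrite vunif mulr1.
    have h2 : pw vD (n * d)%N%:Z (w n) by apply: ule; rewrite leq_pmul2r.
    by have := pw_scale P h1 h2; rewrite PoszM mulNr addNr.
  have [a [aO aE]] := xP _ Ow; exists (fun i => unif ^+ n * a i); split.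
    by move=> i; apply: (pwMr vFP) => //; exact: pw_unifX.
  under eq_bigr do rewrite -scalerA.
  by rewrite -scaler_sumr -aE scalerA divff ?scale1r // expf_eq0 (negPf unif0) andbF.
have /choice[b bP] := wP.
have /choice[c cP] i := lf_series (fun n => (bP n).1 i).
exists (u 0%N + \sum_i c i *: x i) => n.
have -> : u 0%N + \sum_i c i *: x i - u (n * d)%N =
    \sum_i (c i - \sum_(m < n) b m i) *: x i.
  under [in RHS]eq_bigr do rewrite scalerBl; rewrite sumrB.
  have -> : u (n * d)%N = u 0%N + \sum_i (\sum_(m < n) b m i) *: x i.
    elim: n => [|n IH].
      by rewrite mul0n big1 ?addr0 // => i _; rewrite big_ord0 scale0r.
    have -> : u (n.+1 * d)%N = u (n * d)%N + w n by rewrite /w addrC subrK.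
    rewrite (bP n).2 IH -addrA; congr (_ + _); rewrite -big_split /=.
    by apply: eq_bigr => i _; rewrite big_ord_recr /= scalerDl.
  by rewrite opprD addrACA subrr add0r.
apply: (pw_sum vDP) => i _.
by have := pw_scale P (cP i n) (Ox i); rewrite addr0 PoszM.
Qed.

End Completeness.

(** * Congruence subgroups and their topology *)

Section Matrices.
Variables (F : localField) (d : nat) (D : divAlg F d).
Local Notation vD := (@da_val F d D).
Local Notation vDP := (@da_valP F d D).

Definition mxpw p q (n : int) (A : 'M[D]_(p, q)) := forall i j, pw vD n (A i j).

Lemma mxpw0 p q n : @mxpw p q n 0.
Proof. by move=> i j; rewrite mxE; left. Qed.

Lemma mxpwD p q n (A B : 'M[D]_(p, q)) : mxpw n A -> mxpw n B -> mxpw n (A + B).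
Proof. by move=> nA nB i j; rewrite mxE; exact: (pwD vDP). Qed.

Lemma mxpwN p q n (A : 'M[D]_(p, q)) : mxpw n A -> mxpw n (- A).
Proof. by move=> nA i j; rewrite mxE; exact: (pwN vDP). Qed.

Lemma mxpwB p q n (A B : 'M[D]_(p, q)) : mxpw n A -> mxpw n B -> mxpw n (A - B).
Proof. by move=> nA /mxpwN; exact: mxpwD. Qed.

Lemma mxpwM p q s n m (A : 'M[D]_(p, q)) (B : 'M[D]_(q, s)) :
  mxpw n A -> mxpw m B -> mxpw (n + m) (A *m B).
Proof.
by move=> nA mB i j; rewrite mxE; apply: (pw_sum vDP) => k _; exact: (pwM vDP).
Qed.

Lemma mxpwMl p q s n (A : 'M[D]_(p, q)) (B : 'M[D]_(q, s)) :
  mxpw 0 A -> mxpw n B -> mxpw n (A *m B).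
Proof. by move=> oA nB; rewrite -(add0r n); exact: mxpwM. Qed.

Lemma mxpwMr p q s n (A : 'M[D]_(p, q)) (B : 'M[D]_(q, s)) :
  mxpw n A -> mxpw 0 B -> mxpw n (A *m B).
Proof. by move=> oA nB; rewrite -(addr0 n); exact: mxpwM. Qed.

Lemma mxpw_le p q n m (A : 'M[D]_(p, q)) : m <= n -> mxpw n A -> mxpw m A.
Proof. by move=> mn nA i j; exact: pw_le (nA i j). Qed.

Lemma mxpw1 r : @mxpw r r 0 1%:M.
Proof.
by move=> i j; rewrite mxE; case: eqP => _; [exact: (pw1 vDP)|left].
Qed.

Lemma mxpw_exists p q (A : 'M[D]_(p, q)) : exists n : nat, mxpw (- n%:Z) A.
Proof.
have /choice[f fP] : forall ij : 'I_p * 'I_q, exists n : nat, pw vD (- n%:Z) (A ij.1 ij.2).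
  by move=> ij; exact: pw_exists.
exists (\sum_ij f ij)%N => i j; apply: pw_le (fP (i, j)).
by rewrite lerN2 lez_nat (bigD1 (i, j)) //= leq_addr.
Qed.

Lemma mxpw_prop0 p q (A : 'M[D]_(p, q)) : (forall n : nat, mxpw n%:Z A) -> A = 0.
Proof.
by move=> nA; apply/matrixP => i j; rewrite mxE; apply: (@pw_prop0 _ vD) => n; exact: nA.
Qed.

Lemma mx_complete (P : cyclicPres D) p q (u : nat -> 'M[D]_(p, q)) :
  (forall n : nat, mxpw n%:Z (u n.+1 - u n)) ->
  exists A, forall n : nat, mxpw n%:Z (A - u n).
Proof.
move=> un.
have /choice[a aP] : forall ij : 'I_p * 'I_q, exists x, forall n : nat,
    pw vD n%:Z (x - u n ij.1 ij.2).
  move=> ij; apply: (da_complete P) => n; have := un n ij.1 ij.2.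
  by rewrite !mxE.
by exists (\matrix_(i, j) a (i, j)) => n i j; rewrite !mxE; exact: (aP (i, j)).
Qed.

(* The inverse is the geometric series. *)
Lemma mx_one_plus_inv (P : cyclicPres D) r (A : 'M[D]_r) : mxpw 1 (A - 1%:M) ->
  exists B, [/\ A *m B = 1%:M & mxpw 0 B].
Proof.
move=> A1; pose Y := 1%:M - A.
have Y1 : mxpw 1 Y by rewrite /Y -opprB; exact: mxpwN.
pose Yn n := iter n (mulmx Y) 1%:M.
have YnP n : mxpw n%:Z (Yn n).
  elim: n => [|n IH]; first exact: mxpw1.
  by rewrite /Yn iterS -/(Yn n) -add1n PoszD; exact: mxpwM.
pose S n := \sum_(k < n) Yn k.
have [n|B BP] := @mx_complete P r r S.
  suff -> : S n.+1 - S n = Yn n by [].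
  by rewrite /S big_ord_recr /= addrAC subrr add0r.
exists B; split; last first.
  move=> i j; have := BP 0%N i j; rewrite /S big_ord0 subr0; exact.
apply/subr0_eq/mxpw_prop0 => n.
have AS : A *m S n = 1%:M - Yn n.
  rewrite (_ : A = 1%:M - Y); last by rewrite /Y opprB addrC subrK.
  elim: n => [|n IH]; first by rewrite /S big_ord0 mulmx0 subrr.
  rewrite /S big_ord_recr /= -/(S n) mulmxDr IH mulmxBl mul1mx.
  by rewrite addrA subrK.
have -> : A *m B - 1%:M = A *m (B - S n) - Yn n.
  by rewrite mulmxBr AS opprB addrA addrAC addrK.
apply: mxpwB => //; apply: mxpwMl => //.
rewrite -(subrK 1%:M A); apply: mxpwD (@mxpw1 r).
exact: mxpw_le A1.
Qed.

(** Determinants being absent over D, a right inverse A' is built as B times the inverse of AB, and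
    C forces A'A to be 1 modulo P. Then A'A is idempotent and right invertible, hence equal to 1. *)
Lemma mx_unit_of_residue (P : cyclicPres D) r (A B C : 'M[D]_r) :
  mxpw 0 A -> mxpw 0 B -> mxpw 0 C ->
  mxpw 1 (A *m B - 1%:M) -> mxpw 1 (C *m A - 1%:M) ->
  exists A', [/\ A *m A' = 1%:M, A' *m A = 1%:M & mxpw 0 A'].
Proof.
move=> OA OB OC AB CA.
have [X [ABX OX]] := mx_one_plus_inv P AB.
pose A' := B *m X; have AA' : A *m A' = 1%:M by rewrite mulmxA.
have OA' : mxpw 0 A' by exact: mxpwMl.
clearbody A'.
exists A'; split=> //.
have CA' : mxpw 1 (C *m A *m A' - A').
  by rewrite -[X in _ - X]mul1mx -mulmxBl; exact: mxpwMr.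
rewrite -mulmxA AA' mulmx1 in CA'.
have A'A : mxpw 1 (A' *m A - 1%:M).
  have -> : A' *m A - 1%:M = (C *m A - 1%:M) - (C - A') *m A.
    by rewrite mulmxBl opprB [RHS]addrC addrA subrK.
  by apply: mxpwB => //; exact: mxpwMr.
have [Z [A'AZ _]] := mx_one_plus_inv P A'A.
by rewrite -[LHS]mulmx1 -[in LHS]A'AZ !mulmxA -(mulmxA A' A A') AA' mulmx1.
Qed.

End Matrices.

Lemma finite_representatives (T : choiceType) (A : set T) (I : finType) (f : T -> I)
    (R : T -> T -> Prop) : (forall x y, A x -> A y -> f x = f y -> R x y) ->
  exists s : seq T, (forall x, x \in s -> A x) /\
    forall y, A y -> exists2 x, x \in s & R x y.
Proof.
move=> fR.
pose g i : option T := if pselect (exists x, A x /\ f x = i) is left h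
  then Some (projT1 (cid h)) else None.
exists (pmap g (enum I)); split=> [x|y Ay].
  rewrite mem_pmap => /mapP[i _]; rewrite /g; case: pselect => // h [->].
  by case: cid => ? [].
have h : exists x, A x /\ f x = f y by exists y.
have gE : exists2 x, g (f y) = Some x & A x /\ f x = f y.
  by rewrite /g; case: pselect => // h'; case: cid => z ?; exists z.
have [x gx [Ax fx]] := gE; exists x; last exact: fR.
by rewrite mem_pmap; apply/mapP; exists (f y); rewrite ?mem_enum.
Qed.

Section GLTopology.
Variables (F : localField) (d : nat) (D : divAlg F d) (r : nat).
Local Notation G := (GL D r).
Local Notation K := (congK D r).
Local Notation vD := (@da_val F d D).
Local Notation vDP := (@da_valP F d D).
Implicit Types (g h k x y : G) (n m l : nat).

Lemma glmM g h : glm (g * h)%g = glm g *m glm h. Proof. by []. Qed.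

Lemma glm1 : glm (1%g : G) = 1%:M. Proof. by []. Qed.
Lemma glmVE g : glmV g = glm g^-1%g. Proof. by []. Qed.

Let dge1 : 1 <= d%:Z. Proof. by rewrite lez_nat (da_degree_gt0 D). Qed.

Lemma congK0P g : K 0 g <-> mxpw 0 (glm g) /\ mxpw 0 (glm g^-1%g).
Proof.
split=> [h|[h1 h2] i j]; last by split; [exact: h1|exact: h2].
by split=> i j; have [] := h i j.
Qed.

Lemma congKSP l g : K l.+1 g <-> mxpw (l.+1 * d)%:Z (glm g - 1%:M).
Proof. by split=> h i j; have := h i j; rewrite !mxE. Qed.

(** The identity X = 1 + (1 - g)X for the inverse X improves a bound P^(-k-1) on X to P^(-k), until
    no denominator is left. *)
Lemma mxpw_inv g n : mxpw n.+1%:Z (glm g - 1%:M) ->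
  mxpw 0 (glm g^-1%g) /\ mxpw n.+1%:Z (glm g^-1%g - 1%:M).
Proof.
move=> gn; set X := glm g^-1%g.
have XE : X - 1%:M = (1%:M - glm g) *m X.
  by rewrite mulmxBl mul1mx /X -glmM mulgV.
have gn' : mxpw n.+1%:Z (1%:M - glm g) by rewrite -opprB; exact: mxpwN.
suff OX : mxpw 0 X by split=> //; rewrite XE; exact: mxpwMr.
have [k kX] := mxpw_exists X.
elim: k kX => [|k IH] kX; first by rewrite oppr0 in kX.
apply: IH; rewrite -(subrK 1%:M X) XE; apply: mxpwD.
  by apply: mxpw_le (mxpwM gn' kX); lia.
by apply: mxpw_le (@mxpw1 _ _ _ _); lia.
Qed.

Lemma congK_int l g : K l g -> mxpw 0 (glm g).
Proof.
case: l => [/congK0P[]//|l /congKSP gl].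
rewrite -(subrK 1%:M (glm g)); apply: mxpwD (@mxpw1 _ _ _ _).
by apply: mxpw_le gl.
Qed.

Lemma congKV l g : K l g -> K l g^-1%g.
Proof.
case: l => [/congK0P[g1 g2]|l /congKSP gl]; first by apply/congK0P; rewrite invgK.
have ld_gt0 : (0 < l.+1 * d)%N by rewrite muln_gt0 (da_degree_gt0 D).
apply/congKSP; have [|_] := @mxpw_inv g (l.+1 * d)%N.-1; first by rewrite prednK.
by rewrite prednK.
Qed.

Lemma congK1 l : K l 1%g.
Proof.
case: l => [|l]; first by apply/congK0P; rewrite invg1 glm1; split; exact: mxpw1.
by apply/congKSP; rewrite glm1 subrr; exact: mxpw0.
Qed.

Lemma congKM l g h : K l g -> K l h -> K l (g * h)%g.
Proof.
case: l => [|l].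
  move=> /congK0P[g1 g2] /congK0P[h1 h2]; apply/congK0P; rewrite invMg !glmM.
  by split; exact: mxpwMl.
move=> gl hl; have gO := congK_int gl.
move/congKSP: gl => gl; move/congKSP: hl => hl; apply/congKSP.
have -> : glm (g * h)%g - 1%:M = glm g *m (glm h - 1%:M) + (glm g - 1%:M).
  by rewrite mulmxBr mulmx1 glmM addrA subrK.
by apply: mxpwD => //; exact: mxpwMl.
Qed.

Lemma congK_le l m g : (l <= m)%N -> K m g -> K l g.
Proof.
case: m l => [[]//|m] [|l] lm gm.
  by apply/congK0P; split; [exact: congK_int gm|exact/congK_int/(congKV gm)].
move/congKSP: gm => gm; apply/congKSP; apply: mxpw_le gm.
by rewrite lez_nat leq_mul2r lm orbT.
Qed.

Lemma congK_norm l k g : K 0 k -> K l g -> K l (k^-1 * g * k)%g.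
Proof.
move=> k0; case: l => [|l] gl; first by do 2?apply: congKM => //; exact: congKV.
move/congKSP: gl => gl; apply/congKSP.
have [k1 k2] := (congK0P k).1 k0.
have -> : glm (k^-1 * g * k)%g - 1%:M = glm k^-1%g *m (glm g - 1%:M) *m glm k.
  by rewrite mulmxBr mulmx1 mulmxBl -!glmM mulVg.
by apply: mxpwMr => //; exact: mxpwMl.
Qed.

Lemma congK_normV l k g : K 0 k -> K l g -> K l (k * g * k^-1)%g.
Proof. by move=> k0 gl; have := congK_norm (congKV k0) gl; rewrite invgK. Qed.

Lemma congK_near g m : exists n : nat, forall h,
  mxpw n%:Z (glm h - glm g) -> K m (g^-1 * h)%g.
Proof.
have [N gN] := mxpw_exists (glm g^-1%g).
exists (m.+1 * d + N)%N => h gh; apply: (@congK_le _ m.+1) => //; apply/congKSP.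
have -> : glm (g^-1 * h)%g - 1%:M = glm g^-1%g *m (glm h - glm g).
  by rewrite mulmxBr -!glmM mulVg.
by apply: mxpw_le (mxpwM gN gh); lia.
Qed.

Lemma congK_nearV g n : exists m : nat, forall k,
  K m k -> mxpw n%:Z (glm (g * k)%g - glm g).
Proof.
have [N gN] := mxpw_exists (glm g); exists (n + N).+1 => k /congKSP km.
have -> : glm (g * k)%g - glm g = glm g *m (glm k - 1%:M).
  by rewrite mulmxBr mulmx1.
apply: mxpw_le (mxpwM gN km).
have := dge1; move: (d : int) => e; have := leq_pmulr (n + N).+1 (da_degree_gt0 D).
lia.
Qed.

Lemma congK_conj g m : exists n : nat, forall k, K n k -> K m (g^-1 * k * g)%g.
Proof.
have [N gN] := mxpw_exists (glm g); have [N' gN'] := mxpw_exists (glm g^-1%g).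
exists (m.+1 * d + N + N').+1 => k /congKSP kn.
apply: (@congK_le _ m.+1) => //; apply/congKSP.
have -> : glm (g^-1 * k * g)%g - 1%:M = glm g^-1%g *m (glm k - 1%:M) *m glm g.
  by rewrite mulmxBr mulmx1 mulmxBl -!glmM mulVg.
apply: mxpw_le (mxpwM (mxpwM gN' kn) gN).
have := leq_pmulr (m.+1 * d + N + N').+1 (da_degree_gt0 D); lia.
Qed.

(** Multiplying by the fixed matrices g and g^-1 costs a bounded power of P, so the cosets g K^n
    form a basis of neighbourhoods of g for the topology defined by entries. *)
Lemma gl_openP (U : set G) :
  open U <-> forall g, U g -> exists n, forall k, K n k -> U (g * k)%g.
Proof.
rewrite -[open U]/(gl_open U).
split=> [oU g /oU[n nU]|hU g /hU[n nU]].
  have [m mP] := congK_nearV g n; exists m => k /mP kP; apply: nU => i j.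
  by have := kP i j; rewrite !mxE.
have [m mP] := congK_near g n; exists m => h gh.
rewrite -(mulKVg g h); apply/nU/mP => i j; have := gh i j; by rewrite !mxE.
Qed.

Lemma open_coset n g : open [set x | K n (g^-1 * x)%g].
Proof.
apply/gl_openP => x /= gx; exists n => k kn.
by rewrite mulgA; exact: congKM.
Qed.

Lemma coset_sym n x y : K n (x^-1 * y)%g -> K n (y^-1 * x)%g.
Proof. by move=> /congKV; rewrite invMg invgK. Qed.

Lemma coset_trans n x y z :
  K n (x^-1 * y)%g -> K n (y^-1 * z)%g -> K n (x^-1 * z)%g.
Proof. by move=> /congKM h /h; rewrite mulgA mulgK. Qed.

Hypothesis P : cyclicPres D.

(** An element of K^0 is recorded by the classes of its entries modulo P^((n+1)d), a finite
    invariant by [da_int_finite]. *)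
Lemma congK0_finite n : exists s : seq G, (forall x, x \in s -> K 0 x) /\
  forall y, K 0 y -> exists2 x, x \in s & K n (x^-1 * y)%g.
Proof.
have [s sP] := da_int_finite P (n.+1 * d)%N.
pose f g : {ffun 'I_r * 'I_r -> 'I_(size s).+1} :=
  [ffun ij => inord (find (fun t : D => `[< pw vD (n.+1 * d)%:Z (glm g ij.1 ij.2 - t) >]) s)].
apply: (@finite_representatives _ (K 0) _ f) => x y x0 y0 fxy.
apply: (@congK_le _ n.+1) => //; apply/congKSP.
have [Ox OxV] := (congK0P x).1 x0; have Oy := congK_int y0.
have -> : glm (x^-1 * y)%g - 1%:M = glm x^-1%g *m (glm y - glm x).
  by rewrite mulmxBr -!glmM mulVg.
apply: mxpwMl => // i j; rewrite !mxE.
have nthP z : mxpw 0 (glm z) -> exists2 k, (k < size s)%N /\ f z (i, j) = inord k &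
    pw vD (n.+1 * d)%:Z (glm z i j - nth 0 s k).
  move=> Oz; have [t ts [_ tP]] := sP _ (Oz i j).
  have hs : has (fun t : D => `[< pw vD (n.+1 * d)%:Z (glm z i j - t) >]) s.
    by apply/hasP; exists t => //; apply/asboolP.
  exists (find (fun t : D => `[< pw vD (n.+1 * d)%:Z (glm z i j - t) >]) s).
    by split; [rewrite -has_find|rewrite ffunE].
  by have /asboolP := nth_find 0 hs.
have [a [la fa] Pa] := nthP x Ox; have [b [lb fb] Pb] := nthP y Oy.
have ab : a = b.
  have := congr1 val (etrans (esym fa) (etrans (congr1 (fun h : {ffun _} => h (i, j)) fxy) fb)).
  by rewrite /= !inordK // ltnS ltnW.
subst b; have -> : glm y i j - glm x i j =
  (glm y i j - nth 0 s a) - (glm x i j - nth 0 s a) by rewrite opprB addrA subrK.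
exact: (pwB vDP).
Qed.

(** The matrices and their inverses are made to converge together, so that the two limits are
    inverse to each other. *)
Lemma congK_complete (u : nat -> G) :
  (forall n, K 0 (u n)) -> (forall n, K n ((u n)^-1 * u n.+1)%g) ->
  exists2 x, K 0 x & forall n, K n ((u n)^-1 * x)%g.
Proof.
move=> u0 uP; have ud n : mxpw 0 (glm (u n)) by exact: congK_int (u0 n).
have uVd n : mxpw 0 (glm (u n)^-1%g) by exact: congK_int (congKV (u0 n)).
have lend n : n%:Z <= (n * d)%:Z by rewrite lez_nat leq_pmulr // da_degree_gt0.
have step n h : K n (h^-1 * u n)%g -> K 0 h -> mxpw n%:Z (glm (u n) - glm h).
  move=> hP h0; have hO := congK_int h0; case: n hP => [|n] hP.
    by apply: mxpwB.
  have -> : glm (u n.+1) - glm h = glm h *m (glm (h^-1 * u n.+1)%g - 1%:M).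
    by rewrite mulmxBr mulmx1 -glmM mulKVg.
  by apply: mxpwMl => //; move/congKSP: hP; exact: mxpw_le.
have stepV n h : K n (h * (u n)^-1)%g -> K 0 h -> mxpw n%:Z (glm h - glm (u n)).
  move=> hP h0; have hO := congK_int h0; case: n hP => [|n] hP.
    by apply: mxpwB.
  have -> : glm h - glm (u n.+1) = (glm (h * (u n.+1)^-1)%g - 1%:M) *m glm (u n.+1).
    by rewrite mulmxBl mul1mx -glmM mulgKV.
  by apply: mxpwMr => //; move/congKSP: hP; exact: mxpw_le.
have [|A AP] := @mx_complete _ _ _ P r r (fun n => glm (u n)).
  move=> n /=; rewrite -opprB; apply: mxpwN; apply: step (u0 _).
  exact: coset_sym.
have [|B BP] := @mx_complete _ _ _ P r r (fun n => glm (u n)^-1%g).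
  move=> n /=.
  have -> : glm (u n.+1)^-1%g - glm (u n)^-1%g =
      - (glm ((u n)^-1 * u n.+1)%g - 1%:M) *m glm (u n.+1)^-1%g.
    by rewrite mulNmx mulmxBl mul1mx -glmM mulgK opprB.
  apply: mxpwMr => //; apply: mxpwN; case: n (uP n) => [|n] uPn.
    apply: mxpwB (@mxpw1 _ _ _ _); exact: congK_int uPn.
  by move/congKSP: uPn; exact: mxpw_le.
have OA : mxpw 0 A.
  by rewrite -(subrK (glm (u 0%N)) A); apply: mxpwD => //; exact: AP.
have OB : mxpw 0 B.
  by rewrite -(subrK (glm (u 0%N)^-1%g) B); apply: mxpwD => //; exact: BP.
have AB : A *m B = 1%:M.
  apply/subr0_eq/mxpw_prop0 => n.
  have -> : A *m B - 1%:M = (A - glm (u n)) *m B + glm (u n) *m (B - glm (u n)^-1%g).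
    by rewrite mulmxBl mulmxBr -glmM mulgV addrA subrK.
  by apply: mxpwD; [apply: mxpwMr|apply: mxpwMl].
have BA : B *m A = 1%:M.
  apply/subr0_eq/mxpw_prop0 => n.
  have -> : B *m A - 1%:M = (B - glm (u n)^-1%g) *m A + glm (u n)^-1%g *m (A - glm (u n)).
    by rewrite mulmxBl mulmxBr -glmM mulVg addrA subrK.
  by apply: mxpwD; [apply: mxpwMr|apply: mxpwMl].
exists (mkGL AB BA); first by apply/congK0P.
have uni n m : (n <= m)%N -> K n ((u n)^-1 * u m)%g.
  elim: m => [|m IH]; first by rewrite leqn0 => /eqP ->; rewrite mulVg; exact: congK1.
  rewrite leq_eqVlt => /orP[/eqP->|nm]; first by rewrite mulVg; exact: congK1.
  by apply: coset_trans (IH nm) _; apply: congK_le (uP m).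
move=> n; case: n => [|n]; first by apply: congKM; [exact/congKV|exact/congK0P].
apply: coset_trans (uni n.+1 (n.+1 * d)%N _) _.
  by rewrite leq_pmulr // da_degree_gt0.
apply/congKSP; set v := u _.
have -> : glm (v^-1 * mkGL AB BA)%g - 1%:M = glm v^-1%g *m (A - glm v).
  by rewrite mulmxBr -glmM mulVg.
by apply: mxpwMl; [exact: uVd|exact: (AP (n.+1 * d)%N)].
Qed.

(** An ultrafilter on K^0 selects one of the finitely many cosets of each K^n. The selected cosets
    are nested, and [congK_complete] provides a common point. *)
Lemma compact_congK0 : compact (K 0).
Proof.
rewrite compact_ultra => FF FU FK.
have /choice[u uP] : forall n, exists x, K 0 x /\ FF [set y | K n (x^-1 * y)%g].
  move=> n; have [s [s0 sP]] := congK0_finite n.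
  apply: contrapT => nx.
  have allC : forall x, x \in s -> FF [set y | ~ K n (x^-1 * y)%g].
    move=> x xs; have [//|//] := in_ultra_setVsetC [set y | K n (x^-1 * y)%g] FU.
    by move=> h; case: nx; exists x; split=> //; exact: s0.
  have : FF [set y | forall x, x \in s -> ~ K n (x^-1 * y)%g].
    elim: s {s0 sP} allC => [_|a s IH allC].
      by apply: filterS filterT => y _ x; rewrite in_nil.
    apply: filterS (filterI (allC a (mem_head _ _))
      (IH (fun x xs => allC x (@mem_behead _ (a :: s) _ xs)))) => y [ya ys] x.
    rewrite inE => /orP[/eqP->//|]; exact: ys.
  move=> /(filterI FK) /filter_ex[y [y0 yn]].
  by have [x xs] := sP _ y0; exact: yn.
have uu n : K n ((u n)^-1 * u n.+1)%g.
  have [y [y1 y2]] := filter_ex (filterI (uP n).2 (uP n.+1).2).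
  by apply: coset_trans y1 _; apply: coset_sym; exact: congK_le y2.
have [x x0 xP] := congK_complete (fun n => (uP n).1) uu.
exists x; split=> // A; rewrite nbhsE => -[U [oU Ux] UA].
have [n nU] := (gl_openP U).1 oU _ Ux.
apply: filterS (uP n).2 => y yn; apply: UA.
rewrite -(mulKVg x y); apply: nU.
by apply: coset_trans yn; exact: coset_sym.
Qed.

End GLTopology.

(** * Finite coset decompositions of compact sets *)

Section Cosets.
Variables (F : localField) (d : nat) (D : divAlg F d) (r : nat).
Local Notation G := (GL D r).
Local Notation K := (congK D r).
Implicit Types (g h k x y : G) (n m l : nat) (s : seq G) (S : set G).

Lemma translation_continuous g h : continuous (fun x : G => (g * x * h)%g : G).
Proof.
apply/continuousP => A /gl_openP oA; apply/gl_openP => x /oA[n nA].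
have [m mP] := congK_conj h n; exists m => k /mP /nA.
by rewrite /= !mulgA mulgK.
Qed.

Lemma compact_translation g h (C : set G) : compact C ->
  compact [set (g * x * h)%g | x in C].
Proof.
move=> cC; apply: continuous_compact => //.
by apply: continuous_subspaceT; exact: translation_continuous.
Qed.

Lemma compact_cosets_cover n (C : set G) : compact C -> exists s, forall x, C x ->
  exists2 y, y \in s & K n (y^-1 * x)%g.
Proof.
rewrite compact_cover => /(_ G setT (fun y => [set x | K n (y^-1 * x)%g])).
case=> [y _|x Cx|s _ sC]; first exact: open_coset.
  by exists x => //=; rewrite mulVg; exact: congK1.
by exists (finmap.enum_fset s) => x /sC[y ys xy]; exists y.
Qed.

(** The representatives lie in S, which need not be a union of cosets: S will also be the
    intersection of a congruence subgroup with a parabolic subgroup. *)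
Definition cosets n s S := [/\ uniq s, forall x, x \in s -> S x,
  forall x y, x \in s -> y \in s -> K n (x^-1 * y)%g -> x = y &
  forall y, S y -> exists2 x, x \in s & K n (x^-1 * y)%g].

Lemma cosets_exist n s S : (forall y, S y -> exists2 x, x \in s & K n (x^-1 * y)%g) ->
  exists s', cosets n s' S.
Proof.
elim: s S => [|a s IH] S sS.
  by exists [::]; split=> // y /sS[x]; rewrite in_nil.
have [y [Sy yna]|s' [us' s'S s'inj s's]] := IH (fun y => S y /\ ~ K n (a^-1 * y)%g).
  have [x] := sS y Sy; rewrite inE => /orP[/eqP->//|xs xy]; by exists x.
have [[y [Sy ay]]|nay] := pselect (exists y, S y /\ K n (a^-1 * y)%g); last first.
  exists s'; split=> // [x /s'S[]//|y Sy].
  by apply: s's; split=> // ay; apply: nay; exists y.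
have ynx x : x \in s' -> ~ K n (y^-1 * x)%g.
  by move=> /s'S[_ ax] yx; apply: ax; exact: coset_trans ay yx.
exists (y :: s'); split.
- rewrite /= us' andbT; apply/negP => /ynx; apply; rewrite mulVg; exact: congK1.
- by move=> x; rewrite inE => /orP[/eqP->//|/s'S[]].
- move=> x z; rewrite !inE => /orP[/eqP->|xs] /orP[/eqP->|zs] // xz.
  + by case: (ynx _ zs).
  + by case: (ynx _ xs); exact: coset_sym.
  + exact: s'inj.
move=> x Sx; have [ax|nax] := pselect (K n (a^-1 * x)%g).
  exists y; rewrite ?mem_head //; apply: coset_trans ax; exact: coset_sym.
have [//|z zs zx] := s's x; exists z => //; by rewrite inE zs orbT.
Qed.

Lemma cosets_compact n (C : set G) : compact C -> exists s, cosets n s C.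
Proof. by move=> /(compact_cosets_cover n)[s /cosets_exist]. Qed.

Hypothesis P : cyclicPres D.

Lemma compact_congK n : compact (K n).
Proof.
apply: (@subclosed_compact _ _ (K 0)); last by move=> g; exact: congK_le.
  2: exact: compact_congK0.
rewrite -[K n]setCK; apply: open_closedC; apply/gl_openP => g ng; exists n => k kn kg; apply: ng.
by rewrite -(mulgK k g); apply: congKM => //; exact: congKV.
Qed.

Lemma compact_coset n g : compact [set x | K n (g^-1 * x)%g].
Proof.
have := compact_translation (g := g) (h := 1%g) (@compact_congK n); congr (compact _).
apply/seteqP; split=> x /= => [[k kn <-]|kn]; first by rewrite mulg1 mulKg.
by exists (g^-1 * x)%g => //; rewrite mulg1 mulKVg.
Qed.

Lemma compact_cosets n s : compact [set x | exists2 y, y \in s & K n (y^-1 * x)%g].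
Proof.
elim: s => [|a s IH].
  by rewrite (_ : mkset _ = set0); [exact: compact0|apply/seteqP; split=> x // [y]; rewrite in_nil].
have := compactU (@compact_coset n a) IH; congr (compact _).
apply/seteqP; split=> x /=.
  by case=> [ax|[y ys yx]]; [exists a; rewrite ?mem_head|exists y; rewrite // inE ys orbT].
by case=> y; rewrite inE => /orP[/eqP->|ys yx]; [left|right; exists y].
Qed.

(** Conjugation by g carries a deeper congruence subgroup into K^n, so finitely many cosets of K^n
    cover the double coset, which is closed because its complement is a union of cosets. *)
Lemma compact_dcoset n g : compact (dcoset (K n) g).
Proof.
have [m mP] := congK_conj g^-1%g n.
have [m' m'P] := congK_conj g n.
have [s sP] := compact_cosets_cover m' (@compact_congK n).
apply: (@subclosed_compact _ _ [set x | exists2 y, y \in [seq (k * g)%g | k <- s] & K n (y^-1 * x)%g]).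
- rewrite -[dcoset _ _]setCK; apply: open_closedC; apply/gl_openP => x nx; exists n => k kn [[k1 k2] /= [k1n k2n] xE]; apply: nx.
  exists (k1, k2 * k^-1)%g => /=; first by split => //; apply/congKM/congKV.
  by rewrite mulgA xE mulgK.
- exact: compact_cosets.
move=> _ [[k1 k2] /= [k1n k2n] <-]; have [k ks kk1] := sP _ k1n.
exists (k * g)%g; first exact: map_f.
rewrite invMg !mulgA; apply: congKM => //; rewrite -(mulgA _ k^-1%g k1).
exact: m'P.
Qed.

End Cosets.

(** * Haar volumes, and integrals as finite sums *)

Section Volume.
Variables (R : realType) (F : localField) (d : nat) (D : divAlg F d) (r : nat).
Variables (mu : haarMeasures R D r) (P : cyclicPres D).
Local Notation G := (GL D r).
Local Notation K := (congK D r).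
Implicit Types (g h k x y : G) (n m l : nat) (s : seq G) (S : set G).

Lemma open_measurable_GL (U : set G) : open U -> measurable (U : set (borelGL D r)).
Proof. by move=> oU; apply: sub_sigma_algebra. Qed.

Definition vol n : R := fine (hm_G mu (K n)).

Lemma haar_coset n g : hm_G mu [set x | K n (g^-1 * x)%g] = hm_G mu (K n).
Proof.
rewrite -[RHS](hm_G_inv mu g); last first.
  apply: open_measurable_GL; have := @open_coset _ _ D r n 1%g.
  by congr (open _); apply/seteqP; split=> x /=; rewrite -(mul1g x) mulKg ?mul1g // invg1 !mul1g.
congr (hm_G mu _); apply/seteqP; split=> x /= => [kn|[k kn <-]].
  by exists (g^-1 * x)%g => //; rewrite mulKVg.
by rewrite mulKg.
Qed.

Lemma haar_cosets n s : uniq s ->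
  (forall x y, x \in s -> y \in s -> K n (x^-1 * y)%g -> x = y) ->
  hm_G mu [set x | exists2 y, y \in s & K n (y^-1 * x)%g] = (hm_G mu (K n) *+ size s)%E.
Proof.
elim: s => [_ _|a s IH /= /andP[nas us] inj].
  by rewrite (_ : mkset _ = set0); [rewrite measure0|apply/seteqP; split=> x // [y]; rewrite in_nil].
have -> : [set x | exists2 y, y \in a :: s & K n (y^-1 * x)%g] =
  [set x | K n (a^-1 * x)%g] `|` [set x | exists2 y, y \in s & K n (y^-1 * x)%g].
  apply/seteqP; split=> x /=.
    by case=> y; rewrite inE => /orP[/eqP->|ys yx]; [left|right; exists y].
  by case=> [ax|[y ys yx]]; [exists a; rewrite ?mem_head|exists y; rewrite // inE ys orbT].
have disj : [set x : G | K n (a^-1 * x)%g] `&`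
    [set x : G | exists2 y, y \in s & K n (y^-1 * x)%g] = set0.
  apply/seteqP; split=> x //= [ax [y ys yx]].
  have yE : y = a.
    apply: inj; [by rewrite inE ys orbT|exact: mem_head|].
    by apply: coset_trans yx _; exact: coset_sym.
  by move: nas; rewrite -yE ys.
rewrite measureU //.
- transitivity (hm_G mu (K n) + (hm_G mu (K n) *+ size s))%E.
    congr (_ + _)%E; first exact: haar_coset.
    by apply: IH => // x y xs ys; apply: inj; rewrite inE ?xs ?ys orbT.
  by case: (size s) => [|n']; rewrite ?adde0.
- by apply: open_measurable_GL; exact: open_coset.
- apply: open_measurable_GL; apply/gl_openP => x [y ys yx]; exists n => k kn.
  by exists y => //; rewrite mulgA; exact: congKM.
Qed.

(** K^0, of volume 1, is a disjoint union of N translates of K^n. This is the source of both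
    finiteness and positivity of all volumes. *)
Lemma haar_congK n : exists2 N : nat, (0 < N)%N & hm_G mu (K n) = (N%:R^-1)%:E.
Proof.
have [s [us s0 sinj sP]] := cosets_compact n (@compact_congK0 _ _ _ r P).
have K0E : K 0 = [set x | exists2 y, y \in s & K n (y^-1 * x)%g].
  apply/seteqP; split=> x /=; first exact: sP.
  case=> y /s0 y0 yx; rewrite -(mulKVg y x); apply: congKM => //.
  exact: congK_le yx.
have := haar_cosets us sinj; rewrite -K0E hm_G_norm => h.
have s_gt0 : (0 < size s)%N.
  by rewrite lt0n; apply/eqP => s0'; move: h; rewrite s0' mule0n => /eqP;
    rewrite onee_eq0.
exists (size s) => //; move: h; case: (hm_G mu (K n)) => [a| |].
- rewrite -EFin_natmul => -[h]; congr EFin.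
  have sN0 : (size s)%:R != 0 :> R by rewrite pnatr_eq0 -lt0n.
  by apply: (mulIf sN0); rewrite mulVf // mulr_natr.
- by rewrite -(prednK s_gt0) enatmul_pinfty.
- by rewrite -(prednK s_gt0) enatmul_ninfty.
Qed.

Lemma vol_gt0 n : 0 < vol n.
Proof. by rewrite /vol; have [N N0 ->] := haar_congK n; rewrite invr_gt0 ltr0n. Qed.

Lemma vol_EFin n : hm_G mu (K n) = (vol n)%:E.
Proof. by rewrite /vol; have [N N0 ->] := haar_congK n. Qed.

Lemma haar_cosets_fine n s : uniq s ->
  (forall x y, x \in s -> y \in s -> K n (x^-1 * y)%g -> x = y) ->
  hm_G mu [set x | exists2 y, y \in s & K n (y^-1 * x)%g] = ((size s)%:R * vol n)%:E.
Proof.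
by move=> us inj; rewrite haar_cosets // vol_EFin -EFin_natmul mulr_natl.
Qed.

(** The bridge from measure theory to algebra: convolutions and Hecke operators are computed through
    this finite sum. Both sides are compared value by value of f. *)
Lemma lc_integral_cosets (V : lmodType R[i]) n s S (f : G -> V) : cosets n s S ->
  (forall x k, K n k -> f (x * k)%g = f x) -> (forall x, f x != 0 -> S x) ->
  lc_integral (hm_G mu) f = (vol n)%:C%C *: \sum_(x <- s) f x.
Proof.
move=> [us sS inj cov] fK fS; rewrite /lc_integral.
pose T w : V := (fine (hm_G mu (f @^-1` [set w])))%:C%C *: w.
have TE w : w != 0 -> T w = (vol n)%:C%C *: (w *+ count_mem w (map f s)).
  move=> w0; rewrite /T.
  have -> : f @^-1` [set w] =
      [set x | exists2 y, y \in [seq y <- s | f y == w] & K n (y^-1 * x)%g].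
    apply/seteqP; split=> x /= => [fx|[y]].
      have [|y ys yx] := cov x; first by apply: fS; rewrite fx.
      exists y => //; rewrite mem_filter ys andbT.
      by rewrite -(fK y _ yx) mulKVg fx.
    by rewrite mem_filter => /andP[/eqP <- _] yx; rewrite -(fK y _ yx) mulKVg.
  rewrite haar_cosets_fine ?filter_uniq //; last first.
    by move=> x y; rewrite !mem_filter => /andP[_ xs] /andP[_ ys]; exact: inj.
  rewrite (_ : fine _ = (size [seq y <- s | f y == w])%:R * vol n) //.
  rewrite size_filter count_map -(scaler_nat _ w) scalerA; congr (_ *: w).
  by rewrite rmorphM /= mulrC rmorph_nat.
rewrite -(@fsbig_widen _ _ _ _ [set` undup (map f s)]) //; last first.
  move=> w /= [_ wns]; rewrite -/(T w).
  have [->|w0] := eqVneq w 0; first by rewrite /T scaler0.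
  rewrite TE //; have -> : count_mem w (map f s) = 0%N.
    by apply/eqP; rewrite -leqn0 leqNgt -has_count has_pred1 -mem_undup; exact/negP.
  by rewrite mulr0n scaler0.
rewrite -fsbig_seq ?undup_uniq // [RHS]scaler_sumr.
rewrite -(big_map f xpredT (fun w => (vol n)%:C%C *: w)).
rewrite -[RHS]big_undup_iterop_count.
apply: eq_bigr => w _; rewrite -/(T w).
rewrite -[RHS]/(((vol n)%:C%C *: w) *+ count_mem w (map f s)).
have [->|w0] := eqVneq w 0; first by rewrite /T !scaler0 mul0rn.
by rewrite TE // scalerMnr.
Qed.

Lemma lc_integral_translate (V : lmodType R[i]) n s S (f : G -> V) g : cosets n s S ->
  (forall x k, K n k -> f (x * k)%g = f x) -> (forall x, f x != 0 -> S x) ->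
  lc_integral (hm_G mu) (fun x => f (g * x)%g) = lc_integral (hm_G mu) f.
Proof.
move=> cs fK fS; rewrite (lc_integral_cosets cs fK fS).
have cs' : cosets n [seq (g^-1 * x)%g | x <- s] [set x | S (g * x)%g].
  case: cs => us sS inj cov; split.
  - by rewrite map_inj_uniq //; exact: mulgI.
  - by move=> _ /mapP[x xs ->] /=; rewrite mulKVg; exact: sS.
  - move=> _ _ /mapP[x xs ->] /mapP[y ys ->]; rewrite invMg invgK mulgA mulgK.
    by move=> /inj ->.
  - move=> y /= /cov[x xs xy]; exists (g^-1 * x)%g; first exact: map_f.
    by rewrite invMg invgK -mulgA.
rewrite (lc_integral_cosets cs'); first 1 last.
- by move=> x k kn; rewrite mulgA (fK _ _ kn).
- by move=> x /fS.
by rewrite big_map; congr (_ *: _); apply: eq_bigr => x _; rewrite mulKVg.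
Qed.

End Volume.

(** * Averages and the Hecke algebra *)

Section Subspaces.
Variables (C : fieldType) (V : lmodType C).

Definition subspace (W : set V) :=
  W 0 /\ forall a u v, W u -> W v -> W (a *: u + v).

Variable W : set V.
Hypothesis sW : subspace W.

Lemma subspaceZ a u : W u -> W (a *: u).
Proof. by move=> Wu; rewrite -[_ *: _]addr0; apply: sW.2 => //; exact: sW.1. Qed.

Lemma subspaceD u v : W u -> W v -> W (u + v).
Proof. by move=> Wu Wv; rewrite -[u]scale1r; exact: sW.2. Qed.

Lemma subspaceN u : W u -> W (- u).
Proof. by move=> Wu; rewrite -scaleN1r; exact: subspaceZ. Qed.

Lemma subspaceB u v : W u -> W v -> W (u - v).
Proof. by move=> Wu /subspaceN; exact: subspaceD. Qed.

Lemma subspaceBC u v : W (u - v) -> W (v - u).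
Proof. by move=> /subspaceN; rewrite opprB. Qed.

Lemma subspace_sum (I : eqType) (s : seq I) (f : I -> V) :
  (forall i, i \in s -> W (f i)) -> W (\sum_(i <- s) f i).
Proof.
by move=> Wf; rewrite big_seq; elim/big_ind : _ => //; [exact: sW.1|exact: subspaceD].
Qed.

Lemma subspace_sumT (I : Type) (s : seq I) (f : I -> V) :
  (forall i, W (f i)) -> W (\sum_(i <- s) f i).
Proof.
by move=> Wf; elim/big_ind : _ => //; [exact: sW.1|exact: subspaceD].
Qed.

Lemma subspaceBD u v w : W (u - v) -> W (v - w) -> W (u - w).
Proof. by move=> uv vw; rewrite -(subrK v u) -addrA; exact: subspaceD. Qed.

Lemma subspace_cong u v : W (u - v) -> W v -> W u.
Proof. by move=> uv Wv; rewrite -(subrK v u); exact: subspaceD. Qed.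

End Subspaces.

Section Averages.
Variables (R : realType) (F : localField) (d : nat) (D : divAlg F d) (r : nat).
Variables (P : cyclicPres D) (pi : smoothRep R D r).
Local Notation G := (GL D r).
Local Notation K := (congK D r).
Local Notation act := (rep_act pi).
Implicit Types (g h k x y : G) (n m l : nat) (s : seq G) (u v w : pi).

Lemma actK g v : act g^-1%g (act g v) = v.
Proof. by rewrite -rep_actM mulVg rep_act1. Qed.

Lemma actVK g v : act g (act g^-1%g v) = v.
Proof. by rewrite -rep_actM mulgV rep_act1. Qed.

Lemma rep_smoothP v : exists n, fixed pi (K n) v.
Proof.
have /gl_openP/(_ 1%g) := @rep_smooth _ _ _ _ _ pi v.
by case=> [|n nv]; [exact: rep_act1|exists n => k /nv; rewrite /= mul1g].
Qed.

Lemma fixed_le n m v : (n <= m)%N -> fixed pi (K n) v -> fixed pi (K m) v.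
Proof. by move=> nm vn k /(congK_le nm) /vn. Qed.

Lemma subspace_fixed (C : set G) : subspace (fixed pi C).
Proof.
split=> [k _|a u v uf vf k kC]; first by rewrite raddf0.
by rewrite linearP uf ?vf.
Qed.

(** Inclusion in K^0 gives finite coset lists at every level, even when C is not open, as for the
    intersection of K^l with a parabolic subgroup. *)
Definition is_subgroup (C : set G) := [/\ C 1%g,
  forall x y, C x -> C y -> C (x * y)%g, forall x, C x -> C x^-1%g & C `<=` K 0].

Lemma is_subgroup_congK n : is_subgroup (K n).
Proof.
split; [exact: congK1|by move=> x y; exact: congKM|by move=> x; exact: congKV|].
by move=> x; exact: congK_le.
Qed.

Section OneGroup.
Variables (C : set G) (gC : is_subgroup C).

Lemma subgroup_cosets n : exists s, cosets n s C.
Proof.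
have [s sP] := compact_cosets_cover n (@compact_congK0 _ _ _ r P).
by apply: (@cosets_exist _ _ _ _ _ s) => y Cy; apply: sP; case: gC => _ _ _; exact.
Qed.

(** The map h induces an injection of a finite set of cosets into itself, hence a permutation. *)
Lemma cosets_reindex (V : nmodType) n s (f : G -> V) (h : G -> G) : cosets n s C ->
  (forall x k, C x -> C k -> K n k -> f (x * k)%g = f x) ->
  (forall x, C x -> C (h x)) ->
  (forall x y, C x -> C y -> K n ((h x)^-1 * h y)%g -> K n (x^-1 * y)%g) ->
  \sum_(x <- s) f (h x) = \sum_(x <- s) f x.
Proof.
move=> [us sC sinj scov] fK hC hinj; have [C1 CM CV _] := gC.
have /choice[t tP] : forall x, exists y, x \in s -> y \in s /\ K n (y^-1 * h x)%g.
  move=> x; have [xs|xns] := boolP (x \in s); last by exists 1%g.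
  by have [y ys yx] := scov _ (hC _ (sC _ xs)); exists y.
have -> : \sum_(x <- s) f (h x) = \sum_(x <- [seq t x | x <- s]) f x.
  rewrite big_map; apply: eq_big_seq => x xs; have [ts tx] := tP _ xs.
  rewrite -(mulKVg (t x) (h x)) fK //; first exact: sC.
  by apply: CM; [apply/CV/sC|apply/hC/sC].
apply: perm_big; have tsub : {subset map t s <= s}.
  by move=> _ /mapP[x xs ->]; have [] := tP _ xs.
have ut : uniq (map t s).
  rewrite map_inj_in_uniq // => x y xs ys txy; apply: sinj => //.
  apply: hinj; [exact: sC|exact: sC|].
  have [_ tx] := tP _ xs; have [_ ty] := tP _ ys; rewrite txy in tx.
  by apply: coset_trans ty; exact: coset_sym.
apply: uniq_perm => //; have [] := uniq_min_size ut tsub; first by rewrite size_map.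
by [].
Qed.

Definition avgs s v : pi := (size s)%:R^-1 *: \sum_(x <- s) act x v.

Definition fixedI n v := forall k, C k -> K n k -> act k v = v.

Lemma cosets_size n s : cosets n s C -> (size s)%:R != 0 :> R[i].
Proof.
case=> _ _ _ /(_ 1%g); case: gC => C1 _ _ _ /(_ C1)[x]; case: s => // a s _ _.
by rewrite pnatr_eq0.
Qed.

Lemma mean_const n s w : cosets n s C -> (size s)%:R^-1 *: \sum_(x <- s) w = w.
Proof.
move=> /cosets_size s0; rewrite big_const_seq count_predT iter_addr_0.
by rewrite -(scaler_nat _ w) scalerA mulVf ?scale1r.
Qed.

Lemma act_avgs n s v c : cosets n s C -> fixedI n v -> C c ->
  act c (avgs s v) = avgs s v.
Proof.
move=> cs vn Cc; have [C1 CM CV _] := gC; rewrite /avgs linearZ linear_sum /=; congr (_ *: _).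
under eq_bigr do rewrite -rep_actM.
apply: (cosets_reindex (f := fun x => act x v) (h := mulg c) cs) => [x k Cx Ck Kk|x Cx|x y _ _].
- by rewrite rep_actM vn.
- exact: CM.
- by rewrite invMg -mulgA mulKg.
Qed.

Lemma avgs_act n s v c : cosets n s C -> fixedI n v -> C c ->
  avgs s (act c v) = avgs s v.
Proof.
move=> cs vn Cc; have [C1 CM CV CK] := gC; rewrite /avgs; congr (_ *: _).
under eq_bigr do rewrite -rep_actM.
apply: (cosets_reindex (f := fun x => act x v) (h := fun x => (x * c)%g) cs) => [x k Cx Ck Kk|x Cx|x y _ _].
- by rewrite rep_actM vn.
- exact: CM.
- rewrite invMg => /(congK_normV (CK _ Cc)).
  by rewrite !mulgA mulgV mul1g mulgK.
Qed.

Lemma avgs_id n s v : cosets n s C -> (forall c, C c -> act c v = v) -> avgs s v = v.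
Proof.
move=> cs vC; rewrite /avgs (eq_big_seq (fun=> v)); last first.
  by move=> x xs; apply: vC; case: cs => _ sC _ _; exact: sC.
exact: (mean_const _ cs).
Qed.

Lemma avgs_sum (I : Type) (t : seq I) s (f : I -> pi) a :
  avgs s (a *: \sum_(i <- t) f i) = a *: \sum_(i <- t) avgs s (f i).
Proof.
rewrite /avgs; under eq_bigr do rewrite linearZ linear_sum.
by rewrite -scaler_sumr exchange_big /= -scaler_sumr !scalerA mulrC.
Qed.

(** The double average over s and s' is evaluated in two ways: the inner average is already C-fixed,
    and the outer one absorbs the translations by s'. *)
Lemma avgs_unique n s n' s' v : cosets n s C -> cosets n' s' C ->
  fixedI n v -> fixedI n' v -> avgs s v = avgs s' v.
Proof.
move=> cs cs' vn vn'.
transitivity (avgs s (avgs s' v)); last first.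
  by apply: (avgs_id cs) => c Cc; exact: (act_avgs cs').
rewrite -[RHS]/(avgs s ((size s')%:R^-1 *: \sum_(x <- s') act x v)) avgs_sum.
rewrite (eq_big_seq (fun=> avgs s v)); last first.
  by move=> x xs; apply: (avgs_act cs vn); case: cs' => _ sC _ _; exact: sC.
by rewrite (mean_const _ cs').
Qed.

(** The projector e_C onto the C-fixed vectors. A level n suited to v exists by smoothness, and the
    result depends on no choice by [avgs_unique]. *)
Definition avg v : pi := xget 0 [set y | exists n s,
  [/\ cosets n s C, fixedI n v & y = avgs s v]].

Lemma avgE n s v : cosets n s C -> fixedI n v -> avg v = avgs s v.
Proof.
move=> cs vn; rewrite /avg; case: xgetP => [y -> [n' [s' [cs' vn' ->]]]|/(_ (avgs s v))].
  exact: (avgs_unique cs' cs).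
by case; exists n, s.
Qed.

Lemma avg_exists (I : eqType) (t : seq I) (f : I -> pi) : exists n s,
  cosets n s C /\ forall i, i \in t -> fixedI n (f i).
Proof.
have /choice[N NP] : forall i, exists n, fixed pi (K n) (f i) by move=> i; exact: rep_smoothP.
exists (\max_(i <- t) N i)%N; have [s sP] := subgroup_cosets (\max_(i <- t) N i)%N.
exists s; split=> // i it k _ kn; apply: (NP i); apply: congK_le kn.
exact: leq_bigmax_seq.
Qed.

Lemma avg_linear_comb (I : eqType) (t : seq I) (a : I -> R[i]) (f : I -> pi) :
  avg (\sum_(i <- t) a i *: f i) = \sum_(i <- t) a i *: avg (f i).
Proof.
have [n [s [cs fn]]] := avg_exists t f.
rewrite (avgE cs); last first.
  move=> k Ck Kk; rewrite linear_sum; apply: eq_big_seq => i it.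
  by rewrite linearZ /= fn.
rewrite [RHS](eq_big_seq (fun i => a i *: avgs s (f i))); last first.
  by move=> i it; rewrite (avgE cs (fn i it)).
rewrite /avgs (eq_bigr (fun x => \sum_(i <- t) a i *: act x (f i))); last first.
  by move=> x _; rewrite linear_sum; apply: eq_bigr => i _; rewrite linearZ.
rewrite exchange_big /= scaler_sumr; apply: eq_bigr => i _.
by rewrite -scaler_sumr !scalerA mulrC.
Qed.

Lemma avgP a u v : avg (a *: u + v) = a *: avg u + avg v.
Proof.
have := avg_linear_comb [:: true; false] (fun b => if b then a else 1) (fun b => if b then u else v).
by rewrite !big_cons !big_nil /= !scale1r !addr0.
Qed.

Lemma avg0 : avg 0 = 0.
Proof. by have := avgP (-1) 0 0; rewrite scaler0 addr0 scaleN1r addNr. Qed.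

Lemma avgZ a v : avg (a *: v) = a *: avg v.
Proof. by rewrite -[a *: v]addr0 avgP avg0 addr0. Qed.

Lemma act_avg c v : C c -> act c (avg v) = avg v.
Proof.
have [n [s [cs /(_ tt (mem_head _ _)) vn]]] := avg_exists [:: tt] (fun=> v).
by rewrite (avgE cs vn); exact: act_avgs cs vn.
Qed.

Lemma avg_id v : (forall c, C c -> act c v = v) -> avg v = v.
Proof.
move=> vC; have [s cs] := subgroup_cosets 0%N.
by rewrite (avgE cs) ?(avgs_id cs) // => k Ck _; exact: vC.
Qed.

Lemma avg_act c v : C c -> avg (act c v) = avg v.
Proof.
move=> Cc; have [n [s [cs vn]]] := avg_exists [:: true; false] (fun b => if b then v else act c v).
have vn1 := vn true (mem_head _ _); have vn2 : fixedI n (act c v) by exact: (vn false).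
by rewrite (avgE cs vn1) (avgE cs vn2); exact: avgs_act cs vn1 Cc.
Qed.

Lemma avg_stable (W : set pi) v : subspace W -> (forall c, C c -> W (act c v)) -> W (avg v).
Proof.
move=> sW Wc; have [n [s [cs /(_ tt (mem_head _ _)) vn]]] := avg_exists [:: tt] (fun=> v).
rewrite (avgE cs vn); apply: subspaceZ => //; apply: subspace_sum => // x xs.
by apply: Wc; case: cs => _ + _ _; exact.
Qed.

(** Together with [avg_stable] this lets averages act on V/W while all vectors stay in V. *)
Lemma avg_mod (W : set pi) v : subspace W -> (forall c, C c -> W (act c v - v)) ->
  W (avg v - v).
Proof.
move=> sW Wc; have [n [s [cs /(_ tt (mem_head _ _)) vn]]] := avg_exists [:: tt] (fun=> v).
rewrite (avgE cs vn).
have -> : avgs s v - v = (size s)%:R^-1 *: \sum_(x <- s) (act x v - v).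
  rewrite sumrB scalerBr; congr (_ - _).
  by rewrite (mean_const _ cs).
apply: subspaceZ => //; apply: subspace_sum => // x xs.
by apply: Wc; case: cs => _ + _ _; exact.
Qed.

Lemma avg_form (xi : {linear pi -> R[i]^o}) v : (forall c u, C c -> xi (act c u) = xi u) ->
  xi (avg v) = xi v.
Proof.
move=> xiC; have : [set u | xi u = 0] (avg v - v).
  apply: avg_mod => [|c Cc]; last by rewrite /= linearB /= xiC // subrr.
  by split=> [|a u w /= u0 w0]; rewrite /= ?linear0 // linearP u0 w0 scaler0 addr0.
by rewrite /= linearB => /subr0_eq.
Qed.

Lemma act_avg_norm k v : (forall c, C c -> C (k^-1 * c * k)%g) ->
  (forall c, C c -> C (k * c * k^-1)%g) -> act k (avg v) = avg (act k v).
Proof.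
move=> kC kC'; transitivity (avg (act k (avg v))).
  symmetry; apply: avg_id => c Cc.
  have := act_avg v (kC _ Cc); rewrite !rep_actM => h.
  by rewrite -{2}h actVK.
have [n [s [cs /(_ tt (mem_head _ _)) vn]]] := avg_exists [:: tt] (fun=> v).
rewrite (avgE cs vn) /avgs linearZ linear_sum /= scaler_sumr avg_linear_comb.
rewrite (eq_big_seq (fun=> (size s)%:R^-1 *: avg (act k v))); last first.
  move=> x xs; congr (_ *: _); have [_ sC _ _] := cs.
  by rewrite -[RHS](avg_act _ (kC' _ (sC _ xs))) -!rep_actM mulgVK.
by rewrite -scaler_sumr (mean_const _ cs).
Qed.

End OneGroup.
End Averages.

(** * The Hecke algebra and its action on fixed vectors *)

Section HeckeAlgebra.
Variables (R : realType) (F : localField) (d : nat) (D : divAlg F d) (r : nat).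
Variables (mu : haarMeasures R D r) (P : cyclicPres D).
Local Notation G := (GL D r).
Local Notation K := (congK D r).
Local Notation hecke := (@hecke R F d D r).
Implicit Types (g h k x y : G) (n m l : nat) (s : seq G).

(** Local constancy with compact support, in algebraic form and with an explicit level. *)
Definition finsupp (V : nmodType) n (f : G -> V) :=
  (forall x k, K n k -> f (x * k)%g = f x) /\
  exists s, forall x, f x != 0 -> exists2 y, y \in s & K n (y^-1 * x)%g.

Lemma finsupp_cosets (V : nmodType) n (f : G -> V) : finsupp n f ->
  exists s, cosets n s [set x | f x != 0].
Proof. by case=> _ [s sP]; apply: (cosets_exist sP). Qed.

Lemma cosets_common n s : exists s', cosets n s' [set x | exists2 y, y \in s & K n (y^-1 * x)%g].
Proof. by apply: (@cosets_exist _ _ _ _ _ s). Qed.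

Lemma lc_integralP (V : lmodType R[i]) n a (f f' : G -> V) : finsupp n f -> finsupp n f' ->
  lc_integral (hm_G mu) (fun x => a *: f x + f' x) =
  a *: lc_integral (hm_G mu) f + lc_integral (hm_G mu) f'.
Proof.
move=> [fK [s sP]] [f'K [s' s'P]]; have [t tP] := cosets_common n (s ++ s').
have cov x : f x != 0 \/ f' x != 0 -> exists2 y, y \in s ++ s' & K n (y^-1 * x)%g.
  by case=> [/sP|/s'P][y ys yx]; exists y; rewrite // mem_cat ys ?orbT.
rewrite (lc_integral_cosets mu P tP); first last.
- move=> x; have [->|f0] := eqVneq (f x) 0; first by rewrite scaler0 add0r => f'0; apply: cov; right.
  by move=> _; apply: cov; left.
- by move=> x k kn; rewrite fK ?f'K.
rewrite (lc_integral_cosets mu P tP fK); last by move=> x f0; apply: cov; left.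
rewrite (lc_integral_cosets mu P tP f'K); last by move=> x f0; apply: cov; right.
by rewrite big_split -scaler_sumr /= scalerDr !scalerA mulrC.
Qed.

Lemma lc_integral0 (V : lmodType R[i]) : lc_integral (hm_G mu) (fun=> 0 : V) = 0.
Proof.
have [t tP] := cosets_common 0 [::].
by rewrite (lc_integral_cosets mu P tP) ?big1 ?scaler0 // => x /eqP.
Qed.

Lemma finsuppP (V : lmodType R[i]) n a (f f' : G -> V) : finsupp n f -> finsupp n f' ->
  finsupp n (fun x => a *: f x + f' x).
Proof.
move=> [fK [s sP]] [f'K [s' s'P]]; split=> [x k kn|]; first by rewrite fK ?f'K.
exists (s ++ s') => x.
have [->|f0 _] := eqVneq (f x) 0; first rewrite scaler0 add0r => /s'P[y ys yx].
  by exists y; rewrite // mem_cat ys orbT.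
by have [y ys yx] := sP _ f0; exists y; rewrite // mem_cat ys.
Qed.

Lemma finsupp0 (V : nmodType) n : finsupp n (fun=> 0 : V).
Proof. by split=> //; exists [::] => x /eqP. Qed.

Lemma lc_integral_sum (V : lmodType R[i]) n (I : Type) (t : seq I) (a : I -> R[i]) (f : I -> G -> V) :
  (forall i, finsupp n (f i)) ->
  finsupp n (fun x => \sum_(i <- t) a i *: f i x) /\
  lc_integral (hm_G mu) (fun x => \sum_(i <- t) a i *: f i x) =
    \sum_(i <- t) a i *: lc_integral (hm_G mu) (f i).
Proof.
move=> fn; elim: t => [|i t [IH1 IH2]].
  rewrite big_nil (_ : (fun x => _) = fun=> 0); last by apply/funext => x; rewrite big_nil.
  by rewrite lc_integral0; split=> //; exact: finsupp0.
rewrite (_ : (fun x => _) = fun x => a i *: f i x + \sum_(i <- t) a i *: f i x); last first.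
  by apply/funext => x; rewrite big_cons.
by rewrite (lc_integralP _ (fn i) IH1) IH2 big_cons; split=> //; exact: finsuppP.
Qed.

Lemma lc_integral_linear (V W : lmodType R[i]) n (phi : {linear V -> W}) (f : G -> V) :
  finsupp n f -> lc_integral (hm_G mu) (fun x => phi (f x)) = phi (lc_integral (hm_G mu) f).
Proof.
move=> fn; have [fK _] := fn; have [t tP] := finsupp_cosets fn.
rewrite (lc_integral_cosets mu P tP fK) // linearZ linear_sum.
rewrite (lc_integral_cosets mu P tP) // => [x k kn|x]; first by rewrite fK.
by apply: contra_neq => /= ->; rewrite linear0.
Qed.

Lemma finsupp_translate (V : nmodType) n (f : G -> V) g : finsupp n f ->
  finsupp n (fun x => f (g * x)%g).
Proof.
move=> [fK [s sP]]; split=> [x k kn|]; first by rewrite mulgA (fK _ _ kn).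
exists [seq (g^-1 * y)%g | y <- s] => x /sP[y ys yx].
by exists (g^-1 * y)%g; [exact: map_f|rewrite invMg invgK -mulgA].
Qed.

Lemma finsupp_lc_translate (V : lmodType R[i]) n (f : G -> V) g : finsupp n f ->
  lc_integral (hm_G mu) (fun x => f (g * x)%g) = lc_integral (hm_G mu) f.
Proof.
move=> fn; have [t tP] := finsupp_cosets fn.
by case: fn => fK _; exact: (lc_integral_translate mu P g tP fK).
Qed.

Lemma dcosetP n g x : dcoset (K n) g x <-> exists k k', [/\ K n k, K n k' & x = (k * g * k')%g].
Proof.
split=> [[[k k'] [/= kn k'n <-]]|[k [k' [kn k'n ->]]]]; first by exists k, k'.
by exists (k, k').
Qed.

Lemma dcoset_refl n g : dcoset (K n) g g.
Proof. by apply/dcosetP; exists 1%g, 1%g; rewrite mulg1 mul1g; split=> //; exact: congK1. Qed.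

Lemma dcoset_sym n g h : dcoset (K n) g h -> dcoset (K n) h g.
Proof.
move=> /dcosetP[k [k' [kn k'n ->]]]; apply/dcosetP; exists k^-1%g, k'^-1%g.
by rewrite -!mulgA mulgV mulg1 mulKg; split=> //; exact: congKV.
Qed.

Lemma dcoset_trans n g h x : dcoset (K n) g h -> dcoset (K n) h x -> dcoset (K n) g x.
Proof.
move=> /dcosetP[k [k' [kn k'n ->]]] /dcosetP[c [c' [cn c'n ->]]]; apply/dcosetP.
by exists (c * k)%g, (k' * c')%g; rewrite !mulgA; split=> //; exact: congKM.
Qed.

Lemma dcoset_eq n g h : dcoset (K n) g h -> dcoset (K n) g = dcoset (K n) h.
Proof.
move=> gh; apply/seteqP; split=> x; apply: dcoset_trans => //.
exact: dcoset_sym.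
Qed.

Lemma dcosetM n g k k' : K n k -> K n k' -> dcoset (K n) g (k * g * k')%g.
Proof. by move=> kn k'n; apply/dcosetP; exists k, k'. Qed.

Lemma dcosetV n g h : dcoset (K n) g h -> dcoset (K n) g^-1%g h^-1%g.
Proof.
move=> /dcosetP[k [k' [kn k'n ->]]]; rewrite !invMg mulgA.
by apply: dcosetM; exact: congKV.
Qed.

Lemma hecke_indic n g : hecke (K n) (\1_(dcoset (K n) g)).
Proof.
have biK k k' x : K n k -> K n k' ->
    \1_(dcoset (K n) g) (k * x * k')%g = \1_(dcoset (K n) g) x :> R[i].
  move=> kn k'n; rewrite !indicE; congr (_%:R); congr nat_of_bool.
  apply/idP/idP => /set_mem h; apply/mem_set; last by apply: dcoset_trans h _; exact: dcosetM.
  by apply: dcoset_trans h _; apply: dcoset_sym; exact: dcosetM.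
split=> //.
  move=> c; apply/gl_openP => x xc; exists n => k kn.
  by rewrite /= -(mul1g x) biK //; exact: congK1.
exists (dcoset (K n) g); first exact: compact_dcoset.
by move=> x; rewrite indicE; case: (boolP (x \in _)) => [/set_mem|_ /eqP].
Qed.

Lemma hecke_finsupp n f : hecke (K n) f -> finsupp n (f : G -> R[i]^o).
Proof.
case=> _ [C /(compact_cosets_cover n)[s sP] fC] fK; split=> [x k kn|].
  by rewrite -[(x * k)%g]mul1g mulgA fK //; exact: congK1.
by exists s => x /fC /sP.
Qed.

Lemma finsupp_hecke n (f : G -> R[i]^o) : finsupp n f ->
  (forall k x, K n k -> f (k * x)%g = f x) -> hecke (K n) f.
Proof.
move=> [fK [s sP]] Kf; split.
- by move=> c; apply/gl_openP => x xc; exists n => k kn; rewrite /= fK.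
- exists [set x | exists2 y, y \in s & K n (y^-1 * x)%g]; first exact: compact_cosets.
  exact: sP.
- by move=> k k' x kn k'n; rewrite fK // Kf.
Qed.

Lemma heckeP n c f f' : hecke (K n) f -> hecke (K n) f' ->
  hecke (K n) (fun x => c * f x + f' x).
Proof.
move=> hf hf'; apply: finsupp_hecke.
  exact: (finsuppP c (hecke_finsupp hf) (hecke_finsupp hf')).
move=> k x kn; case: hf => _ _ fK; case: hf' => _ _ f'K.
by rewrite -[(k * x)%g]mulg1 fK ?f'K //; exact: congK1.
Qed.

Lemma hecke0 n : hecke (K n) (fun=> 0).
Proof. by apply: finsupp_hecke => //; exact: finsupp0. Qed.

Lemma hecke_decomp n f : hecke (K n) f -> exists t : seq G,
  f = (fun x => \sum_(g <- t) f g * \1_(dcoset (K n) g) x).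
Proof.
move=> hf; have [_ [s sP]] := hecke_finsupp hf; case: hf => _ _ fK.
(* Disjointness of the chosen double cosets is expressed by the bound 1 on the sum of their
   indicators. *)
suff [t [tdis tcov]] : exists t, (forall x, \sum_(g <- t) \1_(dcoset (K n) g) x <= 1 :> R[i]) /\
    forall x, x \in s -> exists2 g, g \in t & dcoset (K n) g x.
  exists t; apply/funext => x.
  have fE g : f g * \1_(dcoset (K n) g) x = f x * \1_(dcoset (K n) g) x.
    rewrite indicE; case: (boolP (x \in _)) => [|_]; last by rewrite !mulr0.
    by move=> /set_mem /dcosetP[k [k' [kn k'n ->]]]; rewrite fK.
  under eq_bigr do rewrite fE.
  rewrite -mulr_sumr; have [->|fx] := eqVneq (f x) 0; first by rewrite mul0r.
  have [y ys yx] := sP _ fx; have [g gt gy] := tcov _ ys.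
  have gx : dcoset (K n) g x.
    apply: dcoset_trans gy _; rewrite -(mulKVg y x) -[X in dcoset _ _ X]mul1g mulgA.
    by apply: dcosetM => //; exact: congK1.
  rewrite (_ : \sum_(g <- t) _ = 1) ?mulr1 //; apply/eqP; rewrite eq_le tdis /=.
  rewrite (big_rem g) //= indicE mem_set // lerDl; apply: sumr_ge0 => i _.
  by rewrite indicE ler0n.
elim: s {sP} => [|a s [t [tdis tcov]]].
  by exists [::]; split=> // x; rewrite big_nil ler01.
have [[g gt ga]|ng] := pselect (exists2 g, g \in t & dcoset (K n) g a).
  exists t; split=> // x; rewrite inE => /orP[/eqP->|/tcov//]; by exists g.
exists (a :: t); split=> [x|x]; last first.
  rewrite inE => /orP[/eqP->|/tcov[g gt gx]]; first by exists a; rewrite ?mem_head //; exact: dcoset_refl.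
  by exists g; rewrite // inE gt orbT.
rewrite big_cons [\1_(dcoset _ a) x]indicE; case: (boolP (x \in _)) => [/set_mem ax|_]; last by rewrite add0r.
rewrite big_seq big1 ?addr0 // => g gt; rewrite indicE memNset // => gx; apply: ng.
by exists g => //; apply: dcoset_trans gx _; exact: dcoset_sym.
Qed.

Section HeckeAction.
Variable pi : smoothRep R D r.
Local Notation act := (rep_act pi).
Local Notation hact := (@hecke_act R F d D r mu pi).
Local Notation e n := (avg (K n)).
Implicit Types (v w : pi) (f : G -> R[i]).

Lemma hecke_act_finsupp n f v : finsupp n (f : G -> R[i]^o) -> fixed pi (K n) v ->
  finsupp n (fun g => f g *: act g v).
Proof.
move=> [fK [s sP]] vn; split=> [x k kn|]; first by rewrite fK // rep_actM vn.
by exists s => x fx; apply: sP; apply: contra_neq fx => ->; rewrite scale0r.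
Qed.

Lemma hecke_act_lin n f c v w : hecke (K n) f -> fixed pi (K n) v -> fixed pi (K n) w ->
  hact f (c *: v + w) = c *: hact f v + hact f w.
Proof.
move=> hf vn wn; have h1 := hecke_act_finsupp (hecke_finsupp hf) vn.
have h2 := hecke_act_finsupp (hecke_finsupp hf) wn.
rewrite /hecke_act -(lc_integralP c h1 h2); congr lc_integral.
by apply/funext => x; rewrite linearP scalerDr !scalerA mulrC.
Qed.

Lemma hecke_act_fixed n f v : hecke (K n) f -> fixed pi (K n) v -> fixed pi (K n) (hact f v).
Proof.
move=> hf vn k kn; have hfv := hecke_act_finsupp (hecke_finsupp hf) vn.
rewrite /hecke_act -(lc_integral_linear (act k) hfv).
rewrite -[RHS](finsupp_lc_translate k hfv).
congr lc_integral; apply/funext => x; rewrite linearZ rep_actM; congr (_ *: _).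
by case: hf => _ _ fK; rewrite -[(k * x)%g]mulg1 fK //; exact: congK1.
Qed.

Lemma hecke_act_sum n (I : Type) (t : seq I) (c : I -> R[i]) (f : I -> G -> R[i]) v :
  (forall i, hecke (K n) (f i)) -> fixed pi (K n) v ->
  hact (fun x => \sum_(i <- t) c i * f i x) v = \sum_(i <- t) c i *: hact (f i) v.
Proof.
move=> hf vn; have h i := hecke_act_finsupp (hecke_finsupp (hf i)) vn.
have [_ <-] := lc_integral_sum t c h; congr lc_integral; apply/funext => x.
by rewrite scaler_suml; apply: eq_bigr => i _; rewrite scalerA.
Qed.

Lemma hecke_act0 n f : hecke (K n) f -> hact f 0 = 0.
Proof.
move=> hf; have v0 : fixed pi (K n) 0 by move=> k _; rewrite linear0.
by have := hecke_act_lin (-1) hf v0 v0; rewrite scaler0 addr0 scaleN1r addNr.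
Qed.

Lemma hecke_conv_cosets n f f' s S : cosets n s S -> hecke (K n) f -> hecke (K n) f' ->
  (forall x, f x != 0 -> S x) ->
  forall x, hecke_conv mu f f' x = (vol mu n)%:C%C * \sum_(y <- s) f y * f' (y^-1 * x)%g.
Proof.
move=> cs hf hf' fS x; rewrite /hecke_conv.
have [fK _] := hecke_finsupp hf; have [_ _ f'K] := hf'.
rewrite (lc_integral_cosets mu P cs) // => [y k kn|y].
  rewrite fK // invMg -mulgA -[(k^-1 * _)%g]mulg1 f'K //; [exact: congKV|exact: congK1].
by move=> h; apply: fS; apply: contra_neq h => ->; rewrite mul0r.
Qed.

Lemma hecke_conv_hecke n f f' : hecke (K n) f -> hecke (K n) f' ->
  hecke (K n) (hecke_conv mu f f').
Proof.
move=> hf hf'; have [s cs] := finsupp_cosets (hecke_finsupp hf).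
have cE := hecke_conv_cosets cs hf hf' (fun x => id).
have [f'1 f'2] := hecke_finsupp hf'.
apply: finsupp_hecke; last first.
  move=> k x kn; rewrite /hecke_conv.
  have fin : finsupp n (fun y => (f y * f' (y^-1 * (k * x))%g : R[i]^o)).
    have [f1 [t tP]] := hecke_finsupp hf; split.
      move=> y c cn; rewrite f1 //; congr (_ * _); have [_ _ f'K] := hf'.
      rewrite invMg -[RHS](f'K c^-1%g 1%g) ?mulg1 ?mulgA //; [exact: congKV|exact: congK1].
    by exists t => y h; apply: tP; apply: contra_neq h => ->; rewrite mul0r.
  rewrite -(finsupp_lc_translate k fin); congr lc_integral; apply/funext => y.
  rewrite invMg !mulgA mulgVK; congr (_ * _).
  by have [_ _ fK] := hf; rewrite -[(k * y)%g]mulg1 fK //; exact: congK1.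
rewrite (_ : hecke_conv _ _ _ = fun x => (vol mu n)%:C%C *:
    (\sum_(y <- s) f y *: (f' (y^-1 * x)%g : R[i]^o)) + 0); last first.
  by apply/funext => x; rewrite cE addr0.
apply: finsuppP; last exact: finsupp0.
apply: (lc_integral_sum _ _ _).1 => y; exact: (finsupp_translate y^-1%g (hecke_finsupp hf')).
Qed.

(** The outer integral becomes a finite sum over cosets y in the support of f; each inner integral
    is then translated by y. *)
Lemma hecke_act_conv n f f' v : hecke (K n) f -> hecke (K n) f' -> fixed pi (K n) v ->
  hact (hecke_conv mu f f') v = hact f (hact f' v).
Proof.
move=> hf hf' vn; have [s cs] := finsupp_cosets (hecke_finsupp hf).
have wn := hecke_act_fixed hf' vn; set w := hact f' v in wn *.
rewrite {2}/hecke_act (lc_integral_cosets mu P cs); first last.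
- by move=> x; apply: contra_neq => ->; rewrite scale0r.
- by have [] := hecke_act_finsupp (hecke_finsupp hf) wn.
have fin y : finsupp n (fun x => f' (y^-1 * x)%g *: act x v).
  exact: (hecke_act_finsupp (finsupp_translate y^-1%g (hecke_finsupp hf')) vn).
have [_ h] := lc_integral_sum s (fun y => (vol mu n)%:C%C * f y) fin.
transitivity (lc_integral (hm_G mu) (fun x =>
    \sum_(y <- s) ((vol mu n)%:C%C * f y) *: (f' (y^-1 * x)%g *: act x v))).
  congr lc_integral; apply/funext => x.
  rewrite (hecke_conv_cosets cs hf hf') // mulr_sumr scaler_suml.
  by apply: eq_bigr => y _; rewrite scalerA mulrA.
rewrite h scaler_sumr; apply: eq_bigr => y _; rewrite -scalerA; do 2 congr (_ *: _).
rewrite -(finsupp_lc_translate y (fin y)) /w /hecke_act.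
rewrite -(lc_integral_linear (act y) (hecke_act_finsupp (hecke_finsupp hf') vn)).
by congr lc_integral; apply/funext => x; rewrite mulKg linearZ rep_actM.
Qed.

Definition dvol n g : R := fine (hm_G mu (dcoset (K n) g)).

Lemma dcoset_cosets n g : exists s, cosets n s (dcoset (K n) g).
Proof. exact/cosets_compact/compact_dcoset. Qed.

Lemma dcoset_closed n g x k : K n k -> dcoset (K n) g x -> dcoset (K n) g (x * k)%g.
Proof.
move=> kn gx; apply: dcoset_trans gx _; rewrite -[(x * k)%g]mul1g mulgA.
by apply: dcosetM => //; exact: congK1.
Qed.

Lemma dvolE n g s : cosets n s (dcoset (K n) g) -> dvol n g = (size s)%:R * vol mu n.
Proof.
move=> [us sS inj cov]; rewrite /dvol.
have -> : dcoset (K n) g = [set x | exists2 y, y \in s & K n (y^-1 * x)%g].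
  apply/seteqP; split=> x /=; first exact: cov.
  by case=> y /sS gy yx; rewrite -(mulKVg y x); exact: dcoset_closed.
by rewrite haar_cosets_fine.
Qed.

Lemma dvol_gt0 n g : 0 < dvol n g.
Proof.
have [s cs] := dcoset_cosets n g; rewrite (dvolE cs) mulr_gt0 ?vol_gt0 // ltr0n.
by case: cs => _ _ _ /(_ g (dcoset_refl _ _))[x]; case: (s).
Qed.

(** The dictionary between the Hecke algebra and the group: up to the volume, the indicator of K g K
    acts as e g e. It holds because all representatives of the double coset have the same image
    under e g e. *)
Lemma hecke_act_indic n g v : fixed pi (K n) v ->
  hact (\1_(dcoset (K n) g)) v = (dvol n g)%:C%C *: e n (act g v).
Proof.
move=> vn; have [s cs] := dcoset_cosets n g.
have gK := is_subgroup_congK D r n.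
have hv := hecke_act_fixed (hecke_indic n g) vn.
have hE : hact (\1_(dcoset (K n) g)) v =
    (vol mu n)%:C%C *: \sum_(x <- s) (\1_(dcoset (K n) g) x : R[i]) *: act x v.
  rewrite /hecke_act (lc_integral_cosets mu P cs) //.
    by have [] := hecke_act_finsupp (hecke_finsupp (hecke_indic n g)) vn.
  move=> x; rewrite indicE; case: (boolP (x \in _)) => [/set_mem//|_].
  by rewrite scale0r eqxx.
rewrite -(avg_id P gK hv) hE; set X := \sum_(x <- s) _.
have -> : X = \sum_(x <- s) act x v.
  apply: eq_big_seq => x xs; rewrite indicE mem_set ?scale1r //.
  by case: cs => _ sS _ _; exact: sS.
have := avg_linear_comb P gK [:: tt] (fun=> (vol mu n)%:C%C) (fun=> \sum_(x <- s) act x v).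
rewrite !big_seq1 => ->.
have := avg_linear_comb P gK s (fun=> 1) (fun x => act x v).
under eq_bigr do rewrite scale1r.
move=> ->; under eq_big_seq => x xs.
  rewrite scale1r (_ : e n (act x v) = e n (act g v)); first over.
  case: cs => _ /(_ _ xs)/dcosetP[k [k' [kn k'n ->]]] _ _.
  by rewrite !rep_actM vn // avg_act.
rewrite big_const_seq count_predT iter_addr_0 -(scaler_nat _ (e n _)) scalerA.
by rewrite (dvolE cs) rmorphM rmorph_nat mulrC.
Qed.

Lemma avg_fixed n v : fixed pi (K n) (e n v).
Proof. by move=> k kn; apply: act_avg => //; exact: is_subgroup_congK. Qed.

End HeckeAction.
End HeckeAlgebra.

(** * Smooth representations on spaces of functions by right translation *)

Section FunctionRepresentation.
Variables (R : realType) (F : localField) (d : nat) (D : divAlg F d) (r : nat).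
Local Notation G := (GL D r).
Local Notation K := (congK D r).
Variables (V : lmodType R[i]) (S : set (G -> V)).
Hypothesis sS : subspace S.
Hypothesis S_translate : forall f g, S f -> S (fun x => f (x * g)%g).
Hypothesis S_smooth : forall f, S f -> exists n, forall x k, K n k -> f (x * k)%g = f x.

Definition fun_pred : {pred (G -> V)} := fun f => `[< S f >].

Fact fun_pred_closed : submod_closed fun_pred.
Proof.
split; first by apply/asboolP; exact: sS.1.
by move=> a u v /asboolP Su /asboolP Sv; apply/asboolP; exact: sS.2.
Qed.

HB.instance Definition _ := GRing.isSubmodClosed.Build R[i] (G -> V) fun_pred fun_pred_closed.

Record fun_sub := FunSub { fun_val :> G -> V; fun_valP : fun_val \in fun_pred }.
HB.instance Definition _ := [isSub for fun_val].
HB.instance Definition _ := [Choice of fun_sub by <:].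
HB.instance Definition _ := [SubChoice_isSubLmodule of fun_sub by <:].

Fact fun_valS (f : fun_sub) : S f.
Proof. by have /asboolP := fun_valP f. Qed.

Fact fun_act_subproof g (f : fun_sub) : (fun x => f (x * g)%g) \in fun_pred.
Proof. by apply/asboolP/S_translate/fun_valS. Qed.

Definition fun_act g (f : fun_sub) : fun_sub := FunSub (fun_act_subproof g f).

Fact fun_act_linear g : linear (fun_act g).
Proof. by move=> a u v; apply/val_inj/funext. Qed.

HB.instance Definition _ g :=
  GRing.isLinear.Build R[i] fun_sub fun_sub _ (fun_act g) (fun_act_linear g).

Fact fun_act1 f : fun_act 1%g f = f.
Proof. by apply/val_inj/funext => x /=; rewrite mulg1. Qed.

Fact fun_actM g h f : fun_act (g * h)%g f = fun_act g (fun_act h f).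
Proof. by apply/val_inj/funext => x /=; rewrite mulgA. Qed.

Fact fun_act_smooth f : open [set g | fun_act g f = f].
Proof.
have [n fn] := S_smooth (fun_valS f).
apply/gl_openP => g fg; exists n => k kn /=.
rewrite -[RHS]fg; apply/val_inj/funext => x /=.
by rewrite mulgA (fn _ _ kn).
Qed.

Definition fun_rep : smoothRep R D r :=
  @SmoothRep R F d D r fun_sub (fun g => fun_act g : {linear _ -> _})
    fun_act1 fun_actM fun_act_smooth.
End FunctionRepresentation.

Arguments fun_rep : simpl never.

(** * Convolution identities read in the regular representation *)

Section HeckeIdentities.
Variables (R : realType) (F : localField) (d : nat) (D : divAlg F d) (r : nat).
Variables (mu : haarMeasures R D r) (P : cyclicPres D).
Local Notation G := (GL D r).
Local Notation K := (congK D r).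
Local Notation hecke := (@hecke R F d D r).
Local Notation conv := (hecke_conv mu).

Lemma dcoset1 n : dcoset (K n) 1%g = K n.
Proof.
apply/seteqP; split=> x.
  by move=> /dcosetP[k [k' [kn k'n ->]]]; rewrite mulg1; exact: congKM.
by move=> xn; apply/dcosetP; exists x, 1%g; rewrite !mulg1; split=> //; exact: congK1.
Qed.

Lemma cosets_congK n : cosets n [:: 1%g : G] (K n).
Proof.
split=> //.
- by move=> x; rewrite inE => /eqP ->; exact: congK1.
- by move=> x y; rewrite !inE => /eqP -> /eqP ->.
- by move=> y yn; exists 1%g; rewrite ?mem_head // invg1 mul1g.
Qed.

Lemma dvol1 n : dvol mu n 1%g = vol mu n.
Proof.
by have := cosets_congK n; rewrite -{1}dcoset1 => /(dvolE mu P) ->; rewrite mul1r.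
Qed.

Lemma hecke_conv1l n f : hecke (K n) f -> conv (\1_(dcoset (K n) 1%g)) f =
  (fun x => (vol mu n)%:C%C * f x).
Proof.
move=> hf; apply/funext => x.
rewrite (hecke_conv_cosets mu P (cosets_congK n) (hecke_indic R P n 1%g) hf).
  by rewrite big_seq1 dcoset1 indicE mem_set ?mul1r ?invg1 ?mul1g //; exact: congK1.
by move=> y; rewrite dcoset1 indicE; case: (boolP (_ \in _)) => [/set_mem|_ /eqP].
Qed.

Lemma hecke_conv1r n f : hecke (K n) f -> conv f (\1_(dcoset (K n) 1%g)) =
  (fun x => (vol mu n)%:C%C * f x).
Proof.
move=> hf; apply/funext => x.
have [s cs] := finsupp_cosets (hecke_finsupp hf).
rewrite (hecke_conv_cosets mu P cs hf (hecke_indic R P n 1%g)) //.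
congr (_ * _); have [us sS sinj scov] := cs; have [fK _] := hecke_finsupp hf.
have indE y : \1_(dcoset (K n) 1%g) (y^-1 * x)%g = (`[< K n (y^-1 * x)%g >])%:R :> R[i].
  by rewrite dcoset1 indicE; case: asboolP => h; [rewrite mem_set|rewrite memNset].
have [f0|f0] := eqVneq (f x) 0.
  rewrite big1_seq ?f0 // => y /andP[_ ys]; rewrite indE; case: asboolP => [yx|_]; last by rewrite mulr0.
  by have := sS _ ys; rewrite /= -(fK _ _ yx) mulKVg f0 eqxx.
have [y ys yx] := scov _ f0.
rewrite (bigD1_seq y) //= big1_seq ?addr0; first by rewrite indE asboolT // mulr1 -(fK _ _ yx) mulKVg.
move=> z /andP[zy zs]; rewrite indE asboolF ?mulr0 // => zx; move/eqP: zy; apply.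
by apply: sinj => //; apply: coset_trans zx _; exact: coset_sym.
Qed.

Lemma avg_act_avg (pi : smoothRep R D r) n n' s g h (v : pi) : cosets n' s (K n) ->
  fixed pi (K n') (rep_act pi h v) ->
  avg (K n) (rep_act pi g (avg (K n) (rep_act pi h v))) =
  (size s)%:R^-1 *: \sum_(k <- s) avg (K n) (rep_act pi (g * k * h)%g v).
Proof.
move=> cs hv; have gK := is_subgroup_congK D r n.
have hvI : fixedI (K n) n' (rep_act pi h v) by move=> k _; exact: hv.
rewrite (avgE gK cs hvI).
rewrite /avgs linearZ linear_sum /= scaler_sumr avg_linear_comb // scaler_sumr.
by apply: eq_bigr => k _; rewrite !rep_actM.
Qed.

Local Notation smooth_fun := [set f : G -> R[i]^o | exists n, forall x k, K n k -> f (x * k)%g = f x].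

Lemma smooth_fun_subspace : subspace smooth_fun.
Proof.
split; first by exists 0%N.
move=> a u v [n un] [m vm]; exists (maxn n m) => x k km /=.
rewrite [LHS]/(a *: u (x * k)%g + v (x * k)%g) un ?vm //.
  by apply: congK_le km; rewrite leq_maxr.
by apply: congK_le km; rewrite leq_maxl.
Qed.

Lemma smooth_fun_translate f g : smooth_fun f -> smooth_fun (fun x => f (x * g)%g).
Proof.
move=> [n fn]; have [m mP] := congK_conj g n; exists m => x k /mP km.
by rewrite -(fn (x * g)%g _ km) !mulgA mulgK.
Qed.

Definition regular_rep : smoothRep R D r :=
  fun_rep smooth_fun_subspace smooth_fun_translate (fun f h => h).

Arguments regular_rep : simpl never.

Definition regular_ev x (f : regular_rep) : R[i]^o := fun_val f x.

Fact regular_ev_linear x : linear (regular_ev x). Proof. by []. Qed.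

HB.instance Definition _ x :=
  GRing.isLinear.Build R[i] regular_rep R[i]^o _ (regular_ev x) (regular_ev_linear x).

(** A Hecke function can be recovered from its action on the indicator of K^n. An identity between
    operators on this one vector is therefore an identity between functions. *)
Lemma regular_indic n : exists2 v0 : regular_rep, fixed regular_rep (K n) v0 &
  forall f x, hecke (K n) f ->
    regular_ev x (hecke_act mu f v0) = (vol mu n)%:C%C * f x^-1%g.
Proof.
have ind_in : (\1_(K n) : G -> R[i]^o) \in fun_pred smooth_fun.
  apply/asboolP; exists n => x k kn; rewrite !indicE; congr (_%:R); congr nat_of_bool.
  apply/idP/idP => /set_mem h; apply/mem_set; last exact: congKM.
  by rewrite -(mulgK k x); apply: congKM => //; exact: congKV.
pose v0 : regular_rep := FunSub ind_in; exists v0.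
  move=> k kn; apply/val_inj/funext => x /=; rewrite !indicE; congr (_%:R); congr nat_of_bool.
  apply/idP/idP => /set_mem h; apply/mem_set; last exact: congKM.
  by rewrite -(mulgK k x); apply: congKM => //; exact: congKV.
move=> f x hf.
have v0n : fixed regular_rep (K n) v0.
  move=> k kn; apply/val_inj/funext => y /=; rewrite !indicE; congr (_%:R); congr nat_of_bool.
  apply/idP/idP => /set_mem h; apply/mem_set; last exact: congKM.
  by rewrite -(mulgK k y); apply: congKM => //; exact: congKV.
have hfin := hecke_act_finsupp (hecke_finsupp hf) v0n.
rewrite /hecke_act -(lc_integral_linear mu P (regular_ev x) hfin).
pose s := [:: x^-1%g]; have cs : cosets n s [set y | K n (x * y)%g].
  split=> //.
  - by move=> y; rewrite inE => /eqP -> /=; rewrite mulgV; exact: congK1.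
  - by move=> y z; rewrite !inE => /eqP -> /eqP ->.
  - by move=> y yn; exists x^-1%g; rewrite ?mem_head // invgK.
rewrite (lc_integral_cosets mu P cs); first last.
- move=> y; rewrite linearZ /= /regular_ev /= indicE.
  by case: (boolP (_ \in _)) => [/set_mem//|_]; rewrite scaler0 eqxx.
- by move=> y k kn; have [h _] := hfin; congr regular_ev; exact: h.
rewrite big_seq1 linearZ /= /regular_ev /= indicE mem_set ?mulgV; last exact: congK1.
by rewrite [_ *: true%:R]mulr1 [LHS]mulrC.
Qed.

(** This is e g e h e = mean of e gkh e over k in K^n, with the volumes that normalize indicators.
    The level n' is such that h v is fixed by K^n' for every K^n-fixed v. *)
Lemma hecke_conv_indic n g h : exists n' s, cosets n' s (K n) /\
  (forall k, K n' k -> K n (h^-1 * k * h)%g) /\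
  conv (\1_(dcoset (K n) g)) (\1_(dcoset (K n) h)) = (fun x => \sum_(k <- s)
    ((dvol mu n g * dvol mu n h / (size s)%:R / dvol mu n (g * k * h)%g)%:C%C *
     \1_(dcoset (K n) (g * k * h)%g) x)).
Proof.
have [v0 v0n v0E] := regular_indic n.
have gK := is_subgroup_congK D r n; have [n' n'P] := congK_conj h n.
have [s cs] := subgroup_cosets P gK n'.
exists n', s; split=> //; split=> //.
have hn' : fixed regular_rep (K n') (rep_act regular_rep h v0).
  by move=> k /n'P /v0n; rewrite !rep_actM => h'; rewrite -{2}h' actVK.
apply/funext => x.
have vol0 : (vol mu n)%:C%C != 0 :> R[i] by rewrite fmorph_eq0 gt_eqF ?(vol_gt0 mu P).
apply: (mulfI vol0); rewrite -{1}(invgK x) -v0E; last exact: (hecke_conv_hecke mu P (hecke_indic R P n g) (hecke_indic R P n h)).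
rewrite (hecke_act_conv mu P (hecke_indic R P n g) (hecke_indic R P n h) v0n).
rewrite (hecke_act_indic mu P h v0n) hecke_act_indic //; last first.
  by apply: (subspaceZ (@subspace_fixed _ _ _ _ _ regular_rep (K n))); exact: avg_fixed.
rewrite (linearZZ (rep_act regular_rep g)) (avgZ P gK) (avg_act_avg g cs hn').
rewrite !scalerA scaler_sumr (linear_sum (regular_ev x^-1%g)) mulr_sumr.
apply: eq_bigr => k _.
have dv0 : (dvol mu n (g * k * h)%g)%:C%C != 0 :> R[i].
  by rewrite fmorph_eq0 gt_eqF // (dvol_gt0 mu P).
have -> : avg (K n) (rep_act regular_rep (g * k * h)%g v0) =
   (dvol mu n (g * k * h)%g)%:C%C^-1 *: hecke_act mu (\1_(dcoset (K n) (g * k * h)%g)) v0.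
  by rewrite hecke_act_indic // scalerA mulVf // scale1r.
rewrite scalerA (linearZZ (regular_ev x^-1%g)).
rewrite [X in _ *: X](v0E _ x^-1%g (hecke_indic R P n _)).
rewrite invgK [LHS]mulrCA; congr (_ * (_ * _)).
by rewrite !rmorphM !fmorphV rmorph_nat.
Qed.

End HeckeIdentities.

(** * Rebuilding an irreducible representation from a Hecke module *)

Section HeckeIsomorphism.
Variables (R : realType).
Variables (F1 : localField) (d1 : nat) (D1 : divAlg F1 d1).
Variables (F2 : localField) (d2 : nat) (D2 : divAlg F2 d2).
Variables (r1 r2 : nat).
Variables (mu1 : haarMeasures R D1 r1) (mu2 : haarMeasures R D2 r2).
Variables (P1 : cyclicPres D1) (P2 : cyclicPres D2) (l : nat).
Local Notation G1 := (GL D1 r1).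
Local Notation G2 := (GL D2 r2).
Local Notation K1 := (congK D1 r1).
Local Notation K2 := (congK D2 r2).
Local Notation H1 := (hecke R (K1 l)).
Local Notation H2 := (hecke R (K2 l)).
Implicit Types (z : (G1 -> R[i]) -> (G2 -> R[i])).

Definition hecke_iso z :=
  [/\ set_bij H1 H2 z,
      forall (c : R[i]) f g, H1 f -> H1 g ->
        z (fun x => c * f x + g x) = (fun y => c * z f y + z g y) &
      forall f g, H1 f -> H1 g ->
        z (hecke_conv mu1 f g) = hecke_conv mu2 (z f) (z g)].

Definition module_iso z (pi1 : smoothRep R D1 r1) (pi2 : smoothRep R D2 r2) (phi : pi2 -> pi1) :=
  [/\ set_bij (fixed pi2 (K2 l)) (fixed pi1 (K1 l)) phi,
      forall (c : R[i]) u v, fixed pi2 (K2 l) u -> fixed pi2 (K2 l) v ->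
        phi (c *: u + v) = c *: phi u + phi v &
      forall f v, H1 f -> fixed pi2 (K2 l) v ->
        phi (hecke_act mu2 (z f) v) = hecke_act mu1 f (phi v)].

Variable z : (G1 -> R[i]) -> (G2 -> R[i]).
Hypothesis zP : hecke_iso z.
Local Notation ind1 g := (\1_(dcoset (K1 l) g) : G1 -> R[i]).
Local Notation ind2 g := (\1_(dcoset (K2 l) g) : G2 -> R[i]).

Let Hind1 g : H1 (ind1 g) := hecke_indic R P1 l g.
Let Hind2 g : H2 (ind2 g) := hecke_indic R P2 l g.

Lemma hecke_iso_hecke f : H1 f -> H2 (z f).
Proof. by case: zP => -[+ _ _] _ _; exact. Qed.

Lemma hecke_iso_inj f g : H1 f -> H1 g -> z f = z g -> f = g.
Proof. by case: zP => -[_ zi _] _ _ hf hg; apply: zi; rewrite inE. Qed.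

Lemma hecke_iso_surj f : H2 f -> exists2 g, H1 g & z g = f.
Proof. by case: zP => -[_ _ zs] _ _ /zs[g hg <-]; exists g. Qed.

Lemma hecke_iso0 : z (fun=> 0) = fun=> 0.
Proof.
case: zP => _ zl _; have h0 := hecke0 R r1 P1 l.
have := zl (-1) _ _ h0 h0; rewrite (_ : (fun=> -1 * 0 + 0) = fun=> 0); last first.
  by apply/funext => x; rewrite mulr0 addr0.
by move=> ->; apply/funext => y; rewrite mulN1r addNr.
Qed.

Lemma hecke_iso_sum (I : Type) (t : seq I) (c : I -> R[i]) (f : I -> G1 -> R[i]) :
  (forall i, H1 (f i)) ->
  H1 (fun x => \sum_(i <- t) c i * f i x) /\
  z (fun x => \sum_(i <- t) c i * f i x) = (fun y => \sum_(i <- t) c i * z (f i) y).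
Proof.
move=> hf; case: zP => _ zl _; elim: t => [|i t [IH1 IH2]].
  rewrite (_ : (fun x => _) = fun=> 0); last by apply/funext => x; rewrite big_nil.
  rewrite hecke_iso0; split; first exact: (hecke0 R r1 P1).
  by apply/funext => y; rewrite big_nil.
rewrite (_ : (fun x => _) = fun x => c i * f i x + \sum_(i <- t) c i * f i x); last first.
  by apply/funext => x; rewrite big_cons.
rewrite zl // IH2; split; first exact: heckeP.
by apply/funext => y; rewrite big_cons.
Qed.

(* The multiples of the indicators of K^l are the units of the Hecke algebras. *)
Lemma hecke_iso_one : z (ind1 1%g) = (fun x => (vol mu1 l / vol mu2 l)%:C%C * ind2 1%g x).
Proof.
have v20 : (vol mu2 l)%:C%C != 0 :> R[i] by rewrite fmorph_eq0 gt_eqF ?(vol_gt0 mu2 P2).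
case: zP => _ zl zM; have [f hf zf] := hecke_iso_surj (Hind2 1%g).
have h0 := hecke0 R r1 P1 l.
have := zM _ _ (Hind1 1%g) hf; rewrite zf hecke_conv1l // hecke_conv1r //; last exact: hecke_iso_hecke.
have -> : (fun x => (vol mu1 l)%:C%C * f x) = (fun x => (vol mu1 l)%:C%C * f x + 0).
  by apply/funext => x; rewrite addr0.
rewrite (zl _ _ _ hf h0) hecke_iso0 zf => h; apply/funext => x.
have /= := congr1 (fun f => f x) h; rewrite addr0 => hx; apply: (mulfI v20).
rewrite -hx mulrA; congr (_ * _); rewrite -rmorphM; congr (_%:C%C).
by rewrite mulrC divfK // gt_eqF ?(vol_gt0 mu2 P2).
Qed.

Section Existence.
Variable pi2 : smoothRep R D2 r2.
Hypothesis irr2 : irreducible pi2.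
Variable w0 : pi2.
Hypotheses (w0_fixed : fixed pi2 (K2 l) w0) (w0_neq0 : w0 != 0).
Local Notation M := (fixed pi2 (K2 l)).
Local Notation hact2 := (@hecke_act R F2 d2 D2 r2 mu2 pi2).
Implicit Types (w : pi2) (g h : G1).

(** The operator e g e of the representation of G1 yet to be constructed, as prescribed by
    [hecke_act_indic] and transported along z. *)
Definition tau g w : pi2 := (dvol mu1 l g)%:C%C^-1 *: hact2 (z (ind1 g)) w.

Let dv0 g : (dvol mu1 l g)%:C%C != 0 :> R[i].
Proof. by rewrite fmorph_eq0 gt_eqF // (dvol_gt0 mu1 P1). Qed.

Let sM : subspace M := subspace_fixed pi2 (K2 l).

Lemma hecke_iso_act_sum (I : Type) (t : seq I) (c : I -> R[i]) (f : I -> G1 -> R[i]) w :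
  (forall i, H1 (f i)) -> M w ->
  hact2 (z (fun x => \sum_(i <- t) c i * f i x)) w = \sum_(i <- t) c i *: hact2 (z (f i)) w.
Proof.
move=> hf Mw; have [_ ->] := hecke_iso_sum t c hf.
by rewrite (hecke_act_sum mu2 P2 t c (fun i => hecke_iso_hecke (hf i)) Mw).
Qed.

Lemma tau_fixed g w : M w -> M (tau g w).
Proof.
move=> Mw; apply: (subspaceZ sM).
by apply: (hecke_act_fixed mu2 P2) => //; exact: hecke_iso_hecke.
Qed.

Lemma tauP g c u w : M u -> M w -> tau g (c *: u + w) = c *: tau g u + tau g w.
Proof.
move=> Mu Mw; rewrite /tau (hecke_act_lin mu2 P2 _ (hecke_iso_hecke (Hind1 g)) Mu Mw).
by rewrite scalerDr !scalerA mulrC.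
Qed.

Lemma tau_dcoset g h w : dcoset (K1 l) g h -> tau g w = tau h w.
Proof. by move=> /dcoset_eq gh; rewrite /tau /dvol gh. Qed.

Lemma tau1 w : M w -> tau 1%g w = w.
Proof.
move=> Mw; rewrite /tau hecke_iso_one.
have := hecke_act_sum mu2 P2 [:: tt] (fun=> (vol mu1 l / vol mu2 l)%:C%C)
  (fun=> Hind2 1%g) Mw.
rewrite big_seq1; under [X in hecke_act _ X]funext => x do rewrite big_seq1.
move=> ->; rewrite (hecke_act_indic mu2 P2 _ Mw).
rewrite rep_act1 (avg_id P2 (is_subgroup_congK _ _ _)) //.
rewrite !dvol1 // !scalerA rmorphM fmorphV /= [X in X *: _](_ : _ = 1) ?scale1r //.
have a0 : (vol mu1 l)%:C%C != 0 :> R[i] by rewrite fmorph_eq0 gt_eqF ?(vol_gt0 mu1 P1).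
have b0 : (vol mu2 l)%:C%C != 0 :> R[i] by rewrite fmorph_eq0 gt_eqF ?(vol_gt0 mu2 P2).
by rewrite divfK // mulVf.
Qed.

(** The image under z of the convolution formula for two indicators; through it [tau] obeys the same
    product rule as e g e. *)
Lemma tauM g h : exists n' s, [/\ cosets n' s (K1 l),
  forall k, K1 n' k -> K1 l (h^-1 * k * h)%g &
  forall w, M w -> tau g (tau h w) = (size s)%:R^-1 *: \sum_(k <- s) tau (g * k * h)%g w].
Proof.
have [n' [s [cs [kP convE]]]] := hecke_conv_indic mu1 P1 l g h.
exists n', s; split=> // w Mw; case: zP => _ zl zM.
have hzg := hecke_iso_hecke (Hind1 g); have hzh := hecke_iso_hecke (Hind1 h).
have Mhw := hecke_act_fixed mu2 P2 hzh Mw.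
have := hecke_act_conv mu2 P2 hzg hzh Mw; rewrite -zM //.
rewrite convE (hecke_iso_act_sum _ _ (fun k => Hind1 (g * k * h)%g) Mw) => e.
have -> : tau g (tau h w) = ((dvol mu1 l g)%:C%C^-1 * (dvol mu1 l h)%:C%C^-1) *:
    hact2 (z (ind1 g)) (hact2 (z (ind1 h)) w).
  rewrite /tau -[X in hact2 _ X]addr0 (hecke_act_lin mu2 P2 _ hzg Mhw sM.1).
  by rewrite (hecke_act0 mu2 P2 _ hzg) addr0 scalerA.
rewrite -e.
rewrite !scaler_sumr; apply: eq_bigr => k _; rewrite /tau !scalerA; congr (_ *: _).
rewrite !rmorphM !fmorphV rmorph_nat /=.
have := dv0 g; have := dv0 h; have := dv0 (g * k * h)%g.
move: (dvol mu1 l g)%:C%C (dvol mu1 l h)%:C%C (dvol mu1 l (g * k * h)%g)%:C%C => a b c c0 b0 a0.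
have s0 := cosets_size R (is_subgroup_congK _ _ _) cs.
by field; rewrite a0 b0 c0 s0.
Qed.

(** A vector v of the desired representation is encoded by the function x -> e x v. For v = h w with
    w in M this function is x -> tau (x h) w, and such vectors span. *)
Definition matrix_space : set (G1 -> pi2) := [set f | exists t : seq (pi2 * G1),
  (forall p, p \in t -> M p.1) /\ f = fun x => \sum_(p <- t) tau (x * p.2)%g p.1].

Lemma matrix_space_fun w h : M w -> matrix_space (fun x => tau (x * h)%g w).
Proof.
move=> Mw; exists [:: (w, h)]; split=> [p|]; first by rewrite inE => /eqP ->.
by apply/funext => x; rewrite big_seq1.
Qed.

Lemma tauZ g c w : M w -> tau g (c *: w) = c *: tau g w.
Proof.
move=> Mw; have M0 : M 0 by exact: sM.1.
have t0 : tau g 0 = 0 by have := tauP g (-1) M0 M0; rewrite scaler0 addr0 scaleN1r addNr.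
by have := tauP g c Mw M0; rewrite t0 !addr0.
Qed.

Lemma matrix_space_subspace : subspace matrix_space.
Proof.
split; first by exists [::]; split=> //; apply/funext => x; rewrite big_nil.
move=> a u v [t [Mt ->]] [t' [Mt' ->]]; exists ([seq (a *: p.1, p.2) | p <- t] ++ t').
split=> [p|].
  rewrite mem_cat => /orP[/mapP[q qt ->]|/Mt'//] /=.
  by apply: (subspaceZ sM); exact: Mt.
apply/funext => x; rewrite big_cat big_map /=; congr (_ + _).
transitivity (a *: \sum_(p <- t) tau (x * p.2)%g p.1) => //.
rewrite scaler_sumr; apply: eq_big_seq => p pt /=.
by rewrite tauZ //; exact: Mt.
Qed.

Lemma matrix_space_translate f g : matrix_space f -> matrix_space (fun x => f (x * g)%g).
Proof.
move=> [t [Mt ->]]; exists [seq (p.1, g * p.2)%g | p <- t]; split=> [_ /mapP[p pt ->]|].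
  exact: (Mt _ pt).
by apply/funext => x; rewrite big_map; apply: eq_bigr => p _; rewrite mulgA.
Qed.

Lemma matrix_space_smooth f : matrix_space f ->
  exists n, forall x k, K1 n k -> f (x * k)%g = f x.
Proof.
move=> [t [_ ->]].
have /choice[N NP] : forall p : pi2 * G1, exists n, forall k, K1 n k -> K1 l (p.2^-1 * k * p.2)%g.
  by move=> p; exact: congK_conj.
exists (\max_(p <- t) N p)%N => x k kn; apply: eq_big_seq => p pt.
rewrite -(tau_dcoset (g := (x * p.2)%g)) //; apply/dcosetP.
exists 1%g, (p.2^-1 * k * p.2)%g; split; first exact: congK1.
  by apply: NP; apply: congK_le kn; exact: leq_bigmax_seq.
by rewrite mul1g !mulgA mulgK.
Qed.

Definition transfer_rep : smoothRep R D1 r1 :=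
  fun_rep matrix_space_subspace matrix_space_translate matrix_space_smooth.
Arguments transfer_rep : simpl never.
Local Notation pi1 := transfer_rep.

Definition transfer_ev x (f : pi1) : pi2 := fun_val f x.

Fact transfer_ev_linear x : linear (transfer_ev x). Proof. by []. Qed.
HB.instance Definition _ x :=
  GRing.isLinear.Build R[i] pi1 pi2 _ (transfer_ev x) (transfer_ev_linear x).

Lemma transfer_ext (f f' : pi1) : (forall x, transfer_ev x f = transfer_ev x f') -> f = f'.
Proof. by move=> ff'; apply/val_inj/funext. Qed.

Lemma transfer_ev_act x g (f : pi1) : transfer_ev x (rep_act pi1 g f) = transfer_ev (x * g)%g f.
Proof. by []. Qed.

Definition transfer_map w : pi1 :=
  if pselect (M w) is left Mw then
    FunSub (asboolT (matrix_space_fun 1%g Mw) : _ \in fun_pred matrix_space) else 0.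

Lemma transfer_mapE w x : M w -> transfer_ev x (transfer_map w) = tau x w.
Proof.
by move=> Mw; rewrite /transfer_map; case: pselect => // h; rewrite /transfer_ev /= mulg1.
Qed.

Lemma transfer_map_fixed w : M w -> fixed pi1 (K1 l) (transfer_map w).
Proof.
move=> Mw k kl; apply: transfer_ext => x.
rewrite transfer_ev_act !transfer_mapE //; symmetry; apply: tau_dcoset.
by apply/dcosetP; exists 1%g, k; rewrite mul1g; split=> //; exact: congK1.
Qed.

Lemma transfer_mapP c u w : M u -> M w ->
  transfer_map (c *: u + w) = c *: transfer_map u + transfer_map w.
Proof.
move=> Mu Mw; apply: transfer_ext => x.
rewrite (transfer_mapE x (sM.2 c _ _ Mu Mw)) tauP // -(transfer_mapE x Mu).
by rewrite -(transfer_mapE x Mw) (linearP (transfer_ev x)).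
Qed.

Lemma transfer_mapZ c w : M w -> transfer_map (c *: w) = c *: transfer_map w.
Proof.
move=> Mw; apply: transfer_ext => x; rewrite (linearZZ (transfer_ev x)).
rewrite (transfer_mapE _ (subspaceZ sM c Mw)) tauZ //; congr (_ *: _).
exact/esym/transfer_mapE.
Qed.

Lemma transfer_ev_fixed x (f : pi1) : M (transfer_ev x f).
Proof.
have [t [Mt fE]] := fun_valS f; rewrite /transfer_ev fE.
apply: (subspace_sum sM) => p pt; apply: tau_fixed; exact: Mt.
Qed.

Lemma avg_transfer_map h w : M w ->
  avg (K1 l) (rep_act pi1 h (transfer_map w)) = transfer_map (tau h w).
Proof.
move=> Mw; apply: transfer_ext => x; rewrite transfer_mapE; last exact: tau_fixed.
have [n' [s [cs kP ->]]] // := tauM x h.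
rewrite (avgE (is_subgroup_congK _ _ _) cs); last first.
  move=> k _ /kP kk; rewrite -[in RHS](transfer_map_fixed Mw kk) -!rep_actM.
  by rewrite !mulgA mulgV mul1g.
rewrite /avgs (linearZZ (transfer_ev x)) (linear_sum (transfer_ev x)).
congr (_ *: _); apply: eq_bigr => k _.
exact: (transfer_mapE (x * k * h)%g Mw).
Qed.

(** In the model x -> e x v, evaluation at 1 is the projector e. Hence the K^l-fixed functions are
    the image of M. *)
Lemma avg_transfer (f : pi1) : avg (K1 l) f = transfer_map (transfer_ev 1%g f).
Proof.
have [t [Mt fE]] := fun_valS f.
have fE' : f = \sum_(p <- t) 1 *: rep_act pi1 p.2 (transfer_map p.1).
  apply: transfer_ext => x; rewrite (linear_sum (transfer_ev x)) {1}/transfer_ev fE.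
  apply: eq_big_seq => p pt; rewrite scale1r.
  exact/esym/(transfer_mapE _ (Mt _ pt)).
have gK := is_subgroup_congK D1 r1 l.
rewrite {1}fE' avg_linear_comb //; apply: transfer_ext => x.
rewrite transfer_mapE; last exact: transfer_ev_fixed.
have -> : transfer_ev 1%g f = \sum_(p <- t) tau p.2 p.1.
  by rewrite /transfer_ev fE; apply: eq_bigr => p _; rewrite mul1g.
have -> : tau x (\sum_(p <- t) tau p.2 p.1) = \sum_(p <- t) tau x (tau p.2 p.1).
  elim: t Mt {fE fE'} => [_|p t IH Mt].
    by rewrite !big_nil; have := tauZ x 0 w0_fixed; rewrite !scale0r.
  have Mt' q : q \in t -> M q.1 by move=> qt; apply: Mt; rewrite inE qt orbT.
  rewrite !big_cons -IH // -[X in tau x (X + _)]scale1r tauP ?scale1r //.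
    by apply: tau_fixed; apply: Mt; exact: mem_head.
  apply: (subspace_sum sM) => q qt; apply: tau_fixed; exact: Mt'.
rewrite (linear_sum (transfer_ev x)); apply: eq_big_seq => p pt.
rewrite scale1r (avg_transfer_map _ (Mt _ pt)).
by apply: transfer_mapE; apply: tau_fixed; exact: Mt.
Qed.

Lemma transfer_module_iso : module_iso z (pi1 := pi1) transfer_map.
Proof.
split; first split.
- exact: transfer_map_fixed.
- move=> u w; rewrite !inE => Mu Mw uw.
  by rewrite -(tau1 Mu) -(tau1 Mw) -!transfer_mapE // uw.
- move=> f fK; exists (transfer_ev 1%g f); first exact: transfer_ev_fixed.
  by rewrite -avg_transfer (avg_id P1 (is_subgroup_congK _ _ _)).
- by move=> c u v Mu Mv; exact: transfer_mapP.
move=> f w hf Mw; have [t fE] := hecke_decomp hf.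
have mapK := transfer_map_fixed Mw.
have -> : hecke_act mu1 f (transfer_map w) =
    \sum_(g <- t) f g *: hecke_act mu1 (ind1 g) (transfer_map w).
  by rewrite {1}fE (hecke_act_sum mu1 P1 _ _ Hind1 mapK).
have -> : hact2 (z f) w = \sum_(g <- t) f g *: hact2 (z (ind1 g)) w.
  by rewrite {1}fE (hecke_iso_act_sum _ _ Hind1 Mw).
have Mg g : M (hact2 (z (ind1 g)) w).
  by apply: (hecke_act_fixed mu2 P2) => //; exact: hecke_iso_hecke.
elim: {fE} t => [|g t IH].
  rewrite !big_nil; have := transfer_mapP (-1) w0_fixed w0_fixed.
  by rewrite !scaleN1r !addNr.
rewrite !big_cons transfer_mapP //; last first.
  apply: (subspace_sumT sM) => g'.
  exact: (subspaceZ sM).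
rewrite IH; congr (_ *: _ + _).
rewrite (hecke_act_indic mu1 P1 _ mapK) avg_transfer_map //.
rewrite -transfer_mapZ; last exact: tau_fixed.
by rewrite /tau scalerA mulfV // scale1r.
Qed.

(** A nonzero stable W meets the image of M in a nonzero Hecke submodule N. Irreducibility of [pi2]
    gives N = M, and M generates the whole space. *)
Lemma transfer_rep_irreducible : irreducible pi1.
Proof.
have gK := is_subgroup_congK D1 r1 l; have gK2 := is_subgroup_congK D2 r2 l.
split.
  exists (transfer_map w0); apply: contra_neq w0_neq0 => h.
  by rewrite -(tau1 w0_fixed) -transfer_mapE // h linear0.
move=> W W0 WP WG; have sW : subspace W by [].
have [allW|] := pselect (forall f, W f -> f = 0).
  by left; apply/seteqP; split=> f /=; [exact: allW|move=> ->].
move=> /existsNP[f /not_implyP[Wf f0]]; right.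
have [g fg] : exists g, transfer_ev g f != 0.
  apply: contrapT => h; apply: f0; apply: transfer_ext => x.
  by rewrite linear0; apply/eqP; apply: contrapT => /negP ?; apply: h; exists x.
pose N := [set w | M w /\ W (transfer_map w)].
have Nf : N (transfer_ev g f).
  split; first exact: transfer_ev_fixed.
  have -> : transfer_ev g f = transfer_ev 1%g (rep_act pi1 g f) by rewrite transfer_ev_act mul1g.
  rewrite -avg_transfer; apply: (avg_stable P1 gK) => // c _; exact/WG/WG.
have sN : subspace N.
  split.
    split; first exact: sM.1.
    have -> : transfer_map 0 = 0 :> pi1; last by [].
    by have := transfer_mapP (-1) w0_fixed w0_fixed; rewrite !scaleN1r !addNr.
  move=> a u v [Mu Wu] [Mv Wv]; split; first exact: sM.2.
  by rewrite transfer_mapP //; exact: WP.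
have Ntau h w : N w -> N (tau h w).
  move=> [Mw Ww]; split; first exact: tau_fixed.
  by rewrite -avg_transfer_map //; apply: (avg_stable P1 gK) => // c _; exact/WG/WG.
have Nhact f2 w : H2 f2 -> N w -> N (hact2 f2 w).
  move=> hf2 Nw; have [Mw _] := Nw; have [f1 hf1 <-] := hecke_iso_surj hf2.
  have [t ->] := hecke_decomp hf1; rewrite (hecke_iso_act_sum _ _ Hind1 Mw).
  apply: (subspace_sumT sN) => h; apply: (subspaceZ sN).
  have := Ntau h _ Nw; rewrite /tau => /(subspaceZ sN (dvol mu1 l h)%:C%C).
  by rewrite scalerA mulfV // scale1r.
have NM w : M w -> N w.
  (* The largest subrepresentation of [pi2] that projects into N. It contains the nonzero vector
     [transfer_ev g f], so it is everything. *)
  pose X := [set u : pi2 | forall h : G2, N (avg (K2 l) (rep_act pi2 h u))].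
  have XE : X = setT.
    case: irr2 => _ /(_ X) []; last by [].
    - by move=> h; rewrite linear0 avg0 //; exact: sN.1.
    - by move=> a u v Xu Xv h; rewrite linearP avgP //; apply: sN.2.
    - by move=> h v Xv h'; rewrite -rep_actM.
    - move=> X0; exfalso; have : X (transfer_ev g f).
        move=> h; have /(Nhact _ _ (Hind2 h)) := Nf.
        rewrite (hecke_act_indic mu2 P2 h Nf.1) => /(subspaceZ sN (dvol mu2 l h)%:C%C^-1).
        by rewrite scalerA mulVf ?scale1r // fmorph_eq0 gt_eqF // (dvol_gt0 mu2 P2).
      by rewrite X0 /= => /eqP; rewrite (negPf fg).
  move=> Mw; have : X w by rewrite XE.
  by move=> /(_ 1%g); rewrite rep_act1 (avg_id P2 gK2).
apply/seteqP; split=> // f' _; have [t [Mt fE]] := fun_valS f'.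
have -> : f' = \sum_(p <- t) rep_act pi1 p.2 (transfer_map p.1).
  apply: transfer_ext => x; rewrite (linear_sum (transfer_ev x)) {1}/transfer_ev fE.
  by apply: eq_big_seq => p pt; exact/esym/(transfer_mapE _ (Mt _ pt)).
by apply: (subspace_sum sW) => p pt; apply: WG; have [] := NM _ (Mt _ pt).
Qed.

End Existence.

Lemma hecke_iso_transfer_exists (pi2 : smoothRep R D2 r2) : irreducible pi2 ->
  (exists2 v, fixed pi2 (K2 l) v & v != 0) ->
  exists (pi1 : smoothRep R D1 r1), irreducible pi1 /\
    exists phi : pi2 -> pi1, module_iso z phi.
Proof.
move=> irr2 [w0 w0K w0_neq0]; exists (transfer_rep pi2); split.
  exact: (transfer_rep_irreducible irr2 w0K w0_neq0).
by exists (@transfer_map pi2); exact: (transfer_module_iso w0K).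
Qed.

End HeckeIsomorphism.

(** * Equivalence of representations and the level *)

Section Equivalence.
Variables (R : realType) (F : localField) (d : nat) (D : divAlg F d) (r : nat).
Variables (mu : haarMeasures R D r) (P : cyclicPres D) (l : nat).
Local Notation G := (GL D r).
Local Notation K := (congK D r).
Implicit Types (pi : smoothRep R D r).

Lemma equivalent_refl pi : equivalent pi pi.
Proof. by exists (GRing.Linear.clone _ _ _ _ idfun _) => //; exists idfun. Qed.

Lemma linear_inverse pi pi' (phi : {linear pi -> pi'}) : bijective phi ->
  exists psi : {linear pi' -> pi}, cancel phi psi /\ cancel psi phi.
Proof.
case=> psi phiK psiK; have lin : linear psi.
  by move=> a u v; apply: (can_inj phiK); rewrite linearP !psiK.
pose L : {linear pi' -> pi} := HB.pack psi (GRing.isLinear.Build R[i] pi' pi _ psi lin).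
by exists L.
Qed.

Lemma equivalent_sym pi pi' : equivalent pi pi' -> equivalent pi' pi.
Proof.
case=> phi /linear_inverse[psi [phiK psiK]] phiG; exists psi; first by exists phi.
by move=> g v; apply: (can_inj phiK); rewrite phiG !psiK.
Qed.

Lemma equivalent_trans pi pi' pi'' :
  equivalent pi pi' -> equivalent pi' pi'' -> equivalent pi pi''.
Proof.
case=> phi bphi phiG [psi bpsi psiG].
exists (GRing.Linear.clone _ _ _ _ (psi \o phi) _); first exact: bij_comp.
by move=> g v /=; rewrite phiG psiG.
Qed.

Lemma equivalent_eq pi pi' : equivalent pi pi' -> equivalent pi = equivalent pi'.
Proof.
move=> e; apply/funext => rho; apply/propext; split; last exact: equivalent_trans.
by apply: equivalent_trans; exact: equivalent_sym.
Qed.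

Lemma irreducible_sub pi (W : set pi) : irreducible pi -> subspace W ->
  (forall g v, W v -> W (rep_act pi g v)) -> (exists2 v, W v & v != 0) -> W = setT.
Proof.
case=> _ irr [W0 WP] WG [v Wv v0]; case: (irr W W0 WP WG) => // WE.
by move: Wv; rewrite WE /= => /eqP; rewrite (negPf v0).
Qed.

(* The largest subrepresentation without K^l-fixed vectors vanishes. *)
Lemma avg_translates_eq0 pi (v : pi) : irreducible pi ->
  (exists2 w, fixed pi (K l) w & w != 0) ->
  (forall g, avg (K l) (rep_act pi g v) = 0) -> v = 0.
Proof.
move=> irr [w wK w0] ev; have gK := is_subgroup_congK D r l.
apply: contrapT => /eqP vN0.
pose W := [set u : pi | forall g : G, avg (K l) (rep_act pi g u) = 0].
have WT : W = setT.
  apply: (irreducible_sub irr); last by exists v.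
    split=> [g|a x y Wx Wy g]; first by rewrite linear0 avg0.
    by rewrite linearP avgP // Wx Wy scaler0 addr0.
  by move=> g x Wx h; rewrite -rep_actM.
have : W w by rewrite WT.
by move=> /(_ 1%g); rewrite rep_act1 (avg_id P gK) // => /eqP; rewrite (negPf w0).
Qed.

Lemma fixed_module_equivalent pi pi' (psi : pi -> pi') : irreducible pi -> irreducible pi' ->
  (exists2 w, fixed pi (K l) w & w != 0) ->
  set_bij (fixed pi (K l)) (fixed pi' (K l)) psi ->
  (forall (c : R[i]) u v, fixed pi (K l) u -> fixed pi (K l) v ->
     psi (c *: u + v) = c *: psi u + psi v) ->
  (forall f v, hecke R (K l) f -> fixed pi (K l) v ->
     psi (hecke_act mu f v) = hecke_act mu f (psi v)) ->
  equivalent pi pi'.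
Proof.
move=> irr irr' [w wK w0] [psiK psi_inj psi_surj] psiP psiH.
have gK := is_subgroup_congK D r l.
have f0 : fixed pi (K l) 0 by move=> k _; rewrite linear0.
have psi0 : psi 0 = 0 by have := psiP (-1) _ _ f0 f0; rewrite scaler0 addr0 scaleN1r addNr.
have psi_eq0 u : fixed pi (K l) u -> psi u = 0 -> u = 0.
  by move=> uK pu; apply: psi_inj; rewrite ?inE // pu psi0.
have psiw0 : psi w != 0 by apply: contra_neq w0; exact: psi_eq0.
have irr'w : exists2 w', fixed pi' (K l) w' & w' != 0 by exists (psi w) => //; exact: psiK.
have eK g (v : pi) : fixed pi (K l) (avg (K l) (rep_act pi g v)) by exact: avg_fixed.
(* [X] is the graph of the future intertwiner: [avg_translates_eq0] says that v' is determined by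
   all its projections e g v', and irreducibility of [pi] makes the domain total. *)
pose X (v : pi) (v' : pi') := forall g : G,
  psi (avg (K l) (rep_act pi g v)) = avg (K l) (rep_act pi' g v').
have XP a u u' v v' : X u u' -> X v v' -> X (a *: u + v) (a *: u' + v').
  by move=> Xu Xv g; rewrite !linearP !avgP // psiP // Xu Xv.
have XG g u u' : X u u' -> X (rep_act pi g u) (rep_act pi' g u').
  by move=> Xu h; rewrite -!rep_actM.
have Xuniq v v1 v2 : X v v1 -> X v v2 -> v1 = v2.
  move=> X1 X2; apply: subr0_eq; apply: (avg_translates_eq0 irr') => // g.
  have := XP (-1) _ _ _ _ X2 X1; rewrite !scaleN1r addNr => /(_ g).
  by rewrite linear0 avg0 // psi0 addrC => <-.
have Xfix u : fixed pi (K l) u -> X u (psi u).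
  move=> uK g; have := psiH _ _ (hecke_indic R P l g) uK.
  rewrite !(hecke_act_indic mu P) //; last exact: psiK.
  have dv0 : (dvol mu l g)%:C%C != 0 :> R[i] by rewrite fmorph_eq0 gt_eqF // (dvol_gt0 mu P).
  rewrite -[X in psi X]addr0 psiP // psi0 addr0 => h.
  by rewrite -[LHS]scale1r -(mulVf dv0) -scalerA h scalerA mulVf // scale1r.
have Xtot v : exists v', X v v'.
  pose W := [set v | exists v', X v v'].
  have : W v; last by [].
  suff -> : W = setT by [].
  apply: (irreducible_sub irr); last by exists w => //; exists (psi w); exact: Xfix.
    split; first by exists 0 => g; rewrite !linear0 !avg0.
    by move=> a x y [x' Xx] [y' Xy]; exists (a *: x' + y'); exact: XP.
  by move=> g x [x' Xx]; exists (rep_act pi' g x'); exact: XG.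
have /choice[Phi PhiP] := Xtot.
have lin : linear Phi.
  by move=> a u v; apply: (Xuniq (a *: u + v)) => //; exact: XP.
pose L : {linear pi -> pi'} := HB.pack Phi (GRing.isLinear.Build R[i] pi pi' _ Phi lin).
have Linj : injective Phi.
  have ker v : Phi v = 0 -> v = 0.
    move=> v0; apply: (avg_translates_eq0 irr); first by exists w.
    by move=> g; apply: psi_eq0 => //; rewrite PhiP v0 linear0 avg0.
  move=> u v uv; apply: subr0_eq; apply: ker.
  by rewrite -[LHS]/(L (u - v)) linearB /= uv subrr.
have Lsurj v' : exists v, Phi v = v'.
  have : [set v' | exists v, Phi v = v'] v'; last by [].
  suff -> : [set v' | exists v, Phi v = v'] = setT by [].
  apply: (irreducible_sub irr').
  - split; first by exists 0; exact: (linear0 L).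
    by move=> a x y [x' <-] [y' <-]; exists (a *: x' + y'); exact: (linearP L).
  - move=> g x [x' <-]; exists (rep_act pi g x').
    by apply: (Xuniq (rep_act pi g x')) => //; exact: XG.
  - by exists (psi w) => //; exists w; apply: (Xuniq w) => //; exact: Xfix.
have /choice[Psi PsiP] := Lsurj.
exists L; first by exists Psi => v //; apply: Linj; rewrite PsiP.
by move=> g v; apply: (Xuniq (rep_act pi g v)) => //; exact: XG.
Qed.

Lemma equivalent_hecke_act n pi pi' (phi : {linear pi -> pi'}) f v :
  (forall g v, phi (rep_act pi g v) = rep_act pi' g (phi v)) ->
  hecke R (K n) f -> fixed pi (K n) v ->
  phi (hecke_act mu f v) = hecke_act mu f (phi v).
Proof.
move=> phiG hf vn; rewrite /hecke_act.
rewrite -(lc_integral_linear mu P phi (hecke_act_finsupp (hecke_finsupp hf) vn)).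
by congr lc_integral; apply/funext => g; rewrite linearZ /= phiG.
Qed.

Lemma equivalent_irreducible pi pi' : equivalent pi pi' -> irreducible pi -> irreducible pi'.
Proof.
case=> phi /linear_inverse[psi [phiK psiK]] phiG [[v v0] irr]; split.
  by exists (phi v); rewrite -(linear0 phi) (can_eq phiK).
move=> W W0 WP WG.
case: (irr (phi @^-1` W)) => [|a x y|g x|WE|WE] /=.
- by rewrite linear0.
- by rewrite linearP; exact: WP.
- by rewrite phiG; exact: WG.
- left; apply/seteqP; split=> x /=; last by move=> ->.
  rewrite -{1}(psiK x) => h; have : (phi @^-1` W) (psi x) by [].
  by rewrite WE /= => h'; rewrite -(psiK x) h' linear0.
- right; apply/seteqP; split=> // x _.
  by have : (phi @^-1` W) (psi x) by [rewrite WE]; rewrite /= psiK.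
Qed.

Lemma equivalent_fixed pi pi' (phi : {linear pi -> pi'}) (C : set G) v : injective phi ->
  (forall g v, phi (rep_act pi g v) = rep_act pi' g (phi v)) ->
  fixed pi C v <-> fixed pi' C (phi v).
Proof.
move=> phi_inj phiG; split=> vC k kC; first by rewrite -phiG vC.
by apply: phi_inj; rewrite phiG vC.
Qed.

Lemma equivalent_has_level pi pi' n : equivalent pi pi' -> has_level pi n -> has_level pi' n.
Proof.
case=> phi /linear_inverse[psi [phiK psiK]] phiG [[v vK v0] vmin].
have inj := can_inj phiK; split.
  exists (phi v); first exact/(equivalent_fixed _ _ inj).
  by rewrite -(linear0 phi) (can_eq phiK).
move=> k kn u uK /=; rewrite -[u]psiK (_ : psi u = 0) ?linear0 //.
by apply: (vmin k kn); apply/(equivalent_fixed _ _ inj phiG); rewrite psiK.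
Qed.

Lemma equivalent_level_le pi pi' n : equivalent pi pi' -> level_le n pi -> level_le n pi'.
Proof. by move=> e [k kn vk]; exists k => //; exact: equivalent_has_level vk. Qed.

Lemma level_le_fixed pi n : level_le n pi <-> exists2 v, fixed pi (K n) v & v != 0.
Proof.
split=> [[k kn [[v vk v0] _]]|[v vn v0]].
  by exists v => //; exact: fixed_le vk.
have ex : exists k, `[< exists2 v, fixed pi (K k) v & v != 0 >].
  by exists n; apply/asboolP; exists v.
case: (ex_minnP ex) => k /asboolP kP kmin; exists k.
  by apply: kmin; apply/asboolP; exists v.
split=> // j jk u uj /=; apply: contrapT => /eqP u0.
have : (k <= j)%N by apply: kmin; apply/asboolP; exists u.
by rewrite leqNgt jk.
Qed.

End Equivalence.

(** * Parabolic subgroups *)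

Section BlockGroups.
Variables (F : localField) (d : nat) (D : divAlg F d) (r : nat) (P : cyclicPres D).
Local Notation G := (GL D r).
Local Notation K := (congK D r).
Local Notation vD := (@da_val F d D).
Local Notation vDP := (@da_valP F d D).
Implicit Types (g h x y : G) (i j k t : 'I_r) (Z : rel 'I_r) (I J : {set 'I_r}).

Definition zgrp Z g := forall i j, Z i j -> glm g i j = 0 /\ glm g^-1%g i j = 0.

(** The condition under which a pattern of zeros survives products: each term A i k * B k j of an
    entry in Z has a factor in Z. *)
Definition cotransitive Z := forall i j k, Z i j -> Z i k || Z k j.

Lemma zgrp1 Z : irreflexive Z -> zgrp Z 1%g.
Proof.
move=> Zi i j Zij; have ij : i != j by apply: contraTneq Zij => ->; rewrite Zi.
by rewrite invg1 glm1 !mxE (negPf ij).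
Qed.

Lemma zgrpV Z g : zgrp Z g -> zgrp Z g^-1%g.
Proof. by move=> gZ i j Zij; have [? ?] := gZ _ _ Zij; rewrite invgK. Qed.

Lemma zgrpM Z g h : cotransitive Z -> zgrp Z g -> zgrp Z h -> zgrp Z (g * h)%g.
Proof.
move=> cZ gZ hZ i j Zij; rewrite invMg !glmM !mxE.
by split; apply: big1 => k _; have /orP[/gZ[e1 e2]|/hZ[e1 e2]] := cZ i j k Zij;
  have /orP[/hZ[e3 e4]|/gZ[e3 e4]] := cZ i j k Zij;
  rewrite ?e1 ?e2 ?e3 ?e4 ?mul0r ?mulr0.
Qed.

(* The elements of [I] are the first indices of the blocks. *)
Definition sep I i j := [exists t in I, (j < t <= i)%N].
Definition same I i j := ~~ sep I i j && ~~ sep I j i.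
Definition nsame I i j := ~~ same I i j.
(** The block upper triangular parabolic subgroup: the whole group when I is empty, the Borel
    subgroup when I is full. *)
Definition PI I := zgrp (sep I).
Definition MI I := zgrp (nsame I).

Lemma sepP I i j : reflect (exists2 t, t \in I & (j < t <= i)%N) (sep I i j).
Proof. exact: exists_inP. Qed.

Lemma sep_irr I : irreflexive (sep I).
Proof. by move=> i; apply/sepP => -[t _ /andP[h1 h2]]; rewrite leqNgt h1 in h2. Qed.

Lemma sep_cotrans I : cotransitive (sep I).
Proof.
move=> i j k /sepP[t tI /andP[jt ti]]; case: (leqP t k) => tk.
  by apply/orP; right; apply/sepP; exists t; rewrite // jt tk.
by apply/orP; left; apply/sepP; exists t; rewrite // tk ti.
Qed.

Lemma sep_lt I i j : sep I i j -> (j < i)%N.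
Proof. by move=> /sepP[t _ /andP[jt ti]]; exact: leq_trans jt ti. Qed.

Lemma sep_sub I J i j : I \subset J -> sep I i j -> sep J i j.
Proof. by move=> /fintype.subsetP IJ /sepP[t tI jti]; apply/sepP; exists t => //; exact: IJ. Qed.

Lemma sepT i j : sep [set: 'I_r]%SET i j = (j < i)%N.
Proof.
apply/idP/idP => [/sep_lt//|ji]; apply/sepP; exists i; rewrite ?inE // ji leqnn.
by [].
Qed.

Lemma same_refl I i : same I i i.
Proof. by rewrite /same sep_irr. Qed.

Lemma same_sym I i j : same I i j = same I j i.
Proof. by rewrite /same andbC. Qed.

Lemma same_trans I i j k : same I i k -> same I k j -> same I i j.
Proof.
move=> /andP[ik ki] /andP[kj jk]; apply/andP; split; apply/negP.
  by move=> /(@sep_cotrans _ _ _ k)/orP[]; apply/negP.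
by move=> /(@sep_cotrans _ _ _ k)/orP[]; apply/negP.
Qed.

Lemma nsame_irr I : irreflexive (nsame I).
Proof. by move=> i; rewrite /nsame same_refl. Qed.

Lemma nsame_cotrans I : cotransitive (nsame I).
Proof.
move=> i j k; rewrite /nsame -negb_and; apply: contra => /andP[]; exact: same_trans.
Qed.

Lemma sep_nsame I i j : sep I i j -> nsame I i j.
Proof. by rewrite /nsame /same => ->. Qed.

Lemma MI_PI I g : MI I g -> PI I g.
Proof. by move=> gM i j /sep_nsame /gM. Qed.

Lemma PI_sub I J g : I \subset J -> PI J g -> PI I g.
Proof. by move=> IJ gJ i j /(sep_sub IJ) /gJ. Qed.

Lemma PIM I g h : PI I g -> PI I h -> PI I (g * h)%g.
Proof. exact/zgrpM/sep_cotrans. Qed.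

Lemma MIM I g h : MI I g -> MI I h -> MI I (g * h)%g.
Proof. exact/zgrpM/nsame_cotrans. Qed.

Lemma PIV I g : PI I g -> PI I g^-1%g. Proof. exact: zgrpV. Qed.

Lemma PI0 g : PI finset.set0 g.
Proof. by move=> i j /sepP[t]; rewrite inE. Qed.

Definition bd I (A : 'M[D]_r) := \matrix_(i, j) (if same I i j then A i j else 0).

(** In an entry of a diagonal block of AB, an intermediate index outside the block makes one of the
    two factors lie below the diagonal blocks, where it is 0. *)
Lemma bdM I (A B : 'M[D]_r) : (forall i j, sep I i j -> A i j = 0) ->
  (forall i j, sep I i j -> B i j = 0) -> bd I (A *m B) = bd I A *m bd I B.
Proof.
move=> A0 B0; apply/matrixP => i j; rewrite !mxE; case: ifPn => ij.
  apply: eq_bigr => k _; rewrite !mxE; case: ifPn => ik.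
    case: ifPn => kj //; rewrite same_sym in ik.
    by case/negP: kj; exact: same_trans ik ij.
  move: ik; rewrite /same negb_and !negbK => /orP[/A0->|ki]; first by rewrite !mul0r.
  have /orP[/B0->|ji] := sep_cotrans j ki; first by rewrite mulr0 mul0r.
  by move: ij; rewrite /same ji andbF.
rewrite big1 // => k _; rewrite !mxE; case: ifPn => ik; last by rewrite mul0r.
case: ifPn => kj; last by rewrite mulr0.
by case/negP: ij; exact: same_trans ik kj.
Qed.

Lemma bd1 I : bd I 1%:M = 1%:M.
Proof.
apply/matrixP => i j; rewrite !mxE; case: ifPn => // ij.
by case: eqP ij => // ->; rewrite same_refl.
Qed.

(** The unipotent radical of [PI I]. *)
Definition NI I g := [/\ PI I g, bd I (glm g) = 1%:M & bd I (glm g^-1%g) = 1%:M].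

Lemma PI_zero I g : PI I g -> forall i j, sep I i j -> glm g i j = 0.
Proof. by move=> gP i j /gP[]. Qed.

Lemma bd_glmM I g h : PI I g -> PI I h ->
  bd I (glm (g * h)%g) = bd I (glm g) *m bd I (glm h).
Proof. by move=> /PI_zero gP /PI_zero hP; rewrite glmM bdM. Qed.

Lemma NI_conj I g n : PI I g -> NI I n -> NI I (g * n * g^-1)%g.
Proof.
move=> gP [nP n1 n2].
have bdgV : bd I (glm g) *m bd I (glm g^-1%g) = 1%:M.
  by rewrite -bd_glmM ?mulgV ?bd1 //; exact: PIV.
have gV := PIV gP; have nV := PIV nP; split.
- exact/PIM/PIV/gP/PIM.
- by rewrite !bd_glmM ?n1 ?mulmx1 //; exact: PIM.
- rewrite !invMg invgK mulgA !bd_glmM ?n2 ?mulmx1 //; exact: PIM.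
Qed.

Lemma Levi_decomposition I g : PI I g -> exists2 m, MI I m &
  [/\ glm m = bd I (glm g), glm m^-1%g = bd I (glm g^-1%g) & NI I (m^-1 * g)%g].
Proof.
move=> gP; have gV := PIV gP.
have h1 : bd I (glm g) *m bd I (glm g^-1%g) = 1%:M.
  by rewrite -bd_glmM ?mulgV ?bd1 //; exact: PIV.
have h2 : bd I (glm g^-1%g) *m bd I (glm g) = 1%:M.
  by rewrite -bd_glmM ?mulVg ?bd1 //; exact: PIV.
have bdbd (A : 'M[D]_r) : bd I (bd I A) = bd I A.
  by apply/matrixP => i j; rewrite !mxE; case: (same I i j).
pose m : G := mkGL h1 h2.
have mM : MI I m.
  move=> i j; rewrite /nsame => ij.
  by split; rewrite /glm /= mxE (negPf ij).
exists m => //; split=> //; have mP := MI_PI mM; have mV := PIV mP; split.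
- exact: PIM.
- by rewrite bd_glmM // [glm m^-1%g]/(bd I _) bdbd h2.
- by rewrite invMg invgK bd_glmM // [glm m]/(bd I _) bdbd h2.
Qed.

Lemma transvection_subproof (u : 'cV[D]_r) (w : 'rV[D]_r) : w *m u = 0 ->
  (1%:M + u *m w) *m (1%:M - u *m w) = 1%:M /\ (1%:M - u *m w) *m (1%:M + u *m w) = 1%:M.
Proof.
move=> wu; have uwuw : u *m w *m (u *m w) = 0.
  by rewrite mulmxA -(mulmxA u w u) wu mulmx0 mul0mx.
split; first by rewrite mulmxBr mulmx1 mulmxDl mul1mx uwuw addr0 addrK.
by rewrite mulmxBl mul1mx mulmxDr mulmx1 uwuw addr0 addrK.
Qed.

Definition transvection (u : 'cV[D]_r) (w : 'rV[D]_r) (wu : w *m u = 0) : G :=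
  mkGL (transvection_subproof wu).1 (transvection_subproof wu).2.

Lemma tperm_glm_subproof i j : tperm_mx i j *m tperm_mx i j = 1%:M :> 'M[D]_r.
Proof. by rewrite /tperm_mx -perm_mxM tperm2 perm_mx1. Qed.

Definition tperm_GL i j : G := mkGL (tperm_glm_subproof i j) (tperm_glm_subproof i j).

Lemma tperm_GL_glm i j : glm (tperm_GL i j) = tperm_mx i j. Proof. by []. Qed.

Lemma tperm_mxE i j i' j' : (tperm_mx i j : 'M[D]_r) i' j' = (tperm i j i' == j')%:R.
Proof. by rewrite !mxE. Qed.

Lemma tperm_GL_K0 i j : K 0 (tperm_GL i j).
Proof.
have h : mxpw 0 (tperm_mx i j : 'M[D]_r).
  by move=> i' j'; rewrite tperm_mxE; case: eqP => _; [exact: (pw1 vDP)|left].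
exact/congK0P.
Qed.

Lemma tperm_GL_MI I i j : same I i j -> MI I (tperm_GL i j).
Proof.
move=> ij i' j' ns.
have h : (tperm_mx i j : 'M[D]_r) i' j' = 0.
  rewrite tperm_mxE; case: eqP => // e; case/negP: ns; move: e.
  case: tpermP => [->|->|_ _] <-; [by []|by rewrite same_sym|exact: same_refl].
by [].
Qed.

Lemma transvection_col (c : 'cV[D]_r) i0 : c i0 0 = 0 -> (delta_mx 0 i0 : 'rV[D]_r) *m c = 0.
Proof.
by move=> c0; rewrite -rowE; apply/matrixP => i j; rewrite !mxE (ord1 j) c0.
Qed.

Lemma transvection_row (c : 'rV[D]_r) i0 : c 0 i0 = 0 -> c *m (delta_mx i0 0 : 'cV[D]_r) = 0.
Proof.
by move=> c0; rewrite -colE; apply/matrixP => i j; rewrite !mxE (ord1 i) c0.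
Qed.

Definition rowop (c : 'cV[D]_r) i0 (c0 : c i0 0 = 0) := transvection (transvection_col c0).
Definition colop (c : 'rV[D]_r) i0 (c0 : c 0 i0 = 0) := transvection (transvection_row c0).

Lemma rowopE (c : 'cV[D]_r) i0 (c0 : c i0 0 = 0) (A : 'M[D]_r) i j :
  (glm (rowop c0) *m A) i j = A i j + c i 0 * A i0 j.
Proof.
by rewrite [glm _]/(1%:M + c *m delta_mx 0 i0) mulmxDl mul1mx -mulmxA -rowE mxE; congr (_ + _);
  rewrite mxE big_ord1 !mxE.
Qed.

Lemma colopE (c : 'rV[D]_r) i0 (c0 : c 0 i0 = 0) (A : 'M[D]_r) i j :
  (A *m glm (colop c0)) i j = A i j + A i i0 * c 0 j.
Proof.
by rewrite [glm _]/(1%:M + delta_mx i0 0 *m c) mulmxDr mulmx1 mulmxA -colE mxE; congr (_ + _);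
  rewrite mxE big_ord1 !mxE.
Qed.

Lemma rowop_entry (c : 'cV[D]_r) i0 i j : (c *m (delta_mx 0 i0 : 'rV[D]_r)) i j = (j == i0)%:R * c i 0.
Proof. by rewrite mxE big_ord1 mxE eqxx /= mulr_natr mulr_natl. Qed.

Lemma colop_entry (c : 'rV[D]_r) i0 i j : ((delta_mx i0 0 : 'cV[D]_r) *m c) i j = (i == i0)%:R * c 0 j.
Proof. by rewrite mxE big_ord1 mxE eqxx andbT. Qed.

Lemma transvection_K0 u w wu : mxpw 0 (u *m w) -> K 0 (@transvection u w wu).
Proof.
move=> Ouw; apply/congK0P; split; first exact: mxpwD (@mxpw1 _ _ _ _) Ouw.
exact: mxpwB (@mxpw1 _ _ _ _) Ouw.
Qed.

Lemma transvection_MI I u w wu : (forall i j, nsame I i j -> (u *m w) i j = 0) ->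
  MI I (@transvection u w wu).
Proof.
move=> uw0 i j ns; have ij : i != j by apply: contraTneq ns => ->; rewrite nsame_irr.
have e1 : (1%:M : 'M[D]_r) i j = 0 by rewrite mxE (negPf ij).
have h := uw0 _ _ ns.
split; rewrite -?glmVE /glmV /glm /=; rewrite mxE e1 add0r; first exact: h.
by rewrite mxE h oppr0.
Qed.

Lemma rowop_K0_MI I (c : 'cV[D]_r) i0 (c0 : c i0 0 = 0) : (forall i, pw vD 0 (c i 0)) ->
  (forall i, nsame I i i0 -> c i 0 = 0) -> K 0 (rowop c0) /\ MI I (rowop c0).
Proof.
move=> Oc cn; split.
  apply: transvection_K0 => i j; rewrite rowop_entry; case: eqP => _; rewrite ?mul1r ?mul0r //.
  by left.
apply: transvection_MI => i j ns; rewrite rowop_entry; case: eqP => [e|_]; last by rewrite mul0r.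
by rewrite mul1r cn // -e.
Qed.

Lemma colop_K0_MI I (c : 'rV[D]_r) i0 (c0 : c 0 i0 = 0) : (forall i, pw vD 0 (c 0 i)) ->
  (forall i, nsame I i0 i -> c 0 i = 0) -> K 0 (colop c0) /\ MI I (colop c0).
Proof.
move=> Oc cn; split.
  apply: transvection_K0 => i j; rewrite colop_entry; case: eqP => _; rewrite ?mul1r ?mul0r //.
  by left.
apply: transvection_MI => i j ns; rewrite colop_entry; case: eqP => [e|_]; last by rewrite mul0r.
by rewrite mul1r cn // -e.
Qed.

Lemma diag_GL_subproof (f : 'I_r -> D) : (forall i, f i \is a GRing.unit) ->
  diag_mx (\row_i f i) *m diag_mx (\row_i (f i)^-1) = 1%:M /\
  diag_mx (\row_i (f i)^-1) *m diag_mx (\row_i f i) = 1%:M.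
Proof.
move=> fu; split; apply/matrixP => i j; rewrite mul_diag_mx !mxE.
  by case: eqP => [->|_]; rewrite ?mulr0 // divrr.
by case: eqP => [->|_]; rewrite ?mulr0 // mulVr.
Qed.

Definition diag_GL (f : 'I_r -> D) (fu : forall i, f i \is a GRing.unit) : G :=
  mkGL (diag_GL_subproof fu).1 (diag_GL_subproof fu).2.

Lemma diag_GL_MI I f fu : MI I (@diag_GL f fu).
Proof.
move=> i j ns; have ij : i != j by apply: contraTneq ns => ->; rewrite nsame_irr.
by split; rewrite -?glmVE /glmV /glm /= !mxE (negPf ij).
Qed.

Lemma diag_GL_K0 f fu : (forall i, vD (f i) = 0) -> K 0 (@diag_GL f fu).
Proof.
move=> f0; apply/congK0P; split=> i j; rewrite -?glmVE /glmV /glm /= !mxE; case: eqP => _ /=.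
- by rewrite mulr1n; right; rewrite f0.
- by left.
- by rewrite mulr1n; exact: (pw_unitV vDP).
- by left.
Qed.

Definition ppow (a : 'I_r -> int) : G := @diag_GL (fun i => cp_pi P ^ a i)
  (fun i => unitrXz (a i) (cp_pi_unit P)).

Lemma ppowE a : glm (ppow a) = diag_mx (\row_i cp_pi P ^ a i). Proof. by []. Qed.

Lemma ppowVE a : glm (ppow a)^-1%g = diag_mx (\row_i cp_pi P ^ (- a i)).
Proof. by congr diag_mx; apply/matrixP => i j; rewrite !mxE invr_expz. Qed.

Lemma ppow_entry a : glm (ppow a) =2 fun i j => (cp_pi P ^ a i) *+ (i == j).
Proof. by move=> i j; rewrite ppowE !mxE. Qed.

End BlockGroups.

(** * Iwasawa and Cartan decompositions by elimination *)

Section Decompositions.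
Variables (F : localField) (d : nat) (D : divAlg F d) (r : nat) (P : cyclicPres D).
Local Notation G := (GL D r).
Local Notation K := (congK D r).
Local Notation vD := (@da_val F d D).
Local Notation vDP := (@da_valP F d D).
Implicit Types (g h : G) (i j t : 'I_r) (I J : {set 'I_r}).

Lemma glm_mulV_entry g i j : \sum_k glm g i k * glm g^-1%g k j = (i == j)%:R.
Proof. by have := congr1 (fun A : 'M[D]_r => A i j) (glmK g); rewrite !mxE. Qed.

(** Back substitution from the last row: in row i of g g^-1 = 1 only the term with the diagonal
    entry of g remains. *)
Lemma triangular_inverse g (m : nat) :
  (forall i j, (m <= i)%N -> (j < i)%N -> glm g i j = 0) ->
  (forall i, (m <= i)%N -> glm g i i != 0) ->
  forall i j, (m <= i)%N -> (j < i)%N -> glm g^-1%g i j = 0.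
Proof.
move=> tri dg i j; have [n] := ubnP (r - i)%N.
elim: n i => // n IH i; rewrite ltnS => rin mi ji.
have := glm_mulV_entry g i j; rewrite [RHS](_ : _ = 0); last first.
  by case: eqP ji => // ->; rewrite ltnn.
rewrite (bigD1 i) //= big1 ?addr0 => [/eqP|k ki].
  by apply: contraTeq => Bij; rewrite (val_mul_neq0 vDP) // dg.
case: (ltngtP k i) => [k_lt|k_gt|/val_inj ke]; first by rewrite tri // mul0r.
  rewrite IH ?mulr0 //; [|exact: leq_trans mi (ltnW k_gt)|exact: ltn_trans ji k_gt].
  by apply: leq_trans rin; rewrite ltn_sub2l // (ltn_trans k_gt).
by rewrite ke eqxx in ki.
Qed.

Lemma triangular_pivot g i0 :
  (forall i j, (i0 < i)%N -> (j < i)%N -> glm g i j = 0) ->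
  (forall i, (i0 < i)%N -> glm g i i != 0) ->
  exists2 j : 'I_r, (j <= i0)%N & glm g i0 j != 0.
Proof.
move=> tri dg; apply: contrapT => no.
have := glm_mulV_entry g i0 i0; rewrite eqxx big1 => [/esym/eqP|k _].
  by rewrite oner_eq0.
case: (leqP k i0) => ki.
  suff -> : glm g i0 k = 0 by rewrite mul0r.
  by apply/eqP; apply: contrapT => /negP h; apply: no; exists k.
by rewrite (triangular_inverse tri dg) // mulr0.
Qed.

Lemma glm_mul_tperm g i j a b : glm (g * tperm_GL D i j)%g a b = glm g a (tperm i j b).
Proof. by rewrite glmM tperm_GL_glm -xcolE mxE. Qed.

Lemma glm_tperm_mul g i j a b : glm (tperm_GL D i j * g)%g a b = glm g (tperm i j a) b.
Proof. by rewrite glmM tperm_GL_glm -xrowE mxE. Qed.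

Lemma glm_mul_diag g f (fu : forall i, f i \is a GRing.unit) i j :
  glm (g * diag_GL fu)%g i j = glm g i j * f j.
Proof.
by rewrite glmM [glm (diag_GL fu)]/(diag_mx _) mul_mx_diag mxE [X in _ * X]mxE.
Qed.

(** Column elimination, starting with the bottom row. A pivot of least valuation in its row makes
    the multipliers integral; since g is in [PI I], the nonzero entries up to column i0 lie in the
    block of i0, so every operation is in [MI I]. *)
Lemma Iwasawa I g : PI I g -> exists k, [/\ K 0 k, MI I k & PI [set: 'I_r]%SET (g * k)%g].
Proof.
move=> gP.
suff H n : (n <= r)%N -> exists k, [/\ K 0 k, MI I k,
    forall i j, (r - n <= i)%N -> (j < i)%N -> glm (g * k)%g i j = 0 &
    forall i, (r - n <= i)%N -> glm (g * k)%g i i != 0].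
  have [k [k0 kM tri dg]] := H r (leqnn r); exists k; split=> // i j; rewrite sepT => ji.
  rewrite subnn in tri dg; split; first exact: tri.
  exact: (triangular_inverse tri dg).
elim: n => [_|n IH nr].
  exists 1%g; split; [exact: congK1|exact/zgrp1/nsame_irr| |].
    by move=> i j; rewrite subn0 leqNgt ltn_ord.
  by move=> i; rewrite subn0 leqNgt ltn_ord.
have [k [k0 kM tri dg]] := IH (ltnW nr); set h := (g * k)%g in tri dg.
have hP : PI I h by apply: PIM => //; exact: MI_PI.
have mr : (r - n.+1 < r)%N by rewrite ltn_subrL /= (leq_trans _ nr).
pose i0 := Ordinal mr.
have rn : (r - n)%N = (r - n.+1).+1 by rewrite subnSK.
have [j1 j1i0 hj1] : exists2 j : 'I_r, (j <= i0)%N & glm h i0 j != 0.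
  apply: triangular_pivot => [i j i0i|i i0i]; [apply: tri|apply: dg];
  by rewrite rn.
pose Q (j : 'I_r) := (j <= i0)%N && (glm h i0 j != 0).
have pj1 : Q j1 by rewrite /Q j1i0.
have [j0 /andP[j0i0 hj0] j0min] := @arg_minP _ _ _ j1 Q (fun j => vD (glm h i0 j)) pj1.
have same_of j : (j <= i0)%N -> glm h i0 j != 0 -> same I i0 j.
  move=> ji hj; apply/andP; split; apply/negP; last first.
    by move=> /sep_lt; rewrite ltnNge ji.
  by move=> s; case/eqP: hj; have [] := hP _ _ s.
pose k1 := tperm_GL D j0 i0.
have k1M : MI I k1 by apply: tperm_GL_MI; rewrite same_sym; exact: same_of.
pose h1 := (h * k1)%g.
have h1E i j : glm h1 i j = glm h i (tperm j0 i0 j) by exact: glm_mul_tperm.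
have piv : glm h1 i0 i0 != 0 by rewrite h1E tpermR.
have pivu := da_div piv.
have h1min j : (j <= i0)%N -> glm h1 i0 j != 0 -> vD (glm h1 i0 i0) <= vD (glm h1 i0 j).
  rewrite !h1E tpermR => ji hj; apply: j0min; rewrite /Q hj andbT.
  by case: tpermP.
pose c : 'rV[D]_r := \row_j (if (j < i0)%N then - ((glm h1 i0 i0)^-1 * glm h1 i0 j) else 0).
have c0 : c 0 i0 = 0 by rewrite mxE ltnn.
have [k20 k2M] : K 0 (colop c0) /\ MI I (colop c0).
  apply: colop_K0_MI => j; rewrite mxE.
    case: ifPn => ji; last by left.
    have [->|hj] := eqVneq (glm h1 i0 j) 0; first by left; rewrite mulr0 oppr0.
    apply: (pwN vDP); right; rewrite (valM vDP) // ?invr_eq0 // (valV vDP) //.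
    by have := h1min j (ltnW ji) hj; rewrite addrC subr_ge0.
  move=> ns; case: ifPn => // ji; rewrite (h1E i0 j).
  have [->|hj] := eqVneq (glm h i0 (tperm j0 i0 j)) 0; first by rewrite mulr0 oppr0.
  case/negP: ns; have jj : (tperm j0 i0 j <= i0)%N by case: tpermP => // *; exact: ltnW.
  have s1 := same_of _ jj hj; apply: same_trans s1 _.
  case: tpermP => [->|->|_ _]; [exact: same_of|by rewrite same_sym; exact: same_of|exact: same_refl].
have gE : (g * (k * k1 * colop c0) = h1 * colop c0)%g by rewrite /h1 /h !mulgA.
exists (k * k1 * colop c0)%g; split.
- by do 2?apply: congKM => //; exact: tperm_GL_K0.
- by do 2?apply: MIM => //.
- rewrite gE => i j; rewrite glmM colopE => ni ji.
  have [i0i|] := ltnP i0 i; last first.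
    move=> ii0; have ie : i = i0 by apply/val_inj/eqP; rewrite eqn_leq ii0.
    rewrite ie in ji *.
    by rewrite [c 0 j]mxE ji mulrN mulrA divrr // mul1r subrr.
  have ri : (r - n <= i)%N by rewrite rn.
  have t1 : glm h1 i j = 0.
    by rewrite h1E tri //; case: tpermP => // _; exact: leq_ltn_trans j0i0 i0i.
  have t2 : glm h1 i i0 = 0 by rewrite h1E tpermR tri // (leq_ltn_trans j0i0).
  by rewrite t1 t2 mul0r addr0.
- rewrite gE => i ni; rewrite glmM colopE [c 0 i]mxE.
  have [i0i|ii0] := ltnP i0 i.
    rewrite ltnNge (ltnW i0i) /= mulr0 addr0 h1E tpermD ?dg ?rn //.
      by apply: contraTneq i0i => <-; rewrite -leqNgt.
    by apply: contraTneq i0i => <-; rewrite ltnn.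
  have -> : i = i0 by apply/val_inj/eqP; rewrite eqn_leq ii0.
  by rewrite ltnn mulr0 addr0.
Qed.

Lemma da_unit_factor (x : D) : x != 0 -> exists u : D,
  [/\ u \is a GRing.unit, vD u = 0 & x * u = cp_pi P ^ vD x].
Proof.
move=> x0; have xu := da_div x0; have pu := unitrXz (vD x) (cp_pi_unit P).
exists (x^-1 * cp_pi P ^ vD x); split.
- by rewrite unitrMl // unitrV.
- have xV0 : x^-1 != 0 by rewrite invr_eq0.
  have p0 : cp_pi P ^ vD x != 0 by apply: contraTneq pu => ->; rewrite unitr0.
  rewrite (valM vDP) // (valV vDP) // (valXz vDP) ?cp_pi_unit //.
  by rewrite da_val_pi mulr1 addNr.
- by rewrite mulrA divrr // mul1r.
Qed.

(** Two-sided elimination from the bottom right corner. The pivot has least valuation among the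
    remaining rows of its block, which makes the multipliers integral and the exponents decreasing
    along a block. *)
Lemma Cartan_Levi I g : MI I g -> exists k1 k2 (a : 'I_r -> int),
  [/\ K 0 k1, K 0 k2, MI I k1, MI I k2 &
   (k1 * g * k2)%g = ppow P a /\
   forall i j, same I i j -> (i <= j)%N -> a j <= a i].
Proof.
move=> gM.
suff H n : (n <= r)%N -> exists k1 k2 (a : 'I_r -> int),
    [/\ K 0 k1, K 0 k2, MI I k1, MI I k2 &
     [/\ forall i j, (r - n <= i)%N -> j != i ->
          glm (k1 * g * k2)%g i j = 0 /\ glm (k1 * g * k2)%g j i = 0,
         forall i, (r - n <= i)%N -> glm (k1 * g * k2)%g i i = cp_pi P ^ a i,
         (* The entries still to be treated are divisible by the pivots already found in their
            block. This clause yields the monotonicity of a. *)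
         forall i j j', (r - n <= i)%N -> same I i j -> (j < r - n)%N -> (j' < r - n)%N ->
            pw vD (a i) (glm (k1 * g * k2)%g j j') &
         forall i j, (r - n <= i)%N -> same I i j -> (i <= j)%N -> a j <= a i]].
  have [k1 [k2 [a [k10 k20 k1M k2M [c1 c2 _ c4]]]]] := H r (leqnn r).
  rewrite subnn in c1 c2 c4.
  exists k1, k2, a; split=> //; split; last by move=> i j; exact: c4.
  apply: glm_inj; apply/matrixP => i j; rewrite ppow_entry; case: eqP => [->|/eqP ij].
    by rewrite c2 // mulr1n.
  by rewrite mulr0n; have [] := c1 i j (leq0n _); rewrite // eq_sym.
elim: n => [_|n IH nr].
  exists 1%g, 1%g, (fun=> 0).
  split; [exact: congK1|exact: congK1|exact/zgrp1/nsame_irr|exact/zgrp1/nsame_irr|].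
  by split=> i => [j|||j]; rewrite subn0 leqNgt ltn_ord.
have [k1 [k2 [a [k10 k20 k1M k2M [c1 c2 c3 c4]]]]] := IH (ltnW nr).
set h := (k1 * g * k2)%g in c1 c2 c3.
have hM : MI I h by do 2?apply: MIM.
have mr : (r - n.+1 < r)%N by rewrite ltn_subrL /= (leq_trans _ nr).
pose i0 := Ordinal mr.
have rn : (r - n)%N = i0.+1 by rewrite /= subnSK.
rewrite rn in c1 c2 c3 c4.
have i0lt i : (r - n.+1 <= i)%N = (i0 <= i)%N by [].
have h0 i j : nsame I i j -> glm h i j = 0 by move=> /hM[].
have hsame i j : glm h i j != 0 -> same I i j.
  by move=> hij; apply: contraNT hij => /h0 ->.
have [j1 hj1] : exists j, glm h i0 j != 0.
  apply: contrapT => no; have := glm_mulV_entry h i0 i0.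
  rewrite eqxx big1 => [/esym/eqP|k _]; first by rewrite oner_eq0.
  suff -> : glm h i0 k = 0 by rewrite mul0r.
  by apply/eqP; apply: contrapT => /negP hk; apply: no; exists k.
have nz_lt i j : (i <= i0)%N -> glm h i j != 0 -> (j <= i0)%N.
  move=> ii0 hij; rewrite leqNgt; apply/negP => ji0.
  have ij : i != j by apply: contraTneq ji0 => <-; rewrite -leqNgt.
  by case/eqP: hij; have [] := c1 j i ji0 ij.
pose Q (p : 'I_r * 'I_r) := [&& (p.1 <= i0)%N, same I i0 p.1 & glm h p.1 p.2 != 0].
have Qj1 : Q (i0, j1) by rewrite /Q /= leqnn same_refl.
have [[p q] /and3P[/= pi0 ps hpq] pqmin] := @arg_minP _ _ _ (i0, j1) Q (fun p => vD (glm h p.1 p.2)) Qj1.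
have qi0 := nz_lt _ _ pi0 hpq.
have qs : same I i0 q by apply: same_trans ps _; exact: hsame.
pose t1 := tperm_GL D p i0; pose t2 := tperm_GL D q i0.
have t1M : MI I t1 by apply: tperm_GL_MI; rewrite same_sym.
have t2M : MI I t2 by apply: tperm_GL_MI; rewrite same_sym.
pose h1 := (t1 * h * t2)%g.
have h1E i j : glm h1 i j = glm h (tperm p i0 i) (tperm q i0 j).
  by rewrite glm_mul_tperm glm_tperm_mul.
have h1M : MI I h1 by do 2?apply: MIM.
have h10 i j : nsame I i j -> glm h1 i j = 0 by move=> /h1M[].
have tpp i : (i0 < i)%N -> tperm p i0 i = i.
  move=> ii; rewrite tpermD //; apply: contraTneq ii => <-; rewrite -leqNgt //.
have tpq i : (i0 < i)%N -> tperm q i0 i = i.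
  move=> ii; rewrite tpermD //; apply: contraTneq ii => <-; rewrite -leqNgt //.
have lepp i : (i <= i0)%N -> (tperm p i0 i <= i0)%N by case: tpermP => // -> _.
have lepq i : (i <= i0)%N -> (tperm q i0 i <= i0)%N by case: tpermP => // -> _.
have samep i : same I i0 i -> same I i0 (tperm p i0 i).
  by case: tpermP => // -> _; exact: same_refl.
have piv : glm h1 i0 i0 != 0 by rewrite h1E !tpermR.
have pivu := da_div piv.
set v := vD (glm h1 i0 i0).
have h1min i j : (i <= i0)%N -> same I i0 i -> pw vD v (glm h1 i j).
  move=> ii si; have [->|hij] := eqVneq (glm h1 i j) 0; first by left.
  right; have := pqmin (tperm p i0 i, tperm q i0 j); rewrite /v !h1E !tpermR; apply.
  rewrite /Q /= lepp // samep //=; by rewrite -h1E.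
have c1' i j : (i0 < i)%N -> j != i -> glm h1 i j = 0 /\ glm h1 j i = 0.
  move=> ii ji; rewrite !h1E (tpp _ ii) (tpq _ ii).
  have ne1 : tperm q i0 j != i.
    by rewrite -(tpq _ ii) (inj_eq perm_inj).
  have ne2 : tperm p i0 j != i.
    by rewrite -(tpp _ ii) (inj_eq perm_inj).
  by split; [have [] := c1 _ _ ii ne1|have [] := c1 _ _ ii ne2].
pose cr : 'cV[D]_r := \col_i (if i == i0 then 0 else - (glm h1 i i0 * (glm h1 i0 i0)^-1)).
pose cc : 'rV[D]_r := \row_j (if j == i0 then 0 else - ((glm h1 i0 i0)^-1 * glm h1 i0 j)).
have cr0 : cr i0 0 = 0 by rewrite mxE eqxx.
have cc0 : cc 0 i0 = 0 by rewrite mxE eqxx.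
have pivV : pw vD (- v) (glm h1 i0 i0)^-1 by right; rewrite (valV vDP).
have lti i : ~~ (i <= i0)%N -> i != i0 by apply: contraNneq => ->.
have [kr0 krM] : K 0 (rowop cr0) /\ MI I (rowop cr0).
  apply: rowop_K0_MI => i; rewrite mxE.
    case: eqP => [_|/eqP ii]; first by left.
    have [si|/h10->] := boolP (same I i i0); last by left; rewrite mul0r oppr0.
    apply: (pwN vDP); rewrite -(subrr v); apply: (pwM vDP) => //.
    have [ii0|i0i] := leqP i i0; first by apply: h1min; rewrite // same_sym.
    by have [-> _] := c1' i i0 i0i (contra_neq esym ii); left.
  by move=> /h10 ->; rewrite mul0r oppr0; case: eqP.
have [kc0 kcM] : K 0 (colop cc0) /\ MI I (colop cc0).
  apply: colop_K0_MI => j; rewrite mxE.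
    case: eqP => [_|/eqP ji]; first by left.
    apply: (pwN vDP); rewrite -(addNr v); apply: (pwM vDP) => //.
    by apply: h1min; rewrite // same_refl.
  by move=> /h10 ->; rewrite mulr0 oppr0; case: eqP.
have [u [uu vu pu]] := da_unit_factor piv; rewrite -/v in pu.
pose f i : D := if i == i0 then u else 1.
have fu i : f i \is a GRing.unit by rewrite /f; case: ifP => // _; exact: unitr1.
have f0 i : vD (f i) = 0 by rewrite /f; case: ifP => // _; exact: (val1 vDP).
pose h2 := (rowop cr0 * h1 * colop cc0 * diag_GL fu)%g.
have h2E i j : glm h2 i j = (glm h1 i j + cr i 0 * glm h1 i0 j +
     (glm h1 i i0 + cr i 0 * glm h1 i0 i0) * cc 0 j) * f j.
  by rewrite glm_mul_diag glmM colopE glmM !rowopE.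
have col0 i : i != i0 -> glm h1 i i0 + cr i 0 * glm h1 i0 i0 = 0.
  by move=> ii; rewrite [cr i 0]mxE (negPf ii) mulNr divrK // subrr.
have h2i0 j : j != i0 -> glm h2 i0 j = 0.
  move=> ji; rewrite h2E cr0 !mul0r !addr0 [cc 0 j]mxE (negPf ji).
  by rewrite mulrN mulrA divrr // mul1r subrr mul0r.
have h2j0 i : i != i0 -> glm h2 i i0 = 0.
  by move=> ii; rewrite h2E col0 // mul0r add0r mul0r.
have h2ij i j : i != i0 -> j != i0 -> glm h2 i j = glm h1 i j + cr i 0 * glm h1 i0 j.
  by move=> ii ji; rewrite h2E col0 // mul0r addr0 /f (negPf ji) mulr1.
have crbig i : (i0 < i)%N -> cr i 0 = 0.
  move=> ii; have ni : i != i0 by apply: contraTneq ii => ->; rewrite ltnn.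
  by rewrite mxE (negPf ni); have [-> _] := c1' i i0 ii (contra_neq esym ni); rewrite mul0r oppr0.
have gE : (rowop cr0 * t1 * k1 * g * (k2 * t2 * colop cc0 * diag_GL fu) = h2)%g.
  by rewrite /h2 /h1 /h !mulgA.
exists (rowop cr0 * t1 * k1)%g, (k2 * t2 * colop cc0 * diag_GL fu)%g.
exists (fun i => if i == i0 then v else a i).
split; [by do 2?apply: congKM => //; exact: tperm_GL_K0| |by do 2?apply: MIM| |].
- do 3?apply: congKM => //; first exact: tperm_GL_K0.
  by apply: diag_GL_K0.
- by do 3?apply: MIM => //; exact: diag_GL_MI.
rewrite gE; split.
- move=> i j; rewrite i0lt leq_eqVlt => /orP[/eqP/val_inj <-|ii] ji.
    by rewrite h2i0 // h2j0.
  have ni : i != i0 by apply: contraTneq ii => ->; rewrite ltnn.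
  have [e1 e2] := c1' i j ii ji; have [->|ji0] := eqVneq j i0.
    by rewrite h2i0 ?h2j0.
  have [_ e3] := c1' i i0 ii (contra_neq esym ni).
  by rewrite !h2ij // e1 e2 e3 crbig // mul0r mulr0 !addr0.
- move=> i; rewrite i0lt leq_eqVlt => /orP[/eqP/val_inj <-|ii].
    by rewrite eqxx h2E cr0 cc0 !mul0r mulr0 !addr0 /f eqxx pu.
  have ni : i != i0 by apply: contraTneq ii => ->; rewrite ltnn.
  have [_ e3] := c1' i i0 ii (contra_neq esym ni).
  by rewrite (negPf ni) h2ij // e3 mulr0 addr0 h1E tpp // tpq // c2.
- move=> i j j'; rewrite !i0lt => ii sij ji j'i.
  have nj : j != i0 by apply: contraTneq ji => ->; rewrite ltnn.
  have nj' : j' != i0 by apply: contraTneq j'i => ->; rewrite ltnn.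
  rewrite h2ij //; case: eqP => [ie|/eqP ni].
    rewrite ie in sij; apply: (pwD vDP); first by apply: h1min; rewrite // ltnW.
    have crO : pw vD 0 (cr j 0).
      rewrite mxE (negPf nj); apply: (pwN vDP); rewrite -(subrr v); apply: (pwM vDP) => //.
      by apply: h1min; rewrite // ltnW.
    by apply: (pwMl vDP) => //; apply: h1min; rewrite ?leqnn ?same_refl.
  have ii0 : (i0 < i)%N by rewrite ltn_neqAle ii andbT; apply: contra_neq ni => /val_inj.
  have apw (x y : 'I_r) : same I i x -> (x <= i0)%N -> (y <= i0)%N -> pw vD (a i) (glm h1 x y).
    move=> sx xi yi; rewrite h1E; apply: c3 => //; rewrite ?ltnS ?lepp ?lepq //.
    case: (tpermP p i0 x) => [xe|xe|_ _] //; rewrite xe in sx; last exact: same_trans sx ps.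
    by apply: same_trans sx _; rewrite same_sym.
  apply: (pwD vDP); first by apply: apw; rewrite // ltnW.
  have [s0|ns0] := boolP (same I j i0); last first.
    by left; rewrite [cr j 0]mxE (negPf nj) (h10 _ _ ns0) mul0r oppr0 mul0r.
  have crO : pw vD 0 (cr j 0).
    rewrite mxE (negPf nj); apply: (pwN vDP); rewrite -(subrr v); apply: (pwM vDP) => //.
    by apply: h1min; rewrite 1?same_sym // ltnW.
  by apply: (pwMl vDP) => //; apply: apw; rewrite ?leqnn // 1?ltnW //; exact: same_trans sij s0.
- move=> i j; rewrite i0lt => ii sij ij.
  case: (eqVneq j i0) => [je|nj].
    have -> : i = i0 by apply/val_inj/eqP; rewrite eqn_leq ii -je ij.
    by rewrite eqxx.
  have jj : (i0 < j)%N.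
    by rewrite ltn_neqAle (leq_trans ii ij) andbT; apply: contra_neq nj => /val_inj.
  case: eqP => [ie|/eqP ni].
    rewrite ie in sij; have : pw vD (a j) (glm h1 i0 i0).
      rewrite h1E !tpermR; apply: c3 => //; rewrite ?ltnS //.
      by rewrite same_sym in sij; exact: same_trans sij ps.
    by rewrite pwP.
  by apply: c4 => //; rewrite ltn_neqAle ii andbT; apply: contra_neq ni => /val_inj.
Qed.

End Decompositions.

Section CartanCorollaries.
Variables (F : localField) (d : nat) (D : divAlg F d) (r : nat) (P : cyclicPres D).
Local Notation G := (GL D r).
Local Notation K := (congK D r).
Implicit Types (g h : G) (i j t : 'I_r) (I J : {set 'I_r}).

Lemma Cartan_parabolic I g : PI I g -> exists k1 k2 n (a : 'I_r -> int),
  [/\ K 0 k1, K 0 k2, MI I k1, MI I k2 &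
   [/\ NI I n, g = (k1 * ppow P a * k2 * n)%g &
   forall i j, same I i j -> (i <= j)%N -> a j <= a i]].
Proof.
move=> /Levi_decomposition[m mM [_ _ nN]].
have [k1 [k2 [a [k10 k20 k1M k2M [mE amon]]]]] := Cartan_Levi P mM.
exists k1^-1%g, k2^-1%g, (m^-1 * g)%g, a.
split; [exact: congKV|exact: congKV|exact: zgrpV|exact: zgrpV|split=> //].
by rewrite -mE !mulgA mulVg mul1g mulgK mulgV mul1g.
Qed.

Lemma perm_GL_subproof (s : {perm 'I_r}) :
  perm_mx s *m perm_mx s^-1%g = 1%:M :> 'M[D]_r /\ perm_mx s^-1%g *m perm_mx s = 1%:M :> 'M[D]_r.
Proof. by rewrite -!perm_mxM mulgV mulVg perm_mx1. Qed.

Definition perm_GL (s : {perm 'I_r}) : G := mkGL (perm_GL_subproof s).1 (perm_GL_subproof s).2.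

Lemma perm_GL_K0 s : K 0 (perm_GL s).
Proof.
have h s' : mxpw 0 (perm_mx s' : 'M[D]_r).
  by move=> i j; rewrite !mxE; case: eqP => _; [exact: (pw1 (@da_valP F d D))|left].
by apply/congK0P; split; exact: h.
Qed.

(** With I empty, the Levi factor is the whole group. The permutation reversing the order turns
    decreasing exponents into the increasing ones used to index the basis of the Hecke algebra. *)
Lemma Cartan g : exists k1 k2 (a : 'I_r -> int), [/\ K 0 k1, K 0 k2,
  forall i j, (i <= j)%N -> a i <= a j & g = (k1 * ppow P a * k2^-1)%g].
Proof.
have gM : MI finset.set0 g.
  have s0 i j : sep finset.set0 i j = false by apply/sepP => -[t]; rewrite inE.
  by move=> i j; rewrite /nsame /same !s0.
have [k1 [k2 [a [k10 k20 _ _ [gE amon]]]]] := Cartan_Levi P gM.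
pose s := perm (@rev_ord_inj r).
have sE i : s i = rev_ord i by rewrite permE.
have sV : s^-1%g = s.
  by apply/permP => i; apply: (canLR (permK s)); rewrite !sE rev_ordK.
exists (k1^-1 * perm_GL s)%g, (k2 * perm_GL s)%g, (fun i => a (s i)); split.
- by apply: congKM; [exact: congKV|exact: perm_GL_K0].
- by apply: congKM => //; exact: perm_GL_K0.
- move=> i j ij; apply: amon.
    by apply/andP; split; apply/sepP => -[t]; rewrite inE.
  by rewrite !sE /= leq_sub2l.
have pE : ppow P a = (perm_GL s * ppow P (fun i => a (s i)) * (perm_GL s)^-1)%g.
  apply: glm_inj; rewrite !glmM.
  have -> : glm (perm_GL s)^-1%g = perm_mx s^-1%g by [].
  rewrite -col_permE [glm (perm_GL s)]/(perm_mx s) -row_permE.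
  apply/matrixP => i j; rewrite ppow_entry !mxE.
  by rewrite (inj_eq (@perm_inj _ s)) !sE rev_ordK.
rewrite invMg !mulgA.
have -> : g = (k1^-1 * ppow P a * k2^-1)%g by rewrite -gE !mulgA mulVg mul1g mulgK.
by rewrite {1}pE !mulgA.
Qed.

(** In the Cartan decomposition the two outer factors may be replaced by members of finite lists at
    suitable levels, which leaves countably many products. *)
Lemma congK_dense_sequence : exists e : nat -> G, forall g N, exists n, K N ((e n)^-1 * g)%g.
Proof.
have /choice[rep repP] N := congK0_finite r P N.
pose e n : G := match (unpickle n : option ((nat * nat) * (nat * nat) * {ffun 'I_r -> int})) with
  | Some p => (nth 1 (rep p.1.1.1) p.1.1.2 * ppow P p.2 * nth 1 (rep p.1.2.1) p.1.2.2)%g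
  | None => 1%g end.
exists e => g N; have [k1 [k2 [a [k10 k20 _ gE]]]] := Cartan g.
pose h := (ppow P a * k2^-1)%g.
have [N' N'P] := congK_conj h N.
have [_ /(_ _ k10)[x1 x1s x1P]] := repP N'.
have [_ /(_ _ (congKV k20))[x2 x2s x2P]] := repP N.
exists (pickle ((N', index x1 (rep N')), (N, index x2 (rep N)), [ffun i => a i])).
rewrite /e pickleK /= !nth_index //.
have -> : ppow P [ffun i => a i] = ppow P a.
  by apply: glm_inj; apply/matrixP => i j; rewrite !ppow_entry ffunE.
have -> : ((x1 * ppow P a * x2)^-1 * g = (x2^-1 * k2^-1) * (h^-1 * (x1^-1 * k1) * h))%g.
  by rewrite gE /h !invMg invgK !mulgA mulgVK.
exact/congKM/N'P.
Qed.

End CartanCorollaries.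

(** * Irreducible representations are admissible *)

Section LinearAlgebra.
Variable C : fieldType.

Section Span.
Variable V : lmodType C.
Implicit Types (S W M : set V) (s : seq V).

Definition lspan S : set V := [set v | exists t : seq (C * V),
  (forall p, p \in t -> S p.2) /\ v = \sum_(p <- t) p.1 *: p.2].

Lemma lspan_subspace S : subspace (lspan S).
Proof.
split; first by exists [::]; rewrite big_nil.
move=> a u v [t [tS ->]] [t' [t'S ->]].
exists ([seq (a * p.1, p.2) | p <- t] ++ t'); split=> [p|].
  by rewrite mem_cat => /orP[/mapP[q qt ->]|/t'S//]; exact: (tS q qt).
rewrite big_cat big_map /= scaler_sumr; congr (_ + _).
by apply: eq_bigr => p _; rewrite scalerA.
Qed.

Lemma lspan_sub S : S `<=` lspan S.
Proof.
move=> v Sv; exists [:: (1, v)]; split; first by move=> p; rewrite inE => /eqP ->.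
by rewrite big_seq1 scale1r.
Qed.

Lemma lspan_min S W : subspace W -> S `<=` W -> lspan S `<=` W.
Proof.
move=> sW SW _ [t [tS ->]]; apply: (subspace_sum sW) => p pt.
by apply: (subspaceZ sW); apply/SW/tS.
Qed.

Lemma lspan_mono S S' : S `<=` S' -> lspan S `<=` lspan S'.
Proof. by move=> SS'; apply: lspan_min (lspan_subspace _) _ => v /SS'; exact: lspan_sub. Qed.

Lemma lspan_cons a s v : lspan [set` a :: s] v ->
  exists c u, lspan [set` s] u /\ v = c *: a + u.
Proof.
suff sub : lspan [set` a :: s] `<=` [set v | exists c u, lspan [set` s] u /\ v = c *: a + u].
  exact: sub.
have [l0 lP] := lspan_subspace [set` s].
apply: lspan_min.
  split; first by exists 0, 0; rewrite scale0r addr0.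
  move=> b _ _ [c [u [us ->]]] [c' [u' [us' ->]]]; exists (b * c + c'), (b *: u + u').
  by split; [exact: lP|rewrite scalerDr scalerA addrACA -scalerDl].
move=> x /=; rewrite inE => /orP[/eqP->|xs]; first by exists 1, 0; rewrite scale1r addr0.
by exists 0, x; rewrite scale0r add0r; split=> //; exact: lspan_sub.
Qed.

Lemma lspan_nil v : lspan [set` [::]] v -> v = 0.
Proof.
case=> -[|p t] [tS ->]; first by rewrite big_nil.
by have := tS p (mem_head _ _).
Qed.

Definition fgmod W M := exists s, forall v, M v -> exists2 u, lspan [set` s] u & W (v - u).

Lemma fgmod_sub W M M' : M `<=` M' -> fgmod W M' -> fgmod W M.
Proof. by move=> MM' [s sP]; exists s => v /MM' /sP. Qed.

Lemma fgmod_seq W M s : subspace W -> (forall v, M v -> lspan ([set` s] `|` W) v) -> fgmod W M.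
Proof.
move=> sW sP; exists s => v /sP; have [l0 lP] := lspan_subspace [set` s].
apply: (@lspan_min _ [set v | exists2 u, lspan [set` s] u & W (v - u)]).
  split; first by exists 0 => //; rewrite subrr; exact: sW.1.
  move=> a u v' [x xs ux] [y ys vy]; exists (a *: x + y); first exact: lP.
  have -> : a *: u + v' - (a *: x + y) = a *: (u - x) + (v' - y).
    by rewrite scalerBr opprD addrACA.
  exact: sW.2.
move=> x [xs|Wx]; first by exists x; [exact: lspan_sub|rewrite subrr; exact: sW.1].
by exists 0 => //; rewrite subr0.
Qed.

End Span.

(** Moves the spanning vectors into M. By induction on s: if some v1 in M has a nonzero coordinate
    at the head a, subtracting multiples of v1 leaves vectors whose images need only the tail. *)
Lemma fgmod_chain (V V' : lmodType C) (f : {linear V -> V'}) (W' : set V') (M : set V)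
    (s : seq V') : subspace W' -> subspace M ->
  (forall v, M v -> exists2 u, lspan [set` s] u & W' (f v - u)) ->
  exists s' : seq V, (forall x, x \in s' -> M x) /\
    forall v, M v -> exists2 u, lspan [set` s'] u & W' (f (v - u)).
Proof.
move=> sW'; elim: s M => [|a s IH] M sM Ms.
  exists [::]; split=> // v /Ms[u /lspan_nil -> Wv]; exists 0; first exact: (lspan_subspace _).1.
  by move: Wv; rewrite !subr0.
have [l0 lP] := lspan_subspace [set` s].
pose M0 := [set v | M v /\ exists2 u, lspan [set` s] u & W' (f v - u)].
have sM0 : subspace M0.
  split.
    split; first exact: sM.1.
    by exists 0 => //; rewrite linear0 subrr; exact: sW'.1.
  move=> b u v [Mu [x xs ux]] [Mv [y ys vy]]; split; first exact: sM.2.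
  exists (b *: x + y); first exact: lP.
  have -> : f (b *: u + v) - (b *: x + y) = b *: (f u - x) + (f v - y).
    by rewrite linearP scalerBr opprD addrACA.
  exact: sW'.2.
have [v []//|s0 [s0M s0P]] := IH M0 sM0.
have [sub|/existsNP[v1 /not_implyP[Mv1 nv1]]] := pselect (M `<=` M0).
  by exists s0; split=> [x /s0M[]//|v /sub /s0P].
have [u1 /lspan_cons[c [w1 [w1s ->]]] fu1] := Ms _ Mv1.
have c0 : c != 0.
  apply: contra_notN nv1 => /eqP c0; split=> //; exists w1 => //.
  by move: fu1; rewrite c0 scale0r add0r.
exists (v1 :: s0); split=> [x|v Mv]; first by rewrite inE => /orP[/eqP->//|/s0M[]].
have [u2 /lspan_cons[c' [w2 [w2s ->]]] fu2] := Ms _ Mv.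
have Mw : M0 (v - (c' / c) *: v1).
  split; first by apply: (subspaceB sM) => //; exact: (subspaceZ sM).
  exists (w2 - (c' / c) *: w1).
    by apply: (subspaceB (lspan_subspace _)) => //; exact: (subspaceZ (lspan_subspace _)).
  have -> : f (v - (c' / c) *: v1) - (w2 - (c' / c) *: w1) =
     (f v - (c' *: a + w2)) - (c' / c) *: (f v1 - (c *: a + w1)).
    rewrite linearB linearZ /= !scalerBr scalerDr scalerA divfK //.
    rewrite !opprB [c' *: a + w2]addrC opprD [f v + (_ - _ *: a)]addrA -[c' *: a + _ - _]addrA subrKA.
    by rewrite addrACA [in RHS]addrACA [- w2 + _]addrC.
  by apply: (subspaceB sW') => //; exact: (subspaceZ sW').
have [u us Wu] := s0P _ Mw; exists ((c' / c) *: v1 + u); last by rewrite opprD addrA.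
have [m0 mP] := lspan_subspace [set` v1 :: s0].
apply: mP; first by apply: lspan_sub; rewrite /= mem_head.
by move: us; apply: lspan_mono => x /= xs; rewrite inE xs orbT.
Qed.

(** M modulo W is controlled by its images in finitely many copies of V'/W'. The maps are treated
    one at a time, each on the kernel of the preceding ones. *)
Lemma fgmod_joint_kernel (V V' : lmodType C) (I : Type) (fs : seq I) (f : I -> {linear V -> V'})
    (W' : set V') (W M : set V) : subspace W' -> subspace W -> subspace M ->
  (forall i, List.In i fs -> fgmod W' [set f i v | v in M]) ->
  (forall v, M v -> (forall i, List.In i fs -> W' (f i v)) -> W v) -> fgmod W M.
Proof.
move=> sW' sW; elim: fs M => [|i fs IH] M sM fg MW.
  by exists [::] => v Mv; exists 0; [exact: (lspan_subspace _).1|rewrite subr0; exact: MW].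
have [s sP] := fg i (or_introl erefl).
have [v Mv|s' [s'M s'P]] := @fgmod_chain _ _ (f i) W' M s sW' sM; first by apply: sP; exists v.
pose M1 := [set v | M v /\ W' (f i v)].
have [| |v [Mv Wv] h|s1 s1P] := IH M1.
- split; first by split; [exact: sM.1|rewrite linear0; exact: sW'.1].
  by move=> a u v [Mu Wu] [Mv Wv]; split; [exact: sM.2|rewrite linearP; exact: sW'.2].
- by move=> j jfs; apply: fgmod_sub (fg j (or_intror jfs)) => _ [v [Mv _] <-]; exists v.
- by apply: MW => // j [<-//|]; exact: h.
exists (s' ++ s1) => v Mv; have [u us Wu] := s'P _ Mv.
have Mu : M u by apply: lspan_min us => // x; exact: s'M.
have [|u1 us1 Wu1] := s1P (v - u); first by split=> //; exact: (subspaceB sM).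
exists (u + u1); last by rewrite opprD addrA.
apply: (subspaceD (lspan_subspace _)).
  by move: us; apply: lspan_mono => x /= xs; rewrite mem_cat xs.
by move: us1; apply: lspan_mono => x /= xs; rewrite mem_cat xs orbT.
Qed.

(** Zorn's lemma. A chain whose union were everything would contain all the generators in one of its
    members, and this member would be everything. *)
Lemma maximal_stable (V : lmodType C) (T : Type) (op : T -> V -> V) (S : set T)
    (U : set V) (gens : seq V) : subspace U -> (forall t v, S t -> U v -> U (op t v)) ->
  U <> setT ->
  (forall X, subspace X -> (forall t v, S t -> X v -> X (op t v)) -> U `<=` X ->
    (forall v, v \in gens -> X v) -> X = setT) ->
  exists W, [/\ subspace W, forall t v, S t -> W v -> W (op t v), U `<=` W, W <> setT &
    forall X, subspace X -> (forall t v, S t -> X v -> X (op t v)) -> W `<=` X ->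
      X = W \/ X = setT].
Proof.
move=> sU US UT gensP.
pose st X := subspace X /\ forall t v, S t -> X v -> X (op t v).
pose Pr (X : set V) := X = set0 \/ [/\ st X, U `<=` X & X <> setT].
have [F FP Ftot|A [PA Amax]] := @Zorn_bigcup V Pr.
  have [[X0 [FX0 X0n]]|allE] := pselect (exists X, F X /\ X <> set0); last first.
    left; apply/seteqP; split=> v // [X FX Xv]; have : X = set0.
      by apply: contrapT => Xn; apply: allE; exists X.
    by move=> XE; rewrite XE in Xv.
  have FPr X : F X -> X <> set0 -> [/\ st X, U `<=` X & X <> setT].
    by move=> /FP[->|].
  have [[sX0 X0S] UX0 X0T] := FPr _ FX0 X0n.
  have pick2 X Y : F X -> F Y -> X `<=` Y \/ Y `<=` X by exact: Ftot.
  right; split.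
  - split.
      split; first by exists X0 => //; exact: sX0.1.
      move=> a u v [X FX Xu] [Y FY Yv].
      have Xn : X <> set0 by move=> XE; rewrite XE in Xu.
      have Yn : Y <> set0 by move=> YE; rewrite YE in Yv.
      have [[sX _] _ _] := FPr _ FX Xn; have [[sY _] _ _] := FPr _ FY Yn.
      have [XY|YX] := pick2 X Y FX FY; [exists Y => //; apply: sY.2 => //; exact: XY|].
      by exists X => //; apply: sX.2 => //; exact: YX.
    move=> t v St [X FX Xv]; have Xn : X <> set0 by move=> XE; rewrite XE in Xv.
    by have [[_ XS] _ _] := FPr _ FX Xn; exists X => //; exact: XS.
  - by move=> v /UX0 X0v; exists X0.
  move=> UE; have [X FX Xg] : exists2 X, F X & forall v, v \in gens -> X v.
    have : forall v, v \in gens -> exists2 X, F X & X v.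
      by move=> v _; have : (\bigcup_(X in F) X) v by [rewrite UE]; case=> X; exists X.
    elim: gens {gensP} => [_|a gens IH h]; first by exists X0.
    have [X FX Xg] := IH (fun v vg => h v (@mem_behead _ (a :: gens) v vg)).
    have [Y FY Ya] := h a (mem_head _ _).
    have [XY|YX] := pick2 X Y FX FY.
      by exists Y => // v; rewrite inE => /orP[/eqP->//|/Xg /XY].
    by exists X => // v; rewrite inE => /orP[/eqP->|/Xg//]; exact: YX.
  have [XY|YX] := pick2 X X0 FX FX0.
    apply: X0T; apply: gensP => // v /Xg; exact: XY.
  have Xn : X <> set0 by move=> XE; apply: X0n; apply/seteqP; split=> v // /YX; rewrite XE.
  by have [[sX XS] UX XT] := FPr _ FX Xn; apply: XT; exact: gensP.
have Pr_U : Pr U by right; split.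
have AP : [/\ st A, U `<=` A & A <> setT].
  case: PA => // A0; exfalso; apply: (Amax U) => //; rewrite A0; split=> //.
  by move=> /(_ 0 sU.1).
have [[sA AS] UA AT] := AP; exists A; split=> // X sX XS AX.
have [->|XT] := pselect (X = setT); first by right.
left; apply: contrapT => XA; apply: (Amax X); last first.
  by right; split=> //; exact: subset_trans UA AX.
by split=> // XA'; apply: XA; apply/seteqP.
Qed.

End LinearAlgebra.

(** * Schur's lemma in countable dimension *)

Section Schur.
Variable R : realType.
Local Notation C := R[i].
Variables (V : lmodType C) (T : {linear V -> V}) (W : set V).
Hypotheses (sW : subspace W) (TW : forall v, W v -> W (T v)).
Implicit Types (p q : {poly C}) (c : C) (u v : V).

Definition peval p v : V := \sum_(k < size p) p`_k *: iter k T v.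

Lemma iterT_linear k c u v : iter k T (c *: u + v) = c *: iter k T u + iter k T v.
Proof. by elim: k => //= k ->; rewrite linearP. Qed.

Lemma pevalE (n : nat) p v : (size p <= n)%N -> peval p v = \sum_(k < n) p`_k *: iter k T v.
Proof.
move=> pn; rewrite /peval (big_ord_widen _ (fun k => p`_k *: iter k T v) pn) big_mkcond /=.
by apply: eq_bigr => k _; case: ltnP => // h; rewrite nth_default // scale0r.
Qed.

Lemma pevalP p c u v : peval p (c *: u + v) = c *: peval p u + peval p v.
Proof.
rewrite /peval scaler_sumr -big_split /=; apply: eq_bigr => k _.
by rewrite iterT_linear scalerDr !scalerA mulrC.
Qed.

Lemma peval1 v : peval 1 v = v.
Proof. by rewrite /peval size_poly1 big_ord1 coef1 scale1r. Qed.

Lemma peval_comb (I : Type) (s : seq I) (a : I -> C) (p : I -> {poly C}) v :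
  peval (\sum_(i <- s) a i *: p i) v = \sum_(i <- s) a i *: peval (p i) v.
Proof.
elim: s => [|i s IH]; first by rewrite !big_nil /peval size_poly0 big_ord0.
rewrite !big_cons -IH; set q := \sum_(i <- s) _.
pose n := maxn (size (p i)) (maxn (size q) (size (a i *: p i + q))).
rewrite (@pevalE n (_ + _)); last by rewrite !leq_max leqnn !orbT.
rewrite (@pevalE n (p i)) ?leq_max ?leqnn // (@pevalE n q); last by rewrite !leq_max leqnn !orbT.
rewrite scaler_sumr -big_split /=; apply: eq_bigr => k _.
by rewrite coefD coefZ scalerDl scalerA.
Qed.

Lemma peval_sum (I : Type) (s : seq I) (a : I -> C) (v : I -> V) p :
  peval p (\sum_(i <- s) a i *: v i) = \sum_(i <- s) a i *: peval p (v i).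
Proof.
elim: s => [|i s IH]; last by rewrite !big_cons pevalP IH.
rewrite !big_nil; have := pevalP p (-1) 0 0.
by rewrite !scaleN1r oppr0 addr0 addNr.
Qed.

Lemma pevalXsub q c v : peval (('X - c%:P) * q) v = peval q (T v - c *: v).
Proof.
have sq : (size (('X - c%:P) * q)%R <= (size q).+1)%N.
  by apply: leq_trans (size_polyMleq _ _) _; rewrite size_XsubC.
rewrite (pevalE v sq) (pevalE (T v - _) (leqnSn _)).
have iterB k : iter k T (T v - c *: v) = iter k.+1 T v - c *: iter k T v.
  by rewrite iterSr -scaleNr addrC iterT_linear addrC scaleNr.
under [RHS]eq_bigr do rewrite iterB scalerBr.
under [LHS]eq_bigr do rewrite mulrBl coefB coefCM scalerBl.
rewrite !sumrB; congr (_ - _); last by apply: eq_bigr => k _; rewrite scalerA mulrC.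
rewrite big_ord_recl big_ord_recr /= coefXM /= scale0r add0r nth_default // scale0r addr0.
by apply: eq_bigr => k _; rewrite coefXM.
Qed.

Lemma peval_stable p v : W v -> W (peval p v).
Proof.
move=> Wv; apply: (subspace_sumT sW) => k; apply: (subspaceZ sW).
by elim: (nat_of_ord k) => //= j; exact: TW.
Qed.

Lemma lspan_range (e : nat -> V) v : lspan (range e) v ->
  exists (n : nat) (c : nat -> C), forall N, (n <= N)%N -> v = \sum_(j < N) c j *: e j.
Proof.
apply: (@lspan_min _ _ _ [set v | exists (n : nat) (c : nat -> C), forall N, (n <= N)%N ->
   v = \sum_(j < N) c j *: e j]).
  split; first by exists 0%N, (fun=> 0) => N _; rewrite big1 // => j _; rewrite scale0r.
  move=> a u w [n [c cP]] [n' [c' cP']]; exists (maxn n n'), (fun j => a * c j + c' j) => N.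
  rewrite geq_max => /andP[/cP -> /cP' ->]; rewrite scaler_sumr -big_split /=.
  by apply: eq_bigr => j _; rewrite scalerDl scalerA.
move=> _ [m _ <-]; exists m.+1, (fun j => (j == m)%:R) => N mN.
rewrite (bigD1 (Ordinal mN)) //= eqxx scale1r big1 ?addr0 // => j.
by rewrite -val_eqE /= => /negPf ->; rewrite scale0r.
Qed.

(** Otherwise the real line would be a countable union of finite sets, hence of Lebesgue measure
    0. *)
Lemma uncountable_fibre (f : R -> nat) : exists n, infinite_set (f @^-1` [set n]).
Proof.
apply: contrapT => /forallNP fin.
have cT : countable [set: R].
  have -> : [set: R] = \bigcup_(n in [set: nat]) (f @^-1` [set n]).
    by apply/seteqP; split=> x // _; exists (f x).
  apply: bigcup_countable => // n _; apply: finite_set_countable.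
  by apply: contrapT => h; exact: (fin n h).
have := countable_lebesgue_measure0 cT.
by rewrite -set_itvNyy lebesgue_measure_itv /=.
Qed.

(* For v0 outside W, the vectors (T - t)^-1 v0, t in R, are dependent modulo W;
   clearing denominators gives a polynomial in T killing v0. *)
Lemma countable_spectrum (e : nat -> V) (v0 : V) :
  (forall v, exists2 u, lspan (range e) u & W (v - u)) -> ~ W v0 ->
  (forall c v, W (T v - c *: v) -> W v) ->
  (forall c v, exists u, W (T u - c *: u - v)) -> False.
Proof.
move=> eP v0W Tinj Tsurj.
have /choice[u uP] : forall t : R, exists u, W (T u - t%:C%C *: u - v0).
  by move=> t; exact: Tsurj.
have /choice[nf nfP] (t : R) : exists n : nat, exists c : 'rV[C]_n,
    W (u t - \sum_(j < n) c 0 j *: e j).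
  have [w /lspan_range[n [c cP]] Ww] := eP (u t).
  exists n, (\row_j c j); rewrite (cP n) // in Ww.
  by under eq_bigr do rewrite mxE.
(* Infinitely many t share a number n of vectors [e j] that suffice for [u t]; n + 1 of these t give
   a linear relation modulo W. *)
have [n ninf] := uncountable_fibre nf.
have [B BA Bn] := infinite_set_fset n.+1 ninf.
pose t (i : 'I_n.+1) : R := nth 0 (finmap.enum_fset B) i.
have tI : injective t.
  move=> i j /eqP; rewrite nth_uniq ?finmap.fset_uniq //; try exact: leq_trans (ltn_ord _) Bn.
  by move=> /eqP /val_inj.
have /choice[c cP] (i : 'I_n.+1) : exists c : 'rV[C]_n, W (u (t i) - \sum_(j < n) c 0 j *: e j).
  have nE : nf (t i) = n by exact: BA (mem_nth 0 (leq_trans (ltn_ord i) Bn)).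
   rewrite -nE; exact: nfP.
pose M := \matrix_(i < n.+1) c i.
have [b /sub_kermxP bM b0] : exists2 b : 'rV_n.+1, (b <= kermx M)%MS & b != 0.
  apply/rowV0Pn; rewrite -mxrank_eq0 mxrank_ker subn_eq0 -ltnNge ltnS; exact: rank_leq_col.
have Wb : W (\sum_i b 0 i *: u (t i)).
  have -> : \sum_i b 0 i *: u (t i) = \sum_i b 0 i *: (u (t i) - \sum_(j < n) c i 0 j *: e j).
    under [RHS]eq_bigr do rewrite scalerBr scaler_sumr.
    rewrite sumrB exchange_big /= [X in _ - X]big1 ?subr0 // => j _.
    under eq_bigr do rewrite scalerA; rewrite -scaler_suml.
    have /rowP/(_ j) := bM; rewrite !mxE => h; rewrite [X in X *: _](_ : _ = 0) ?scale0r //.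
    by rewrite -[RHS]h; apply: eq_bigr => i _; rewrite mxE.
  by apply: (subspace_sumT sW) => i; apply: (subspaceZ sW); exact: cP.
pose tc i : C := (t i)%:C%C.
pose p i : {poly C} := \prod_(j | j != i) ('X - (tc j)%:P).
pose q : {poly C} := \prod_j ('X - (tc j)%:P).
have qE i : q = ('X - (tc i)%:P) * p i by rewrite /q (bigD1 i).
(* Multiplying the relation b by q clears all denominators. The result f is nonzero, since at [tc i]
   every term but the i-th vanishes. *)
pose f := \sum_i b 0 i *: p i.
have f0 : f != 0.
  have [i bi] : exists i, b 0 i != 0.
    by apply: contrapT => /forallNP h; case/eqP: b0; apply/rowP => i; rewrite mxE;
       have /negP := h i; rewrite negbK => /eqP.
  apply: contraNneq bi => f0; have := congr1 (fun g => g.[tc i]) f0.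
  rewrite hornerC /f horner_sum (bigD1 i) //= big1 ?addr0 => [|j ji].
    rewrite hornerZ => /eqP; rewrite mulf_eq0 => /orP[//|].
    rewrite horner_prod prodf_seq_eq0 => /hasP[j _ /andP[ji]].
    rewrite hornerXsubC subr_eq0 => /eqP tij; case/eqP: ji; apply: tI.
    by move: tij => [].
  by rewrite hornerZ horner_prod (bigD1 i) 1?eq_sym //= hornerXsubC subrr mul0r mulr0.
have Wf : W (peval f v0).
  rewrite /f peval_comb.
  have -> : \sum_i b 0 i *: peval (p i) v0 =
     peval q (\sum_i b 0 i *: u (t i)) -
     \sum_i b 0 i *: peval (p i) (T (u (t i)) - tc i *: u (t i) - v0).
    rewrite peval_sum -sumrB; apply: eq_bigr => i _.
    rewrite (qE i) pevalXsub -scalerBr; congr (_ *: _).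
    set x := T _ - _; rewrite -[X in peval _ X - _](subrK v0) -[X in X + v0]scale1r pevalP scale1r.
    by rewrite addrAC subrr add0r.
  apply: (subspaceB sW); first exact: peval_stable.
  by apply: (subspace_sumT sW) => i; apply: (subspaceZ sW); apply: peval_stable; exact: uP.
have [s fE] := closed_field_poly_normal f.
apply: v0W; have lf0 : lead_coef f != 0 by rewrite lead_coef_eq0.
have {Wf} : W (peval (\prod_(z <- s) ('X - z%:P)) v0).
  have := subspaceZ sW (lead_coef f)^-1 Wf; rewrite {2}fE.
  have := peval_comb [:: tt] (fun=> lead_coef f) (fun=> \prod_(z <- s) ('X - z%:P)) v0.
  by rewrite !big_seq1 => ->; rewrite scalerA mulVf // scale1r.
(* Each linear factor T - z is injective modulo W, so the factors are removed one by one. *)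
elim: s v0 {fE uP p q qE f f0 lf0 Wb} => [|z s IH] v0; first by rewrite big_nil peval1.
by rewrite big_cons pevalXsub => /IH; exact: Tinj.
Qed.

End Schur.

(** * Irreducible quotients under a parabolic subgroup *)

Section StableSubspaces.
Variables (R : realType) (F : localField) (d : nat) (D : divAlg F d) (r : nat).
Variables (P : cyclicPres D) (pi : smoothRep R D r).
Hypothesis irr : irreducible pi.
Local Notation G := (GL D r).
Local Notation K := (congK D r).
Local Notation act := (rep_act pi).
Implicit Types (g h k x y : G) (I J : {set 'I_r}) (u v w : pi) (W X : set pi).

Lemma subspace_preim (C : fieldType) (V V' : lmodType C) (f : {linear V -> V'}) (X : set V') :
  subspace X -> subspace [set v | X (f v)].
Proof.
move=> sX; split; first by rewrite /= linear0; exact: sX.1.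
by move=> a u v /= Xu Xv; rewrite linearP; exact: sX.2.
Qed.

(** This says that V/W is an irreducible representation of [PI I]. *)
Definition maximalP I W := [/\ subspace W, forall g v, PI I g -> W v -> W (act g v),
  W <> setT & forall X, subspace X -> (forall g v, PI I g -> X v -> X (act g v)) ->
    W `<=` X -> X = W \/ X = setT].

Definition trivialN I W := forall n v, NI I n -> W (act n v - v).

Definition fixedmod I W l := [set v | forall k, K l k -> PI I k -> W (act k v - v)].

Lemma PI1 I : PI I (1%g : G).
Proof. exact/zgrp1/sep_irr. Qed.

Lemma maximal_generate I W v0 : maximalP I W -> ~ W v0 -> forall v,
  exists t : seq (R[i] * G), (forall p, p \in t -> PI I p.2) /\
    W (v - \sum_(p <- t) p.1 *: act p.2 v0).
Proof.
move=> [sW SW _ Wmax] v0W.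
pose X := [set v | exists t : seq (R[i] * G), (forall p, p \in t -> PI I p.2) /\
    W (v - \sum_(p <- t) p.1 *: act p.2 v0)].
have WX : W `<=` X by move=> v Wv; exists [::]; rewrite big_nil subr0.
suff : X = setT by move=> XT v; have : X v by rewrite XT.
have [| |//|XW|//] := Wmax X.
- split; first exact/WX/sW.1.
  move=> a u v [t [tP Wt]] [t' [t'P Wt']].
  exists ([seq (a * p.1, p.2) | p <- t] ++ t'); split=> [p|].
    by rewrite mem_cat => /orP[/mapP[q qt ->]|/t'P//]; exact: (tP q qt).
  rewrite big_cat big_map /= opprD addrACA; apply: (subspaceD sW) => //.
  under eq_bigr do rewrite -scalerA.
  by rewrite -scaler_sumr -scalerBr; exact: subspaceZ.
- move=> g v gP [t [tP Wt]]; exists [seq (p.1, (g * p.2)%g) | p <- t]; split=> [p|].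
    by move=> /mapP[q qt ->]; apply: PIM => //; exact: tP.
  rewrite big_map /=; have := SW g _ gP Wt; rewrite linearB linear_sum /=.
  by congr (W (_ - _)); apply: eq_bigr => p _; rewrite rep_actM linearZZ.
exfalso; apply: v0W; rewrite -XW; exists [:: (1, 1%g)]; split=> [p|].
  by rewrite inE => /eqP ->; exact: PI1.
by rewrite big_seq1 rep_act1 scale1r subrr; exact: sW.1.
Qed.

Lemma countable_generate : exists e : nat -> pi, forall v, lspan (range e) v.
Proof.
have [[v0 v00] /(_ (lspan [set act g v0 | g in setT]))] := irr.
have [l0 lP] := lspan_subspace [set act g v0 | g in setT].
case=> //.
- move=> g; apply: lspan_min; first exact/subspace_preim/lspan_subspace.
  by move=> _ [h _ <-] /=; rewrite -rep_actM; apply: lspan_sub; exists (g * h)%g.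
- move=> l0E; have : lspan [set act g v0 | g in setT] v0.
    by apply: lspan_sub; exists 1%g => //; rewrite rep_act1.
  by rewrite l0E /= => v0E; rewrite v0E eqxx in v00.
have [N v0N] := rep_smoothP v0; have [e eP] := congK_dense_sequence r P.
move=> lT; exists (fun n => act (e n) v0) => v; have : setT v by []; rewrite -lT.
apply: lspan_mono => _ [g _ <-]; have [n en] := eP g N; exists n => //=.
by rewrite -[in LHS](v0N _ en) -rep_actM mulKVg.
Qed.

(** The kernel and the image of z - c modulo W are stable, so if z is not a scalar then every z - c
    is bijective modulo W, which [countable_spectrum] excludes. *)
Lemma maximal_scalar I W z : maximalP I W -> PI I z ->
  (forall g v, PI I g -> W (act z (act g v) - act g (act z v))) ->
  exists c, forall v, W (act z v - c *: v).
Proof.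
move=> [sW SW WT Wmax] zP zc.
have [v0 v0W] : exists v0, ~ W v0.
  by apply: contrapT => /forallNP h; apply: WT; apply/seteqP; split=> v // _; apply: contrapT.
have [e eP] := countable_generate.
apply: contrapT => /forallNP nc.
have commg c g v : PI I g ->
    W (act g (act z v - c *: v) - (act z (act g v) - c *: act g v)).
  move=> gP; rewrite linearB linearZZ opprB subrKA.
  by apply: (subspaceBC sW); exact: zc.
apply: (@countable_spectrum _ _ (act z) W sW _ e v0) => //.
- by move=> v; exact: SW.
- by move=> v; exists v => //; rewrite subrr; exact: sW.1.
- move=> c v; have [| | |XW|XT] := Wmax [set v | W (act z v - c *: v)].
  + split; first by rewrite /= linear0 scaler0 subrr; exact: sW.1.
    move=> a u w /= Wu Ww; rewrite linearP scalerDr opprD addrACA.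
    by rewrite scalerA mulrC -scalerA -scalerBr; exact: sW.2.
  + move=> g u gP /= Wu; apply: (subspace_cong sW); first exact: (subspaceBC sW (commg c g u gP)).
    exact: SW.
  + by move=> u Wu /=; apply: (subspaceB sW); [exact: SW|exact: subspaceZ].
  + by move=> Wv; rewrite -XW.
  by exfalso; apply: (nc c) => u; have : setT u by []; rewrite -XT.
move=> c v; have [| | |XW|XT] := Wmax [set v | exists u, W (act z u - c *: u - v)].
- split; first by exists 0; rewrite linear0 scaler0 !subr0; exact: sW.1.
  move=> a u w [u' Wu] [w' Ww]; exists (a *: u' + w').
  have -> : act z (a *: u' + w') - c *: (a *: u' + w') - (a *: u + w) =
     a *: (act z u' - c *: u' - u) + (act z w' - c *: w' - w).
    rewrite linearP !scalerDr !scalerN opprD addrACA opprD addrACA !scalerA.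
    by rewrite [a * c]mulrC [X in X + _ = _]addrACA [LHS]addrACA.
  exact: sW.2.
- move=> g u gP [u' Wu]; exists (act g u').
  apply: (subspaceBD sW); last first.
    by have := SW g _ gP Wu; rewrite linearB; exact.
  by apply: (subspaceBC sW); exact: commg.
- by move=> u Wu; exists 0; rewrite linear0 scaler0 subrr sub0r; exact: subspaceN.
- exfalso; apply: (nc c) => u; have : [set v | exists u, W (act z u - c *: u - v)] (act z u - c *: u).
    by exists u; rewrite subrr; exact: sW.1.
  by rewrite XW.
by have : setT v by []; rewrite -XT.
Qed.

Lemma unif_power_central (s : int) (x : D) : cp_pi P ^ (d%:Z * s) * x = x * cp_pi P ^ (d%:Z * s).
Proof.
have u0 : (cp_unif P)%:A != 0 :> D by rewrite scaler_eq0 oner_eq0 orbF; have [->] := cp_unifP P.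
have -> : cp_pi P ^ (d%:Z * s) = (cp_unif P)%:A ^ s :> D by rewrite -exprz_exp -exprnP cp_pi_pow.
have c n (y : D) : (cp_unif P)%:A ^+ n * y = y * (cp_unif P)%:A ^+ n.
  by rewrite exprZn expr1n mulr_algl mulr_algr.
case: s => n; first by rewrite -!exprnP c.
rewrite NegzE -exprnN; apply: (mulrI (unitrX n.+1 (da_div u0))).
by rewrite mulrA divrr ?unitrX ?da_div // mul1r mulrA c mulrK ?unitrX ?da_div.
Qed.

(** The diagonal matrix of the powers of pi_F with exponents s i, as pi_D^d = pi_F; it is central in
    [MI I] when s is constant on blocks. *)
Definition center_GL (s : 'I_r -> int) : G := ppow P (fun i => d%:Z * s i).

Lemma center_GL_comm (s : 'I_r -> int) g :
  (forall i j, s i != s j -> glm g i j = 0) -> (center_GL s * g = g * center_GL s)%g.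
Proof.
move=> gs; apply: glm_inj; rewrite !glmM ppowE; apply/matrixP => i j.
rewrite mul_diag_mx mul_mx_diag [LHS]mxE [RHS]mxE [X in X * _ = _]mxE [X in _ = _ * X]mxE.
have [sij|/gs ->] := eqVneq (s i) (s j); last by rewrite mulr0 mul0r.
by rewrite sij unif_power_central.
Qed.

Lemma ppow_MI I a : MI I (ppow P a).
Proof. exact: diag_GL_MI. Qed.

(** The element commutes with [MI I] and normalizes [NI I], which acts trivially on V/W. So it
    commutes with all of [PI I] modulo W. *)
Lemma center_scalar I W (s : 'I_r -> int) : maximalP I W -> trivialN I W ->
  (forall i j, same I i j -> s i = s j) ->
  exists c, forall v, W (act (center_GL s) v - c *: v).
Proof.
move=> Wmax Wn sI; have zP : PI I (center_GL s) by exact/MI_PI/ppow_MI.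
apply: (maximal_scalar Wmax) => // g v gP; have [sW SW _ _] := Wmax.
have [m mM [_ _ nN]] := Levi_decomposition gP.
have mc : (center_GL s * m = m * center_GL s)%g.
  apply: center_GL_comm => i j sij; have [] // := mM i j.
  by apply: contra sij => h; rewrite (sI _ _ h).
rewrite -(mulKVg m g); move: (m^-1 * g)%g nN => n nN.
rewrite -!rep_actM !mulgA mc.
have nz := NI_conj zP nN; set z := center_GL s in zP mc nz *.
have -> : (m * z * n = m * (z * n * z^-1) * z)%g by rewrite !mulgA mulgVK.
rewrite (rep_actM (m * _) z) (rep_actM m (z * n * z^-1)) (rep_actM (m * n) z) (rep_actM m n).
rewrite -linearB; apply: SW; first exact: MI_PI.
by apply: (subspaceBD sW (v := act z v)); [exact: Wn|apply: (subspaceBC sW); exact: Wn].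
Qed.

End StableSubspaces.

(** * Finiteness of fixed vectors by descent along parabolic subgroups *)

Section Admissibility.
Variables (R : realType) (F : localField) (d : nat) (D : divAlg F d) (r : nat).
Variables (P : cyclicPres D) (pi : smoothRep R D r).
Hypothesis irr : irreducible pi.
Local Notation G := (GL D r).
Local Notation K := (congK D r).
Local Notation act := (rep_act pi).
Implicit Types (g h k x y : G) (I J : {set 'I_r}) (t i j : 'I_r) (u v w : pi) (W X : set pi).

Definition KP I l := [set k : G | K l k /\ PI I k].

Lemma KP_subgroup I l : is_subgroup (KP I l).
Proof.
split; first by split; [exact: congK1|exact: PI1].
- by move=> x y [xK xP] [yK yP]; split; [exact: congKM|exact: PIM].
- by move=> x [xK xP]; split; [exact: congKV|exact: PIV].
by move=> x [xK _]; exact: congK_le xK.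
Qed.

Lemma proper_point W : W <> setT -> exists v, ~ W v.
Proof.
by move=> WT; apply: contrapT => /forallNP h; apply: WT; apply/seteqP; split=> v // _; apply: contrapT.
Qed.

Lemma fixedmod_subspace I W l : subspace W -> subspace (fixedmod I W l).
Proof.
move=> sW; split=> [k _ _|a u v uf vf k kl kP]; first by rewrite linear0 subrr; exact: sW.1.
by rewrite linearP opprD addrACA -scalerBr; apply: sW.2; [exact: uf|exact: vf].
Qed.

Lemma fixedmod_stable I W l k v : subspace W -> (forall g u, PI I g -> W u -> W (act g u)) ->
  K 0 k -> PI I k -> fixedmod I W l v -> fixedmod I W l (act k v).
Proof.
move=> sW SW k0 kP vf h hl hP; rewrite -(actVK k (act h _)) -linearB -!rep_actM; apply: SW => //.
apply: vf; [exact: congK_norm|by apply: PIM => //; apply: PIM => //; exact: PIV].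
Qed.

(* Here the coinvariants of NI (t |: I) do not vanish modulo W. *)
Lemma admissible_descent I t W l : maximalP I W -> trivialN I W ->
  lspan (W `|` [set u | exists n v, NI (t |: I) n /\ u = act n v - v]) <> setT ->
  (forall W', maximalP (t |: I) W' -> trivialN (t |: I) W' ->
     fgmod W' (fixedmod (t |: I) W' l)) ->
  fgmod W (fixedmod I W l).
Proof.
set J := t |: I; set U := lspan _ => Wmax Wn UT IH.
have [sW SW WT Wmx] := Wmax; have IJ : I \subset J by exact: finset.subsetUr.
have sU : subspace U by exact: lspan_subspace.
have WU : W `<=` U by move=> v Wv; apply: lspan_sub; left.
have US g v : PI J g -> U v -> U (act g v).
  move=> gJ; move: v; apply: lspan_min; first exact: subspace_preim.
  move=> u [Wu|[n [w [nN ->]]]] /=; apply: lspan_sub.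
    by left; apply: SW => //; exact: PI_sub gJ.
  right; exists (g * n * g^-1)%g, (act g w); split; first exact: NI_conj.
  by rewrite linearB -!rep_actM mulgVK.
have [v1 v1W] := proper_point WT; have [N v1N] := rep_smoothP v1.
have [reps [reps0 repsP]] := congK0_finite r P N.
(* By the Iwasawa decomposition [PI I] is contained in [PI J] times K^0, so finitely many
   K^0-translates of v1 generate V over [PI J] modulo W, as Zorn's lemma requires. *)
have [|W' [sW' SW' UW' W'T W'max]] := @maximal_stable _ _ G (fun g => act g) (PI J) U
    [seq act x v1 | x <- reps] sU US UT.
  move=> X sX XS UX Xg; apply/seteqP; split=> v // _.
  have [tt [ttP Wtt]] := maximal_generate Wmax v1W v.
  apply: (subspace_cong sX); first exact/UX/WU/Wtt.
  apply: (subspace_sum sX) => p ptt; apply: (subspaceZ sX).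
  have [k [k0 _ kT]] := Iwasawa (ttP _ ptt); have [x xr xk] := repsP _ (congKV k0).
  rewrite -(mulgK k p.2) rep_actM; apply: XS; first by apply: PI_sub kT; exact: finset.subsetT.
  rewrite -(mulKVg x k^-1%g) rep_actM v1N //; apply: Xg; exact: map_f.
have WW' : W `<=` W' by move=> v /WU /UW'.
have W'n : trivialN J W'.
  by move=> n v nN; apply/UW'/lspan_sub; right; exists n, v.
have {IH} fgW' := IH W' (And4 sW' SW' W'T W'max) W'n.
(* This set is the kernel of the map from V to the representation of [PI I] induced from V/W'. It is
   stable by the Iwasawa decomposition, and maximality of W identifies it with W. *)
have W2E : [set v | forall k, K 0 k -> PI I k -> W' (act k v)] = W.
  have [| | | //|W2T] := Wmx [set v | forall k, K 0 k -> PI I k -> W' (act k v)].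
  - split=> [k _ _|a u v Wu Wv k k0 kP]; first by rewrite linear0; exact: sW'.1.
    by rewrite linearP; apply: sW'.2; [exact: Wu|exact: Wv].
  - move=> g v gP Wv k k0 kP; rewrite -rep_actM.
    have [x [x0 xM xT]] := Iwasawa (PIM kP gP).
    rewrite -(mulgK x (k * g)%g) rep_actM; apply: SW'.
      by apply: PI_sub xT; exact: finset.subsetT.
    by apply: Wv; [exact: congKV|exact/PIV/MI_PI].
  - by move=> v Wv k _ kP; apply/WW'/SW.
  exfalso; apply: W'T; apply/seteqP; split=> v // _; rewrite -(rep_act1 v).
  have : setT v by []; rewrite -W2T => /(_ 1%g); apply; first exact: congK1.
  exact: PI1.
(* For vectors fixed modulo W by K^l, the condition defining the kernel need only be tested on
   finitely many k; [fgmod_joint_kernel] then applies. *)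
have [s [us sP sinj scov]] := subgroup_cosets P (KP_subgroup I 0) l.
apply: (@fgmod_joint_kernel _ _ _ G s (fun k => act k) W' W _ sW' sW).
- exact: fixedmod_subspace.
- move=> k ks; apply: fgmod_sub fgW' => _ [v vf <-] h hl hP.
  have [k0 kP] : KP I 0 k by apply: sP; elim: (s) ks => //= a s' IHs [->|/IHs h']; rewrite inE ?eqxx ?h' ?orbT.
  by apply: WW'; apply: (fixedmod_stable sW SW k0 kP vf hl); exact: PI_sub hP.
move=> v vf vW'; rewrite -W2E => k k0 kP.
have [x xs xk] := scov k (conj k0 kP); have [x0 xP] := sP _ xs.
have Wx : W' (act x v).
  by apply: vW'; elim: (s) xs => //= a s' IHs; rewrite inE => /orP[/eqP ->|/IHs]; [left|right].
apply: (subspace_cong sW') Wx; apply: WW'.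
rewrite -(mulKVg x k) rep_actM -linearB; apply: SW => //; apply: vf => //.
exact/PIM/kP/PIV.
Qed.

Lemma avg_KP_stable I W l v : subspace W -> (forall g u, PI I g -> W u -> W (act g u)) ->
  W v -> W (avg (KP I l) v).
Proof. by move=> sW SW Wv; apply: (avg_stable P (KP_subgroup I l) sW) => k [_ kP]; exact: SW. Qed.

Lemma avg_KP_B I l u v : avg (KP I l) (u - v) = avg (KP I l) u - avg (KP I l) v :> pi.
Proof.
by rewrite addrC -scaleN1r (avgP P (KP_subgroup I l)) scaleN1r addrC.
Qed.

Lemma avg_KP_cong I W l u v : subspace W -> (forall g w, PI I g -> W w -> W (act g w)) ->
  W (u - v) -> W (avg (KP I l) u - avg (KP I l) v).
Proof. by move=> sW SW Wuv; rewrite -avg_KP_B; exact: avg_KP_stable. Qed.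

(* Antidominant elements contract the unipotent radical. *)
Lemma ppow_contract I t (a : 'I_r -> int) (B : nat) l n (N : nat) :
  (forall i j, sep (t |: I) j i -> B%:Z <= a i - a j) -> (l.+1 * d + N <= B)%N ->
  NI (t |: I) n -> mxpw (- N%:Z) (glm n) -> KP I l.+1 (ppow P a * n * (ppow P a)^-1)%g.
Proof.
move=> aB lB [nP n1 n2] nN; set J := t |: I in nP n1 n2 aB *.
have IJ : I \subset J by exact: finset.subsetUr.
split; last first.
  apply: PIM; last by apply/PIV/MI_PI; exact: ppow_MI.
  by apply: PIM; [apply/MI_PI; exact: ppow_MI|exact: PI_sub nP].
apply/congKSP => i j; rewrite !glmM ppowE ppowVE.
rewrite mxE mul_mx_diag mxE mul_diag_mx mxE [X in X * _ * _]mxE [X in _ * _ * X]mxE.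
have vDP := @da_valP F d D.
have pE (k : int) : pw (@da_val F d D) k (cp_pi P ^ k).
  by right; rewrite (valXz vDP) ?cp_pi_unit ?cp_pi_neq0 // da_val_pi mulr1.
case: (boolP (sep J j i)) => [ji|nji].
  have := aB i j ji => aij.
  have ij : i != j by apply: contraTneq ji => ->; rewrite sep_irr.
  rewrite !mxE (negPf ij) subr0; apply: (pw_le (n := a i + (- N%:Z) + (- a j))).
    by lia.
  by apply: (pwM vDP); [apply: (pwM vDP)|].
have -> : glm n i j = (1%:M : 'M[D]_r) i j.
  have [ij|nij] := boolP (sep J i j).
    have [-> _] := nP i j ij; have nE : i != j by apply: contraTneq ij => ->; rewrite sep_irr.
    by rewrite !mxE (negPf nE).
  by rewrite -n1 [RHS]mxE /same nij nji.
rewrite !mxE; case: eqP => [->|_]; last by left; rewrite mulr0 mul0r subr0.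
left; rewrite mulr1 -invr_expz divrr ?subrr //; exact/unitrXz/cp_pi_unit.
Qed.

(** As the coinvariants vanish, v is a sum of terms n w - w modulo W. A sufficiently deep a
    conjugates each n into the group over which the average runs, and the two parts cancel. *)
Lemma contracted_avg I t W l v : maximalP I W ->
  lspan (W `|` [set u | exists n v, NI (t |: I) n /\ u = act n v - v]) = setT ->
  exists B : nat, forall a, (forall i j, sep (t |: I) j i -> B%:Z <= a i - a j) ->
    W (avg (KP I l.+1) (act (ppow P a) v)).
Proof.
move=> [sW SW _ _] UT.
have : lspan (W `|` [set u | exists n v, NI (t |: I) n /\ u = act n v - v]) v by rewrite UT.
apply: (@lspan_min _ _ _ [set v | exists B : nat, forall a,
   (forall i j, sep (t |: I) j i -> B%:Z <= a i - a j) -> W (avg (KP I l.+1) (act (ppow P a) v))]).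
  split; first by exists 0%N => a _; rewrite linear0 (avg0 P pi (KP_subgroup I _)); exact: sW.1.
  move=> c u w [B1 uB] [B2 wB]; exists (B1 + B2)%N => a aB; rewrite linearP (avgP P (KP_subgroup I _)).
  by apply: sW.2; [apply: uB|apply: wB] => i j /aB; lia.
move=> u [Wu|[n [w [nN ->]]]].
  by exists 0%N => a _; apply: avg_KP_stable => //; apply: SW => //; exact/MI_PI/ppow_MI.
have [N nP] := mxpw_exists (glm n); exists (l.+1 * d + N)%N => a aB.
rewrite linearB avg_KP_B.
have xK := ppow_contract aB (leqnn _) nN nP.
rewrite -[X in _ - X](avg_act P (KP_subgroup I _) _ xK) -!rep_actM mulgVK.
by rewrite subrr; exact: sW.1.
Qed.

Lemma center_GL_ppow (s b : 'I_r -> int) :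
  ppow P (fun i => d%:Z * s i + b i) = (center_GL P s * ppow P b)%g.
Proof.
apply: glm_inj; rewrite glmM !ppowE; apply/matrixP => i j; rewrite mul_diag_mx !mxE.
by case: eqP => _; rewrite ?mulr0 // !mulr1n exprzDr ?cp_pi_unit.
Qed.

Lemma avg_center I W l (s b : 'I_r -> int) v : maximalP I W -> trivialN I W ->
  (forall i j, same I i j -> s i = s j) -> exists c,
  W (avg (KP I l) (act (ppow P (fun i => d%:Z * s i + b i)) v) - c *: avg (KP I l) (act (ppow P b) v)).
Proof.
move=> Wmax Wn sI; have [c cP] := center_scalar P irr Wmax Wn sI; have [sW SW _ _] := Wmax.
exists c; rewrite -(avgZ P (KP_subgroup I l)); apply: avg_KP_cong => //.
by rewrite center_GL_ppow rep_actM.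
Qed.

(** Constant on blocks and smaller on later blocks, so it can serve as exponent of a central element
    of [MI I] that widens the gaps between blocks. *)
Definition cuts_above I i := #|[set t in I | (i < t)%N]|.

Lemma cuts_above_lt I i j : sep I j i -> (cuts_above I j < cuts_above I i)%N.
Proof.
move=> /sepP[t tI /andP[it tj]]; apply: proper_card; apply/fintype.properP; split.
  apply/fintype.subsetP => t'; rewrite !inE => /andP[-> /=]; apply: leq_ltn_trans.
  by apply: ltnW; exact: leq_trans it tj.
by exists t; rewrite !inE tI ?it // -leqNgt tj.
Qed.

Lemma cuts_above_same I i j : same I i j -> cuts_above I i = cuts_above I j.
Proof.
move=> /andP[ij ji]; apply: eq_card => t; rewrite !inE; case tI: (t \in I) => //=.
apply/idP/idP => it; rewrite ltnNge; apply/negP => h.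
  by case/sepP: ji; exists t; rewrite // it h.
by case/sepP: ij; exists t; rewrite // it h.
Qed.

Lemma same_between I i j (x y : 'I_r) : same I i j ->
  (i <= x)%N -> (x <= y)%N -> (y <= j)%N -> same I x y.
Proof.
move=> /andP[_ /negP ns] ix xy yj; apply/andP; split; apply/negP; first by move=> /sep_lt; lia.
move=> /sepP[t tI /andP[h1 h2]]; apply: ns; apply/sepP; exists t => //.
by apply/andP; split; lia.
Qed.

(** A large gap inside a block makes its upper index t a new cut. The gaps at the old cuts are made
    large by a central element of [MI I], which costs only a scalar modulo W; then [contracted_avg]
    applies to t |: I. *)
Lemma far_avg I W l v : maximalP I W -> trivialN I W ->
  (forall t, t \notin I ->
    lspan (W `|` [set u | exists n v, NI (t |: I) n /\ u = act n v - v]) = setT) ->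
  exists B : nat, forall a, (forall i j, same I i j -> (i <= j)%N -> a j <= a i) ->
   (exists i j, [/\ same I i j, nat_of_ord j = i.+1 & B%:Z <= a i - a j]) ->
    W (avg (KP I l.+1) (act (ppow P a) v)).
Proof.
move=> Wmax Wn UT; have [sW SW _ _] := Wmax.
have /choice[Bt BtP] t : exists B : nat, t \notin I -> forall a,
    (forall i j, sep (t |: I) j i -> B%:Z <= a i - a j) -> W (avg (KP I l.+1) (act (ppow P a) v)).
  have [tI|tI] := boolP (t \in I); first by exists 0%N.
  by have [B BP] := contracted_avg l v Wmax (UT t tI); exists B.
exists (\max_t Bt t)%N => a amon [i0 [t [it tE gap]]].
have tI : t \notin I.
  by apply: contraL it => tI; apply/nandP; right; apply/negPn/sepP; exists t; rewrite // tE ltnSn /=.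
have BB : (Bt t <= \max_t Bt t)%N by exact: leq_bigmax.
(* Two exponents differ by at most 2A, so a shift by M = Bt t + 2A leaves a gap of at least Bt t. *)
pose A := (\max_i `|a i|)%N; have aA i : (`|a i| <= A)%N by exact: (leq_bigmax i).
pose M := (Bt t + A + A)%N.
pose b i := a i + d%:Z * (M * cuts_above I i)%:Z.
have [|c cP] := @avg_center I W l.+1 (fun i => - (M * cuts_above I i)%:Z) b v Wmax Wn.
  by move=> i j /cuts_above_same ->.
have abE : ppow P a = ppow P (fun i => d%:Z * - (M * cuts_above I i)%:Z + b i).
  by congr ppow; apply/funext => i; rewrite /b; ring.
rewrite abE; apply: (subspace_cong sW cP); apply: (subspaceZ sW); apply: (BtP t tI) => i j.
have d1 := da_degree_gt0 D.
have [ji _|nji /sepP[t']] := boolP (sep I j i).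
  have := cuts_above_lt ji; have := aA i; have := aA j; rewrite /b /M.
  move: (cuts_above I i) (cuts_above I j) => x y ai aj xy.
  have : (d * (Bt t + A + A) * y + (Bt t + A + A) <= d * (Bt t + A + A) * x)%N.
    apply: (@leq_trans (d * (Bt t + A + A) * y.+1)); last by rewrite leq_mul2l xy orbT.
    by rewrite mulnS addnC leq_add2r leq_pmull.
  by nia.
rewrite finset.in_setU1 => /orP[/eqP -> /andP[ilt tlj]|t'I /andP[ilt tlj]]; last first.
  by case/sepP: nji; exists t' => //; rewrite ilt tlj.
have ij : same I i j by rewrite /same nji andbT; apply/negP => /sep_lt; lia.
rewrite /b (cuts_above_same ij).
have h1 : a i0 <= a i by apply: amon; [apply: (same_between ij)|]; lia.
have h2 : a j <= a t by apply: amon; [apply: (same_between ij)|]; lia.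
by lia.
Qed.

Lemma same_gap I (a : 'I_r -> int) (B : nat) :
  (forall i j, same I i j -> nat_of_ord j = i.+1 -> a i - a j < B%:Z) ->
  forall i j, same I i j -> (i <= j)%N -> a i - a j <= ((j - i) * B)%:Z.
Proof.
move=> aB i j; have [n] := ubnP (j - i)%N; elim: n j => // n IH j jn ij le_ij.
have [e|ne] := eqVneq i j; first by rewrite e; lia.
have lt_ij : (i < j)%N by rewrite ltn_neqAle le_ij andbT.
have jr : (j.-1 < r)%N by apply: leq_ltn_trans (ltn_ord j); exact: leq_pred.
pose j' := Ordinal jr.
have h1 : a i - a j' <= ((j' - i) * B)%:Z by apply: IH; [|apply: (same_between ij)|] => /=; lia.
have h2 : a j' - a j < B%:Z by apply: aB; [apply: (same_between ij) => /=|rewrite /=]; lia.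
have -> : (j - i)%N = (j' - i).+1 by rewrite /=; lia.
by lia.
Qed.

(** A central element of [MI I] removes the multiple of d at a chosen index of each block. What
    remains is bounded by r B for the variation inside a block and d for the remainder. *)
Lemma near_avg I W l v (B : nat) (a : 'I_r -> int) : maximalP I W -> trivialN I W ->
  (forall i j, same I i j -> (i <= j)%N -> a j <= a i) ->
  (forall i j, same I i j -> nat_of_ord j = i.+1 -> a i - a j < B%:Z) ->
  exists b c, (forall i, (`|b i| <= r * B + d)%N) /\
   W (avg (KP I l) (act (ppow P a) v) - c *: avg (KP I l) (act (ppow P b) v)).
Proof.
move=> Wmax Wn amon agap; have d1 := da_degree_gt0 D.
pose rep i := odflt i [pick j | same I i j].
have repP i : same I i (rep i).
  by rewrite /rep; case: pickP => [j //|/(_ i)]; rewrite same_refl.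
have repE i j : same I i j -> rep i = rep j.
  move=> ij; rewrite /rep (@eq_pick _ _ (same I j)); last first.
    by move=> k; apply/idP/idP; apply: same_trans; rewrite // same_sym.
  by case: pickP => [//|/(_ j)]; rewrite same_refl.
pose s i := (a (rep i) %/ d%:Z)%Z; pose b i := a i - d%:Z * s i.
have [|c cP] := @avg_center I W l s b v Wmax Wn.
  by move=> i j /repE; rewrite /s => ->.
exists b, c; split; last first.
  have aE : ppow P a = ppow P (fun i => d%:Z * s i + b i).
    by congr ppow; apply/funext => i; rewrite /b; ring.
  by rewrite aE.
move=> i; have gap (x y : 'I_r) : same I x y -> (`|a x - a y| <= r * B)%N.
  move=> xy; have := ltn_ord x; have := ltn_ord y.
  case/orP: (leq_total x y) => le.
    have := same_gap agap xy le; have := amon _ _ xy le; nia.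
  rewrite same_sym in xy; have := same_gap agap xy le; have := amon _ _ xy le; nia.
have := gap _ _ (repP i); rewrite /b /s; have := divz_eq (a (rep i)) d%:Z.
have := modz_ge0 (a (rep i)) (d := d%:Z); have := ltz_mod (a (rep i)) (d := d%:Z).
by move: (_ %/ _)%Z (_ %% _)%Z => x y; lia.
Qed.

(** Write [PI I] as K A K N with N trivial on V/W. Among the averages of g v0, large gaps give 0 and
    small gaps give, up to scalars, finitely many vectors modulo W. Since v0 generates V/W, these
    span all fixed vectors of V/W. *)
Lemma admissible_step I W l : maximalP I W -> trivialN I W ->
  (forall t, t \notin I ->
    lspan (W `|` [set u | exists n v, NI (t |: I) n /\ u = act n v - v]) = setT) ->
  fgmod W (fixedmod I W l.+1).
Proof.
move=> Wmax Wn UT; have [sW SW WT _] := Wmax.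
have gK := KP_subgroup I l.+1.
have [v0 v0W] := proper_point WT; have [N v0N] := rep_smoothP v0.
have [reps [reps0 repsP]] := congK0_finite r P N.
have [ks [_ ksP _ kscov]] := subgroup_cosets P (KP_subgroup I 0) l.+1.
have /choice[B BP] (x : G) : exists B : nat, forall a : 'I_r -> int,
    (forall i j, same I i j -> (i <= j)%N -> a j <= a i) ->
    (exists i j, [/\ same I i j, nat_of_ord j = i.+1 & B%:Z <= a i - a j]) ->
    W (avg (KP I l.+1) (act (ppow P a) (act x v0))).
  by exact: far_avg.
pose M := (\max_(x <- reps) (r * B x + d))%N.
pose box (f : {ffun 'I_r -> 'I_(M + M).+1}) (i : 'I_r) : int := (f i)%:Z - M%:Z.
pose S := [seq act p.1 p.2 | p <- [seq (k, avg (KP I l.+1) (act q.1 (act q.2 v0))) | k <- ks,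
   q <- [seq (ppow P (box f), x) | f <- enum {: {ffun 'I_r -> 'I_(M + M).+1}}, x <- reps]]].
have inS k f x : k \in ks -> x \in reps ->
    act k (avg (KP I l.+1) (act (ppow P (box f)) (act x v0))) \in S.
  move=> kks xr; apply/mapP; exists (k, avg (KP I l.+1) (act (ppow P (box f)) (act x v0))) => //.
  apply/allpairsP; exists (k, (ppow P (box f), x)); split=> //=.
  by apply/allpairsP; exists (f, x); split=> //=; rewrite mem_enum.
pose Y := lspan ([set` S] `|` W); have sY : subspace Y by exact: lspan_subspace.
have WY : W `<=` Y by move=> v Wv; apply: lspan_sub; right.
have SY v : v \in S -> Y v by move=> vS; apply: lspan_sub; left.
apply: (@fgmod_seq _ _ _ _ S sW) => v vf.
have avY g : PI I g -> Y (avg (KP I l.+1) (act g v0)).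
  move=> /(Cartan_parabolic P)[k1 [k2 [n [a [k10 k20 k1M k2M [nN -> amon]]]]]].
  have k1P := MI_PI k1M; have k2P := MI_PI k2M; have aP := MI_PI (@ppow_MI _ _ _ _ P I a).
  rewrite rep_actM; set g' := (k1 * _ * k2)%g.
  have g'P : PI I g' by apply: PIM => //; exact: PIM.
  have : W (avg (KP I l.+1) (act g' (act n v0)) - avg (KP I l.+1) (act g' v0)).
    by apply: avg_KP_cong => //; rewrite -linearB; apply: SW => //; exact: Wn.
  move=> /WY /(subspace_cong sY); apply.
  have [x xr xk] := repsP _ k20; rewrite /g' rep_actM.
  have -> : act k2 v0 = act x v0 by rewrite -(mulKVg x k2) rep_actM v0N.
  rewrite rep_actM -(@act_avg_norm _ _ _ _ _ P pi (KP I l.+1) gK); last 2 first.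
  - by move=> c [cK cP]; split; [exact: congK_norm|apply: PIM => //; apply: PIM => //; exact: PIV].
  - by move=> c [cK cP]; split; [exact: congK_normV|apply: PIM; [exact: PIM|exact: PIV]].
  have [k kks kk] := kscov k1 (conj k10 k1P); have [k0 kP] := ksP _ kks.
  set u := act (ppow P a) _; rewrite -(mulKVg k k1) rep_actM.
  rewrite (act_avg P gK); last by split=> //; apply: PIM => //; exact: PIV.
  have [far|near] := pselect (exists i j, [/\ same I i j, nat_of_ord j = i.+1 & (B x)%:Z <= a i - a j]).
    by apply/WY/SW => //; exact: BP.
  have [|b [c [bB Wb]]] := @near_avg I W l.+1 (act x v0) (B x) a Wmax Wn amon.
    by move=> i j ij ji; rewrite ltNge; apply/negP => h; apply: near; exists i, j.
  have Wkb := SW _ _ kP Wb; rewrite linearB linearZZ in Wkb.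
  apply: (subspace_cong sY (WY _ Wkb)); apply: (subspaceZ sY); apply: SY.
  have BM : (r * B x + d <= M)%N by exact: leq_bigmax_seq.
  have bM i : (`|(b i + M%:Z)%R| < (M + M).+1)%N by have := leq_trans (bB i) BM; lia.
  have -> : ppow P b = ppow P (box [ffun i => Ordinal (bM i)]).
    by congr ppow; apply/funext => i; rewrite /box ffunE /=; have := leq_trans (bB i) BM; lia.
  exact: inS.
have [tt [ttP Wtt]] := maximal_generate Wmax v0W v.
have Wav : W (avg (KP I l.+1) v - v) by apply: (avg_mod P gK sW) => k [kl kP]; exact: vf.
apply: (subspace_cong sY (WY _ (subspaceBC sW Wav))).
apply: (subspace_cong sY (WY _ (avg_KP_cong _ sW SW Wtt))).
rewrite (avg_linear_comb P gK); apply: (subspace_sum sY) => p ptt.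
by apply: (subspaceZ sY); exact/avY/ttP.
Qed.

(** Induction on the number of indices not in I: the descent applies as long as some new cut keeps
    nonzero coinvariants, and [admissible_step] ends it. *)
Lemma admissible_parabolic I W l : maximalP I W -> trivialN I W ->
  fgmod W (fixedmod I W l.+1).
Proof.
have [n] := ubnP #|~: I|; elim: n I W => // n IH I W cI Wmax Wn.
have [[t [tI UT]]|all] := pselect (exists t, t \notin I /\
    lspan (W `|` [set u | exists n v, NI (t |: I) n /\ u = act n v - v]) <> setT).
  apply: (admissible_descent Wmax Wn UT) => W' W'max W'n; apply: IH => //.
  rewrite ltnS in cI; apply: leq_trans cI; apply: proper_card.
  apply/fintype.properP; split; first by rewrite finset.setCS finset.subsetUr.
  by exists t; rewrite !inE // eqxx.
apply: admissible_step => // t tI; apply: contrapT => UT.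
by apply: all; exists t.
Qed.

Lemma maximalP0 : maximalP finset.set0 [set (0 : pi)].
Proof.
have [[v v0] irrP] := irr; split.
- by split=> // a u w -> ->; rewrite /= scaler0 addr0.
- by move=> g u _ ->; rewrite /= linear0.
- move=> e; have : setT v by []; rewrite -e /= => ve; by rewrite ve eqxx in v0.
by move=> X sX XS _; apply: irrP; [exact: sX.1|exact: sX.2|move=> g u; exact/XS/PI0].
Qed.

(** The case of I empty and W = 0, where the unipotent radical is trivial. The positive level l + 1
    is used with l = n, since vectors fixed by K^n are fixed by K^(n+1). *)
Theorem admissible n : exists s : seq pi, forall v, fixed pi (K n) v -> lspan [set` s] v.
Proof.
have W0 := maximalP0.
have N0 : trivialN finset.set0 [set (0 : pi)].
  move=> g v [_ + _]; have -> : bd finset.set0 (glm g) = glm g.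
    by apply/matrixP => i j; rewrite mxE ifT //; apply/andP; split; apply/sepP => -[t]; rewrite inE.
  by move=> g1; have -> : g = 1%g; [exact: glm_inj|rewrite rep_act1 /= subrr].
have [s sP] := admissible_parabolic n W0 N0; exists s => v vn.
have [k kl _|u us] := sP v; first by rewrite /= (fixed_le (leqnSn n) vn) ?subrr.
by move=> /= /subr0_eq ->.
Qed.

End Admissibility.

Lemma nth_In (T : Type) (x : T) (t : seq T) (i : nat) : (i < size t)%N -> List.In (nth x t i) t.
Proof. by elim: t i => // a t IH [|i] /= it; [left|right; exact: IH]. Qed.

(** * Matrix coefficients *)

Section LinearForms.
Variables (C : fieldType) (V : lmodType C).
Implicit Types (U W : set V) (s : seq V) (f : V -> C).

(** Forms on a subspace are plain functions on V, so restricting to a smaller subspace leaves the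
    function unchanged. *)
Definition linear_on U f := forall a u v, U u -> U v -> f (a *: u + v) = a * f u + f v.

Lemma linear_on0 U f : subspace U -> linear_on U f -> f 0 = 0.
Proof.
move=> sU fl; have := fl (-1) _ _ sU.1 sU.1.
by rewrite scaler0 addr0 mulN1r addNr.
Qed.

Lemma linear_onZ U f a u : subspace U -> linear_on U f -> U u -> f (a *: u) = a * f u.
Proof.
by move=> sU fl Uu; rewrite -[a *: u]addr0 fl ?(linear_on0 sU fl) ?addr0 //; exact: sU.1.
Qed.

Lemma linear_onB U f u v : subspace U -> linear_on U f -> U u -> U v -> f (u - v) = f u - f v.
Proof. by move=> sU fl Uu Uv; rewrite addrC -scaleN1r fl // mulN1r addrC. Qed.

Lemma linear_on_sub U U' f : U `<=` U' -> linear_on U' f -> linear_on U f.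
Proof. by move=> UU' fl a u v /UU' Uu /UU' Uv; exact: fl. Qed.

Lemma subspaceI U U' : subspace U -> subspace U' -> subspace (U `&` U').
Proof.
move=> sU sU'; split; first by split; [exact: sU.1|exact: sU'.1].
by move=> a u v [Uu Uu'] [Uv Uv']; split; [exact: sU.2|exact: sU'.2].
Qed.

(** The induction step on dimension: if U is not in the span of s, then neither is a, and the
    coordinate along a is a well-defined form c on U. *)
Lemma fg_step a s U : subspace U -> U `<=` lspan [set` a :: s] ->
  U `<=` lspan [set` s] \/ exists c, [/\ linear_on U c, exists2 u, U u & c u != 0 &
    forall u, U u -> c u = 0 -> lspan [set` s] u].
Proof.
move=> sU Us; have sl := lspan_subspace [set` s].
have [?|/existsNP[u1 /not_implyP[Uu1 nu1]]] := pselect (U `<=` lspan [set` s]); [by left|right].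
have na : ~ lspan [set` s] a.
  move=> sa; apply: nu1; move: (Us _ Uu1); apply: lspan_min => // x /=.
  by rewrite inE => /orP[/eqP ->//|]; exact: lspan_sub.
have /choice[c cP] u : exists c, U u -> lspan [set` s] (u - c *: a).
  have [Uu|nU] := pselect (U u); last by exists 0.
  have [c [w [ws ->]]] := lspan_cons (Us _ Uu); exists c.
  by rewrite addrAC subrr add0r.
have cu u x : U u -> lspan [set` s] (u - x *: a) -> x = c u.
  move=> Uu ux; apply: contra_notP na => /eqP xc.
  have xc0 : x - c u != 0 by rewrite subr_eq0.
  rewrite -[a](scalerK xc0); apply: (subspaceZ sl); rewrite scalerBl.
  by have := subspaceB sl (cP _ Uu) ux; rewrite [_ - (u - _)]addrC opprB subrKA.
exists c; split.
- move=> b u v Uu Uv; symmetry; apply: cu; first exact: sU.2.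
  rewrite scalerDl -scalerA opprD addrACA -scalerBr; exact: sl.2 (cP _ Uu) (cP _ Uv).
- exists u1 => //; apply: contra_notN nu1 => /eqP c0.
  by have := cP _ Uu1; rewrite c0 scale0r subr0.
by move=> u Uu c0; have := cP _ Uu; rewrite c0 scale0r subr0.
Qed.

(** If c(u0) = 0, a form on the kernel of c is extended to U through the projection p along u1,
    which fixes u0. *)
Lemma fg_dual s U u0 : subspace U -> U `<=` lspan [set` s] -> U u0 -> u0 != 0 ->
  exists f, linear_on U f /\ f u0 != 0.
Proof.
elim: s U u0 => [|a s IH] U u0 sU Us Uu0 u00.
  by move: u00; rewrite (lspan_nil (Us _ Uu0)) eqxx.
have [Us'|[c [cl [u1 Uu1 cu1] cP]]] := fg_step sU Us; first exact: IH Us' Uu0 u00.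
have [cu0|cu0] := eqVneq (c u0) 0; last by exists c.
pose U0 := U `&` lspan [set` s].
have sU0 : subspace U0 by apply: subspaceI => //; exact: lspan_subspace.
pose p u := u - (c u / c u1) *: u1.
have Up u : U u -> U0 (p u).
  move=> Uu; have UZ := subspaceZ sU (c u / c u1) Uu1.
  have Upu : U (p u) by exact: subspaceB.
  split=> //; apply: cP => //; rewrite (linear_onB sU cl Uu UZ) (linear_onZ _ sU cl Uu1) divfK //.
  by rewrite subrr.
have pu0 : p u0 = u0 by rewrite /p cu0 mul0r scale0r subr0.
have [||f [fl fu0]] := IH U0 u0 sU0 _ _ u00; first by move=> ? [].
  by rewrite -pu0; exact: Up.
exists (f \o p); split; last by rewrite /= pu0.
move=> b u v Uu Uv /=; rewrite -fl; [|exact: Up|exact: Up].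
by congr f; rewrite /p cl // mulrDl scalerDl scalerBr -mulrA -scalerA opprD addrACA.
Qed.

(** If t separates the kernel of the coordinate c, then t fails at most on a line of U, and one more
    form detects that line. *)
Lemma separating_finite (Xi : set (V -> C)) s U : subspace U -> U `<=` lspan [set` s] ->
  (forall f, Xi f -> linear_on U f) ->
  (forall u, U u -> u != 0 -> exists2 f, Xi f & f u != 0) ->
  exists t : seq (V -> C), (forall f, List.In f t -> Xi f) /\
    forall u, U u -> (forall f, List.In f t -> f u = 0) -> u = 0.
Proof.
elim: s U => [|a s IH] U sU Us Xl sep.
  by exists [::]; split=> // u /Us /lspan_nil.
have [Us'|[c [cl _ cP]]] := fg_step sU Us; first exact: IH Us' Xl sep.
pose U0 := U `&` lspan [set` s].
have sU0 : subspace U0 by apply: subspaceI => //; exact: lspan_subspace.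
have [|f Xf|u [Uu _]|t [tX tP]] := IH U0 sU0; [by move=> ? []| |exact: sep|].
  by apply: linear_on_sub (Xl _ Xf) => ? [].
have [[u2 [Uu2 u20 u2t]]|no] := pselect (exists u, [/\ U u, u != 0 &
    forall f, List.In f t -> f u = 0]); last first.
  exists t; split=> // u Uu ut; apply: contrapT => /eqP u0.
  by apply: no; exists u.
have cu2 : c u2 != 0.
  by apply: contra_neqN u20 => /eqP cu2; apply: tP => //; split=> //; exact: cP.
have [e Xe eu2] := sep _ Uu2 u20.
exists (e :: t); split=> [f [<-//|/tX//]|u Uu ut].
pose k := c u / c u2; have Uk := subspaceZ sU k Uu2.
have uk : u - k *: u2 = 0.
  have Uw : U (u - k *: u2) by exact: subspaceB.
  apply: tP => [|f ft].
    split=> //; apply: cP => //.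
    by rewrite (linear_onB sU cl Uu Uk) (linear_onZ _ sU cl Uu2) divfK // subrr.
  have fl := Xl _ (tX _ ft); rewrite (linear_onB sU fl Uu Uk) (linear_onZ _ sU fl Uu2).
  by rewrite u2t // mulr0 subr0; apply: ut; right.
have uE : u = k *: u2 by apply: subr0_eq.
have : e u = 0 by apply: ut; left.
rewrite uE (linear_onZ _ sU (Xl _ Xe) Uu2) => /eqP; rewrite mulf_eq0 (negPf eu2) orbF => /eqP ->.
by rewrite scale0r.
Qed.

(** On the kernel of the head f the tail suffices by induction. The coefficient of f is then fixed
    by comparing values at a vector u1 with f(u1) nonzero. *)
Lemma form_combination (t : seq (V -> C)) (xi : V -> C) U : subspace U ->
  (forall f, List.In f t -> linear_on U f) -> linear_on U xi ->
  (forall u, U u -> (forall f, List.In f t -> f u = 0) -> xi u = 0) ->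
  exists c : nat -> C, forall u, U u -> xi u = \sum_(i < size t) c i * nth (fun=> 0) t i u.
Proof.
elim: t U xi => [|f t IH] U xi sU tl xl ker.
  by exists (fun=> 0) => u Uu; rewrite big_ord0; exact: ker.
have fl : linear_on U f by apply: tl; left.
pose U0 := U `&` [set u | f u = 0].
have sU0 : subspace U0.
  split; first by split; [exact: sU.1|exact: linear_on0 fl].
  move=> a u v [Uu fu] [Uv fv]; split; first exact: sU.2.
  by rewrite /= fl // fu fv mulr0 addr0.
have U0U : U0 `<=` U by move=> ? [].
have [| | |c cP] := IH U0 xi sU0.
- by move=> g gt; apply: linear_on_sub U0U _; apply: tl; right.
- exact: linear_on_sub xl.
- by move=> u [Uu fu] ut; apply: ker => // g [<-//|]; exact: ut.
pose xi' u := \sum_(i < size t) c i * nth (fun=> 0) t i u.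
have xi'l : linear_on U xi'.
  move=> a u v Uu Uv; rewrite /xi' mulr_sumr -big_split /=; apply: eq_bigr => i _.
  have -> : nth (fun=> 0) t i (a *: u + v) = a * nth (fun=> 0) t i u + nth (fun=> 0) t i v.
    by apply: (tl (nth (fun=> 0) t i)) => //; right; exact: nth_In.
  by rewrite mulrDr mulrCA.
have [[u1 [Uu1 fu1]]|no] := pselect (exists u, U u /\ f u != 0); last first.
  exists (fun i => if i is j.+1 then c j else 0) => u Uu.
  rewrite big_ord_recl mul0r add0r; apply: cP; split=> //=.
  by apply: contrapT => /eqP fu; apply: no; exists u.
exists (fun i => if i is j.+1 then c j else (xi u1 - xi' u1) / f u1) => u Uu.
rewrite big_ord_recl /= -/(xi' u); pose k := f u / f u1; have Uk := subspaceZ sU k Uu1.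
have Uw : U (u - k *: u1) by exact: subspaceB.
have : xi (u - k *: u1) = xi' (u - k *: u1).
  apply: cP; split=> //=.
  by rewrite (linear_onB sU fl Uu Uk) (linear_onZ _ sU fl Uu1) divfK // subrr.
rewrite (linear_onB sU xl Uu Uk) (linear_onZ _ sU xl Uu1).
rewrite (linear_onB sU xi'l Uu Uk) (linear_onZ _ sU xi'l Uu1) => /(canRL (subrK _)) ->.
by rewrite /k; ring.
Qed.

End LinearForms.

(** * Reduction to coefficients of fixed vectors and fixed forms *)

Section Coefficients.
Variables (R : realType) (F : localField) (d : nat) (D : divAlg F d) (r : nat).
Variables (P : cyclicPres D) (pi : smoothRep R D r) (n : nat).
Hypotheses (irr : irreducible pi) (pin : exists2 v, fixed pi (congK D r n) v & v != 0).
Local Notation G := (GL D r).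
Local Notation K := (congK D r).
Local Notation act := (rep_act pi).
Implicit Types (g h k x y : G) (u v w : pi).

Let gK m := is_subgroup_congK D r m.

Definition mkform (f : pi -> R[i]) (fl : linear_on setT f) : {linear pi -> R[i]^o} :=
  HB.pack f (GRing.isLinear.Build R[i] pi R[i]^o _ f (fun a u v => fl a u v I I)).

Lemma form_linear_on U (xi : {linear pi -> R[i]^o}) : linear_on U xi.
Proof. by move=> a u v _ _; rewrite linearP. Qed.

Lemma form_avg (f : pi -> R[i]) m v : linear_on setT f ->
  (forall k u, K m k -> f (act k u) = f u) -> f (avg (K m) v) = f v.
Proof. by move=> fl fK; exact: (avg_form P (gK m) (xi := mkform fl) v fK). Qed.

(** The average is defined at a level of v, the sum on the right runs at the level n' of f.
    Averaging over both and exchanging the finite sums links them, since K^n' is normal in K^0. *)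
Lemma form_avgs (f : pi -> R[i]) m n' s v : linear_on setT f ->
  cosets n' s (K m) -> (forall k u, K n' k -> f (act k u) = f u) ->
  f (avg (K m) v) = (size s)%:R^-1 * \sum_(y <- s) f (act y v).
Proof.
move=> fl cs fK; have [_ sm _ _] := cs; pose L := mkform fl.
have s0 := cosets_size R (gK m) cs.
have fsum (I : eqType) (t : seq I) (c : R[i]) (z : I -> pi) :
    f (c *: \sum_(i <- t) z i) = c * \sum_(i <- t) f (z i).
  by rewrite -[LHS]/(L (c *: \sum_(i <- t) z i)) linearZZ linear_sum.
have sumc (t : seq G) (a : R[i]) : \sum_(y <- t) a = (size t)%:R * a.
  by rewrite big_const_seq count_predT iter_addr_0 mulr_natl.
have [n2 [s2 [cs2 /(_ tt (mem_head _ _)) vn2]]] := avg_exists P (gK m) [:: tt] (fun=> v).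
have m0 x : K m x -> K 0 x by exact: congK_le.
have shift x : K m x -> \sum_(y <- s) f (act y (act x v)) = \sum_(y <- s) f (act y v).
  move=> xm; under eq_bigr do rewrite -rep_actM.
  apply: (cosets_reindex (gK m) (f := fun y => f (act y v)) (h := fun y => (y * x)%g) cs).
  - move=> y k ym _ kn; rewrite -(fK (y * k^-1 * y^-1)%g) -?rep_actM ?mulgVK //.
      by rewrite !mulgA !mulgVK.
    by apply: congK_normV; [exact: m0|exact: congKV].
  - by move=> y ym; exact: congKM.
  - by move=> y y' _ _; rewrite invMg => /(congK_normV (m0 _ xm)); rewrite !mulgA mulgV mul1g mulgK.
transitivity ((size s)%:R^-1 * \sum_(y <- s) f (act y (avg (K m) v))).
  rewrite (eq_big_seq (fun=> f (avg (K m) v))); last by move=> y ys; rewrite (act_avg P (gK m)) //; exact: sm.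
  by rewrite sumc mulKf.
congr (_ * _); rewrite (avgE (gK m) cs2 vn2) /avgs.
under eq_bigr do rewrite linearZZ linear_sum fsum.
rewrite -mulr_sumr exchange_big /= (eq_big_seq (fun=> \sum_(y <- s) f (act y v))); last first.
  by move=> x xs; apply: shift; have [_ + _ _] := cs2; exact.
rewrite sumc mulKf //.
exact: (cosets_size R (gK m) cs2).
Qed.

Lemma translates_span v0 : v0 != 0 -> forall v, exists t : seq (R[i] * G),
  v = \sum_(p <- t) p.1 *: act p.2 v0.
Proof.
move=> v00 v; pose W := [set v | exists t : seq (R[i] * G), v = \sum_(p <- t) p.1 *: act p.2 v0].
suff : W = setT by move=> WT; have : setT v by []; rewrite -WT.
apply: (irreducible_sub irr).
- split; first by exists [::]; rewrite big_nil.
  move=> a _ _ [t ->] [t' ->]; exists ([seq (a * p.1, p.2) | p <- t] ++ t').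
  rewrite big_cat big_map /= scaler_sumr; congr (_ + _).
  by apply: eq_bigr => p _; rewrite scalerA.
- move=> g _ [t ->]; exists [seq (p.1, (g * p.2)%g) | p <- t].
  by rewrite big_map linear_sum; apply: eq_bigr => p _; rewrite linearZZ rep_actM.
by exists v0 => //; exists [:: (1, 1%g)]; rewrite big_seq1 rep_act1 scale1r.
Qed.

(* As the fixed spaces have finite dimension, the smooth dual is spanned by the
   translates of K^n-fixed forms. *)
Lemma coefficient_ind (Q : (G -> R[i]) -> Prop) :
  Q (fun=> 0) -> (forall c f f', Q f -> Q f' -> Q (fun x => c * f x + f' x)) ->
  (forall f g h, Q f -> Q (fun x => f (g * x * h)%g)) ->
  (forall (f : pi -> R[i]) v, linear_on setT f -> (forall k u, K n k -> f (act k u) = f u) ->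
     fixed pi (K n) v -> Q (fun x => f (act x v))) ->
  forall v xi, smooth_form xi -> Q (@coefficient _ _ _ _ _ pi v xi).
Proof.
move=> Q0 QD QT Qb v xi sxi.
have Qsum (I : eqType) (t : seq I) (c : I -> R[i]) (f : I -> G -> R[i]) :
    (forall i, i \in t -> Q (f i)) -> Q (fun x => \sum_(i <- t) c i * f i x).
  elim: t => [|i t IH] Qf.
    by rewrite (_ : (fun x => _) = fun=> 0) //; apply/funext => x; rewrite big_nil.
  rewrite (_ : (fun x => _) = fun x => c i * f i x + \sum_(j <- t) c j * f j x); last first.
    by apply/funext => x; rewrite big_cons.
  apply: QD; first by apply: Qf; rewrite mem_head.
  by apply: IH => j jt; apply: Qf; rewrite inE jt orbT.
have [v0 v0n v00] := pin.
have [s0 s0P] := admissible P irr n; have sn := subspace_fixed pi (K n).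
(* The smooth forms all of whose coefficients satisfy Q. They include the translates of K^n-fixed
   forms, and these already separate the vectors of V. *)
pose Xi := [set f : pi -> R[i] | [/\ linear_on setT f,
  (exists m, forall k u, K m k -> f (act k u) = f u) & forall v, Q (fun x => f (act x v))]].
have Xi_base f g : linear_on setT f -> (forall k u, K n k -> f (act k u) = f u) ->
    Xi (fun u => f (act g u)).
  move=> fl fK; split.
  - by move=> a u w _ _; rewrite linearP fl.
  - have [m mP] := congK_conj g^-1%g n; exists m => k u /mP; rewrite invgK => km.
    by rewrite -[RHS](fK _ _ km) -!rep_actM mulgVK.
  move=> w; have [t ->] := translates_span v00 w.
  have -> : (fun x => f (act g (act x (\sum_(p <- t) p.1 *: act p.2 v0)))) =
      (fun x => \sum_(p <- t) p.1 * f (act (g * x * p.2)%g v0)).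
    apply/funext => x; rewrite -[LHS]/(mkform fl _) !linear_sum; apply: eq_bigr => p _.
    by rewrite !linearZZ !rep_actM.
  apply: Qsum => p _; exact: (QT (fun x => f (act x v0)) g p.2 (Qb _ _ fl fK v0n)).
have sep u : u != 0 -> exists2 f, Xi f & f u != 0.
  move=> u0; have [g gu] : exists g, avg (K n) (act g u) != 0.
    apply: contrapT => /forallNP no; case/eqP: u0.
    by apply: (avg_translates_eq0 P irr pin) => g; have /negP := no g; rewrite negbK => /eqP.
  have avgn w : fixed pi (K n) (avg (K n) w) by move=> k kn; exact: (act_avg P (gK n)).
  have [f [fl fu]] := fg_dual sn (s0P) (avgn (act g u)) gu.
  exists (fun w => f (avg (K n) (act g w))) => //.
  apply: (Xi_base (fun w => f (avg (K n) w))) => [a x y _ _|k x kn].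
    by rewrite (avgP P (gK n)) fl //; exact: avgn.
  by rewrite (avg_act P (gK n)).
have [m mP] : exists m, forall k u, K m k -> xi (act k u) = xi u.
  have /gl_openP/(_ 1%g) := sxi; case=> [u|m mP]; first by rewrite rep_act1.
  by exists m => k u /mP /(_ u); rewrite mul1g.
(* On the K^m-fixed vectors, where m is a level of xi, finitely many members of Xi separate points;
   hence xi agrees there with a combination e of them. *)
have [s sP] := admissible P irr m; have sm := subspace_fixed pi (K m).
have [|u _|t [tX tP]] := separating_finite (Xi := Xi) sm sP; [|exact: sep|].
  by move=> f [fl _ _]; exact: linear_on_sub fl.
have [|u um ut|c cP] := form_combination sm (t := t) (xi := xi) _ (form_linear_on _).
- by move=> f /tX[fl _ _]; exact: linear_on_sub fl.
- by rewrite (tP u) ?linear0.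
pose e u := \sum_(i < size t) c i * nth (fun=> 0) t i u.
have tXi (i : 'I_(size t)) : Xi (nth (fun=> 0) t i) by apply: tX; exact: nth_In.
have el : linear_on setT e.
  move=> a u w _ _; rewrite /e mulr_sumr -big_split; apply: eq_bigr => i _.
  by have [-> // _ _] := tXi i; rewrite mulrDr mulrCA.
have [m' eK] : exists m', forall k u, K m' k -> e (act k u) = e u.
  have /choice[M MP] (i : 'I_(size t)) : exists m', forall k u, K m' k ->
     nth (fun=> 0) t i (act k u) = nth (fun=> 0) t i u by have [] := tXi i.
  exists (\max_i M i)%N => k u km; apply: eq_bigr => i _; rewrite MP //.
  by apply: congK_le km; exact: leq_bigmax.
have Qe u : Q (fun x => e (act x u)) by apply: Qsum => i _; have [_ _] := tXi i; exact.
have [sc cs] := subgroup_cosets P (gK m) m'.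
(* xi factors through the projector of K^m, so it is e composed with this projector: an average of
   left translates of coefficients of e. *)
have -> : @coefficient _ _ _ _ _ pi v xi =
    (fun x => \sum_(y <- sc) (size sc)%:R^-1 * e (act (y * x * 1)%g v)).
  apply/funext => x; rewrite /coefficient -(form_avg (m := m) _ (form_linear_on _) mP).
  rewrite cP; last by move=> k km; exact: (act_avg P (gK m)).
  rewrite -/(e _) (form_avgs _ el cs eK) mulr_sumr; apply: eq_bigr => y _.
  by rewrite mulg1 rep_actM.
by apply: Qsum => y _; exact: (QT (fun x => e (act x v)) y 1%g).
Qed.

End Coefficients.

(** * Square integrability *)

Section InequivalentLists.
Variables (T : eqType) (R : realType).
Implicit Types (E : T -> T -> Prop) (s : seq T) (f : T -> R).

Fixpoint inequivalent E s : Prop :=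
  if s is x :: s' then (forall y, y \in s' -> ~ E x y) /\ inequivalent E s' else True.

(** For a nonnegative f constant on the classes of an equivalence E, this is finiteness of the sum
    of f over the classes. *)
Definition bounded_sums E f := exists M, forall s, inequivalent E s -> \sum_(x <- s) f x <= M.

Lemma inequivalent_filter E (a : pred T) s : inequivalent E s -> inequivalent E ([seq y <- s | a y]).
Proof.
elim: s => //= x s IH [xs /IH h]; case: (a x) => //=; split=> // y.
by rewrite mem_filter => /andP[_ /xs].
Qed.

Lemma inequivalent_sub E E' s : (forall x y, x \in s -> y \in s -> E' x y -> E x y) ->
  inequivalent E s -> inequivalent E' s.
Proof.
elim: s => //= x s IH sub [xs h]; split.
  by move=> y ys /(sub _ _ (mem_head _ _)) xy; apply: (xs y ys); apply: xy; rewrite inE ys orbT.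
by apply: IH h => y z ys zs; apply: sub; rewrite inE ?ys ?zs orbT.
Qed.

(** An E-class holds at most N x members of a list inequivalent for E'. Such a list is thinned
    greedily: the head absorbs the members of its E-class, and its weight N x pays for them. *)
Lemma bounded_sums_refine E E' (N : T -> nat) f : (forall x, E x x) ->
  (forall x y, E x y -> f y = f x) -> (forall x, 0 <= f x) ->
  (forall x s, inequivalent E' s -> (forall y, y \in s -> E x y) -> (size s <= N x)%N) ->
  bounded_sums E (fun x => (N x)%:R * f x) -> bounded_sums E' f.
Proof.
move=> Er fE f0 size_le [M MP].
suff H s : inequivalent E' s -> exists g, [/\ {subset g <= s}, inequivalent E g &
    \sum_(x <- s) f x <= \sum_(x <- g) (N x)%:R * f x].
  by exists M => s /H[g [_ /MP gM sg]]; exact: le_trans sg gM.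
have [n] := ubnP (size s); elim: n s => // n IH [|x s] /= sn.
  by exists [::]; rewrite !big_nil.
move=> h; pose a y := `[< E x y >].
have [||g [gs gE sg]] := IH [seq y <- s | ~~ a y].
- by rewrite ltnS in sn; apply: leq_ltn_trans sn; rewrite size_filter; exact: count_size.
- by apply: inequivalent_filter; case: h.
exists (x :: g); split.
- by move=> y; rewrite !inE => /orP[->//|/gs]; rewrite mem_filter => /andP[_ ->]; rewrite orbT.
- by split=> // y /gs; rewrite mem_filter => /andP[/asboolPn].
rewrite !big_cons (bigID a) /= addrA; apply: lerD; last by rewrite big_filter in sg.
have hx : inequivalent E' (x :: [seq y <- s | a y]).
  by case: h => xs h; split; [move=> y; rewrite mem_filter => /andP[_ /xs]|exact: inequivalent_filter].
have := size_le x _ hx; rewrite -[X in _ -> X <= _]/(f x + _).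
have -> : f x + \sum_(y <- s | a y) f y = (size (x :: [seq y <- s | a y]))%:R * f x.
  rewrite -big_filter (eq_big_seq (fun=> f x)); last first.
    by move=> y; rewrite mem_filter => /andP[/asboolP /fE].
  by rewrite big_const_seq count_predT iter_addr_0 mulr_natl -mulrS.
move=> le; apply: ler_wpM2r => //; rewrite ler_nat; apply: le => y.
by rewrite inE mem_filter => /orP[/eqP ->//|/andP[/asboolP]].
Qed.

Lemma bounded_sums_scale E f (c : R) : 0 <= c -> bounded_sums E f -> bounded_sums E (fun x => c * f x).
Proof.
by move=> c0 [M MP]; exists (c * M) => s /MP h; rewrite -mulr_sumr; exact: ler_wpM2l.
Qed.

Lemma bounded_sums_le E f f' : (forall x, f x <= f' x) -> bounded_sums E f' -> bounded_sums E f.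
Proof.
by move=> ff' [M MP]; exists M => s /MP; apply: le_trans; exact: ler_sum.
Qed.

Lemma bounded_sumsD E f f' : bounded_sums E f -> bounded_sums E f' ->
  bounded_sums E (fun x => f x + f' x).
Proof.
by move=> [M MP] [M' MP']; exists (M + M') => s h; rewrite big_split /= lerD ?MP ?MP'.
Qed.

Lemma bounded_sums_coarsen E E' f : (forall x y, E' x y -> E x y) ->
  bounded_sums E' f -> bounded_sums E f.
Proof.
by move=> sub [M MP]; exists M => s h; apply: MP; apply: inequivalent_sub h => x y _ _; exact: sub.
Qed.

End InequivalentLists.

Lemma inequivalent_map (T U : eqType) (E : U -> U -> Prop) (E' : T -> T -> Prop) (h : T -> U) (s : seq T) :
  (forall x y, x \in s -> y \in s -> E (h x) (h y) -> E' x y) ->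
  inequivalent E' s -> inequivalent E (map h s).
Proof.
elim: s => //= x s IH sub [xs hs]; split.
  move=> _ /mapP[y ys ->] /(sub _ _ (mem_head _ _)) xy; apply: (xs y ys); apply: xy.
  by rewrite inE ys orbT.
by apply: IH hs => y z ys zs; apply: sub; rewrite inE ?ys ?zs orbT.
Qed.

(** * The centre, generated by pi_F and units *)

Section Centre.
Variables (F : localField) (d : nat) (D : divAlg F d) (r : nat) (P : cyclicPres D).
Local Notation G := (GL D r).
Local Notation K := (congK D r).
Local Notation vD := (@da_val F d D).
Implicit Types (g h k x y z : G) (i j : 'I_r).

Definition zp (k : int) : G := center_GL P (fun=> k).

Lemma zpD (a b : int) : zp (a + b) = (zp a * zp b)%g.
Proof.
rewrite /zp -center_GL_ppow; congr ppow; apply/funext => i.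
by rewrite mulrDr.
Qed.

Lemma zp0 : zp 0 = 1%g.
Proof.
apply: glm_inj; rewrite glm1; apply/matrixP => i j.
by rewrite ppow_entry !mxE mulr0 expr0z.
Qed.

Lemma zpN (a : int) : zp (- a) = (zp a)^-1%g.
Proof. by apply: (mulgI (zp a)); rewrite -zpD subrr zp0 mulgV. Qed.

Lemma zp_comm (a : int) g : (zp a * g = g * zp a)%g.
Proof. by apply: center_GL_comm => i j; rewrite eqxx. Qed.

Lemma zp_center (a : int) : glcenter D r (zp a).
Proof. by move=> g; exact: zp_comm. Qed.

(** Commuting with a diagonal matrix having a single entry pi_D kills the off-diagonal entries,
    transpositions equate the diagonal ones, and scalar matrices place the common entry in the
    centre F of D. *)
Lemma center_scalar_entries z : glcenter D r z -> exists a : F, forall i j,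
  glm z i j = (a%:A : D) *+ (i == j).
Proof.
move=> zc; have z0 i j : i != j -> glm z i j = 0.
  move=> ij; pose f (t : 'I_r) : D := if t == i then cp_pi P else 1.
  have fu t : f t \is a GRing.unit by rewrite /f; case: eqP => _; [exact: cp_pi_unit|exact: unitr1].
  have := congr1 (fun g => glm g i j) (zc (diag_GL fu)).
  rewrite glm_mul_diag glmM [glm (diag_GL fu)]/(diag_mx _) mul_diag_mx mxE [X in _ = X * _]mxE.
  rewrite /f eqxx eq_sym (negPf ij) mulr1 => e.
  have : (1 - cp_pi P) * glm z i j = 0 by rewrite mulrBl mul1r -e subrr.
  have pi1 : 1 - cp_pi P != 0.
    by rewrite subr_eq0; apply: contraTneq (oner_neq0 int) => e1; rewrite -(da_val_pi P) -e1 (val1 (@da_valP F d D)).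
  by move=> /(congr1 (fun c : D => (1 - cp_pi P)^-1 * c)); rewrite mulKr ?da_div // mulr0.
have zd i j : glm z i i = glm z j j.
  have := congr1 (fun g => glm g i j) (zc (tperm_GL D i j)).
  by rewrite glm_mul_tperm glm_tperm_mul tpermL tpermR.
have [[i0 _]|no] := pselect (exists i : 'I_r, True); last by exists 0 => i; case: no; exists i.
have : glm z i0 i0 \in 'Z({:D})%VS.
  rewrite memv_cap memvf /=; apply/centvP => x _.
  have [->|x0] := eqVneq x 0; first by rewrite mulr0 mul0r.
  have := congr1 (fun g => glm g i0 i0) (zc (@diag_GL _ _ D r (fun=> x) (fun=> da_div x0))).
  by rewrite glm_mul_diag glmM [glm (diag_GL _)]/(diag_mx _) mul_diag_mx !mxE => ->.
rewrite da_central => /vlineP[a aE]; exists a => i j; have [<-|ij] := eqVneq i j.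
  by rewrite mulr1n (zd i i0) aE.
by rewrite mulr0n z0.
Qed.

(** Dividing the scalar z = a by the power of pi_F given by the valuation of a leaves a unit. *)
Lemma center_decomposition z : glcenter D r z -> exists (k : int) u, [/\ K 0 u, glcenter D r u & z = (zp k * u)%g].
Proof.
move=> zc; have [a aE] := center_scalar_entries zc.
pose k := lf_val a; pose u := (zp (- k) * z)%g.
have uc : glcenter D r u by move=> g; rewrite -mulgA zc mulgA zp_comm -mulgA.
exists k, u; split=> //; last by rewrite /u mulgA -zpD subrr zp0 mul1g.
have vDP := @da_valP F d D.
have entry (y : G) (c : D) : (forall i j, glm y i j = c *+ (i == j)) -> c != 0 -> vD c = 0 ->
    mxpw 0 (glm y).
  by move=> yE c0 vc i j; rewrite yE; case: eqP => _; [rewrite mulr1n; right; rewrite vc|rewrite mulr0n; left].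
have [[i0 _]|no] := pselect (exists i : 'I_r, True); last first.
  by apply/congK0P; split=> i; case: no; exists i.
have a0 : a != 0.
  apply: contraTneq (oner_neq0 D) => a0; have := congr1 (fun A : 'M[D]_r => A i0 i0) (glmK z).
  rewrite !mxE eqxx big1 => [e|j _]; first by rewrite negbK; apply/eqP/esym.
  by rewrite aE a0 scale0r mul0rn mul0r.
have aA0 : (a%:A : D) != 0 by rewrite scaler_eq0 oner_eq0 orbF.
have val0 (k' : int) (c : D) : c != 0 -> vD c = d%:Z * k' -> vD (cp_pi P ^ (d%:Z * - k') * c) = 0.
  move=> c0 vc; have pu := unitrXz (d%:Z * - k') (cp_pi_unit P).
  rewrite (valM vDP) //; last by apply: contraTneq pu => ->; rewrite unitr0.
  by rewrite (valXz vDP) ?cp_pi_unit // da_val_pi vc; ring.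
have nz (k' : int) (c : D) : c != 0 -> cp_pi P ^ (d%:Z * - k') * c != 0.
  move=> c0; apply: (val_mul_neq0 vDP) => //.
  by have pu := unitrXz (d%:Z * - k') (cp_pi_unit P); apply: contraTneq pu => ->; rewrite unitr0.
have aVE i j : glm z^-1%g i j = (a%:A : D)^-1 *+ (i == j).
  have := congr1 (fun A : 'M[D]_r => A i j) (glmK z); rewrite !mxE (bigD1 i) //= big1 ?addr0.
    rewrite aE eqxx mulr1n => e; have := congr1 (fun c : D => (a%:A : D)^-1 * c) e.
    by rewrite /= -glmVE mulKr ?da_div // => ->; rewrite mulr_natr.
  by move=> t ti; rewrite aE eq_sym (negPf ti) mulr0n mul0r.
apply/congK0P; split.
  apply: (entry u (cp_pi P ^ (d%:Z * - k) * a%:A)); last exact/val0/da_val_alg.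
    move=> i j; rewrite glmM ppowE mul_diag_mx mxE [X in X * _]mxE aE.
    by rewrite -mulrnAr.
  exact: nz.
have -> : u^-1%g = (zp (- - k) * z^-1)%g by rewrite /u invMg -zpN zp_comm.
have aV0 : (a%:A : D)^-1 != 0 by rewrite invr_neq0.
apply: (entry _ (cp_pi P ^ (d%:Z * - - k) * (a%:A)^-1)); last first.
- apply: val0 => //; rewrite (valV vDP) ?da_div // da_val_alg //; by ring.
- exact: nz.
move=> i j; rewrite glmM ppowE mul_diag_mx mxE [X in X * _]mxE aVE.
by rewrite -mulrnAr.
Qed.

End Centre.

Section CentralCharacter.
Variables (R : realType) (F : localField) (d : nat) (D : divAlg F d) (r : nat).
Variables (P : cyclicPres D) (pi : smoothRep R D r).
Hypothesis irr : irreducible pi.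
Local Notation G := (GL D r).
Local Notation K := (congK D r).
Local Notation act := (rep_act pi).
Implicit Types (g h k x y z : G) (c : R[i]) (v : pi).

Lemma center_acts z : glcenter D r z -> exists c, forall v, act z v = c *: v.
Proof.
move=> zc; have [g v _|c cP] := maximal_scalar P irr (maximalP0 irr) (PI0 z).
  by rewrite -!rep_actM zc /= subrr.
by exists c => v; apply: subr0_eq; exact: cP.
Qed.

Lemma scalar_inj v c c' : v != 0 -> c *: v = c' *: v -> c = c'.
Proof.
move=> v0 cv; apply: subr0_eq; apply: contraTeq v0 => cc.
by rewrite negbK -(scalerK cc v) scalerBl cv subrr scaler0.
Qed.

(** The powers of z lie in K^0, which has finitely many cosets modulo a K^n fixing v. Two powers
    therefore agree on v, and c is a root of unity. *)
Lemma unit_center_norm z c : K 0 z -> (forall v, act z v = c *: v) -> `|c| = 1.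
Proof.
move=> z0 zc; have [[v v0] _] := irr; have [n vn] := rep_smoothP v.
have [s [_ sP]] := congK0_finite r P n.
have zK i : K 0 (z ^+ i)%g.
  by elim: i => [|i IH]; [exact: congK1|rewrite expgS; exact: congKM].
have zi i : act (z ^+ i)%g v = c ^+ i *: v.
  elim: i => [|i IH]; first by rewrite rep_act1 scale1r.
  by rewrite expgSr rep_actM zc linearZZ IH scalerA exprS.
have /choice[x xP] i : exists x, x \in s /\ K n (x^-1 * z ^+ i)%g.
  by have [x xs xz] := sP _ (zK i); exists x.
pose f (i : 'I_(size s).+1) := x i.
have [i [j [ij fij]]] : exists i j : 'I_(size s).+1, (i < j)%N /\ f i = f j.
  apply: contrapT => no; have fI : injective f.
    move=> i j fij; apply: val_inj; case: (ltngtP i j) => // ij; exfalso; apply: no.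
      by exists i, j.
    by exists j, i.
  have := uniq_leq_size (_ : uniq (map f (enum 'I_(size s).+1))) (s2 := s).
  rewrite map_inj_uniq // enum_uniq size_map size_enum_ord ltnn => h.
  by have : false by apply: h => // _ /mapP[i _ ->]; have [] := xP i.
have xz (k : nat) : act (z ^+ k)%g v = act (x k) v.
  by have [_ /vn h] := xP k; rewrite -[in RHS]h -rep_actM mulKVg.
have cij : c ^+ i = c ^+ j by apply: (scalar_inj v0); rewrite -!zi !xz -/(f i) fij.
have c0 : c != 0.
  apply: contraTneq v0 => c0; have := actK z v; rewrite zc c0 scale0r linear0 => <-.
  by rewrite negbK.
have : `|c| ^+ (j - i) = 1.
  rewrite -normrX; have : c ^+ (j - i) = 1; last by move=> ->; rewrite normr1.
  by apply: (mulfI (expf_neq0 i c0)); rewrite -exprD subnKC ?(ltnW ij) // mulr1.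
by move=> /eqP; rewrite pexpr_eq1 // ?subn_gt0 // => /eqP.
Qed.

Lemma zp_norm c : (forall v, act (zp r P 1) v = c *: v) -> `|c| = 1 ->
  forall (a : int) c', (forall v, act (zp r P a) v = c' *: v) -> `|c'| = 1.
Proof.
move=> c1 nc; have [[v v0] _] := irr.
have step (a : int) ca cb : (forall v, act (zp r P a) v = ca *: v) ->
    (forall v, act (zp r P (a + 1)) v = cb *: v) -> cb = ca * c.
  move=> ha hb; apply: (scalar_inj v0).
  by rewrite -hb zpD rep_actM c1 linearZZ ha scalerA mulrC.
elim/int_rect => [|n IH|n IH] c' hc.
- have -> : c' = 1; last exact: normr1.
  by apply: (scalar_inj v0); rewrite -hc zp0 rep_act1 scale1r.
- have [ca ha] := center_acts (zp_center P n).
  have -> : c' = ca * c by apply: (step n _ _ ha) => u; rewrite -hc; congr (act (zp r P _) u); lia.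
  by rewrite normrM IH // nc mulr1.
have [ca ha] := center_acts (zp_center P (- n%:Z)).
have h : ca = c' * c.
  by apply: (step (- n.+1%:Z) _ _ hc) => u; rewrite -ha; congr (act (zp r P _) u); lia.
by have := IH _ ha; rewrite h normrM nc mulr1.
Qed.

Lemma unitary_criterion : unitary_central_char pi <->
  exists c, `|c| = 1 /\ forall v, act (zp r P 1) v = c *: v.
Proof.
split=> [/(_ _ (zp_center P 1))[c c1 cP]|[c [c1 cP]] z zc]; first by exists c.
have [a [u [u0 uc ->]]] := center_decomposition P zc.
have [ca ha] := center_acts (zp_center P a); have [cu hu] := center_acts uc.
exists (ca * cu); last by move=> v; rewrite rep_actM hu linearZZ ha scalerA mulrC.
by rewrite normrM (zp_norm cP c1 ha) (unit_center_norm u0 hu) mulr1.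
Qed.

End CentralCharacter.

(** * Integrals over the quotient by the centre *)

Section QuotientMeasure.
Variables (R : realType) (F : localField) (d : nat) (D : divAlg F d) (r : nat).
Variables (mu : haarMeasures R D r) (P : cyclicPres D) (n : nat).
Local Notation G := (GL D r).
Local Notation K := (congK D r).
Local Notation Z := (glcenter D r).
Local Notation B := (borelPGL D r).
Implicit Types (g h k x y z : G) (s : seq G).

Lemma center1 : Z 1%g. Proof. by move=> g; rewrite mul1g mulg1. Qed.

Lemma centerM z z' : Z z -> Z z' -> Z (z * z')%g.
Proof. by move=> zc zc' g; rewrite -mulgA (zc' g) mulgA (zc g) -mulgA. Qed.

Lemma centerV z : Z z -> Z z^-1%g.
Proof. by move=> zc g; apply: (mulgI z); rewrite mulgA mulgV mul1g mulgA zc mulgK. Qed.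

Definition eqvZ x y := exists2 z, Z z & K n ((z * x)^-1 * y)%g.

Lemma eqvZ_refl x : eqvZ x x.
Proof. by exists 1%g; [exact: center1|rewrite mul1g mulVg; exact: congK1]. Qed.

Lemma eqvZ_sym x y : eqvZ x y -> eqvZ y x.
Proof.
move=> [z zc /coset_sym zxy]; exists z^-1%g; first exact: centerV.
by rewrite invMg invgK -mulgA.
Qed.

Lemma eqvZ_trans x y w : eqvZ x y -> eqvZ y w -> eqvZ x w.
Proof.
move=> [z zc zxy] [z' zc' zyw]; exists (z' * z)%g; first exact: centerM.
have -> : ((z' * z * x)^-1 * w = ((z * x)^-1 * y) * ((z' * y)^-1 * w))%g.
  by rewrite !invMg !mulgA mulgK.
exact: congKM.
Qed.

Definition cellZ x : set B := [set y | eqvZ x y].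

Lemma open_cellZ_inv (U : set G) : (forall x k, U x -> K n k -> U (x * k)%g) ->
  (forall z x, Z z -> U x -> U (z * x)%g) -> measurable (U : set B).
Proof.
move=> UK UZ; apply: sub_sigma_algebra; split; last by move=> z g; exact: UZ.
by apply/gl_openP => g Ug; exists n => k; exact: UK.
Qed.

Lemma measurable_cellZ x : measurable (cellZ x).
Proof.
apply: open_cellZ_inv => [y k [z zc zxy] kn|z y zc [z' zc' zxy]].
  by exists z => //; rewrite mulgA; exact: congKM.
exists (z * z')%g; first exact: centerM.
by move: zxy; rewrite !invMg !mulgA mulgVK.
Qed.

Lemma measure_cellZ x : hm_Z mu (cellZ x) = hm_Z mu (cellZ 1%g).
Proof.
rewrite -(hm_Z_inv mu x (measurable_cellZ 1%g)); congr (hm_Z mu _).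
apply/seteqP; split=> y; last first.
  move=> [w [z zc zw] <-]; exists z => //.
  by rewrite mulg1 in zw; rewrite zc invMg -!mulgA mulKg.
move=> [z zc zxy]; exists (x^-1 * y)%g; last by rewrite mulKVg.
by exists z => //; rewrite mulg1 mulgA -invMg -zc.
Qed.

Lemma cellZ_finite : (hm_Z mu (cellZ 1%g) < +oo)%E.
Proof.
have := hm_Z_compact mu (@compact_congK _ _ _ r P n); congr (hm_Z mu _ < _)%E.
apply/seteqP; split=> y /=.
  by move=> [z zc [x xn <-]]; exists z => //; rewrite mulg1 mulKg.
move=> [z zc]; rewrite mulg1 => zy; exists z => //; exists (z^-1 * y)%g => //.
by rewrite mulKVg.
Qed.

Definition dense_seq : nat -> G := projT1 (cid (congK_dense_sequence r P)).

Lemma dense_seqP g : exists i, eqvZ (dense_seq i) g.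
Proof.
have [i iP] := projT2 (cid (congK_dense_sequence r P)) g n.
by exists i, 1%g; [exact: center1|rewrite mul1g].
Qed.

(** Keeping only first occurrences turns the countable cover of G by cells Z x K^n into a
    partition. *)
Definition repeated i := `[< exists2 j, (j < i)%N & eqvZ (dense_seq j) (dense_seq i) >].

Lemma first_occurrences m N :
  inequivalent eqvZ [seq dense_seq i | i <- index_iota m N & ~~ repeated i].
Proof.
rewrite /index_iota; move: (N - m)%N => k; elim: k m => //= k IH m; case: ifP => //= rm; split=> // y.
move=> /mapP[j]; rewrite mem_filter mem_iota => /andP[/asboolPn rj /andP[mj _]] -> emj.
by apply: rj; exists m.
Qed.

Definition partZ i : set B := if repeated i then set0 else cellZ (dense_seq i).

Lemma partZ_measurable i : measurable (partZ i).
Proof. by rewrite /partZ; case: ifP => _; [exact: measurable0|exact: measurable_cellZ]. Qed.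

Lemma partZ_cover : \bigcup_i partZ i = setT.
Proof.
apply/seteqP; split=> // x _; have ex : exists i, `[< eqvZ (dense_seq i) x >].
  by have [i ix] := dense_seqP x; exists i; exact/asboolP.
case: (ex_minnP ex) => i /asboolP ix imin; exists i => //; rewrite /partZ ifF //.
apply/asboolPn => -[j ji eji]; have := imin j; rewrite leqNgt ji => h.
by have : false by apply/h/asboolP/eqvZ_trans/ix.
Qed.

Lemma partZ_triv : trivIset setT partZ.
Proof.
apply/trivIsetP => i j _ _ ij; apply/seteqP; split=> // x; rewrite /partZ => -[].
case: ifP => // /asboolPn ri xi; case: ifP => // /asboolPn rj xj.
have eij := eqvZ_trans xi (eqvZ_sym xj); case: (ltngtP i j) => e.
- by apply: rj; exists i.
- by apply: ri; exists j => //; exact: eqvZ_sym.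
by rewrite e eqxx in ij.
Qed.

(** Countably many cells of equal measure cover G, whose measure is not 0. *)
Lemma cellZ_gt0 : (0 < hm_Z mu (cellZ 1%g))%E.
Proof.
rewrite lt0e measure_ge0 andbT; apply/eqP => c0; have T0 := @hm_Z_neq0 _ _ _ _ _ mu; apply: T0.
rewrite -partZ_cover measure_bigcup //; last first.
- exact: partZ_triv.
- by move=> i _; exact: partZ_measurable.
rewrite eseries0 // => i _ _; rewrite /partZ; case: ifP => _; first exact: measure0.
by rewrite measure_cellZ.
Qed.

Variable q : G -> R.
Hypotheses (q0 : forall x, 0 <= q x) (qK : forall x k, K n k -> q (x * k)%g = q x)
  (qZ : forall z x, Z z -> q (z * x)%g = q x).

Lemma eqvZ_fun x y : eqvZ x y -> q y = q x.
Proof. by move=> [z zc /(qK (z * x)%g)]; rewrite mulKVg qZ. Qed.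

Lemma measurable_fun_cellZ (A : set B) : measurable A ->
  let f : B -> \bar R := fun x => (q x)%:E in measurable_fun A f.
Proof.
move=> mA /=; apply: (@measurable_funS _ _ _ _ setT) => // _ Y _; rewrite setTI.
by apply: open_cellZ_inv => [x k /= Yx kn|z x zc /= Yx]; [rewrite qK|rewrite qZ].
Qed.

Lemma integral_cellZ x : (\int[hm_Z mu]_(g in cellZ x) (q g)%:E = (q x)%:E * hm_Z mu (cellZ 1%g))%E.
Proof.
rewrite -(measure_cellZ x) -integral_cst; last exact: measurable_cellZ.
by apply: eq_integral => y; rewrite inE => /eqvZ_fun ->.
Qed.

Lemma inequivalent_uniq s : inequivalent eqvZ s -> uniq s.
Proof.
elim: s => //= x s IH [xs /IH ->]; rewrite andbT; apply/negP => /xs; apply; exact: eqvZ_refl.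
Qed.

Lemma inequivalent_neq s x y : inequivalent eqvZ s -> x \in s -> y \in s -> eqvZ x y -> x = y.
Proof.
elim: s => //= a s IH [as_ h]; rewrite !inE => /orP[/eqP ->|xs] /orP[/eqP ->|ys] // xy.
- by case: (as_ _ ys).
- by case: (as_ _ xs); exact: eqvZ_sym.
exact: IH.
Qed.

(** The cells share a measure c with 0 < c < oo and q is constant on each of them, so the integral
    is c times the sum of q over the cells. *)
Lemma integral_bounded_sums : (\int[hm_Z mu]_g (q g)%:E < +oo)%E <-> bounded_sums eqvZ q.
Proof.
have [c cE] : exists c : R, hm_Z mu (cellZ 1%g) = c%:E.
  by exists (fine (hm_Z mu (cellZ 1%g))); rewrite fineK // ge0_fin_numE ?cellZ_finite // measure_ge0.
have c0 : 0 < c by rewrite -lte_fin -cE; exact: cellZ_gt0.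
split=> [fin|[M MP]].
- have [I IE] : exists I : R, (\int[hm_Z mu]_g (q g)%:E = I%:E)%E.
    exists (fine (\int[hm_Z mu]_g (q g)%:E)); rewrite fineK // ge0_fin_numE //.
    by apply: integral_ge0 => x _; rewrite lee_fin.
  exists (I / c) => s hs; rewrite ler_pdivlMr // -lee_fin -IE.
  apply: (@le_trans _ _ (\int[hm_Z mu]_(g in \big[setU/set0]_(x <- s) cellZ x) (q g)%:E)%E); last first.
    apply: ge0_subset_integral => //.
    + by apply: bigsetU_measurable => x _; exact: measurable_cellZ.
    + exact: measurable_fun_cellZ.
    + by move=> x _; rewrite lee_fin.
  rewrite ge0_integral_bigsetU.
  + rewrite mulr_suml -sumEFin [X in (_ <= X)%E](eq_bigr (fun x => (q x * c)%:E)) // => x _.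
    by rewrite integral_cellZ cE.
  + by move=> x; exact: measurable_cellZ.
  + exact: inequivalent_uniq hs.
  + apply/trivIsetP => x y xs ys xy; apply/seteqP; split=> // w [xw yw].
    by case/eqP: xy; apply: (inequivalent_neq hs xs ys); apply: eqvZ_trans xw _; exact: eqvZ_sym.
  + by apply: measurable_fun_cellZ; apply: bigsetU_measurable => x _; exact: measurable_cellZ.
  + by move=> x _; rewrite lee_fin.
rewrite -partZ_cover ge0_integral_bigcup.
- apply: (@le_lt_trans _ _ (M * c)%:E); last exact: ltry.
  have term i : (\int[hm_Z mu]_(g in partZ i) (q g)%:E =
      (if repeated i then 0 else q (dense_seq i) * c)%:E)%E.
    rewrite /partZ; case: ifP => _; first by rewrite integral_set0.
    by rewrite integral_cellZ cE.
  apply: lime_le.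
    by apply: is_cvg_nneseries => i _ _; apply: integral_ge0 => x _; rewrite lee_fin.
  near=> N; under eq_bigr do rewrite term.
  rewrite sumEFin lee_fin.
  have -> : \sum_(0 <= i < N) (if repeated i then 0 else q (dense_seq i) * c) =
      (\sum_(x <- [seq dense_seq i | i <- index_iota 0 N & ~~ repeated i]) q x) * c.
    rewrite big_map big_filter mulr_suml [RHS]big_mkcond.
    by apply: eq_bigr => i _; case: (repeated i).
  apply: ler_wpM2r; first exact: ltW.
  by apply: MP; exact: first_occurrences.
- exact: partZ_measurable.
- by apply: measurable_fun_cellZ; rewrite partZ_cover; exact: measurableT.
- by move=> x _; rewrite lee_fin.
- exact: partZ_triv.
Unshelve. all: by end_near.
Qed.

End QuotientMeasure.

(** * Sums over double cosets modulo the powers of pi_F *)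

Section CosetSums.
Variables (R : realType) (F : localField) (d : nat) (D : divAlg F d) (r : nat).
Variables (mu : haarMeasures R D r) (P : cyclicPres D).
Hypothesis r_gt0 : (0 < r)%N.
Local Notation G := (GL D r).
Local Notation K := (congK D r).
Local Notation Z := (glcenter D r).
Local Notation zp := (zp r P).
Implicit Types (g h k x y z : G) (s : seq G) (n l : nat) (a b : int) (q : G -> R).

Definition eqv0 n x y := exists a, K n ((zp a * x)^-1 * y)%g.

Definition deqv l x y := exists a, dcoset (K l) (zp a * x)%g y.

Lemma size_inequivalent (E : G -> G -> Prop) s reps (f : G -> G) : inequivalent E s ->
  (forall x, x \in s -> f x \in reps) ->
  (forall x y, x \in s -> y \in s -> f x = f y -> E x y) -> (size s <= size reps)%N.
Proof.
move=> hs fr fE; rewrite -(size_map f); apply: uniq_leq_size; last first.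
  by move=> _ /mapP[x xs ->]; exact: fr.
elim: s hs {fr} fE => //= x s IH [xs hs] fE; rewrite IH // ?andbT; last first.
  by move=> y w ys ws; apply: fE; rewrite inE ?ys ?ws orbT.
apply/negP => /mapP[y ys xy]; apply: (xs y ys).
by apply: fE xy; rewrite inE ?eqxx // ys orbT.
Qed.

(** u labels the members of an E-class by elements of K^0 whose cosets modulo K^n determine the
    E'-class, so the index of K^n in K^0 bounds the number of E'-classes. *)
Lemma bounded_sums_index (E E' : G -> G -> Prop) n q : (forall x, E x x) ->
  (forall x y, E x y -> q y = q x) -> (forall x, 0 <= q x) ->
  (forall x, exists u : G -> G, (forall y, E x y -> K 0 (u y)) /\
     forall y y', E x y -> E x y' -> K n ((u y)^-1 * u y')%g -> E' y y') ->
  bounded_sums E q -> bounded_sums E' q.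
Proof.
move=> Er qE q0 uP bq; have [reps [reps0 repsP]] := congK0_finite r P n.
apply: (@bounded_sums_refine _ _ E E' (fun=> size reps)) => //; last first.
  by apply: bounded_sums_scale => //; exact: ler0n.
move=> x s hs sx; have [u [u0 uE]] := uP x.
have /choice[f fP] y : exists w, E x y -> w \in reps /\ K n (w^-1 * u y)%g.
  have [xy|nxy] := pselect (E x y); last by exists 1%g.
  by have [w wr wy] := repsP _ (u0 _ xy); exists w.
apply: (size_inequivalent (f := f) hs) => [y /sx xy|y y' /sx xy /sx xy' ff].
  by have [] := fP _ xy.
apply: uE => //; have [_ h] := fP _ xy; have [_ h'] := fP _ xy'.
by apply: coset_trans (coset_sym h) _; rewrite ff.
Qed.

Lemma eqv0_refl n x : eqv0 n x x.
Proof. by exists 0; rewrite zp0 mul1g mulVg; exact: congK1. Qed.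

Lemma eqv0_eqvZ n x y : eqv0 n x y -> eqvZ n x y.
Proof. by case=> a h; exists (zp a) => //; exact: zp_center. Qed.

Lemma eqv0E n x y : eqv0 n x y <-> exists a k, K n k /\ y = (zp a * x * k)%g.
Proof.
split=> [[a h]|[a [k [kn ->]]]]; last by exists a; rewrite mulKg.
by exists a, ((zp a * x)^-1 * y)%g; rewrite mulKVg.
Qed.

(** The central units lie in K^0, so by [center_decomposition] a class modulo the centre splits into
    finitely many classes modulo the powers of pi_F. *)
Lemma eqvZ_sums n q : (forall x, 0 <= q x) -> (forall x k, K n k -> q (x * k)%g = q x) ->
  (forall z x, Z z -> q (z * x)%g = q x) ->
  bounded_sums (eqvZ n) q <-> bounded_sums (eqv0 n) q.
Proof.
move=> q0 qK qZ; split; last by apply: bounded_sums_coarsen => x y; exact: eqv0_eqvZ.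
apply: (@bounded_sums_index _ _ n) => // [x|x y|x]; [exact: eqvZ_refl|exact: eqvZ_fun|].
have /choice[u uP] y : exists u, eqvZ n x y -> [/\ K 0 u, Z u &
    exists a k, K n k /\ y = (zp a * u * x * k)%g].
  have [[z zc h]|nxy] := pselect (eqvZ n x y); last by exists 1%g.
  have [a [u [u0 uc zE]]] := center_decomposition P zc; exists u => _; split=> //.
  by exists a, ((z * x)^-1 * y)%g; split; rewrite // -zE mulKVg.
exists u; split=> [y /uP[]//|y y' /uP[_ uc [a [k [kn yE]]]] /uP[_ uc' [a' [k' [kn' yE']]]] vK].
have vc : Z ((u y)^-1 * u y')%g by apply: centerM => //; exact: centerV.
have vE : u y' = (u y * ((u y)^-1 * u y'))%g by rewrite mulKVg.
move: ((u y)^-1 * u y')%g vK vc vE => v vK vc vE; rewrite vE in yE'; clear vE.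
apply/eqv0E; exists (a' - a), (k^-1 * v * k')%g; split.
  by apply: congKM => //; apply: congKM => //; exact: congKV.
by rewrite {1}yE' {2}yE !mulgA mulgK -zpD subrK -(mulgA _ v x) (vc x) !mulgA.
Qed.

Lemma eqv0_sums_le n n' q : (n <= n')%N -> (forall x, 0 <= q x) ->
  (forall x k, K n k -> q (x * k)%g = q x) -> (forall a x, q (zp a * x)%g = q x) ->
  bounded_sums (eqv0 n) q -> bounded_sums (eqv0 n') q.
Proof.
move=> nn' q0 qK qZ.
apply: (@bounded_sums_index _ _ n') => // [x|x y|x].
- exact: eqv0_refl.
- by move=> /eqv0E[a [k [kn ->]]]; rewrite qK ?qZ.
have /choice[u uP] y : exists u, eqv0 n x y -> K n u /\ exists a, y = (zp a * x * u)%g.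
  have [/eqv0E[a [k [kn ->]]]|?] := pselect (eqv0 n x y); last by exists 1%g.
  by exists k; split=> //; exists a.
exists u; split=> [y /uP[un _]|y y' /uP[un [a yE]] /uP[un' [a' yE']] uu']; first exact: congK_le un.
apply/eqv0E; exists (a' - a), ((u y)^-1 * u y')%g; split=> //.
by rewrite {1}yE' {1}yE !mulgA mulgK -zpD subrK.
Qed.

(** Right translation by h replaces K^n by a conjugate, whence the new level n'; a deeper N bounds
    the number of new classes in an old one. *)
Lemma eqv0_sums_translate n q g h : (forall x, 0 <= q x) ->
  (forall x k, K n k -> q (x * k)%g = q x) -> (forall a x, q (zp a * x)%g = q x) ->
  bounded_sums (eqv0 n) q -> exists n', (forall k, K n' k -> K n (h^-1 * k * h)%g) /\
    bounded_sums (eqv0 n') (fun x => q (g * x * h)%g).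
Proof.
move=> q0 qK qZ bq; have [n' n'P] := congK_conj h n; exists n'; split=> //.
pose E' x y := eqv0 n' (g^-1 * x * h^-1)%g (g^-1 * y * h^-1)%g.
have [N NP] := congK_conj h^-1%g n'; rewrite invgK in NP.
have [M MP] : bounded_sums E' q.
  apply: (@bounded_sums_index _ _ N) bq => // [x|x y|x].
  - exact: eqv0_refl.
  - by move=> /eqv0E[a [k [kn ->]]]; rewrite qK ?qZ.
  have /choice[u uP] y : exists u, eqv0 n x y -> K n u /\ exists a, y = (zp a * x * u)%g.
    have [/eqv0E[a [k [kn ->]]]|?] := pselect (eqv0 n x y); last by exists 1%g.
    by exists k; split=> //; exists a.
  exists u; split=> [y /uP[un _]|y y' /uP[un [a yE]] /uP[un' [a' yE']] uu'].
    exact: congK_le un.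
  apply/eqv0E; exists (a' - a), (h * ((u y)^-1 * u y') * h^-1)%g; split; first exact: NP.
  have : y' = (zp (a' - a) * y * ((u y)^-1 * u y'))%g.
    by rewrite {1}yE' {1}yE !mulgA mulgK -zpD subrK.
  move: ((u y)^-1 * u y')%g => w ->.
  by rewrite !mulgA mulgVK -(zp_comm P _ g^-1%g).
exists M => s hs; have := MP [seq (g * x * h)%g | x <- s]; rewrite big_map; apply.
have c w : (g^-1 * (g * w * h) * h^-1 = w)%g by rewrite !mulgA mulVg mul1g mulgK.
by apply: inequivalent_map hs => x y _ _; rewrite /E' !c.
Qed.

(* Multiplication by zp a shifts the valuations of the entries. *)
Lemma zp_dcoset0 a y k k' : K 0 k -> K 0 k' -> (zp a * y = k * y * k')%g -> a = 0.
Proof.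
move=> k0 k'0; have d0 := da_degree_gt0 D.
suff pos b g w w' : 0 < b -> K 0 w -> K 0 w' -> (zp b * g = w * g * w')%g -> False.
  move=> e; have [a0|a0|//] := ltrgtP a 0; last by case: (pos _ _ _ _ a0 k0 k'0 e).
  have a0' : 0 < - a by rewrite oppr_gt0.
  case: (pos _ (zp a * y)%g _ _ a0' (congKV k0) (congKV k'0)).
  by rewrite mulgA -zpD addNr zp0 mul1g e mulgA mulKg mulgK.
move=> b0 w0 w'0 e; have [N gN] := mxpw_exists (glm g).
have [wi wVi] := (congK0P w).1 w0; have [w'i w'Vi] := (congK0P w').1 w'0.
have vDP := @da_valP F d D.
have step (m : int) : mxpw m (glm g) -> mxpw (m + d%:Z * b) (glm g).
  move=> mg; have : mxpw (m + d%:Z * b) (glm (zp b * g)%g).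
    move=> i j; rewrite glmM ppowE mul_diag_mx mxE [X in pw _ _ (X * _)]mxE addrC.
    apply: (pwM vDP) => //; right.
    by rewrite (valXz vDP) ?cp_pi_unit // da_val_pi mulr1.
  rewrite e => h; have -> : g = (w^-1 * (w * g * w') * w'^-1)%g by rewrite !mulgA mulVg mul1g mulgK.
  by rewrite !glmM mulmxA in h *; apply: mxpwMr w'Vi; rewrite -!mulmxA; apply: mxpwMl; rewrite // mulmxA.
have big (j : nat) : mxpw (- N%:Z + j%:Z) (glm g).
  elim: j => [|j IH]; first by rewrite addr0.
  by apply: mxpw_le (step _ IH); nia.
have g0 : glm g = 0.
  by apply: mxpw_prop0 => j; have := big (N + j)%N; rewrite PoszD addKr.
have := congr1 (fun A : 'M[D]_r => A (Ordinal r_gt0) (Ordinal r_gt0)) (glmK g).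
rewrite g0 mul0mx !mxE eqxx => /eqP; rewrite eq_sym.
by rewrite (negPf (oner_neq0 D)).
Qed.

Lemma deqv_refl l x : deqv l x x.
Proof. by exists 0; rewrite zp0 mul1g; exact: dcoset_refl. Qed.

Lemma dcoset_zp l a x y : dcoset (K l) (zp a * x)%g (zp a * y)%g <-> dcoset (K l) x y.
Proof.
split=> /dcosetP[k [k' [kl kl' e]]]; apply/dcosetP; exists k, k'; split=> //.
  by apply: (mulgI (zp a)); rewrite e !mulgA (zp_comm P a k).
by rewrite e !mulgA (zp_comm P a k).
Qed.

Lemma dcoset_zpN l a x y : dcoset (K l) (zp a * x)%g y -> dcoset (K l) x (zp (- a) * y)%g.
Proof. by move=> h; apply/(dcoset_zp l a); rewrite mulgA -zpD subrr zp0 mul1g. Qed.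

Lemma inequivalent_cat (E : G -> G -> Prop) s s' : inequivalent E s -> inequivalent E s' ->
  (forall x y, x \in s -> y \in s' -> ~ E x y) -> inequivalent E (s ++ s').
Proof.
elim: s => //= x s IH [xs hs] hs' xy; split=> [y|].
  by rewrite mem_cat => /orP[/xs//|]; apply: xy; rewrite mem_head.
by apply: IH => // y w ys; apply: xy; rewrite inE ys orbT.
Qed.

Lemma uniq_inequivalent (E : G -> G -> Prop) s : uniq s ->
  (forall x y, x \in s -> y \in s -> E x y -> x = y) -> inequivalent E s.
Proof.
elim: s => //= x s IH /andP[xs us] sE; split.
  move=> y ys xy; case/negP: xs; have -> : x = y => //.
  by apply: sE => //; [exact: mem_head|rewrite in_cons ys orbT].
by apply: IH => // y w ys ws; apply: sE; rewrite in_cons ?ys ?ws orbT.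
Qed.

(** The double coset of x consists of vol(K x K) / vol(K) cosets on which q is constant. By
    [zp_dcoset0] they stay inequivalent modulo the powers of pi_F. *)
Lemma eqv0_deqv_sums l q : (forall x, 0 <= q x) ->
  (forall x k, K l k -> q (x * k)%g = q x) -> (forall x k, K l k -> q (k * x)%g = q x) ->
  (forall a x, q (zp a * x)%g = q x) ->
  bounded_sums (eqv0 l) q <-> bounded_sums (deqv l) (fun x => dvol mu l x * q x).
Proof.
move=> q0 qK qK' qZ; have v0 := vol_gt0 mu P l.
have /choice[cs csP] x : exists s, cosets l s (dcoset (K l) x) by exact: dcoset_cosets.
have volE x : dvol mu l x = (size (cs x))%:R * vol mu l by exact: dvolE.
have qd x y : dcoset (K l) x y -> q y = q x.
  by move=> /dcosetP[k [k' [kl kl' ->]]]; rewrite qK ?qK'.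
have qde x y : deqv l x y -> q y = q x by move=> [a /qd ->]; rewrite qZ.
split=> [[M MP]|bq].
  exists (vol mu l * M) => s hs.
  have hd x y : x \in s -> y \in s -> deqv l x y -> True by [].
  suff [t [tE tD tS]] : exists t, [/\ inequivalent (eqv0 l) t,
      forall y, y \in t -> exists2 x, x \in s & dcoset (K l) x y &
      \sum_(x <- s) dvol mu l x * q x = vol mu l * \sum_(y <- t) q y].
    by rewrite tS ler_wpM2l ?MP // ltW.
  elim: s hs {hd} => [_|x s IH /= [xs /IH[t [tE tD tS]]]].
    by exists [::]; rewrite !big_nil mulr0.
  have [us sD sinj _] := csP x; exists (cs x ++ t); split.
  - apply: inequivalent_cat => // [|y w ys /tD[x' x's x'w] /eqv0E[a [k [kl wE]]]].
      apply: uniq_inequivalent => // y w ycs wcs /eqv0E[a [k [kl wE]]].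
      have a0 : a = 0.
        have /dcosetP[c [c' [cl cl' e]]] := dcoset_trans (dcoset_sym (sD _ ycs)) (sD _ wcs).
        have l0 := congK_le (leq0n l).
        apply: (@zp_dcoset0 a y c (c' * k^-1)%g); [exact: l0|exact/l0/congKM/congKV|].
        by rewrite !mulgA -e wE mulgK.
      by apply: sinj => //; rewrite wE a0 zp0 mul1g mulKg.
    apply: (xs x' x's); exists a; apply: dcoset_trans (dcoset_sym x'w).
    by rewrite wE; apply: dcoset_closed => //; apply/dcoset_zp; exact: sD.
  - move=> y; rewrite mem_cat => /orP[/sD|/tD[x' x's x'y]]; first by exists x; rewrite ?mem_head.
    by exists x'; rewrite // inE x's orbT.
  rewrite big_cons big_cat mulrDr tS; congr (_ + _).
  rewrite volE (eq_big_seq (fun=> q x)); last by move=> y /sD /qd.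
  by rewrite big_const_seq count_predT iter_addr_0 -[X in _ = _ * X]mulr_natl mulrA [_ * vol _ _]mulrC.
apply: (@bounded_sums_refine _ _ (deqv l) _ (fun x => size (cs x))) => //.
- exact: deqv_refl.
- move=> x s hs sx.
  have /choice[f fP] y : exists w, deqv l x y -> w \in cs x /\ exists a, K l (w^-1 * (zp a * y))%g.
    have [[a xy]|?] := pselect (deqv l x y); last by exists 1%g.
    have [_ _ _ cov] := csP x; have [w wc wy] := cov _ (dcoset_zpN xy).
    by exists w => _; split=> //; exists (- a).
  apply: (size_inequivalent (f := f) hs) => [y /sx xy|y y' /sx xy /sx xy' ff].
    by have [] := fP _ xy.
  have [_ [a h]] := fP _ xy; have [_ [a' h']] := fP _ xy'; rewrite ff in h.
  have := coset_trans (coset_sym h) h'.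
  exists (a - a'); rewrite zpD zpN (zp_comm P a).
  by move: H; rewrite !invMg !invgK !mulgA.
have -> : (fun x => (size (cs x))%:R * q x) = (fun x => (vol mu l)^-1 * (dvol mu l x * q x)).
  apply/funext => x; by rewrite volE [_%:R * vol _ _]mulrC !mulrA mulVf ?mul1r ?lt0r_neq0.
by apply: bounded_sums_scale => //; rewrite invr_ge0 ltW.
Qed.

End CosetSums.

(** * Criteria on coefficients of K^l-fixed vectors and forms *)

Section Criteria.
Variables (R : realType) (F : localField) (d : nat) (D : divAlg F d) (r : nat).
Variables (mu : haarMeasures R D r) (P : cyclicPres D) (pi : smoothRep R D r) (l : nat).
Hypotheses (r_gt0 : (0 < r)%N) (irr : irreducible pi).
Hypothesis pil : exists2 v, fixed pi (congK D r l) v & v != 0.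
Local Notation G := (GL D r).
Local Notation K := (congK D r).
Local Notation Z := (glcenter D r).
Local Notation zp := (zp r P).
Local Notation act := (rep_act pi).
Implicit Types (g h k x y z : G) (f : pi -> R[i]) (v : pi) (c : R[i]) (a : int).

Definition fixed_form f := linear_on setT f /\ forall k u, K l k -> f (act k u) = f u.

Lemma fixed_form_smooth f (ff : fixed_form f) : smooth_form (mkform ff.1).
Proof.
apply/gl_openP => g gf; exists l => k kl v /=.
by rewrite rep_actM -[LHS]/(mkform ff.1 _) gf; exact: ff.2.
Qed.

(** A compact set meets finitely many cosets, and the central units lie in K^0, so compact support
    modulo the centre means finitely many double cosets modulo the powers of pi_F. The converse
    passes to all coefficients by [coefficient_ind]. *)
Lemma cuspidal_criterion : cuspidal pi <->
  forall f v, fixed_form f -> fixed pi (K l) v ->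
    exists s : seq G, forall x, f (act x v) != 0 -> exists2 g, g \in s & deqv P l g x.
Proof.
split=> [cusp f v ff vl|fin v xi].
  have [C cC CP] := cusp v _ (@fixed_form_smooth f ff).
  have [s sP] := compact_cosets_cover l cC; have [reps [_ repsP]] := congK0_finite r P l.
  exists [seq (y * w)%g | y <- s, w <- reps] => x fx.
  have [z [h [zc Ch xE]]] := CP x fx.
  have [a [u [u0 uc zE]]] := center_decomposition P zc.
  have [y ys yh] := sP _ Ch; have l0 g : K l g -> K 0 g by exact: congK_le.
  have [w wr wk] := repsP _ (congKM (l0 _ yh) u0).
  exists (y * w)%g; first by apply/allpairsP; exists (y, w).
  exists a; apply/dcosetP; exists 1%g, (w^-1 * (y^-1 * h * u))%g; split=> //; first exact: congK1.
  by rewrite mul1g xE zE -!mulgA mulKVg mulKVg (uc h).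
pose Q (f : G -> R[i]) := exists2 C : set G, compact C &
  forall g, f g != 0 -> exists z h, [/\ Z z, C h & g = (z * h)%g].
move=> sxi; suff : Q (@coefficient _ _ _ _ _ pi v xi) by [].
apply: (coefficient_ind P irr pil) => // {v xi sxi}.
- by exists set0; [exact: compact0|move=> g; rewrite eqxx].
- move=> c f f' [C cC CP] [C' cC' CP']; exists (C `|` C'); first exact: compactU.
  move=> g; have [fg|fg] := eqVneq (f g) 0.
    rewrite fg mulr0 add0r => /CP'[z [h [zc Ch gE]]].
    by exists z, h; split=> //; right.
  by move=> _; have [z [h [zc Ch gE]]] := CP _ fg; exists z, h; split=> //; left.
- move=> f g h [C cC CP]; exists [set (g^-1 * x * h^-1)%g | x in C]; first exact: compact_translation.
  move=> x /CP[z [y [zc Cy e]]]; exists z, (g^-1 * y * h^-1)%g; split=> //; first by exists y.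
  apply: (mulgI g); apply: (mulIg h); rewrite e !mulgA mulgVK.
  by rewrite -(zc g) -!mulgA mulKVg.
move=> f w fl fK wl; have [s sP] := fin f w (conj fl fK) wl.
exists [set x | exists2 g, g \in s & dcoset (K l) g x].
  elim: s {sP} => [|g s IH].
    by rewrite (_ : mkset _ = set0); [exact: compact0|apply/seteqP; split=> x // [y]; rewrite in_nil].
  rewrite (_ : mkset _ = dcoset (K l) g `|` [set x | exists2 g, g \in s & dcoset (K l) g x]).
    by apply: compactU IH; exact: compact_dcoset.
  apply/seteqP; split=> x.
    by move=> [y]; rewrite in_cons => /orP[/eqP ->|ys] yx; [left|right; exists y].
  by move=> [gx|[y ys yx]]; [exists g; rewrite ?mem_head|exists y; rewrite // in_cons ys orbT].
move=> x /sP[g gs [a /dcoset_zpN gx]]; exists (zp a), (zp (- a) * x)%g; split.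
- exact: zp_center.
- by exists g.
by rewrite mulgA -zpD subrr zp0 mul1g.
Qed.

Definition normsq c : R := ComplexField.Normc.normc c ^+ 2.

Lemma normsq_ge0 c : 0 <= normsq c. Proof. exact: sqr_ge0. Qed.

Lemma normsqM c c' : normsq (c * c') = normsq c * normsq c'.
Proof. by rewrite /normsq ComplexField.Normc.normcM exprMn. Qed.

Lemma normsq_unit c : `|c| = 1 -> normsq c = 1.
Proof.
move=> c1; rewrite /normsq; have -> : ComplexField.Normc.normc c = 1; last by rewrite expr1n.
by have := c1; rewrite -[`|c|]/((ComplexField.Normc.normc c)%:C%C) => -[].
Qed.

Lemma normsqD c c' : normsq (c + c') <= 2 * normsq c + 2 * normsq c'.
Proof.
case: c => a b; case: c' => a' b'; rewrite /normsq /= !sqr_sqrtr ?addr_ge0 ?sqr_ge0 //.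
have := sqr_ge0 (a - a'); have := sqr_ge0 (b - b'); nra.
Qed.

Lemma square_criterion : square_integrable mu pi <->
  (exists c, `|c| = 1 /\ forall v, act (zp 1) v = c *: v) /\
  forall f v, fixed_form f -> fixed pi (K l) v ->
    bounded_sums (deqv P l) (fun x => dvol mu l x * normsq (f (act x v))).
Proof.
rewrite /square_integrable; rewrite (unitary_criterion P irr).
have equiv (f : G -> R[i]) n : (forall x k, K n k -> f (x * k)%g = f x) ->
    (forall z x, Z z -> normsq (f (z * x)%g) = normsq (f x)) ->
    (\int[hm_Z mu]_g (normsq (f g))%:E < +oo)%E <->
    bounded_sums (eqv0 P n) (fun x => normsq (f x)).
  move=> fK fZ; rewrite (integral_bounded_sums mu P (n := n)).
  - by apply: eqvZ_sums => [x|x k kn|z x]; [exact: normsq_ge0|rewrite fK|exact: fZ].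
  - by move=> x; exact: normsq_ge0.
  - by move=> x k kn; rewrite fK.
  - exact: fZ.
suff main : (exists c, `|c| = 1 /\ forall v, act (zp 1) v = c *: v) ->
    (forall v xi, smooth_form xi ->
       (\int[hm_Z mu]_g (ComplexField.Normc.normc (@coefficient _ _ _ _ _ pi v xi g) ^+ 2)%:E < +oo)%E) <->
    (forall f v, fixed_form f -> fixed pi (K l) v ->
       bounded_sums (deqv P l) (fun x => dvol mu l x * normsq (f (act x v)))).
  by split=> -[h1 h2]; split=> //; apply/main.
rewrite -(unitary_criterion P irr) => uni.
(* The central character, with an arbitrary value off the centre. *)
have /choice[om omP] z : exists c, Z z -> `|c| = 1 /\ forall v, act z v = c *: v.
  by have [/uni[c c1 cP]|nz] := pselect (Z z); [exists c|exists 0].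
have omega f z v x : linear_on setT f -> Z z -> f (act (z * x)%g v) = om z * f (act x v).
  move=> fl /omP[_ zv]; rewrite rep_actM zv; exact: (linear_onZ _ _ fl).
have sT : subspace [set: pi] by split.
split=> [int f v ff vl|bnd v xi sxi].
  have fKr x k : K l k -> f (act (x * k)%g v) = f (act x v) by move=> kl; rewrite rep_actM vl.
  have fZ z x : Z z -> normsq (f (act (z * x)%g v)) = normsq (f (act x v)).
    by move=> zc; rewrite (omega _ _ _ _ ff.1 zc) normsqM normsq_unit ?mul1r //; have [] := omP _ zc.
  apply/eqv0_deqv_sums => //.
  - by move=> x; exact: normsq_ge0.
  - by move=> x k kl; rewrite fKr.
  - by move=> x k kl; rewrite rep_actM ff.2.
  - by move=> a x; apply: fZ; exact: zp_center.
  exact/(equiv (fun x => f (act x v)) l fKr fZ)/(int v _ (@fixed_form_smooth f ff)).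
(* Q records the central character so that the modulus of a sum of two such functions is again
   invariant under the centre. *)
pose Q (f : G -> R[i]) := exists n, [/\ forall x k, K n k -> f (x * k)%g = f x,
  forall z x, Z z -> f (z * x)%g = om z * f x & bounded_sums (eqv0 P n) (fun x => normsq (f x))].
have QZ (f : G -> R[i]) : (forall z x, Z z -> f (z * x)%g = om z * f x) ->
    forall z x, Z z -> normsq (f (z * x)%g) = normsq (f x).
  by move=> fZ z x zc; rewrite fZ // normsqM normsq_unit ?mul1r //; have [] := omP _ zc.
suff [n [fK fZ bn]] : Q (@coefficient _ _ _ _ _ pi v xi).
  by apply/(equiv _ n) => //; exact: QZ.
apply: (coefficient_ind P irr pil) => // {v xi sxi}.
- exists 0%N; split=> //; first by move=> z x _; rewrite mulr0.
  exists 0 => s _; rewrite big1 // => x _.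
  by rewrite /normsq ComplexField.Normc.normc0 expr0n.
- move=> c f f' [n [fK fZ bn]] [n' [fK' fZ' bn']]; exists (maxn n n').
  have fQ := QZ _ fZ; have fQ' := QZ _ fZ'; split.
  + by move=> x k kn; rewrite fK ?fK' //; apply: congK_le kn; rewrite leq_max leqnn ?orbT.
  + by move=> z x zc; rewrite fZ // fZ' // mulrDr mulrCA.
  apply: (@bounded_sums_le _ _ _ _ (fun x => 2 * normsq c * normsq (f x) + 2 * normsq (f' x))) => [x|].
    by apply: le_trans (normsqD _ _) _; rewrite normsqM mulrA.
  apply: bounded_sumsD.
    apply: bounded_sums_scale; first by apply: mulr_ge0 => //; exact: normsq_ge0.
    apply: (@eqv0_sums_le _ _ _ _ _ P n) bn => [|x|x k kn|a x].
    - exact: leq_maxl.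
    - exact: normsq_ge0.
    - by rewrite fK.
    - by apply: fQ; exact: zp_center.
  apply: bounded_sums_scale; first exact: ler0n.
  apply: (@eqv0_sums_le _ _ _ _ _ P n') bn' => [|x|x k kn|a x].
  - exact: leq_maxr.
  - exact: normsq_ge0.
  - by rewrite fK'.
  - by apply: fQ'; exact: zp_center.
- move=> f g h [n [fK fZ bn]]; have fQ := QZ _ fZ.
  have [|||n' [n'P bn']] := eqv0_sums_translate g h _ _ _ bn.
  + by move=> x; exact: normsq_ge0.
  + by move=> x k kn; rewrite fK.
  + by move=> a x; apply: fQ; exact: zp_center.
  exists n'; split=> // [x k /n'P kn|z x zc]; last first.
    by rewrite -fZ // !mulgA (zc g).
  by rewrite -(fK (g * x * h)%g _ kn) !mulgA mulgK.
move=> f v fl fK vl; have ff : fixed_form f by [].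
exists l; split.
- by move=> x k kl; rewrite rep_actM vl.
- by move=> z x zc; exact: omega.
have fZ z x : Z z -> f (act (z * x)%g v) = om z * f (act x v) by move=> zc; exact: omega.
apply/(eqv0_deqv_sums mu) => //; last exact: bnd.
- by move=> x; exact: normsq_ge0.
- by move=> x k kl; rewrite rep_actM vl.
- by move=> x k kl; rewrite rep_actM ff.2.
- by move=> a x; apply: (QZ _ fZ); exact: zp_center.
Qed.

End Criteria.

(** * Close fields *)

Section LevelIso.
Variables (E E' : fieldType) (v : E -> int) (v' : E' -> int) (m : nat) (lam : E -> E').
Hypotheses (vP : is_valuation v) (vP' : is_valuation v') (lamP : level_iso v v' m lam).
Variables (u : E) (u' : E').
Hypotheses (u0 : u != 0) (vu : v u = 1) (u'0 : u' != 0) (vu' : v' u' = 1).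
Hypotheses (uu' : pw v' m%:Z (lam u - u')) (m_gt0 : (0 < m)%N).
Local Notation O := (pw v 0).
Local Notation O' := (pw v' 0).

Let lamO a : O a -> O' (lam a). Proof. by case: lamP => + _ _ _ _ _; exact. Qed.

Lemma level_iso0 : pw v' m%:Z (lam 0).
Proof.
have O0 : O 0 by left.
have := qi_D lamP O0 O0; rewrite addr0 opprD addrA subrr add0r => /(pwN vP').
by rewrite opprK.
Qed.

Lemma level_iso_sum (I : Type) (s : seq I) (f : I -> E) : (forall i, O (f i)) ->
  O (\sum_(i <- s) f i) /\ pw v' m%:Z (lam (\sum_(i <- s) f i) - \sum_(i <- s) lam (f i)).
Proof.
move=> Of; elim: s => [|i s [IH1 IH2]].
  by rewrite !big_nil subr0; split; [left|exact: level_iso0].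
rewrite !big_cons; split; first exact: (pwD vP).
have := qi_D lamP (Of i) IH1 => h; have := pwD vP' h IH2.
by congr (pw _ _ _); ring.
Qed.

Lemma level_iso_nat (b : bool) : pw v' m%:Z (lam b%:R - b%:R).
Proof. by case: b; [exact: (qi_1 lamP)|rewrite subr0; exact: level_iso0]. Qed.

Let pwX (w : E) k : O w -> O (w ^+ k).
Proof. by move=> Ow; elim: k => [|k IH]; [exact: (pw1 vP)|rewrite exprS -(addr0 0); exact: (pwM vP)]. Qed.

Let Ou : O u. Proof. by right; rewrite vu. Qed.
Let Ou' : O' u'. Proof. by right; rewrite vu'. Qed.

Let pwX' k : pw v' k%:Z (u' ^+ k).
Proof. by right; rewrite (valX vP' k u'0).2 vu' mulr1. Qed.

Lemma level_iso_unifX k : pw v' m%:Z (lam (u ^+ k) - u' ^+ k).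
Proof.
elim: k => [|k IH]; first exact: (level_iso_nat true).
rewrite !exprS; have := qi_M lamP Ou (pwX k Ou).
have h1 : pw v' m%:Z ((lam u - u') * lam (u ^+ k)).
  by rewrite -(addr0 m%:Z); apply: (pwM vP') => //; apply: lamO; exact: pwX.
have h2 : pw v' m%:Z (u' * (lam (u ^+ k) - u' ^+ k)).
  by rewrite -(add0r m%:Z); exact: (pwM vP').
move=> h; have := pwD vP' (pwD vP' h h1) h2.
by congr (pw _ _ _); ring.
Qed.

Lemma level_iso_unif k c : O c -> pw v' m%:Z (lam (u ^+ k * c) - u' ^+ k * lam c).
Proof.
move=> Oc; have := qi_M lamP (pwX k Ou) Oc => h.
have h2 : pw v' m%:Z ((lam (u ^+ k) - u' ^+ k) * lam c).
  by rewrite -(addr0 m%:Z); apply: (pwM vP'); [exact: level_iso_unifX|exact: lamO].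
by have := pwD vP' h h2; congr (pw _ _ _); ring.
Qed.

(** An element of P^k is u^k c with c integral, and [lam] sends it to u'^k lam(c) modulo P^m.
    Conversely c is found by surjectivity of [lam] modulo P^m. *)
Lemma level_iso_pw0 k a : (k <= m)%N -> O a -> pw v k%:Z a <-> pw v' k%:Z (lam a).
Proof.
move=> km Oa; have le_km : k%:Z <= m%:Z by rewrite lez_nat.
have uk0 := expf_neq0 k u0; have u'k0 := expf_neq0 k u'0.
split=> h.
  have Oc : O (a / u ^+ k).
    have := pwM vP h (or_intror (lexx _) : pw v (v (u ^+ k)^-1) (u ^+ k)^-1).
    by rewrite (valV vP) ?unitfE // (valX vP k u0).2 vu mulr1 subrr.
  have := level_iso_unif k Oc; rewrite mulrC divfK // => h1.
  rewrite -(subrK (u' ^+ k * lam (a / u ^+ k)) (lam a)); apply: (pwD vP').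
    exact: pw_le h1.
  by rewrite -(addr0 k%:Z); apply: (pwM vP') => //; exact: lamO.
have Oc' : O' (lam a / u' ^+ k).
  have := pwM vP' h (or_intror (lexx _) : pw v' (v' (u' ^+ k)^-1) (u' ^+ k)^-1).
  by rewrite (valV vP') ?unitfE // (valX vP' k u'0).2 vu' mulr1 subrr.
have [c Oc cP] := qi_surj lamP Oc'.
have Ouc : O (u ^+ k * c) by rewrite -(addr0 0); apply: (pwM vP) => //; exact: pwX.
have : pw v m%:Z (a - u ^+ k * c).
  apply/(qi_inj lamP Oa Ouc).
  have h1 : pw v' m%:Z (u' ^+ k * (lam c - lam a / u' ^+ k)).
    by rewrite -(add0r m%:Z); apply: (pwM vP') => //; exact: pw_le (pwX' k).
  rewrite mulrBr [u' ^+ k * (_ / _)]mulrC divfK // in h1.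
  have := pwD vP' (level_iso_unif k Oc) h1; rewrite addrA subrK => /(pwN vP').
  by rewrite opprB.
move=> h1; rewrite -(subrK (u ^+ k * c) a); apply: (pwD vP); first exact: pw_le h1.
rewrite -(addr0 k%:Z); apply: (pwM vP) => //.
by right; rewrite (valX vP k u0).2 vu mulr1.
Qed.

(** b stands for an entry of the identity matrix, in view of the congruence subgroups. *)
Lemma level_iso_pw k a (b : bool) : (k <= m)%N -> O a ->
  pw v k%:Z (a - b%:R) <-> pw v' k%:Z (lam a - b%:R).
Proof.
move=> km Oa; have le_km : k%:Z <= m%:Z by rewrite lez_nat.
have Ob : O b%:R by case: b; [exact: (pw1 vP)|left].
have Oab : O (a - b%:R) by exact: (pwB vP).
rewrite (level_iso_pw0 km Oab).
have := qi_D lamP Oab Ob; rewrite subrK => h.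
have h2 : pw v' k%:Z (lam a - (lam (a - b%:R) + b%:R)).
  apply: (pw_le le_km); have := pwD vP' h (level_iso_nat b).
  by congr (pw _ _ _); ring.
split=> h3.
  by have := pwD vP' h2 h3; congr (pw _ _ _); ring.
by have := pwB vP' h3 h2; congr (pw _ _ _); ring.
Qed.

End LevelIso.

(** * Lifting group elements between close fields *)

Section Lifts.
Variables (R : realType) (F : localField) (d : nat) (D : divAlg F d)
  (P : cyclicPres D) (r m : nat) (L : localField) (T : closeData R P r m L) (l : nat).
Hypotheses (l_gt0 : (0 < l)%N) (le_lm : (l <= m)%N).
Local Notation D' := (cd_D T).
Local Notation P' := (cd_P T).
Local Notation E := (cp_E P).
Local Notation E' := (cp_E P').
Local Notation vE := (@ue_val F d E).
Local Notation vE' := (@ue_val L d E').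
Local Notation vD := (@da_val F d D).
Local Notation vD' := (@da_val L d D').
Local Notation lam := (cd_lamE T).
Local Notation G := (GL D r).
Local Notation G' := (GL D' r).

Let m_gt0 : (0 < m)%N. Proof. exact: leq_trans l_gt0 le_lm. Qed.
Let d_gt0 := da_degree_gt0 D.

Definition cpsum (F0 : localField) (D0 : divAlg F0 d) (P0 : cyclicPres D0) (e : 'I_d -> cp_E P0) : D0 :=
  \sum_(k < d) cp_pi P0 ^+ k * cp_emb P0 (e k).

Lemma pw_cpsum (F0 : localField) (D0 : divAlg F0 d) (P0 : cyclicPres D0) (e : 'I_d -> cp_E P0) (k : int) :
  pw (@da_val F0 d D0) (k * d%:Z) (cpsum e) <-> forall i, pw (@ue_val F0 d (cp_E P0)) k (e i).
Proof. exact: pw_cp_sum. Qed.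

Lemma cpsumB (F0 : localField) (D0 : divAlg F0 d) (P0 : cyclicPres D0) (e e' : 'I_d -> cp_E P0) :
  cpsum (fun i => e i - e' i) = cpsum e - cpsum e'.
Proof. by rewrite /cpsum -sumrB; apply: eq_bigr => i _; rewrite rmorphB mulrBr. Qed.

Lemma cpsum_bool (F0 : localField) (D0 : divAlg F0 d) (P0 : cyclicPres D0) (b : bool) :
  cpsum (fun i : 'I_d => ((b && (nat_of_ord i == 0%N))%:R : cp_E P0)) = b%:R.
Proof.
rewrite /cpsum (bigD1 (Ordinal d_gt0)) //= big1 => [|i i0]; last first.
  have -> : nat_of_ord i == 0%N = false by apply: negPf; apply: contraNneq i0 => i0; apply/eqP/val_inj.
  by rewrite andbF rmorph0 mulr0.
by rewrite andbT expr0 mul1r addr0; case: b; rewrite ?rmorph1 ?rmorph0.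
Qed.

Lemma cpsum_exists (F0 : localField) (D0 : divAlg F0 d) (P0 : cyclicPres D0) (x : D0) :
  pw (@da_val F0 d D0) 0 x -> exists e : 'I_d -> cp_E P0,
    x = cpsum e /\ forall i, pw (@ue_val F0 d (cp_E P0)) 0 (e i).
Proof.
have [c [xE _]] := cp_sum P0 x; move=> Ox; exists c; split=> //.
by apply/pw_cpsum; rewrite mul0r -[cpsum _]xE.
Qed.

Lemma cpsum_residue (F0 : localField) (D0 : divAlg F0 d) (P0 : cyclicPres D0) (e : 'I_d -> cp_E P0) :
  (forall i, pw (@ue_val F0 d (cp_E P0)) 0 (e i)) ->
  pw (@da_val F0 d D0) 1 (cpsum e - cp_emb P0 (e (Ordinal d_gt0))).
Proof.
move=> Oe; have vDP := @da_valP F0 d D0.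
rewrite /cpsum (bigD1 (Ordinal d_gt0)) //= expr0 mul1r addrAC subrr add0r.
apply: (pw_sum vDP) => i i0; rewrite -(addr0 1); apply: (pwM vDP).
  right; rewrite (valX vDP _ (cp_pi_neq0 P0)).2 da_val_pi mulr1.
  have : nat_of_ord i != 0%N by apply: contraNneq i0 => i0; apply/eqP/val_inj.
  by case: (nat_of_ord i).
by rewrite -(mul0r d%:Z); apply/pw_emb.
Qed.

Lemma pw_emb1 (F0 : localField) (D0 : divAlg F0 d) (P0 : cyclicPres D0) (x : cp_E P0) :
  pw (@da_val F0 d D0) 1 (cp_emb P0 x) <-> pw (@ue_val F0 d (cp_E P0)) 1 x.
Proof.
have [->|x0] := eqVneq x 0; first by rewrite rmorph0; split; left.
by rewrite !pwP ?cp_emb_neq0 // da_val_emb //; nia.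
Qed.

Lemma ue_unif (F0 : localField) (D0 : divAlg F0 d) (P0 : cyclicPres D0) :
  (cp_unif P0)%:A != 0 :> cp_E P0 /\ ue_val ((cp_unif P0)%:A : cp_E P0) = 1.
Proof.
have [u0 vu] := cp_unifP P0; rewrite ue_val_ext // scaler_eq0 oner_eq0 orbF.
by split.
Qed.

Lemma lam_unif : pw vE' m%:Z (lam (cp_unif P)%:A - (cp_unif P')%:A).
Proof.
have vP' := @ue_valP L d E'.
have alg (c : L) : pw (@lf_val L) m%:Z c -> pw vE' m%:Z c%:A.
  have [->|c0] := eqVneq c 0; first by rewrite scale0r; left.
  have cA0 : c%:A != 0 :> E' by rewrite scaler_eq0 oner_eq0 orbF.
  by rewrite !pwP // ue_val_ext.
have Ou : pw (@lf_val F) 0 (cp_unif P) by right; have [_ ->] := cp_unifP P.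
have := pwD vP' (cd_lamE_ext T Ou) (alg _ (cd_lam_unif T)).
by rewrite scalerBl addrA subrK.
Qed.

Lemma lam_pw k (a : E) (b : bool) : (k <= m)%N -> pw vE 0 a ->
  pw vE k%:Z (a - b%:R) <-> pw vE' k%:Z (lam a - b%:R).
Proof.
have [u0 vu] := ue_unif P; have [u'0 vu'] := ue_unif P'.
move=> km Oa; exact: (level_iso_pw (@ue_valP F d E) (@ue_valP L d E') (cd_lamEP T) u0 vu u'0 vu' lam_unif).
Qed.

Lemma lam_int (a : E) : pw vE 0 a -> pw vE' 0 (lam a).
Proof. by have [+ _ _ _ _ _] := cd_lamEP T; exact. Qed.

Definition lifts_to (x : D) (x' : D') := exists e : 'I_d -> E,
  [/\ forall k, pw vE 0 (e k), x = cpsum e & pw vD' (l * d)%:Z (x' - cpsum (fun i => lam (e i)))].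

Lemma lift_exists x : pw vD 0 x -> exists x', pw vD' 0 x' /\ lifts_to x x'.
Proof.
move=> /(cpsum_exists P)[e [xE Oe]]; exists (cpsum (fun i => lam (e i))); split.
  by rewrite -(mul0r d%:Z); apply/pw_cpsum => i; exact: lam_int.
by exists e; split=> //; rewrite subrr; left.
Qed.

Lemma lift_exists_inv x' : pw vD' 0 x' -> exists x, pw vD 0 x /\ lifts_to x x'.
Proof.
move=> /(cpsum_exists P')[e' [xE Oe']].
have [_ _ _ _ _ surj] := cd_lamEP T.
have /choice[e eP] i : exists e, pw vE 0 e /\ pw vE' m%:Z (lam e - e' i).
  by have [e Oe he] := surj _ (Oe' i); exists e.
exists (cpsum e); split; first by rewrite -(mul0r d%:Z); apply/pw_cpsum => i; have [] := eP i.
exists e; split=> // [k|]; first by have [] := eP k.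
rewrite xE -cpsumB PoszM; apply/pw_cpsum => i; have [_ h] := eP i.
by apply/(pwBC (@ue_valP L d E')); apply: pw_le h; rewrite lez_nat.
Qed.

Lemma lift_pw k x x' (b : bool) : (k <= l)%N -> lifts_to x x' ->
  pw vD (k * d)%:Z (x - b%:R) <-> pw vD' (k * d)%:Z (x' - b%:R).
Proof.
move=> kl [e [Oe -> h]]; have vP' := @da_valP L d D'.
have h' : pw vD' (k * d)%:Z (x' - cpsum (fun i => lam (e i))).
  by apply: pw_le h; rewrite lez_nat leq_mul2r kl orbT.
have -> : pw vD' (k * d)%:Z (x' - b%:R) <-> pw vD' (k * d)%:Z (cpsum (fun i => lam (e i)) - b%:R).
  split=> h2; last by have := pwD vP' h' h2; rewrite addrA subrK.
  by have := pwB vP' h2 h'; rewrite opprB addrC addrA subrK.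
rewrite -(cpsum_bool P) -(cpsum_bool P') -!cpsumB PoszM !pw_cpsum.
by split=> h2 i; apply/lam_pw => //; exact: leq_trans kl le_lm.
Qed.

(** Modulo P_D only the coordinate of index 0 of each entry survives. Products can thus be compared
    in the residue fields of E and E', where [lam] is additive and multiplicative. *)
Lemma lift_mul_residue (A C : 'M[D]_r) (A' C' : 'M[D']_r) :
  (forall i j, lifts_to (A i j) (A' i j)) -> (forall i j, lifts_to (C i j) (C' i j)) ->
  mxpw 1 (A *m C - 1%:M) <-> mxpw 1 (A' *m C' - 1%:M).
Proof.
move=> AA CC; have vP := @da_valP F d D; have vP' := @da_valP L d D'.
have res x x' : lifts_to x x' -> exists e, [/\ pw vE 0 e, pw vD 0 x, pw vD' 0 x',
    pw vD 1 (x - cp_emb P e) & pw vD' 1 (x' - cp_emb P' (lam e))].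
  move=> [e [Oe -> h]]; have Ole i := lam_int (Oe i).
  have h0 : pw vD 0 (cpsum e) by rewrite -(mul0r d%:Z); apply/pw_cpsum.
  have h0' : pw vD' 0 (cpsum (fun i => lam (e i))).
    by rewrite -(mul0r d%:Z); apply/pw_cpsum.
  exists (e (Ordinal d_gt0)); split=> //; last 1 first.
  - rewrite -(subrK (cpsum (fun i => lam (e i))) x') -addrA; apply: (pwD vP').
      by apply: pw_le h; rewrite lez_nat muln_gt0 l_gt0.
    exact: (cpsum_residue Ole).
  - by rewrite -(subrK (cpsum (fun i => lam (e i))) x'); apply: (pwD vP') => //; apply: pw_le h.
  - exact: cpsum_residue.
have /choice[a aP] ij : exists e, [/\ pw vE 0 e, pw vD 0 (A ij.1 ij.2), pw vD' 0 (A' ij.1 ij.2),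
    pw vD 1 (A ij.1 ij.2 - cp_emb P e) & pw vD' 1 (A' ij.1 ij.2 - cp_emb P' (lam e))].
  exact/res/AA.
have /choice[c cP] ij : exists e, [/\ pw vE 0 e, pw vD 0 (C ij.1 ij.2), pw vD' 0 (C' ij.1 ij.2),
    pw vD 1 (C ij.1 ij.2 - cp_emb P e) & pw vD' 1 (C' ij.1 ij.2 - cp_emb P' (lam e))].
  exact/res/CC.
have emb0 (F0 : localField) (D0 : divAlg F0 d) (P0 : cyclicPres D0) (e : cp_E P0) :
    pw (@ue_val F0 d (cp_E P0)) 0 e -> pw (@da_val F0 d D0) 0 (cp_emb P0 e).
  by move=> Oe; rewrite -(mul0r d%:Z); apply/pw_emb.
have prod (F0 : localField) (D0 : divAlg F0 d) (P0 : cyclicPres D0) (x y : D0) (e f : cp_E P0) :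
    pw (@ue_val F0 d (cp_E P0)) 0 e -> pw (@da_val F0 d D0) 0 y ->
    pw (@da_val F0 d D0) 1 (x - cp_emb P0 e) -> pw (@da_val F0 d D0) 1 (y - cp_emb P0 f) ->
    pw (@da_val F0 d D0) 1 (x * y - cp_emb P0 (e * f)).
  move=> Oe Oy h1 h2; have v0P := @da_valP F0 d D0.
  have := pwD v0P (pwM v0P h1 Oy) (pwM v0P (emb0 _ _ _ _ Oe) h2).
  by rewrite addr0 mulrBl mulrBr rmorphM addrA subrK.
pose s i k : E := \sum_j a (i, j) * c (j, k).
pose s' i k : E' := \sum_j lam (a (i, j)) * lam (c (j, k)).
have vEP := @ue_valP F d E; have vEP' := @ue_valP L d E'.
have Oac i k j : pw vE 0 (a (i, j) * c (j, k)).
  by rewrite -(addr0 0); apply: (pwM vEP); [have [] := aP (i, j)|have [] := cP (j, k)].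
have [lsum0 lsum] : (forall i k, pw vE 0 (s i k)) /\ forall i k, pw vE' 1 (lam (s i k) - s' i k).
  split=> i k; have [h1 h2] := level_iso_sum vEP vEP' (cd_lamEP T) (index_enum 'I_r) (Oac i k) => //.
  have m1 : 1 <= m%:Z by [].
  rewrite -(subrK (\sum_j lam (a (i, j) * c (j, k))) (lam _)) -addrA; apply: (pwD vEP').
    exact: pw_le h2.
  rewrite -sumrB; apply: (pw_sum vEP') => j _; apply: (pw_le m1).
  by apply: (qi_M (cd_lamEP T)); [have [] := aP (i, j)|have [] := cP (j, k)].
have entry i k : pw vD 1 ((A *m C) i k - cp_emb P (s i k)).
  rewrite mxE rmorph_sum -sumrB; apply: (pw_sum vP) => j _.
  by have [? _ _ ? _] := aP (i, j); have [_ ? _ ? _] := cP (j, k); exact: prod.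
have entry' i k : pw vD' 1 ((A' *m C') i k - cp_emb P' (s' i k)).
  rewrite mxE rmorph_sum -sumrB; apply: (pw_sum vP') => j _.
  have [ha _ _ _ h1] := aP (i, j); have [_ _ h2 _ h3] := cP (j, k).
  by apply: prod => //; exact: lam_int.
have tr (F0 : localField) (D0 : divAlg F0 d) (x y z : D0) :
    pw (@da_val F0 d D0) 1 (x - y) -> pw (@da_val F0 d D0) 1 (x - z) <-> pw (@da_val F0 d D0) 1 (y - z).
  have v0P := @da_valP F0 d D0; move=> xy; split=> h; last first.
    by have := pwD v0P xy h; rewrite addrA subrK.
  by have := pwD v0P (pwBC v0P xy) h; rewrite addrA subrK.
have key i k : pw vD 1 ((A *m C - 1%:M) i k) <-> pw vD' 1 ((A' *m C' - 1%:M) i k).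
  rewrite [(A *m C - _) i k]mxE [(A' *m C' - _) i k]mxE.
  rewrite [(- 1%:M : 'M[D]_r) i k]mxE [(- 1%:M : 'M[D']_r) i k]mxE [(1%:M : 'M[D]_r) i k]mxE [(1%:M : 'M[D']_r) i k]mxE.
  rewrite (tr _ _ _ _ _ (entry i k)) (tr _ _ _ _ _ (entry' i k)).
  have bE (F0 : localField) (D0 : divAlg F0 d) (P0 : cyclicPres D0) (b : bool) :
    b%:R = cp_emb P0 b%:R by case: b; rewrite ?rmorph1 ?rmorph0.
  rewrite (bE _ _ P) (bE _ _ P') -!rmorphB !pw_emb1 (lam_pw (k := 1)) //.
  split=> h; last by have := pwD vEP' (lsum i k) h; rewrite addrA subrK.
  by have := pwD vEP' (pwBC vEP' (lsum i k)) h; rewrite addrA subrK.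
by split=> h i k; apply/key.
Qed.

Lemma liftsP (B : G) (B' : G') : lifts l B B' <->
  [/\ congK D r 0 B, congK D' r 0 B' & forall i j, lifts_to (glm B i j) (glm B' i j)].
Proof. by []. Qed.

(** The matrix and its inverse are lifted separately. The lifts are inverse to each other modulo P,
    and [mx_unit_of_residue] makes the first one invertible. *)
Lemma lift_GL (B : G) : congK D r 0 B -> exists B' : G', lifts l B B'.
Proof.
move=> B0; have [Bi BVi] := (congK0P B).1 B0.
have ex (A : 'M[D]_r) : mxpw 0 A -> exists A' : 'M[D']_r, mxpw 0 A' /\
    forall i j, lifts_to (A i j) (A' i j).
  move=> OA; have /choice[f fP] (ij : 'I_r * 'I_r) := lift_exists (OA ij.1 ij.2).
  exists (\matrix_(i, j) f (i, j)); split=> i j; rewrite mxE; by have [] := fP (i, j).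
have [A' [OA' AA']] := ex _ Bi; have [C' [OC' CC']] := ex _ BVi.
have unit1 (X : 'M[D]_r) : X = 1%:M -> mxpw 1 (X - 1%:M).
  by move=> ->; rewrite subrr; exact: mxpw0.
have AC : mxpw 1 (A' *m C' - 1%:M) by apply/(lift_mul_residue AA' CC')/unit1/glmK.
have CA : mxpw 1 (C' *m A' - 1%:M) by apply/(lift_mul_residue CC' AA')/unit1/glmVK.
have [X [AX XA OX]] := mx_unit_of_residue P' OA' OC' OC' AC CA.
by exists (mkGL AX XA); split=> //; apply/congK0P.
Qed.

Lemma lift_GL_inv (B' : G') : congK D' r 0 B' -> exists B : G, lifts l B B'.
Proof.
move=> B0; have [Bi BVi] := (congK0P B').1 B0.
have ex (A' : 'M[D']_r) : mxpw 0 A' -> exists A : 'M[D]_r, mxpw 0 A /\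
    forall i j, lifts_to (A i j) (A' i j).
  move=> OA; have /choice[f fP] (ij : 'I_r * 'I_r) := lift_exists_inv (OA ij.1 ij.2).
  exists (\matrix_(i, j) f (i, j)); split=> i j; rewrite mxE; by have [] := fP (i, j).
have [A [OA AA']] := ex _ Bi; have [C [OC CC']] := ex _ BVi.
have unit1 (X : 'M[D']_r) : X = 1%:M -> mxpw 1 (X - 1%:M).
  by move=> ->; rewrite subrr; exact: mxpw0.
have AC : mxpw 1 (A *m C - 1%:M) by apply/(lift_mul_residue AA' CC')/unit1/glmK.
have CA : mxpw 1 (C *m A - 1%:M) by apply/(lift_mul_residue CC' AA')/unit1/glmVK.
have [X [AX XA OX]] := mx_unit_of_residue P OA OC OC AC CA.
by exists (mkGL AX XA); split=> //; apply/congK0P.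
Qed.

Lemma lift_congK k (B : G) (B' : G') : (k <= l)%N -> lifts l B B' ->
  congK D r k B <-> congK D' r k B'.
Proof.
move=> kl [B0 B'0 BB']; case: k kl => [|k] kl; first by split.
rewrite !congKSP; split=> h i j; have := h i j; rewrite !mxE.
  by move/(lift_pw (i == j) kl (BB' i j)).
by move=> h1; apply/(lift_pw (i == j) kl (BB' i j)).
Qed.

Lemma lift1 : lifts l (1%g : G) (1%g : G').
Proof.
apply/liftsP; split; [exact: congK1|exact: congK1|] => i j.
rewrite !glm1 !mxE.
exists (fun k => (((i == j) && (nat_of_ord k == 0%N))%:R : E)); split.
- by move=> k; case: (_ && _); [exact: (pw1 (@ue_valP F d E))|left].
- by rewrite (cpsum_bool P).
rewrite -(cpsum_bool P') -cpsumB PoszM; apply/pw_cpsum => k.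
apply/(pwBC (@ue_valP L d E')); apply: (@pw_le _ _ m%:Z); first by rewrite lez_nat.
exact: (level_iso_nat (@ue_valP L d E') (cd_lamEP T)).
Qed.

End Lifts.

(** * Transfer *)

Section Correspondence.
Variables (R : realType) (F1 F2 : localField) (d1 d2 : nat) (D1 : divAlg F1 d1)
  (D2 : divAlg F2 d2) (r1 r2 : nat) (P1 : cyclicPres D1) (P2 : cyclicPres D2)
  (mu1 : haarMeasures R D1 r1) (mu2 : haarMeasures R D2 r2) (l : nat).

(** What the two groups have to share in order to transport level, cuspidality and square
    integrability. A relation rather than a map is used, so that the two sides can be exchanged. *)
Record correspondence (Rel : GL D1 r1 -> GL D2 r2 -> Prop) : Prop := IsCorrespondence {
  corr_exists : forall g, exists g', Rel g g';
  corr_exists_inv : forall g', exists g, Rel g g';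
  corr_dcoset : forall g g' h h', Rel g g' -> Rel h h' ->
    dcoset (congK D1 r1 l) g h <-> dcoset (congK D2 r2 l) g' h';
  corr1 : Rel 1%g 1%g;
  corr_zp : forall (a : int) g g', Rel g g' -> Rel (zp r1 P1 a * g)%g (zp r2 P2 a * g')%g;
  corr_dvol : forall g g', Rel g g' -> dvol mu1 l g = dvol mu2 l g';
  corr_congK : forall k g g', (k <= l)%N -> Rel g g' ->
    congK D1 r1 k g <-> congK D2 r2 k g' }.

Definition module_corr (Rel : GL D1 r1 -> GL D2 r2 -> Prop)
    (pi1 : smoothRep R D1 r1) (pi2 : smoothRep R D2 r2) (phi : pi1 -> pi2) :=
  [/\ set_bij (fixed pi1 (congK D1 r1 l)) (fixed pi2 (congK D2 r2 l)) phi,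
      forall (c : R[i]) u v, fixed pi1 (congK D1 r1 l) u -> fixed pi1 (congK D1 r1 l) v ->
        phi (c *: u + v) = c *: phi u + phi v &
      forall g g' v, Rel g g' -> fixed pi1 (congK D1 r1 l) v ->
        phi (avg (congK D1 r1 l) (rep_act pi1 g v)) =
        avg (congK D2 r2 l) (rep_act pi2 g' (phi v))].
End Correspondence.

Section CorrespondenceSym.
Variables (R : realType) (F1 F2 : localField) (d1 d2 : nat) (D1 : divAlg F1 d1)
  (D2 : divAlg F2 d2) (r1 r2 : nat) (P1 : cyclicPres D1) (P2 : cyclicPres D2)
  (mu1 : haarMeasures R D1 r1) (mu2 : haarMeasures R D2 r2) (l : nat).
Variable Rel : GL D1 r1 -> GL D2 r2 -> Prop.
Hypothesis RelP : correspondence P1 P2 mu1 mu2 l Rel.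

Lemma correspondence_sym : correspondence P2 P1 mu2 mu1 l (fun g' g => Rel g g').
Proof.
case: RelP => h1 h2 h3 h4 h5 h6 h7; split=> //.
- by move=> g' g h' h gg hh; rewrite (h3 _ _ _ _ gg hh).
- by move=> a g' g; exact: h5.
- by move=> g' g /h6.
by move=> k g' g kl /(h7 _ _ _ kl) ->.
Qed.

Variables (pi1 : smoothRep R D1 r1) (pi2 : smoothRep R D2 r2).
Local Notation M1 := (fixed pi1 (congK D1 r1 l)).
Local Notation M2 := (fixed pi2 (congK D2 r2 l)).

Lemma module_corr_sym (phi : pi1 -> pi2) : module_corr l Rel phi ->
  exists psi : pi2 -> pi1, module_corr l (fun g' g => Rel g g') psi.
Proof.
move=> [[phiM phiI phiS] phiP phiA].
have /choice[psi psiP] w : exists v, M2 w -> M1 v /\ phi v = w.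
  by have [/phiS[v vM <-]|?] := pselect (M2 w); [exists v|exists 0].
have inj u v : M1 u -> M1 v -> phi u = phi v -> u = v by move=> uM vM; apply: phiI; rewrite inE.
exists psi; split.
- split; first by move=> w /psiP[].
    move=> w w'; rewrite !inE => /psiP[_ e] /psiP[_ e'] ww; by rewrite -e -e' ww.
  move=> v vM; have wM := phiM _ vM; exists (phi v) => //.
  by have [h1 h2] := psiP _ wM; exact: inj.
- move=> c u v uM vM; have [u1 u2] := psiP _ uM; have [v1 v2] := psiP _ vM.
  have sM := subspace_fixed pi2 (congK D2 r2 l); have [w1 w2] := psiP _ (sM.2 c _ _ uM vM).
  have sM1 := subspace_fixed pi1 (congK D1 r1 l).
  by apply: inj => //; [exact: sM1.2|rewrite phiP // w2 u2 v2].
move=> g' g w gg wM; have [w1 w2] := psiP _ wM.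
have aM : M2 (avg (congK D2 r2 l) (rep_act pi2 g' w)) by exact: (avg_fixed P2).
have [x1 x2] := psiP _ aM.
apply: inj => //; first exact: (avg_fixed P1).
by rewrite x2 (phiA g g') // w2.
Qed.

End CorrespondenceSym.

Section CorrespondenceTransfer.
Variables (R : realType) (F1 F2 : localField) (d1 d2 : nat) (D1 : divAlg F1 d1)
  (D2 : divAlg F2 d2) (r1 r2 : nat) (P1 : cyclicPres D1) (P2 : cyclicPres D2)
  (mu1 : haarMeasures R D1 r1) (mu2 : haarMeasures R D2 r2) (l : nat).
Variable Rel : GL D1 r1 -> GL D2 r2 -> Prop.
Hypothesis RelP : correspondence P1 P2 mu1 mu2 l Rel.
Variables (pi1 : smoothRep R D1 r1) (pi2 : smoothRep R D2 r2) (phi : pi1 -> pi2).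
Hypothesis phiP : module_corr l Rel phi.
Local Notation K1 := (congK D1 r1).
Local Notation K2 := (congK D2 r2).
Local Notation M1 := (fixed pi1 (K1 l)).
Local Notation M2 := (fixed pi2 (K2 l)).
Local Notation act1 := (rep_act pi1).
Local Notation act2 := (rep_act pi2).

Let gK1 := is_subgroup_congK D1 r1 l.
Let gK2 := is_subgroup_congK D2 r2 l.

Lemma module_corr0 : phi 0 = 0.
Proof.
have [_ phiL _] := phiP; have M0 : M1 0 by exact: (subspace_fixed pi1 (K1 l)).1.
by have := phiL (-1) _ _ M0 M0; rewrite scaler0 addr0 scaleN1r addNr.
Qed.

Lemma module_corr_neq0 v : M1 v -> v != 0 -> phi v != 0.
Proof.
have [[_ inj _] _ _] := phiP; move=> vM; apply: contraNneq => v0; apply/eqP.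
apply: inj; rewrite ?inE ?v0 ?module_corr0 //.
exact: (subspace_fixed pi1 (K1 l)).1.
Qed.

(** K^l is normal in K^0, so for g in K^k and v fixed by K^l the vector g v is fixed by K^l, and the
    operator e g e shows whether g fixes v. *)
Lemma fixed_avgP (F : localField) (d : nat) (D : divAlg F d) (r : nat) (P : cyclicPres D)
    (pi : smoothRep R D r) k v : (k <= l)%N ->
  fixed pi (congK D r k) v <-> fixed pi (congK D r l) v /\
    forall g, congK D r k g -> avg (congK D r l) (rep_act pi g v) = v.
Proof.
move=> kl; have gK := is_subgroup_congK D r l; split=> [vk|[vl va] g gk].
  have vl := fixed_le kl vk; split=> // g /vk ->; exact: (avg_id P gK).
rewrite -[RHS](va g gk); symmetry; apply: (avg_id P gK) => c cl.
have g0 : congK D r 0 g by exact: congK_le gk.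
by rewrite -{2}(vl _ (congK_norm g0 cl)) -!rep_actM !mulgA mulgV mul1g.
Qed.

Lemma module_corr_fixed k v : (k <= l)%N -> fixed pi1 (K1 k) v -> fixed pi2 (K2 k) (phi v).
Proof.
have [[phiM _ _] _ phiA] := phiP; move=> kl /(fixed_avgP P1 _ kl)[vl va].
apply/(fixed_avgP P2 _ kl); split=> [|g' gk]; first exact: phiM.
have [g gg] := corr_exists_inv RelP g'.
by rewrite -(phiA g) // va //; apply/(corr_congK RelP kl gg).
Qed.

Lemma module_corr_exists k : (k <= l)%N -> (exists2 v, fixed pi1 (K1 k) v & v != 0) ->
  exists2 v, fixed pi2 (K2 k) v & v != 0.
Proof.
move=> kl [v vk v0]; exists (phi v); first exact: module_corr_fixed.
by apply: module_corr_neq0 => //; exact: fixed_le vk.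
Qed.

(** f is f' composed with phi and the projector onto the K^l-fixed vectors; f' itself factors
    through the projector of the other side. *)
Lemma module_corr_form (f' : pi2 -> R[i]) v' : fixed_form l f' -> M2 v' ->
  exists f v, [/\ fixed_form l f, M1 v &
    forall x x', Rel x x' -> f (act1 x v) = f' (act2 x' v')].
Proof.
have [[phiM _ phiS] phiL phiA] := phiP; move=> [fl fK] /phiS[v vM <-].
have aM w : M1 (avg (K1 l) w) by exact: (avg_fixed P1).
exists (fun w => f' (phi (avg (K1 l) w))), v; split=> //.
  split=> [a u w _ _|k u kl]; last by rewrite (avg_act P1 gK1).
  by rewrite (avgP P1 gK1) phiL // fl.
by move=> x x' xx; rewrite (phiA x x') // (form_avg P2).
Qed.

Lemma cuspidal_corr : irreducible pi1 -> irreducible pi2 -> (exists2 v, M1 v & v != 0) ->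
  cuspidal pi1 -> cuspidal pi2.
Proof.
move=> irr1 irr2 ex1; have ex2 := module_corr_exists (leqnn l) ex1.
move=> /(cuspidal_criterion P1 irr1 ex1) h; apply/(cuspidal_criterion P2 irr2 ex2) => f' v' ff' vM'.
have [f [v [ff vM fE]]] := module_corr_form ff' vM'.
have [s sP] := h f v ff vM; have /choice[t tP] := corr_exists RelP.
exists [seq t g | g <- s] => x' fx'; have [x xx] := corr_exists_inv RelP x'.
have [|g gs [a gx]] := sP x; first by rewrite (fE _ _ xx).
exists (t g); first exact: map_f.
by exists a; apply/(corr_dcoset RelP (corr_zp RelP a (tP g)) xx).
Qed.

Lemma square_integrable_corr : (0 < r1)%N -> (0 < r2)%N -> irreducible pi1 -> irreducible pi2 ->
  (exists2 v, M1 v & v != 0) -> square_integrable mu1 pi1 -> square_integrable mu2 pi2.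
Proof.
move=> r1_gt0 r2_gt0 irr1 irr2 ex1; have ex2 := module_corr_exists (leqnn l) ex1.
have [[phiM _ _] phiL phiA] := phiP.
move=> /(square_criterion mu1 P1 r1_gt0 irr1 ex1)[[c [c1 cP]] h].
apply/(square_criterion mu2 P2 r2_gt0 irr2 ex2); split.
  (* The two uniformizers are related, as translates of 1 by [corr_zp], so they act by the same
     scalar. *)
  have [c2 c2P] := center_acts P2 irr2 (zp_center (r := r2) P2 1).
  exists c2; split=> //; have [v vM v0] := ex1.
  suff -> : c2 = c by [].
  apply: (scalar_inj (module_corr_neq0 vM v0)).
  have zz := corr_zp RelP 1 (corr1 RelP); rewrite !mulg1 in zz.
  have := phiA _ _ _ zz vM; rewrite cP c2P (avgZ P1 gK1) (avgZ P2 gK2).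
  rewrite (avg_id P1 gK1 (v := v)) // (avg_id P2 gK2 (v := phi v)); last exact: phiM.
  have M0 : M1 0 by exact: (subspace_fixed pi1 (K1 l)).1.
  by rewrite -[c *: v]addr0 phiL // module_corr0 addr0 => ->.
move=> f' v' ff' vM'; have [f [v [ff vM fE]]] := module_corr_form ff' vM'.
have [M MP] := h f v ff vM; have /choice[t tP] := corr_exists_inv RelP.
exists M => s' hs'.
have -> : \sum_(x' <- s') dvol mu2 l x' * normsq (f' (act2 x' v')) =
    \sum_(x <- [seq t x' | x' <- s']) dvol mu1 l x * normsq (f (act1 x v)).
  rewrite big_map; apply: eq_bigr => x' _.
  by rewrite (fE _ _ (tP x')) (corr_dvol RelP (tP x')).
apply: MP; apply: inequivalent_map hs' => x' y' _ _ [a txy]; exists a.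
by apply/(corr_dcoset RelP (corr_zp RelP a (tP x')) (tP y')).
Qed.

End CorrespondenceTransfer.

Section CorrespondenceLevel.
Variables (R : realType) (F1 F2 : localField) (d1 d2 : nat) (D1 : divAlg F1 d1)
  (D2 : divAlg F2 d2) (r1 r2 : nat) (P1 : cyclicPres D1) (P2 : cyclicPres D2)
  (mu1 : haarMeasures R D1 r1) (mu2 : haarMeasures R D2 r2) (l : nat).
Variable Rel : GL D1 r1 -> GL D2 r2 -> Prop.
Hypothesis RelP : correspondence P1 P2 mu1 mu2 l Rel.

(** A fixed vector of smaller level in [pi2] would be transported back by the inverse of phi. *)
Lemma has_level_corr (pi1 : smoothRep R D1 r1) (pi2 : smoothRep R D2 r2) (phi : pi1 -> pi2) n :
  module_corr l Rel phi -> (n <= l)%N -> has_level pi1 n -> has_level pi2 n.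
Proof.
move=> phiP nl [ex1 min1]; split; first exact: (module_corr_exists RelP phiP nl).
have [psi psiP] := module_corr_sym P1 P2 phiP.
move=> k kn w wk /=; apply: contrapT => /eqP w0.
have kl : (k <= l)%N by exact: leq_trans (ltnW kn) nl.
have [|v vk v0] := module_corr_exists (correspondence_sym RelP) psiP kl.
  by exists w.
by have := min1 k kn v vk; move=> /= e; rewrite e eqxx in v0.
Qed.

End CorrespondenceLevel.

Section ConvolutionAtOne.
Variables (R : realType) (F : localField) (d : nat) (D : divAlg F d) (r : nat).
Variables (mu : haarMeasures R D r) (P : cyclicPres D).
Local Notation G := (GL D r).
Local Notation K := (congK D r).
Implicit Types (g h : G) (n : nat).

Lemma indic_dcosetE n g x : \1_(dcoset (K n) g) x = `[< dcoset (K n) g x >]%:R :> R[i].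
Proof. by rewrite indicE; case: asboolP => h; [rewrite mem_set|rewrite memNset]. Qed.

Lemma indic_dcoset_eq n g h : \1_(dcoset (K n) g) = \1_(dcoset (K n) h) :> (G -> R[i]) ->
  dcoset (K n) g h.
Proof.
move=> gh; have := congr1 (fun f => f h) gh; rewrite !indic_dcosetE.
rewrite [in RHS]asboolT; last exact: dcoset_refl.
by case: asboolP => // _ /esym/eqP; rewrite oner_eq0.
Qed.

(** The inverses of the elements of K g K lie either all in K h K or all outside it. *)
Lemma hecke_conv_one n g h : hecke_conv mu (\1_(dcoset (K n) g)) (\1_(dcoset (K n) h)) 1%g =
  if `[< dcoset (K n) g h^-1%g >] then (dvol mu n g)%:C%C else 0.
Proof.
have [s cs] := dcoset_cosets P n g.
rewrite (hecke_conv_cosets mu P cs (hecke_indic R P n g) (hecke_indic R P n h)); last first.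
  by move=> x; rewrite indic_dcosetE; case: asboolP => // _; rewrite eqxx.
have [_ sD _ _] := cs.
rewrite (eq_big_seq (fun=> `[< dcoset (K n) g h^-1%g >]%:R)) => [|y ys]; last first.
  have gy := sD _ ys; rewrite !indic_dcosetE asboolT // mul1r mulg1; congr (_%:R); congr nat_of_bool.
  apply/asboolP/asboolP => [/dcosetV|gh].
    by rewrite invgK => hy; apply: dcoset_trans gy _; exact: dcoset_sym.
  by apply: dcoset_sym; rewrite -(invgK h); apply: dcosetV; apply: dcoset_trans (dcoset_sym gy) gh.
rewrite big_const_seq count_predT iter_addr_0; case: asboolP => _; last by rewrite mul0rn mulr0.
by rewrite (dvolE mu P cs) rmorphM rmorph_nat mulrC.
Qed.

End ConvolutionAtOne.

(** * The correspondence defined by zeta *)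

Section ZetaCorrespondence.
Variables (R : realType) (F : localField) (d : nat) (D : divAlg F d)
  (P : cyclicPres D) (r m : nat) (L : localField) (T : closeData R P r m L)
  (mu : haarMeasures R D r) (l : nat).
Hypotheses (l_gt0 : (0 < l)%N) (le_lm : (l <= m)%N).
Local Notation D' := (cd_D T).
Local Notation P' := (cd_P T).
Local Notation mu' := (cd_haar T).
Local Notation G := (GL D r).
Local Notation G' := (GL D' r).
Local Notation K := (congK D r).
Local Notation K' := (congK D' r).
Variable zeta : (G -> R[i]) -> (G' -> R[i]).
Hypotheses (zetaP : is_zeta l zeta) (zetaI : is_hecke_iso l mu zeta).
Local Notation ind g := (\1_(dcoset (K l) g) : G -> R[i]).
Local Notation ind' g := (\1_(dcoset (K' l) g) : G' -> R[i]).

Definition zeta_rel (g : G) (g' : G') := zeta (ind g) = ind' g'.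

Let zI : hecke_iso mu mu' l zeta := zetaI.

Lemma zeta_rel_dcosetr g g' h' : zeta_rel g g' -> dcoset (K' l) g' h' -> zeta_rel g h'.
Proof. by rewrite /zeta_rel => -> /dcoset_eq ->. Qed.

Lemma zeta_rel_dcosetl g h g' : zeta_rel g g' -> dcoset (K l) g h -> zeta_rel h g'.
Proof. by rewrite /zeta_rel => <- /dcoset_eq ->. Qed.

Lemma zeta_rel_unique g g' h' : zeta_rel g g' -> zeta_rel g h' -> dcoset (K' l) g' h'.
Proof. by rewrite /zeta_rel => -> /indic_dcoset_eq. Qed.

Lemma zeta_rel_cartan (a : 'I_r -> int) B C B' C' : (forall i j : 'I_r, (i <= j)%N -> a i <= a j) ->
  lifts l B B' -> lifts l C C' ->
  zeta_rel (B * ppow P a * C^-1)%g (B' * ppow P' a * C'^-1)%g.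
Proof. by move=> amon BB CC; have [_ h] := zetaP; exact: (h a). Qed.

Lemma zeta_rel_form g g' : zeta_rel g g' -> exists a B C B' C',
  [/\ forall i j : 'I_r, (i <= j)%N -> a i <= a j, lifts l B B', lifts l C C',
   g = (B * ppow P a * C^-1)%g & dcoset (K' l) g' (B' * ppow P' a * C'^-1)%g].
Proof.
have [B [C [a [B0 C0 amon gE]]]] := Cartan P g.
have [B' BB] := lift_GL T l_gt0 le_lm B0; have [C' CC] := lift_GL T l_gt0 le_lm C0.
move=> gg; exists a, B, C, B', C'; split=> //; apply: zeta_rel_unique gg _.
by rewrite gE; exact: zeta_rel_cartan.
Qed.

Lemma zeta_rel_exists g : exists g', zeta_rel g g'.
Proof.
have [B [C [a [B0 C0 amon ->]]]] := Cartan P g.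
have [B' BB] := lift_GL T l_gt0 le_lm B0; have [C' CC] := lift_GL T l_gt0 le_lm C0.
by exists (B' * ppow P' a * C'^-1)%g; exact: zeta_rel_cartan.
Qed.

Lemma zeta_rel_exists_inv g' : exists g, zeta_rel g g'.
Proof.
have [B' [C' [a [B0 C0 amon ->]]]] := Cartan P' g'.
have [B BB] := lift_GL_inv l_gt0 le_lm B0; have [C CC] := lift_GL_inv l_gt0 le_lm C0.
by exists (B * ppow P a * C^-1)%g; exact: zeta_rel_cartan.
Qed.

Lemma zeta_rel_dcoset g g' h h' : zeta_rel g g' -> zeta_rel h h' ->
  dcoset (K l) g h <-> dcoset (K' l) g' h'.
Proof.
move=> gg hh; split=> [gh|gh].
  exact: zeta_rel_unique (zeta_rel_dcosetl gg gh) hh.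
apply: (@indic_dcoset_eq R); apply: (hecke_iso_inj zI); [exact: hecke_indic|exact: hecke_indic|].
by rewrite (gg : zeta _ = _) (hh : zeta _ = _) (dcoset_eq gh).
Qed.

Lemma ppow0 (F0 : localField) (D0 : divAlg F0 d) (P0 : cyclicPres D0) :
  @ppow F0 d D0 r P0 (fun=> 0) = 1%g.
Proof.
by apply: glm_inj; rewrite glm1; apply/matrixP => i j; rewrite ppow_entry !mxE expr0z.
Qed.

Lemma zeta_rel_lift B B' : lifts l B B' -> zeta_rel B B'.
Proof.
move=> BB; have := zeta_rel_cartan (a := fun=> 0) (fun _ _ _ => lexx _) BB (lift1 T le_lm).
by rewrite !ppow0 !invg1 !mulg1.
Qed.

(** A power of pi_F shifts all exponents of a Cartan decomposition by the same multiple of d, which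
    keeps them increasing; the same happens over L. *)
Lemma zeta_rel_zp (a : int) g g' : zeta_rel g g' -> zeta_rel (zp r P a * g)%g (zp r P' a * g')%g.
Proof.
move=> /zeta_rel_form[b [B [C [B' [C' [bmon BB CC gE g'E]]]]]].
pose c i := d%:Z * a + b i.
have cE (F0 : localField) (D0 : divAlg F0 d) (P0 : cyclicPres D0) (X Y : GL D0 r) :
    (zp r P0 a * (X * ppow P0 b * Y) = X * ppow P0 c * Y)%g.
  by rewrite /c center_GL_ppow -/(zp r P0 a) !mulgA zp_comm.
apply: (@zeta_rel_dcosetr _ (B' * ppow P' c * C'^-1)%g).
  by rewrite gE cE; apply: zeta_rel_cartan => // i j ij; rewrite /c lerD2l; exact: bmon.
by rewrite -cE; apply/dcoset_zp; exact: dcoset_sym.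
Qed.

Lemma zeta_value f x x' : hecke R (K l) f -> zeta_rel x x' -> zeta f x' = f x.
Proof.
move=> hf xx; have [t fE] := hecke_decomp hf.
have [_ zE] := hecke_iso_sum P zI t f (fun g => hecke_indic R P l g).
have fx := congr1 (fun f => f x) fE; rewrite {1}fE zE fx; apply: eq_bigr => g _; congr (_ * _).
have [g' gg] := zeta_rel_exists g; rewrite (gg : zeta _ = _) !indic_dcosetE.
by congr (_%:R); congr nat_of_bool; apply/asboolP/asboolP; rewrite (zeta_rel_dcoset gg xx).
Qed.

(** The volume of K g K is the value at 1 of the convolution of the indicators of K g K and K g^-1
    K, and [zeta] preserves both convolutions and values. *)
Lemma zeta_rel_dvol g g' : zeta_rel g g' -> dvol mu l g = dvol mu' l g'.
Proof.
move=> gg; have [h' hh] := zeta_rel_exists g^-1%g; have hi := hecke_indic R P l.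
have hc : hecke R (K l) (hecke_conv mu (ind g) (ind g^-1%g)) by exact: (hecke_conv_hecke mu P).
have [_ _ zM] := zI.
have := zeta_value hc (zeta_rel_lift (lift1 T le_lm)).
rewrite zM // (gg : zeta _ = _) (hh : zeta _ = _) (hecke_conv_one mu' P') (hecke_conv_one mu P).
rewrite [in RHS]asboolT; last by rewrite invgK; exact: dcoset_refl.
(* It is not known beforehand that h' lies in the double coset of g'^-1; otherwise the value would
   be 0, against positivity of the volume over F. *)
case: asboolP => _; first by move=> [].
by move=> /esym/eqP; rewrite fmorph_eq0 gt_eqF // (dvol_gt0 mu P).
Qed.

(** For elements of K^0 the relation is lifting up to K^l, and lifts respect K^k for k at most l. *)
Lemma zeta_rel_congK k g g' : (k <= l)%N -> zeta_rel g g' -> K k g <-> K' k g'.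
Proof.
have stable (F0 : localField) (D0 : divAlg F0 d) (x y : GL D0 r) : (k <= l)%N ->
    dcoset (congK D0 r l) x y -> congK D0 r k x -> congK D0 r k y.
  move=> kl /dcosetP[c [c' [cl cl' ->]]] xk.
  have lk z : congK D0 r l z -> congK D0 r k z by exact: congK_le.
  by apply: congKM; [apply: congKM => //; exact: lk|exact: lk].
move=> kl gg; split=> gk.
  have [B BB] := lift_GL T l_gt0 le_lm (congK_le (leq0n k) gk).
  apply: (stable _ _ B) => //; last exact/(lift_congK le_lm kl BB).
  exact: zeta_rel_unique (zeta_rel_lift BB) gg.
have [B BB] := lift_GL_inv l_gt0 le_lm (congK_le (leq0n k) gk).
apply: (stable _ _ B) => //; last exact/(lift_congK le_lm kl BB).
by apply/(zeta_rel_dcoset (zeta_rel_lift BB) gg); exact: dcoset_refl.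
Qed.

Lemma zeta_correspondence : correspondence P P' mu mu' l zeta_rel.
Proof.
split.
- exact: zeta_rel_exists.
- exact: zeta_rel_exists_inv.
- exact: zeta_rel_dcoset.
- by apply: zeta_rel_lift; exact: (lift1 T le_lm).
- exact: zeta_rel_zp.
- exact: zeta_rel_dvol.
exact: zeta_rel_congK.
Qed.

Lemma zeta_module_corr (pi : smoothRep R D r) (pi' : smoothRep R D' r) (phi : pi -> pi') :
  set_bij (fixed pi (K l)) (fixed pi' (K' l)) phi ->
  (forall (c : R[i]) u v, fixed pi (K l) u -> fixed pi (K l) v -> phi (c *: u + v) = c *: phi u + phi v) ->
  (forall f v, hecke R (K l) f -> fixed pi (K l) v ->
     phi (hecke_act mu f v) = hecke_act mu' (zeta f) (phi v)) ->
  module_corr l zeta_rel phi.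
Proof.
move=> phiB phiL phiH; split=> // g g' v gg vM.
have [phiM _ _] := phiB; have M0 : fixed pi (K l) 0 by exact: (subspace_fixed pi (K l)).1.
have phi0 : phi 0 = 0.
  by have := phiL (-1) _ _ M0 M0; rewrite scaler0 addr0 scaleN1r addNr.
have := phiH _ _ (hecke_indic R P l g) vM.
rewrite (gg : zeta _ = _) (hecke_act_indic mu P) // (hecke_act_indic mu' P') //; last exact: phiM.
rewrite -(zeta_rel_dvol gg) -[X in phi X]addr0 phiL //; last exact: (avg_fixed P).
rewrite phi0 addr0; apply: scalerI.
by rewrite fmorph_eq0 gt_eqF // (dvol_gt0 mu P).
Qed.

End ZetaCorrespondence.

(** * Transfer of representations through their fixed vectors *)

Section ModuleTransfer.
Variables (R : realType) (l : nat).

(** Stated for an arbitrary pair of groups, so that such maps can be inverted and composed, the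
    identity of one Hecke algebra included. *)
Definition hecke_semilinear (F1 F2 : localField) (d1 d2 : nat) (D1 : divAlg F1 d1)
    (D2 : divAlg F2 d2) (r1 r2 : nat) (mu1 : haarMeasures R D1 r1) (mu2 : haarMeasures R D2 r2)
    (z : (GL D1 r1 -> R[i]) -> GL D2 r2 -> R[i])
    (pi1 : smoothRep R D1 r1) (pi2 : smoothRep R D2 r2) (phi : pi1 -> pi2) :=
  [/\ set_bij (fixed pi1 (congK D1 r1 l)) (fixed pi2 (congK D2 r2 l)) phi,
      forall (c : R[i]) u v, fixed pi1 (congK D1 r1 l) u -> fixed pi1 (congK D1 r1 l) v ->
        phi (c *: u + v) = c *: phi u + phi v &
      forall f v, hecke R (congK D1 r1 l) f -> fixed pi1 (congK D1 r1 l) v ->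
        phi (hecke_act mu1 f v) = hecke_act mu2 (z f) (phi v)].

Section Two.
Variables (F1 F2 : localField) (d1 d2 : nat) (D1 : divAlg F1 d1)
  (D2 : divAlg F2 d2) (r1 r2 : nat) (P1 : cyclicPres D1) (P2 : cyclicPres D2)
  (mu1 : haarMeasures R D1 r1) (mu2 : haarMeasures R D2 r2).
Local Notation H1 := (hecke R (congK D1 r1 l)).
Local Notation H2 := (hecke R (congK D2 r2 l)).

Lemma hecke_iso_inverse z : hecke_iso mu1 mu2 l z -> exists z',
  [/\ hecke_iso mu2 mu1 l z', forall f, H1 f -> z' (z f) = f & forall f, H2 f -> z (z' f) = f].
Proof.
move=> zP; have [_ zl zM] := zP.
have /choice[z' z'P] f : exists g, H2 f -> H1 g /\ z g = f.
  have [/(hecke_iso_surj zP)[g hg <-]|?] := pselect (H2 f); [by exists g|by exists (fun=> 0)].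
have z'z f : H1 f -> z' (z f) = f.
  move=> hf; have [h1 h2] := z'P _ (hecke_iso_hecke zP hf).
  exact: (hecke_iso_inj zP).
have zz' f : H2 f -> z (z' f) = f by move=> /z'P[].
exists z'; split=> //; split.
- split; first by move=> f /z'P[].
    by move=> f g; rewrite !inE => hf hg e; rewrite -(zz' f) // -(zz' g) // e.
  by move=> f hf; exists (z f); [exact: (hecke_iso_hecke zP)|exact: z'z].
- move=> c f g hf hg; have [hf' ef] := z'P _ hf; have [hg' eg] := z'P _ hg.
  rewrite -[RHS]z'z; last exact: heckeP.
  by rewrite zl // ef eg.
move=> f g hf hg; have [hf' ef] := z'P _ hf; have [hg' eg] := z'P _ hg.
rewrite -[RHS]z'z; last exact: (hecke_conv_hecke mu1 P1).
by rewrite zM // ef eg.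
Qed.

Variables (pi1 : smoothRep R D1 r1) (pi2 : smoothRep R D2 r2).
Local Notation M1 := (fixed pi1 (congK D1 r1 l)).
Local Notation M2 := (fixed pi2 (congK D2 r2 l)).

Lemma hecke_semilinear_exists z (phi : pi1 -> pi2) : hecke_semilinear mu1 mu2 z phi ->
  (exists2 v, M1 v & v != 0) -> exists2 v, M2 v & v != 0.
Proof.
move=> [[phiM inj _] phiL _] [v vM v0]; exists (phi v); first exact: phiM.
have M0 : M1 0 by exact: (subspace_fixed pi1 _).1.
have phi0 : phi 0 = 0 by have := phiL (-1) _ _ M0 M0; rewrite scaler0 addr0 scaleN1r addNr.
by apply: contraNneq v0 => e; apply/eqP; apply: inj; rewrite ?inE // e phi0.
Qed.

Lemma hecke_semilinear_inverse z z' (phi : pi1 -> pi2) :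
  (forall f, H2 f -> H1 (z' f)) -> (forall f, H2 f -> z (z' f) = f) ->
  hecke_semilinear mu1 mu2 z phi ->
  exists psi : pi2 -> pi1, hecke_semilinear mu2 mu1 z' psi.
Proof.
move=> z'H zz' [[phiM phiI phiS] phiL phiH].
have /choice[psi psiP] w : exists v, M2 w -> M1 v /\ phi v = w.
  by have [/phiS[v vM <-]|?] := pselect (M2 w); [exists v|exists 0].
have inj u v : M1 u -> M1 v -> phi u = phi v -> u = v by move=> uM vM; apply: phiI; rewrite inE.
have sM1 := subspace_fixed pi1 (congK D1 r1 l); have sM2 := subspace_fixed pi2 (congK D2 r2 l).
exists psi; split.
- split; first by move=> w /psiP[].
    move=> w w'; rewrite !inE => /psiP[_ e] /psiP[_ e'] ww; by rewrite -e -e' ww.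
  move=> v vM; have wM := phiM _ vM; exists (phi v) => //.
  by have [h1 h2] := psiP _ wM; exact: inj.
- move=> c u v uM vM; have [u1 u2] := psiP _ uM; have [v1 v2] := psiP _ vM.
  have [w1 w2] := psiP _ (sM2.2 c _ _ uM vM).
  by apply: inj => //; [exact: sM1.2|rewrite phiL // w2 u2 v2].
move=> f v hf vM; have [v1 v2] := psiP _ vM.
have [w1 w2] := psiP _ (hecke_act_fixed mu2 P2 hf vM).
apply: inj => //; first exact: (hecke_act_fixed mu1 P1 (z'H _ hf) v1).
by rewrite w2 phiH ?zz' ?v2 //; exact: z'H.
Qed.

End Two.

Lemma hecke_semilinear_comp (F1 F2 F3 : localField) (d1 d2 d3 : nat) (D1 : divAlg F1 d1)
    (D2 : divAlg F2 d2) (D3 : divAlg F3 d3) (r1 r2 r3 : nat) (mu1 : haarMeasures R D1 r1)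
    (mu2 : haarMeasures R D2 r2) (mu3 : haarMeasures R D3 r3)
    z z' z'' (pi1 : smoothRep R D1 r1) (pi2 : smoothRep R D2 r2) (pi3 : smoothRep R D3 r3)
    (phi : pi1 -> pi2) (psi : pi2 -> pi3) :
  (forall f, hecke R (congK D1 r1 l) f -> hecke R (congK D2 r2 l) (z f)) ->
  (forall f, hecke R (congK D1 r1 l) f -> z'' f = z' (z f)) ->
  hecke_semilinear mu1 mu2 z phi -> hecke_semilinear mu2 mu3 z' psi ->
  hecke_semilinear mu1 mu3 z'' (psi \o phi).
Proof.
move=> zH zE [phiB phiL phiH] [psiB psiL psiH]; have [phiM _ _] := phiB.
split; first exact: set_bij_comp psiB.
  by move=> c u v uM vM /=; rewrite phiL // psiL //; exact: phiM.
move=> f v hf vM /=; rewrite phiH // psiH ?zE //; [exact: zH|exact: phiM].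
Qed.

Lemma equivalent_semilinear (F : localField) (d : nat) (D : divAlg F d) (r : nat)
    (P : cyclicPres D) (mu : haarMeasures R D r) (pi pi' : smoothRep R D r) :
  equivalent pi pi' -> exists phi : pi -> pi', hecke_semilinear mu mu id phi.
Proof.
case=> phi bphi phiG; exists phi; have phiI := bij_inj bphi; split.
- split; first by move=> v /(equivalent_fixed _ _ phiI phiG).
    by move=> u v _ _; exact: phiI.
  have [psi phiK psiK] := bphi; move=> w wM; exists (psi w); last exact: psiK.
  by apply/(equivalent_fixed _ _ phiI phiG); rewrite psiK.
- by move=> c u v _ _; rewrite linearP.
by move=> f v hf vM; exact: (equivalent_hecke_act mu P phiG hf vM).
Qed.

End ModuleTransfer.

Section ZetaTransfer.
Variables (R : realType) (F : localField) (d : nat) (D : divAlg F d)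
  (P : cyclicPres D) (r m : nat) (L : localField) (T : closeData R P r m L)
  (mu : haarMeasures R D r) (l : nat).
Hypotheses (l_gt0 : (0 < l)%N) (le_lm : (l <= m)%N).
Local Notation D' := (cd_D T).
Local Notation P' := (cd_P T).
Local Notation mu' := (cd_haar T).
Variable zeta : (GL D r -> R[i]) -> (GL D' r -> R[i]).
Hypotheses (zetaP : is_zeta l zeta) (zetaI : is_hecke_iso l mu zeta).
Local Notation transfers := (transfer l mu zeta).
Implicit Types (pi : smoothRep R D r) (rho : smoothRep R D' r).

Let zI : hecke_iso mu mu' l zeta := zetaI.

Lemma transferP pi rho : transfers pi rho <-> [/\ irreducible rho, level_le l rho &
  exists phi : pi -> rho, hecke_semilinear l mu mu' zeta phi].
Proof. by []. Qed.

(** [hecke_iso_transfer_exists] constructs representations of the source group of an isomorphism, so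
    it is applied to the inverse of [zeta]. *)
Lemma transfer_exists pi : irreducible pi -> level_le l pi -> exists rho, transfers pi rho.
Proof.
move=> irr lev; have ex := (level_le_fixed pi l).1 lev.
have [z' [z'P z'z zz']] := hecke_iso_inverse P zI.
have [rho [irr' [phi [phiB phiL phiH]]]] := hecke_iso_transfer_exists P' P z'P irr ex.
have sl : hecke_semilinear l mu mu' zeta phi.
  split=> // f v hf vM; have := phiH _ v (hecke_iso_hecke zI hf) vM.
  by rewrite z'z.
exists rho; apply/transferP; split=> //; last by exists phi.
by apply/level_le_fixed; exact: hecke_semilinear_exists sl ex.
Qed.

Lemma transfer_exists_inv rho : irreducible rho -> level_le l rho ->
  exists pi, [/\ irreducible pi, level_le l pi & transfers pi rho].
Proof.
move=> irr lev; have ex := (level_le_fixed rho l).1 lev.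
have [z' [z'P z'z zz']] := hecke_iso_inverse P zI.
have [pi [irr' [phi [phiB phiL phiH]]]] := hecke_iso_transfer_exists P P' zI irr ex.
have sl : hecke_semilinear l mu' mu z' phi.
  split=> // f v hf vM; have := phiH (z' f) v (hecke_iso_hecke z'P hf) vM.
  by rewrite zz'.
have [psi psiP] := hecke_semilinear_inverse P' P (fun f hf => hecke_iso_hecke zI hf) z'z sl.
exists pi; split=> //; first by apply/level_le_fixed; exact: hecke_semilinear_exists sl ex.
by apply/transferP; split=> //; exists psi.
Qed.

Lemma transfer_equivr pi rho rho' : transfers pi rho -> equivalent rho rho' -> transfers pi rho'.
Proof.
move=> /transferP[irr lev [phi phiP]] e; have [psi psiP] := equivalent_semilinear l P' mu' e.
apply/transferP; split; [exact: equivalent_irreducible irr|exact: equivalent_level_le lev|].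
exists (psi \o phi); apply: hecke_semilinear_comp phiP psiP => // f.
exact: (hecke_iso_hecke zI).
Qed.

Lemma transfer_equivl pi pi' rho : equivalent pi pi' -> transfers pi' rho -> transfers pi rho.
Proof.
move=> e /transferP[irr lev [phi phiP]]; have [psi psiP] := equivalent_semilinear l P mu e.
apply/transferP; split=> //; exists (phi \o psi).
exact: hecke_semilinear_comp psiP phiP.
Qed.

Lemma transfer_unique pi rho rho' : (exists2 v, fixed pi (congK D r l) v & v != 0) ->
  transfers pi rho -> transfers pi rho' -> equivalent rho rho'.
Proof.
move=> ex /transferP[irr lev [phi phiP]] /transferP[irr' lev' [phi' phiP']].
have [z' [z'P z'z zz']] := hecke_iso_inverse P zI.
have [psi psiP] := hecke_semilinear_inverse P P' (fun f hf => hecke_iso_hecke z'P hf) zz' phiP.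
have [h1 h2 h3] : hecke_semilinear l mu' mu' id (phi' \o psi).
  by apply: hecke_semilinear_comp psiP phiP' => f hf; [exact: (hecke_iso_hecke z'P)|rewrite zz'].
by apply: (fixed_module_equivalent P' irr irr' _ h1 h2 h3); apply/level_le_fixed.
Qed.

Lemma transfer_injective pi pi' rho : irreducible pi -> irreducible pi' -> level_le l pi ->
  transfers pi rho -> transfers pi' rho -> equivalent pi pi'.
Proof.
move=> irr irr' lev /transferP[_ _ [phi phiP]] /transferP[_ _ [phi' phiP']].
have [z' [z'P z'z zz']] := hecke_iso_inverse P zI.
have [psi psiP] := hecke_semilinear_inverse P P' (fun f hf => hecke_iso_hecke z'P hf) zz' phiP'.
have [h1 h2 h3] : hecke_semilinear l mu mu id (psi \o phi).
  by apply: hecke_semilinear_comp phiP psiP => f hf; [exact: (hecke_iso_hecke zI)|rewrite z'z].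
by apply: (fixed_module_equivalent P irr irr' _ h1 h2 h3); apply/level_le_fixed.
Qed.

Lemma transfer_class_equivalent pi rho : irreducible pi -> level_le l pi -> transfers pi rho ->
  transfer_class l mu zeta (equivalent pi) = equivalent rho.
Proof.
move=> irr lev tr; have ex := (level_le_fixed pi l).1 lev.
apply/funext => rho'; apply/propext; split=> [[pi' e tr']|e].
  exact: transfer_unique ex tr (transfer_equivl e tr').
by exists pi; [exact: equivalent_refl|exact: transfer_equivr tr e].
Qed.

(** Both bijections of a) are instances: Q and Q' are either level at most l or level equal to l. *)
Lemma transfer_bij (Q : smoothRep R D r -> Prop) (Q' : smoothRep R D' r -> Prop) :
  (forall pi, Q pi -> level_le l pi) -> (forall rho, Q' rho -> level_le l rho) ->
  (forall pi rho, irreducible pi -> transfers pi rho -> Q pi <-> Q' rho) ->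
  bij_between (irr_class Q) (irr_class Q') (transfer_class l mu zeta).
Proof.
move=> Ql Ql' QQ'; split.
- move=> _ [pi [irr Qpi ->]]; have lev := Ql _ Qpi.
  have [rho tr] := transfer_exists irr lev; rewrite (transfer_class_equivalent irr lev tr).
  by have [irr' _ _] := tr; exists rho; split=> //; apply/(QQ' pi).
- move=> _ _ [pi [irr Qpi ->]] [pi' [irr' Qpi' ->]].
  have lev := Ql _ Qpi; have lev' := Ql _ Qpi'.
  have [rho tr] := transfer_exists irr lev; have [rho' tr'] := transfer_exists irr' lev'.
  rewrite (transfer_class_equivalent irr lev tr) (transfer_class_equivalent irr' lev' tr') => e.
  apply: equivalent_eq; apply: (transfer_injective irr irr' lev (rho := rho')) => //.
  apply: transfer_equivr tr _; rewrite e; exact: equivalent_refl.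
move=> _ [rho [irr' Qrho ->]]; have lev' := Ql' _ Qrho.
have [pi [irr lev tr]] := transfer_exists_inv irr' lev'.
exists (equivalent pi); last exact: transfer_class_equivalent.
by exists pi; split=> //; apply/(QQ' pi rho).
Qed.

Lemma transfer_corr pi rho : transfers pi rho ->
  exists phi : pi -> rho, module_corr l (zeta_rel l zeta) phi.
Proof.
move=> /transferP[_ _ [phi [h1 h2 h3]]]; exists phi.
exact: (zeta_module_corr l_gt0 le_lm zetaP zetaI).
Qed.

Let corr := zeta_correspondence l_gt0 le_lm zetaP zetaI.

Lemma transfer_has_level pi rho n : (n <= l)%N -> transfers pi rho ->
  has_level pi n <-> has_level rho n.
Proof.
move=> nl /transfer_corr[phi phiP]; have [psi psiP] := module_corr_sym P P' phiP.
split; first exact: (has_level_corr corr phiP nl).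
exact: (has_level_corr (correspondence_sym corr) psiP nl).
Qed.

Lemma transfer_cuspidal pi rho : irreducible pi -> level_le l pi -> transfers pi rho ->
  cuspidal pi <-> cuspidal rho.
Proof.
move=> irr lev tr; have [irr' lev' _] := tr; have [phi phiP] := transfer_corr tr.
have [psi psiP] := module_corr_sym P P' phiP.
split; first exact: (cuspidal_corr corr phiP irr irr' ((level_le_fixed pi l).1 lev)).
exact: (cuspidal_corr (correspondence_sym corr) psiP irr' irr ((level_le_fixed rho l).1 lev')).
Qed.

Lemma transfer_square_integrable pi rho : (0 < r)%N -> irreducible pi -> level_le l pi ->
  transfers pi rho -> square_integrable mu pi <-> square_integrable mu' rho.
Proof.
move=> r_gt0 irr lev tr; have [irr' lev' _] := tr; have [phi phiP] := transfer_corr tr.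
have [psi psiP] := module_corr_sym P P' phiP.
split; first exact: (square_integrable_corr corr phiP r_gt0 r_gt0 irr irr' ((level_le_fixed pi l).1 lev)).
exact: (square_integrable_corr (correspondence_sym corr) psiP r_gt0 r_gt0 irr' irr ((level_le_fixed rho l).1 lev')).
Qed.

End ZetaTransfer.

Theorem mainTheorem5 (R : realType) (F : localField)
  (charF : exists p : nat, p \in [pchar F])
  (d : nat) (D : divAlg F d) (P : cyclicPres D)
  (r : nat) (r_gt0 : (0 < r)%N) (mu : haarMeasures R D r)
  (l m : nat) (l_gt0 : (0 < l)%N) (le_lm : (l <= m)%N)
  (T : forall L : localField, [pchar L] =i pred0 -> m_close m F L ->
         closeData R P r m L)
  (zeta_iso : forall (L : localField) (char0 : [pchar L] =i pred0)
     (closeFL : m_close m F L)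
     (zeta : (GL D r -> R[i]) -> (GL (cd_D (T L char0 closeFL)) r -> R[i])),
     is_zeta l zeta -> is_hecke_iso l mu zeta)
  (L : localField) (char0 : [pchar L] =i pred0) (closeFL : m_close m F L)
  (zeta : (GL D r -> R[i]) -> (GL (cd_D (T L char0 closeFL)) r -> R[i]))
  (zetaP : is_zeta l zeta) :
  let muL := cd_haar (T L char0 closeFL) in
  [/\ bij_between (irr_class (@level_le R F d D r l))
              (irr_class (level_le l)) (transfer_class l mu zeta) /\
      bij_between (irr_class (fun pi : smoothRep R D r => has_level pi l))
              (irr_class (fun pi => has_level pi l)) (transfer_class l mu zeta),
      forall pi pi', irreducible pi -> level_le l pi ->
        transfer l mu zeta pi pi' ->
        (square_integrable mu pi <-> square_integrable muL pi') &
      forall pi pi', irreducible pi -> level_le l pi ->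
        transfer l mu zeta pi pi' ->
        (cuspidal pi <-> cuspidal pi')].
Proof.
move=> muL; have zetaI := zeta_iso _ _ _ _ zetaP; split.
- have level_has (F0 : localField) (D0 : divAlg F0 d) (pi : smoothRep R D0 r) :
    has_level pi l -> level_le l pi by move=> h; exists l.
  split.
  - apply: (transfer_bij zetaI) => [//|//|pi rho _ tr].
    have lev n nl := transfer_has_level l_gt0 le_lm zetaP zetaI (n := n) nl tr.
    by split=> -[n nl h]; exists n => //; apply/(lev n nl).
  - apply: (transfer_bij zetaI) => [pi|rho|pi rho _ tr]; try exact: level_has.
    exact: (transfer_has_level l_gt0 le_lm zetaP zetaI (leqnn l) tr).
- by move=> pi rho; exact: (transfer_square_integrable l_gt0 le_lm zetaP zetaI r_gt0).
- by move=> pi rho; exact: (transfer_cuspidal l_gt0 le_lm zetaP zetaI).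
Qed.
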